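(* Let $n\ge2$, $l\in\{0,\dots,n-2\}$, $\phi\in C_c^\infty(\mathbb R^n)$, $f$ a smooth compactly supported $l$-form and $h$ a smooth compactly supported $(n-l-2)$-form on $\mathbb R^n$. (i) If $1<p_1,p_2<\infty$, $1\le q_1,q_2\le\infty$ with $\frac1{p_1}+\frac1{p_2}=\frac1{q_1}+\frac1{q_2}=1$, then $$\int_{\mathbb R^n}\phi\,df\wedge dh\;\lesssim\;[\phi]_{BMO}\,\|\nabla f\|_{L^{(p_1,q_1)}}\,\|\nabla h\|_{L^{(p_2,q_2)}}.$$ (ii) If $0<s_1,s_2,s_3<1$ with $s_1+s_2+s_3=2$, and $1<p_1,p_2,p_3<\infty$, $1\le q_1,q_2,q_3\le\infty$ with $\sum_i\frac1{p_i}=\sum_i\frac1{q_i}=1$, then $$\int_{\mathbb R^n}\phi\,df\wedge dh\;\lesssim\;\|(-\Delta)^{s_1/2}\phi\|_{L^{(p_1,q_1)}}\,\|(-\Delta)^{s_2/2}f\|_{L^{(p_2,q_2)}}\,\|(-\Delta)^{s_3/2}h\|_{L^{(p_3,q_3)}}.$$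
   Context: $A\lesssim B$ means $A\le CB$ with $C$ depending only on the parameters. The integral of an $n$-form $w\,dx^1\wedge\dots\wedge dx^n$ over $\mathbb R^n$ means $\int w\,dx$. For an $l$-form $f=\sum_{i_1<\dots<i_l}f_{i_1\dots i_l}dx^{i_1}\wedge\dots\wedge dx^{i_l}$, any norm is applied componentwise and summed, e.g. $\|\nabla f\|_{L^{(p,q)}}=\sum\|\nabla f_{i_1\dots i_l}\|_{L^{(p,q)}}$. Fourier transform: $\widehat g(\xi)=\int g(x)e^{-2\pi ix\cdot\xi}dx$. Fractional Laplacian: for $\sigma>0$, $\widehat{(-\Delta)^{\sigma/2}g}(\xi)=(2\pi|\xi|)^\sigma\widehat g(\xi)$. BMO seminorm: $[\phi]_{BMO}=\sup_B\frac1{|B|}\int_B|\phi-(\phi)_B|$ over balls $B$. Lorentz (quasi)norm: with $g^*(t)=\inf\{\lambda>0:|\{|g|>\lambda\}|\le t\}$, $\|g\|_{L^{(p,q)}}=\big(\int_0^\infty(t^{1/p}g^*(t))^q\frac{dt}t\big)^{1/q}$ for $q<\infty$ and $\sup_{t>0}t^{1/p}g^*(t)$ for $q=\infty$; $L^{(p,p)}=L^p$. *)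

(* Defs.v *)
From HB Require Import structures.
From mathcomp Require Import all_boot all_order all_algebra.
From mathcomp Require Import all_classical all_reals all_analysis.
Set Implicit Arguments. Unset Strict Implicit. Unset Printing Implicit Defensive.
Import Order.TTheory GRing.Theory Num.Theory.
Import numFieldNormedType.Exports.
Local Open Scope classical_set_scope.
Local Open Scope ring_scope.

Section Defs.
Variable R : realType.

Definition vcons (n : nat) (t : R) (y : 'rV[R]_n) : 'rV[R]_n.+1 :=
  \row_(i < n.+1) (if unlift ord0 i is Some j then y ord0 j else t).

(** Lebesgue measure of a set A of R^n, computed as an iterated integral
    (Tonelli) of its indicator with respect to 1-dimensional Lebesgue measure. *)
Fixpoint lebn (n : nat) : set 'rV[R]_n -> \bar R :=
  match n return set 'rV[R]_n -> \bar R with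
  | 0 => fun A => if `[< A 0 >] then 1%E else 0%E
  | n'.+1 => fun A =>
      (\int[@lebesgue_measure R]_t lebn [set y | A (vcons t y)])%E
  end.

(** Integral over R^n of a (integrable) real function, as an iterated
    integral (Fubini) of 1-dimensional Lebesgue integrals. *)
Fixpoint iint (n : nat) : ('rV[R]_n -> R) -> R :=
  match n return ('rV[R]_n -> R) -> R with
  | 0 => fun g => g 0
  | n'.+1 => fun g => \int[@lebesgue_measure R]_t iint (fun y => g (vcons t y))
  end.

Definition partial (n : nat) (j : 'I_n) (g : 'rV[R]_n -> R) : 'rV[R]_n -> R :=
  'D_(delta_mx 0 j) g.

Fixpoint iterD (n : nat) (vs : seq 'rV[R]_n) (g : 'rV[R]_n -> R) : 'rV[R]_n -> R :=
  match vs with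
  | [::] => g
  | v :: vs' => 'D_v (iterD vs' g)
  end.

Definition smooth (n : nat) (g : 'rV[R]_n -> R) : Prop :=
  forall (vs : seq 'rV[R]_n) (x : 'rV[R]_n), differentiable (iterD vs g) x.

Definition compact_support (n : nat) (g : 'rV[R]_n -> R) : Prop :=
  compact (closure [set x | g x != 0]).

Definition smooth_cc (n : nat) (g : 'rV[R]_n -> R) : Prop :=
  smooth g /\ compact_support g.

Definition dotv (n : nat) (x y : 'rV[R]_n) : R := \sum_(i < n) x ord0 i * y ord0 i.
Definition enorm (n : nat) (x : 'rV[R]_n) : R := Num.sqrt (dotv x x).

Definition gradnorm (n : nat) (g : 'rV[R]_n -> R) : 'rV[R]_n -> R :=
  fun x => Num.sqrt (\sum_(j < n) (partial j g x) ^+ 2).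

Definition distfun (n : nat) (g : 'rV[R]_n -> R) (lam : R) : \bar R :=
  lebn [set x | lam < `|g x|].

Definition rearr (n : nat) (g : 'rV[R]_n -> R) (t : R) : \bar R :=
  ereal_inf [set lam%:E | lam in [set lam : R | 0 < lam /\ (distfun g lam <= t%:E)%E]].

Definition lorentz (n : nat) (p : R) (q : \bar R) (g : 'rV[R]_n -> R) : \bar R :=
  match q with
  | +oo%E => ereal_sup [set ((t `^ p^-1)%:E * rearr g t)%E | t in [set t : R | (0 < t)%R]]
  | q'%:E => ((\int[@lebesgue_measure R]_(t in [set t : R | (0 < t)%R])
                 ((((t `^ p^-1)%:E * rearr g t) `^ q') * (t^-1)%:E))
              `^ q'^-1)%E
  | -oo%E => 0%E
  end.

Definition qinv (q : \bar R) : R :=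
  match q with
  | q'%:E => q'^-1
  | _ => 0
  end.

Definition eball (n : nat) (c : 'rV[R]_n) (r : R) : set 'rV[R]_n :=
  [set x | enorm (x - c) < r].
Definition bmean (n : nat) (g : 'rV[R]_n -> R) (B : set 'rV[R]_n) : R :=
  iint (fun x => g x * \1_B x) / fine (lebn B).
Definition bmo (n : nat) (g : 'rV[R]_n -> R) : \bar R :=
  ereal_sup [set y | exists (c : 'rV[R]_n) (r : R), 0 < r /\
     y = (iint (fun x => `|g x - bmean g (eball c r)| * \1_(eball c r) x)
            / fine (lebn (eball c r)))%:E].

(** Fractional Laplacian (-Delta)^(sigma/2) g of a real function g, defined
    through the Fourier transform
      ghat(xi) = int g(x) e^{-2 pi i x.xi} dx = gC(xi) - i gS(xi),
    (-Delta)^(sigma/2) g (x) = int (2 pi |xi|)^sigma ghat(xi) e^{2 pi i x.xi} dxi,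
    written in real form (the integrand's real part; g is real-valued). *)
Definition fourierC (n : nat) (g : 'rV[R]_n -> R) (xi : 'rV[R]_n) : R :=
  iint (fun x => g x * cos (2 * pi * dotv x xi)).
Definition fourierS (n : nat) (g : 'rV[R]_n -> R) (xi : 'rV[R]_n) : R :=
  iint (fun x => g x * sin (2 * pi * dotv x xi)).
Definition fraclap (n : nat) (sigma : R) (g : 'rV[R]_n -> R) : 'rV[R]_n -> R :=
  fun x => iint (fun xi => (2 * pi * enorm xi) `^ sigma *
       (fourierC g xi * cos (2 * pi * dotv x xi)
        + fourierS g xi * sin (2 * pi * dotv x xi))).

(** Differential forms on R^n: f I is the coefficient of
    dx^{i_1} /\ ... /\ dx^{i_k}, I = {i_1 < ... < i_k}. *)
Definition kform (n : nat) := {set 'I_n} -> 'rV[R]_n -> R.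

Definition is_form (n : nat) (l : nat) (f : kform n) : Prop :=
  forall I : {set 'I_n}, #|I| != l -> forall x, f I x = 0.

Definition form_smooth_cc (n : nat) (f : kform n) : Prop :=
  forall I : {set 'I_n}, smooth_cc (f I).

(** exterior derivative: d(f_I dx^I) = sum_j d_j f_I dx^j /\ dx^I *)
Definition dform (n : nat) (f : kform n) : kform n :=
  fun J x => \sum_(j in J)
     (-1) ^+ #|[set i in J | (i < j)%N]| * partial j (f (J :\ j)) x.

(** coefficient w of the n-form a /\ b = w dx^1 /\ ... /\ dx^n *)
Definition wedge_top (n : nat) (a b : kform n) : 'rV[R]_n -> R :=
  fun x => \sum_(I : {set 'I_n})
     (-1) ^+ #|[set pr : 'I_n * 'I_n |
                 [&& pr.1 \in I, pr.2 \notin I & (pr.2 < pr.1)%N]]|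
     * a I x * b (~: I) x.

Definition grad_lorentz (n : nat) (p : R) (q : \bar R) (f : kform n) : \bar R :=
  (\sum_(I : {set 'I_n}) lorentz p q (gradnorm (f I)))%E.
Definition fraclap_lorentz (n : nat) (s p : R) (q : \bar R) (f : kform n) : \bar R :=
  (\sum_(I : {set 'I_n}) lorentz p q (fraclap s (f I)))%E.

End Defs.

(* Main.v *)
Require Import Defs.
From HB Require Import structures.
From mathcomp Require Import all_boot all_order all_algebra.
From mathcomp Require Import all_classical all_reals all_analysis.
From mathcomp Require Import measurable_realfun ring lra.
Set Implicit Arguments. Unset Strict Implicit. Unset Printing Implicit Defensive.
Import Order.TTheory GRing.Theory Num.Theory.
Import numFieldNormedType.Exports.
Local Open Scope classical_set_scope.
Local Open Scope ring_scope.

(** Let [He t] be the heat semigroup and [J t] the Jacobian integral of the heat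
    flows of [phi], [f], [h]; [J t] tends to 0 as [t] grows.  After integration
    by parts, the antisymmetry of the Jacobian makes [J'] a sum of integrals of
    [|D He phi| |D^2 He f| |D He h|] and its variant with [f] and [h] exchanged,
    which are discretised over dyadic times.
    (i) A BMO function has bounded heat variance [Var] (John-Nirenberg), so its
    square function is a Carleson measure; the other factors are controlled by
    square and maximal functions.
    (ii) Subordination writes [He t g] through the heat flow of [(-Delta)^(s/2) g];
    the powers of [t] balance because [s_1 + s_2 + s_3 = 2].
    Lorentz norms enter by cutting each function into atoms along the dyadic
    levels of its rearrangement: interpolating between vertex exponents gives
    geometric decay off the diagonal of the atomic sums, and Young's inequality
    for sequences sums them. *)

(** The operators are not bounded one by one on Lorentz spaces. Each estimate is proved for
    functions with |u| <= 1 and L^1 norm at most e, at a few extreme exponents, with constants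
    independent of the number M of scales and of the base time; only the final trilinear sums see
    the Lorentz indices. Derivatives of heat flows are replaced by oscillations: D He t u is bounded
    by the deviation of [He tau u] from its mean under the kernel at time 15 tau, and that mean is
    the flow at time 16 tau. Square function estimates thereby become exact telescoping identities,
    as for martingales, along the times tau0 4^i, where two steps multiply the time by 16. The
    Carleson embedding is a Bellman function argument and the maximal bound a maximal ergodic lemma.
    Subordination rests on the integral of exp(-lam |y|^(2/s)) over the line being c lam^(-s/2),
    which has no singular density. In the extended reals 0 times infinity is 0, so a vanishing norm
    must force the left-hand side to be at most 0 even when another norm is infinite; that case is
    proved separately. *)

Local Notation mfun := (measurable_fun setT) (only parsing).
Local Notation nneg u := (forall x, 0 <= u x) (only parsing).
Local Notation absf u := (fun x => `|u x|) (only parsing).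
Local Notation le_via y := (@le_trans _ _ y) (only parsing).
Local Notation sqrt := Num.sqrt (only parsing).

Lemma le_of_eq (R : numDomainType) (x y : R) : x = y -> x <= y. Proof. by move->. Qed.

(** * The coordinate sigma-algebra on row vectors *)

Definition rv_display : measure_display. Proof. exact. Qed.

Section rv_measurable.
Variables (R : realType) (n : nat).
Let coors : 'I_n -> 'rV[R]_n -> R := fun i x => x ord0 i.
Let rv_set0 : g_sigma_preimage coors set0.
Proof. exact: sigma_algebra0. Qed.
Let rv_setC A : g_sigma_preimage coors A -> g_sigma_preimage coors (~` A).
Proof. exact: sigma_algebraC. Qed.
Let rv_bigcup (F : _^nat) : (forall i, g_sigma_preimage coors (F i)) ->
 g_sigma_preimage coors (\bigcup_i (F i)).
Proof. exact: sigma_algebra_bigcup. Qed.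
HB.instance Definition _ := @isMeasurable.Build rv_display
 ('rV[R]_n) (g_sigma_preimage coors) rv_set0 rv_setC rv_bigcup.

Lemma measurable_coord (i : 'I_n) :
 measurable_fun [set: 'rV[R]_n] (fun x : 'rV[R]_n => x ord0 i).
Proof.
move=> _ Y mY; rewrite setTI; apply: sub_sigma_algebra => /=.
rewrite -bigcup_seq/=; exists i => /=; first by rewrite mem_index_enum.
by exists Y => //; rewrite setTI.
Qed.

Lemma measurable_rvP d (T : measurableType d) (f : T -> 'rV[R]_n) :
 (forall i, measurable_fun [set: T] (fun x => f x ord0 i)) ->
 measurable_fun [set: T] f.
Proof.
move=> mf _ A mA; rewrite setTI.
suff : g_sigma_preimage coors `<=` [set B | measurable (f @^-1` B)] by apply.
apply: smallest_sub.
 split => /=.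
 - by rewrite preimage_set0.
 - by move=> B mB; rewrite setTD preimage_setC; exact: measurableC.
 - move=> F mF; rewrite /= preimage_bigcup; exact: bigcupT_measurable.
move=> B; rewrite -bigcup_seq => -[/= i _ [C mC <-]] /=.
rewrite setTI -[X in measurable X]setTI; exact: mf.
Qed.

End rv_measurable.

Section rv_ops.
Variables (R : realType) (n : nat).
Context d (T : measurableType d).
Implicit Types f g : T -> 'rV[R]_n.

Lemma measurable_fun_coord f i : mfun f ->
 mfun (fun x => f x ord0 i).
Proof. by move=> mf; exact: (measurableT_comp (@measurable_coord R n i)). Qed.

Lemma measurable_rvD f g : mfun f -> mfun g ->
 mfun (fun x => f x + g x).
Proof.
move=> mf mg; apply: measurable_rvP => i; under eq_fun do rewrite mxE.
by apply: measurable_funD; exact: measurable_fun_coord.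
Qed.

Lemma measurable_rvB f g : mfun f -> mfun g ->
 mfun (fun x => f x - g x).
Proof.
move=> mf mg; apply: measurable_rvP => i; under eq_fun do rewrite !mxE.
by apply: measurable_funB; exact: measurable_fun_coord.
Qed.

Lemma measurable_rvZ (a : T -> R) f : mfun a ->
 mfun f -> mfun (fun x => a x *: f x).
Proof.
move=> ma mf; apply: measurable_rvP => i; under eq_fun do rewrite !mxE.
by apply: measurable_funM => //; exact: measurable_fun_coord.
Qed.

End rv_ops.

Lemma vcons0 (R : realType) n (t : R) (y : 'rV[R]_n) : vcons t y ord0 ord0 = t.
Proof. by rewrite mxE unlift_none. Qed.

Lemma vconsS (R : realType) n (t : R) (y : 'rV[R]_n) i :
 vcons t y ord0 (lift ord0 i) = y ord0 i.
Proof. by rewrite mxE liftK. Qed.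

(** * Lebesgue measure on R^n by iterated products *)

Section lebm.
Variable R : realType.

Definition ucons n (p : measurableTypeR R * 'rV[R]_n) : 'rV[R]_n.+1 := vcons p.1 p.2.

Lemma measurable_ucons n : mfun (@ucons n).
Proof.
apply: measurable_rvP => i; case: (unliftP ord0 i) => [j|] ->.
 under eq_fun do rewrite vconsS. by apply: measurable_fun_coord.
under eq_fun do rewrite vcons0; exact: measurable_fst.
Qed.

Definition vhead n (x : 'rV[R]_n.+1) : R := x ord0 ord0.
Definition vtail n (x : 'rV[R]_n.+1) : 'rV[R]_n := \row_i x ord0 (lift ord0 i).

Lemma vcons_eta n (x : 'rV[R]_n.+1) : vcons (vhead x) (vtail x) = x.
Proof.
apply/rowP => i; case: (unliftP ord0 i) => [j|] ->; first by rewrite vconsS mxE.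
by rewrite vcons0.
Qed.

Lemma measurable_vhead n : mfun (@vhead n).
Proof. exact: measurable_coord. Qed.

Lemma measurable_vtail n : mfun (@vtail n).
Proof.
by apply: measurable_rvP => i; under eq_fun do rewrite mxE; exact: measurable_coord.
Qed.

Section step.
Variables (n : nat) (m : {sigma_finite_measure set 'rV[R]_n -> \bar R}).
(** The image of the product of Lebesgue measure with m under consing. Integrals against it unfold
    into the iterated integrals from which [lebn] and [iint] are built. *)
Definition stepm : set 'rV[R]_n.+1 -> \bar R :=
 pushforward (@lebesgue_measure R \x m)%E (@ucons n).
Let stepm0 : stepm set0 = 0%E.
Proof. by rewrite /stepm /pushforward preimage_set0 measure0. Qed.
Let stepm_ge0 A : (0 <= stepm A)%E. Proof. by rewrite /stepm /pushforward measure_ge0. Qed.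
Let mpre A : measurable A -> measurable (@ucons n @^-1` A).
Proof. by move=> mA; rewrite -[X in measurable X]setTI; exact: measurable_ucons. Qed.
Let stepm_sigma_additive : semi_sigma_additive stepm.
Proof.
move=> F mF tF mUF; rewrite /stepm /pushforward preimage_bigcup.
apply: measure_semi_sigma_additive => [k||]; first exact: mpre.
- apply/trivIsetP => /= i j _ _ ij; rewrite -preimage_setI. by move/trivIsetP : tF => /(_ _ _ _ _ ij) ->//.
- by rewrite -preimage_bigcup; exact: mpre.
Qed.
HB.instance Definition _ := isMeasure.Build _ _ _ stepm stepm0 stepm_ge0 stepm_sigma_additive.
Lemma stepm_sf : sigma_finite setT stepm.
Proof.
have /sigma_finiteP[F [TF ndF Foo]] := sigma_finiteT (@lebesgue_measure R).
have /sigma_finiteP[G [TG ndG Goo]] := sigma_finiteT m.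
have ucK (k : nat) : (@ucons n) @^-1` [set x | F k (vhead x) /\ G k (vtail x)] = F k `*` G k.
 have vh t (y : 'rV[R]_n) : vhead (vcons t y) = t by rewrite /vhead vcons0. have vt t (y : 'rV[R]_n) : vtail (vcons t y) = y.
  by apply/rowP => i; rewrite mxE vconsS.
 by apply/seteqP; split => -[t y]; rewrite /preimage/= /ucons vh vt.
(* Exhaustion by products F k x G k; both sequences increase, so the larger of two indices serves
   both coordinates. *)
exists (fun k => [set x | F k (vhead x) /\ G k (vtail x)]).
 apply/seteqP; split => // x _. have : (\bigcup_k F k) (vhead x) by rewrite -TF. have : (\bigcup_k G k) (vtail x) by rewrite -TG.
 move=> [k _ Gk] [j _ Fj]; exists (maxn k j) => //; split.
  by move: Fj; apply/subsetPset/ndF; rewrite leq_maxr.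
 by move: Gk; apply/subsetPset/ndG; rewrite leq_maxl.
move=> k; have [mF Fk] := Foo k; have [mG Gk] := Goo k; split.
 apply: measurableI; rewrite -[X in measurable X]setTI.
  exact: (measurable_vhead measurableT mF).
 exact: (measurable_vtail measurableT mG).
rewrite /stepm /pushforward ucK product_measure1E//.
by rewrite lte_mul_pinfty// ge0_fin_numE.
Qed.
HB.instance Definition _ := Measure_isSigmaFinite.Build _ _ _ stepm stepm_sf.
End step.

Fixpoint lebm n : {sigma_finite_measure set 'rV[R]_n -> \bar R} :=
 match n with
 | 0 => [the {sigma_finite_measure set 'rV[R]_0 -> \bar R} of @dirac _ 'rV[R]_0 0 R]
 | n'.+1 => [the {sigma_finite_measure set _ -> \bar R} of stepm (lebm n')]
 end.

End lebm.

(** * A structural solver for measurability goals *)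

Section mfun.
Context d (T : measurableType d) (R : realType).
Implicit Types f g : T -> R.
Notation M f := (measurable_fun [set: T] f).

Lemma mf_cst (c : R) : M (fun _ => c). Proof. by []. Qed.
Lemma mf_add f g : M f -> M g -> M (fun x => f x + g x).
Proof. exact: measurable_funD. Qed.
Lemma mf_opp f : M f -> M (fun x => - f x).
Proof. exact: measurable_funN. Qed.
Lemma mf_mul f g : M f -> M g -> M (fun x => f x * g x).
Proof. exact: measurable_funM. Qed.
Lemma mf_exp f k : M f -> M (fun x => f x ^+ k).
Proof. exact: measurable_funX. Qed.
Lemma mf_norm f : M f -> M (absf f).
Proof. by move=> mf; exact: (measurableT_comp (@normr_measurable R setT)). Qed.
Lemma mf_powR f p : M f -> M (fun x => f x `^ p).
Proof. by move=> mf; exact: (measurableT_comp (@measurable_powR R p)). Qed.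
Lemma mf_expR f : M f -> M (fun x => expR (f x)).
Proof. by move=> mf; exact: (measurableT_comp (@measurable_expR R)). Qed.
Lemma mf_cos f : M f -> M (fun x => cos (f x)).
Proof.
move=> mf; apply: (measurableT_comp _ mf).
exact: (continuous_measurable_fun (@continuous_cos R)).
Qed.
Lemma mf_sin f : M f -> M (fun x => sin (f x)).
Proof.
move=> mf; apply: (measurableT_comp _ mf).
exact: (continuous_measurable_fun (@continuous_sin R)).
Qed.
Lemma mf_max f g : M f -> M g -> M (fun x => Num.max (f x) (g x)).
Proof. exact: measurable_maxr. Qed.
Lemma mf_sum (I : Type) (s : seq I) (P : pred I) (F : I -> T -> R) :
 (forall i, M (F i)) -> M (fun x => \sum_(i <- s | P i) F i x).
Proof.
move=> mF; elim: s => [|a s IH].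
 by under eq_fun do rewrite big_nil; exact: mf_cst.
under eq_fun do rewrite big_cons; case: (P a) => //; exact: mf_add.
Qed.
Lemma mf_prod (I : Type) (s : seq I) (P : pred I) (F : I -> T -> R) :
 (forall i, M (F i)) -> M (fun x => \prod_(i <- s | P i) F i x).
Proof.
move=> mF; elim: s => [|a s IH].
 by under eq_fun do rewrite big_nil; exact: mf_cst.
under eq_fun do rewrite big_cons; case: (P a) => //; exact: mf_mul.
Qed.
Lemma mf_EFin f : M f -> M (fun x => (f x)%:E).
Proof. by move=> mf; apply/measurable_EFinP. Qed.
Lemma mf_indic (A : set T) : measurable A -> M (fun x => \1_A x : R).
Proof. by move=> mA; exact: measurable_indic. Qed.
Lemma mf_inv f : M f -> M (fun x => (f x)^-1).
Proof.
move=> mf; apply: (measurableT_comp _ mf).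
(* Inversion is rewritten through [powR], which is measurable; at 0 both sides are 0. *)
have -> : @GRing.inv R = (fun x : R => x * (x ^+ 2) `^ (-1)).
 apply/funext => x /=; have [->|x0] := eqVneq x 0.
  lra.
 by rewrite powRN powRr1 ?sqr_ge0// expr2 invfM mulrA divff// mul1r.
apply: measurable_funM => //.
exact: (measurableT_comp (@measurable_powR R (-1)) (@exprn_measurable R setT 2)).
Qed.
End mfun.

Section mfunpair.
Context d (T : measurableType d) d1 (T1 : measurableType d1) d2 (T2 : measurableType d2).
Lemma mf_fst (f : T -> T1 * T2) : mfun f -> mfun (fun x => (f x).1).
Proof. by move=> mf; exact: (measurableT_comp measurable_fst mf). Qed.
Lemma mf_snd (f : T -> T1 * T2) : mfun f -> mfun (fun x => (f x).2).
Proof. by move=> mf; exact: (measurableT_comp measurable_snd mf). Qed.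
Lemma mf_pair (f : T -> T1) (g : T -> T2) : mfun f -> mfun g ->
 mfun (fun x => (f x, g x)).
Proof. exact: measurable_fun_pair. Qed.
End mfunpair.

Lemma measurable_vcons d (T : measurableType d) (R : realType) n (f : T -> R) (g : T -> 'rV[R]_n) :
 mfun f -> mfun g ->
 mfun (fun x => vcons (f x) (g x)).
Proof.
move=> mf mg; exact: (measurableT_comp (@measurable_ucons R n) (mf_pair mf mg)).
Qed.

(** Syntax-directed on the head of the body, so that unification stays first-order. A hypothesis on
    v is used both for v and for its compositions. *)
Ltac mm1 := lazymatch goal with
 | |- measurable_fun _ (fun x => x) => exact: measurable_id
 | |- measurable_fun _ fst => exact: measurable_fst
 | |- measurable_fun _ snd => exact: measurable_snd
 | |- measurable_fun _ (fun x => EFin (@?f x)) => refine (@mf_EFin _ _ _ f _)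
 | |- measurable_fun _ (fun x => @GRing.add _ (@?f x) (@GRing.opp _ (@?g x))) =>
   first [refine (@mf_add _ _ _ f (fun x => - g x) _ _) | refine (@measurable_rvB _ _ _ _ f g _ _)]
 | |- measurable_fun _ (fun x => @GRing.add _ (@?f x) (@?g x)) =>
   first [refine (@mf_add _ _ _ f g _ _) | refine (@measurable_rvD _ _ _ _ f g _ _)]
 | |- measurable_fun _ (fun x => @GRing.opp _ (@?f x)) => refine (@mf_opp _ _ _ f _)
 | |- measurable_fun _ (fun x => @GRing.mul _ (@?f x) (@?g x)) => refine (@mf_mul _ _ _ f g _ _)
 | |- measurable_fun _ (fun x => @GRing.scale _ _ (@?f x) (@?g x)) => refine (@measurable_rvZ _ _ _ _ f g _ _)
 | |- measurable_fun _ (fun x => @GRing.inv _ (@?f x)) => refine (@mf_inv _ _ _ f _)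
 | |- measurable_fun _ (fun x => @GRing.exp _ (@?f x) _) => refine (@mf_exp _ _ _ f _ _)
 | |- measurable_fun _ (fun x => Num.norm (@?f x)) => refine (@mf_norm _ _ _ f _)
 | |- measurable_fun _ (fun x => powR (@?f x) _) => refine (@mf_powR _ _ _ f _ _)
 | |- measurable_fun _ (fun x => expR (@?f x)) => refine (@mf_expR _ _ _ f _)
 | |- measurable_fun _ (fun x => cos (@?f x)) => refine (@mf_cos _ _ _ f _)
 | |- measurable_fun _ (fun x => sin (@?f x)) => refine (@mf_sin _ _ _ f _)
 | |- measurable_fun _ (fun x => Order.max (@?f x) (@?g x)) => refine (@mf_max _ _ _ f g _ _)
 | |- measurable_fun _ (fun x => \sum_(i <- _ | _) _) => apply: mf_sum => ?
 | |- measurable_fun _ (fun x => \prod_(i <- _ | _) _) => apply: mf_prod => ?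
 | |- measurable_fun _ (fun x => fun_of_matrix (@?f x) _ _) => refine (@measurable_fun_coord _ _ _ _ f _ _)
 | |- measurable_fun _ (fun x => vcons (@?f x) (@?g x)) => refine (@measurable_vcons _ _ _ _ f g _ _)
 | |- measurable_fun _ (fun x => (@?f x, @?g x)) => refine (@mf_pair _ _ _ _ _ _ f g _ _)
 | |- measurable_fun _ (fun x => fst (@?f x)) => refine (@mf_fst _ _ _ _ _ _ f _)
 | |- measurable_fun _ (fun x => snd (@?f x)) => refine (@mf_snd _ _ _ _ _ _ f _)
 | H : mfun ?v |- measurable_fun _ (fun x => ?v x) => exact: H
 | H : mfun ?v |- measurable_fun _ ?v => exact: H
 | H : mfun ?v |- measurable_fun _ (fun x => ?v (@?g x)) =>
   refine (@measurableT_comp _ _ _ _ _ _ v _ g H _)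
 | H : forall i, mfun (?v i) |- measurable_fun _ (?v ?j) => exact: H
 | H : forall i, mfun (?v i) |- measurable_fun _ (fun x => ?v ?j x) => exact: H
 | H : forall i, mfun (?v i) |- measurable_fun _ (fun x => ?v ?j (@?g x)) =>
   refine (@measurableT_comp _ _ _ _ _ _ (v j) _ g (H j) _)
 | _ => first [assumption | exact: mf_cst | exact: measurable_cst]
 end.
Ltac mm := repeat mm1.

(** * Tonelli and Fubini for real-valued integrands *)

Section tonelli.
Context d1 d2 (T1 : measurableType d1) (T2 : measurableType d2) (R : realType).
Variables (m1 : {sigma_finite_measure set T1 -> \bar R}) (m2 : {sigma_finite_measure set T2 -> \bar R}).

Lemma tonelliE (f : T1 -> T2 -> R) : mfun (fun p => f p.1 p.2) ->
 (forall x y, 0 <= f x y) ->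
 (\int[m1]_x \int[m2]_y (f x y)%:E = \int[m2]_y \int[m1]_x (f x y)%:E)%E.
Proof.
move=> mf f0.
by apply: (@fubini_tonelli _ _ _ _ _ m1 m2 (fun p => (f p.1 p.2)%:E));
 [exact/measurable_EFinP | move=> p; rewrite lee_fin].
Qed.

Lemma measurable_int_nneg (f : T1 -> T2 -> R) : mfun (fun p => f p.1 p.2) ->
 (forall x y, 0 <= f x y) -> mfun (fun x => \int[m2]_y (f x y)%:E)%E.
Proof.
move=> mf f0.
by apply: (@measurable_fun_fubini_tonelli_F _ _ _ _ _ m2 (fun p => (f p.1 p.2)%:E));
 [exact/measurable_EFinP | move=> p; rewrite lee_fin].
Qed.

Lemma measurable_int_ereal (f : T1 -> T2 -> R) : mfun (fun p => f p.1 p.2) ->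
 mfun (fun x => \int[m2]_y (f x y)%:E)%E.
Proof.
move=> mf; under eq_fun do rewrite integralE.
have h (g : T1 * T2 -> \bar R) : mfun g -> (forall z, 0 <= g z)%E ->
  mfun (fun x => \int[m2]_y g (x, y))%E.
 by move=> mg g0; apply: (@measurable_fun_fubini_tonelli_F _ _ _ _ _ m2 g).
have mE : mfun (fun p => (f p.1 p.2)%:E) by exact/measurable_EFinP.
apply: emeasurable_funB.
- have := h _ (measurable_funepos mE) (fun p => funepos_ge0 _ p). congr measurable_fun; apply/funext => x; apply: eq_integral => y _. by rewrite !funeposE.
- have := h _ (measurable_funeneg mE) (fun p => funeneg_ge0 _ p). congr measurable_fun; apply/funext => x; apply: eq_integral => y _. by rewrite !funenegE.
Qed.

Lemma measurable_Rint (f : T1 -> T2 -> R) : mfun (fun p => f p.1 p.2) ->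
 mfun (fun x => \int[m2]_y f x y).
Proof.
move=> mf; apply: (measurableT_comp (@fine_measurable R setT measurableT)).
exact: measurable_int_ereal.
Qed.

(** Every slice is assumed integrable, not almost every one: [Rintegral] takes [fine] of the inner
    integrals, so these must be finite everywhere for the iterated real integrals to agree with the
    extended ones. *)
Lemma fubiniR (f : T1 -> T2 -> R) : mfun (fun p => f p.1 p.2) ->
 (\int[m1]_x \int[m2]_y (`|f x y|)%:E < +oo)%E ->
 (forall x, m2.-integrable setT (fun y => (f x y)%:E)) ->
 (forall y, m1.-integrable setT (fun x => (f x y)%:E)) ->
 \int[m1]_x \int[m2]_y f x y = \int[m2]_y \int[m1]_x f x y.
Proof.
move=> mf foo i2 i1; rewrite /Rintegral; congr fine.
have h : (m1 \x m2)%E.-integrable setT (fun p => (f p.1 p.2)%:E).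
 apply/integrable12ltyP; first exact/measurable_EFinP. exact: foo.
transitivity (\int[m1]_x \int[m2]_y (f x y)%:E)%E.
 by apply: eq_integral => x _; rewrite fineK//; exact: (integrable_fin_num measurableT (i2 x)).
transitivity (\int[m2]_y \int[m1]_x (f x y)%:E)%E; last first.
 by apply: eq_integral => x _; rewrite fineK//; exact: (integrable_fin_num measurableT (i1 x)).
exact: (Fubini h).
Qed.

Lemma fubini_integrable (f : T1 -> T2 -> R) : mfun (fun p => f p.1 p.2) ->
 (\int[m1]_x \int[m2]_y (`|f x y|)%:E < +oo)%E ->
 (forall x, m2.-integrable setT (fun y => (f x y)%:E)) ->
 m1.-integrable setT (fun x => (\int[m2]_y f x y)%:E).
Proof.
move=> mf foo i2.
have h : (m1 \x m2)%E.-integrable setT (fun p => (f p.1 p.2)%:E).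
 apply/integrable12ltyP; first exact/measurable_EFinP. exact: foo.
have := integrable_fubini_F h; apply: eq_integrable => // x _.
by rewrite /fubini_F /Rintegral fineK//; exact: (integrable_fin_num measurableT (i2 x)).
Qed.
End tonelli.

Section leb1.
Variable R : realType.
Notation mu := (@lebesgue_measure R).

(** Uniqueness of Lebesgue measure: the push-forward has the right value on half-open intervals. For
    s = -1 the preimage is half-open at the other end, which has the same length. *)
Lemma leb_affine (s a : R) (f : R -> \bar R) : s = 1 \/ s = -1 ->
 mfun f -> (forall x, (0 <= f x)%E) ->
 (\int[mu]_x f (s * x + a)%R = \int[mu]_x f x)%E.
Proof.
move=> hs mf f0.
pose h : measurableTypeR R -> measurableTypeR R := fun x => s * x + a.
have mh : mfun h by rewrite /h; mm.
pose m : measure (measurableTypeR R) R :=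
 @measure_function_pushforward__canonical__measure_function_Measure _ _ _ _ _
  (@lebesgue_measure R) h mh.
have E A : measurable A -> lebesgue_measure A = m A.
 apply: lebesgue_measure_unique => _ [[u v] _ <-]. rewrite /m /= /pushforward. case: hs => -> in h mh m *.
  have -> : h @^-1` [set` Interval (BRight u) (BRight v)] =
    [set` Interval (BRight (u - a)) (BRight (v - a))].
   apply/seteqP; split => x; rewrite /h /= !in_itv/= mul1r; lra.
  rewrite !lebesgue_measure_itv/= !lte_fin ltrD2r; case: ifP => // _. by rewrite -!EFinB; congr EFin; ring.
 have -> : h @^-1` [set` Interval (BRight u) (BRight v)] =
    [set` Interval (BLeft (a - v)) (BLeft (a - u))].
  apply/seteqP; split => x; rewrite /h /= !in_itv/=; lra.
 rewrite !lebesgue_measure_itv/= !lte_fin ltrD2l ltrN2; case: ifP => // _. by rewrite -!EFinB; congr EFin; ring.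
rewrite [RHS](@eq_measure_integral _ _ _ _ m) => [|A mA _]; last exact: E.
by rewrite [RHS](ge0_integral_pushforward mh).
Qed.
End leb1.

Section lebmS.
Variable R : realType.
Notation mu := (@lebesgue_measure R).

Lemma integral_lebmS n (f : 'rV[R]_n.+1 -> R) : mfun f -> nneg f ->
 (\int[lebm R n.+1]_x (f x)%:E = \int[mu]_t \int[lebm R n]_y (f (vcons t y))%:E)%E.
Proof.
move=> mf f0.
rewrite [LHS](@ge0_integral_pushforward _ _ _ _ _ (@ucons R n) (@measurable_ucons R n)
  (mu \x lebm R n)%E setT (fun x => (f x)%:E)); last 3 first.
- by [].
- by apply/measurable_EFinP.
- by move=> y _; rewrite lee_fin.
rewrite preimage_setT fubini_tonelli1 //.
- by apply/measurable_EFinP; exact: (measurableT_comp mf (@measurable_ucons R n)).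
- by move=> x; rewrite lee_fin.
Qed.

Lemma integral_lebm0 (f : 'rV[R]_0 -> R) : mfun f -> 
 (\int[lebm R 0]_x (f x)%:E = (f 0)%:E)%E.
Proof.
move=> mf; rewrite [LHS](@integral_dirac _ _ _ _ setT measurableT (fun x => (f x)%:E)); last exact/measurable_EFinP.
by rewrite diracT mul1e.
Qed.

Lemma lebnE n (A : set 'rV[R]_n) : measurable A -> lebn A = lebm R n A.
Proof.
elim: n A => [A mA|n IH A mA] /=.
 rewrite /dirac indicE; case: asboolP => h; first by rewrite mem_set. by rewrite memNset.
rewrite /stepm /pushforward /product_measure1/=; apply: eq_integral => t _.
rewrite IH /=.
 by congr (lebm R n _); apply/seteqP; split => y; rewrite /xsection/= ?inE.
rewrite -[X in measurable X]setTI.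
by apply: (measurable_vcons (mf_cst t) (@measurable_id _ _ setT)).
Qed.

(** Translations and x -> -x are the only changes of variables made on R^n; both act coordinate by
    coordinate, hence the induction. *)
Lemma lebm_affine n (s : R) (a : 'rV[R]_n) (f : 'rV[R]_n -> R) : s = 1 \/ s = -1 ->
 mfun f -> nneg f ->
 (\int[lebm R n]_x (f (s *: x + a)%R)%:E = \int[lebm R n]_x (f x)%:E)%E.
Proof.
move=> hs; elim: n a f => [a f mf f0|n IH a f mf f0].
 by apply: eq_integral => x _; rewrite [_ + _](_ : _ = x)//; apply/rowP; case.
have vE t (y : 'rV[R]_n) : s *: vcons t y + a = vcons (s * t + vhead a) (s *: y + vtail a).
 by apply/rowP => i; rewrite !mxE; case: (unliftP ord0 i) => [j|] ->; rewrite ?mxE.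
rewrite (@integral_lebmS n (fun x => f (s *: x + a))); [|by mm|by []].
rewrite (@integral_lebmS n f mf f0).
have m2 : mfun (fun t : measurableTypeR R => \int[lebm R n]_y (f (vcons t y))%:E)%E.
 by apply: measurable_int_nneg; mm.
transitivity (\int[mu]_t ((fun t => \int[lebm R n]_y (f (vcons t y))%:E) (s * t + vhead a)%R))%E.
 apply: eq_integral => t _ /=. under eq_integral do rewrite vE. by apply: (IH (vtail a) (fun y => f (vcons (s * t + vhead a) y))); mm.
apply: (leb_affine _ hs m2) => t.
by apply: integral_ge0 => y _; rewrite lee_fin.
Qed.

Lemma lebm_shift n (a : 'rV[R]_n) (f : 'rV[R]_n -> R) : 
 mfun f -> nneg f ->
 (\int[lebm R n]_x (f (x + a)%R)%:E = \int[lebm R n]_x (f x)%:E)%E.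
Proof.
move=> mf f0; rewrite -[RHS](lebm_affine a (or_introl (erefl 1))) //.
by under [RHS]eq_integral do rewrite scale1r.
Qed.

Lemma lebm_reflect n (a : 'rV[R]_n) (f : 'rV[R]_n -> R) : 
 mfun f -> nneg f ->
 (\int[lebm R n]_x (f (a - x)%R)%:E = \int[lebm R n]_x (f x)%:E)%E.
Proof.
move=> mf f0; rewrite -[RHS](lebm_affine a (or_intror (erefl (-1)))) //.
by under [RHS]eq_integral do rewrite scaleN1r addrC.
Qed.

Lemma lebm_integralR n s (a : 'rV[R]_n) (f : 'rV[R]_n -> R) : s = 1 \/ s = -1 ->
 mfun f ->
 \int[lebm R n]_x (f (s *: x + a)) = \int[lebm R n]_x f x.
Proof.
move=> hs mf; rewrite /Rintegral [X in fine X = _]integralE [X in _ = fine X]integralE.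
congr (fine (_ - _)).
 have -> : ((fun x => (f (s *: x + a))%:E)^\+ = fun x => (Num.max (f (s *: x + a)) 0)%:E)%E.
  by apply/funext => x; rewrite funeposE EFin_max.
 have -> : ((fun x => (f x)%:E)^\+ = fun x => (Num.max (f x) 0)%:E)%E.
  by apply/funext => x; rewrite funeposE EFin_max.
 by apply: (@lebm_affine n s a (fun x => Num.max (f x) 0) hs); 
  [mm|move=> x; rewrite le_max lexx orbT].
have -> : ((fun x => (f (s *: x + a))%:E)^\- = fun x => (Num.max (- f (s *: x + a)) 0)%:E)%E.
 by apply/funext => x; rewrite funenegE EFin_max.
have -> : ((fun x => (f x)%:E)^\- = fun x => (Num.max (- f x) 0)%:E)%E.
 by apply/funext => x; rewrite funenegE EFin_max.
by apply: (@lebm_affine n s a (fun x => Num.max (- f x) 0) hs); 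
  [mm|move=> x; rewrite le_max lexx orbT].
Qed.
End lebmS.

(** * Integrable real functions, and Fubini with a dominated marginal *)

Section itg.
Context d (T : measurableType d) (R : realType) (m : {measure set T -> \bar R}).
Implicit Types f g : T -> R.
Definition itg f := m.-integrable setT (fun x => (f x)%:E).
Definition Ri f := \int[m]_x f x.

Lemma itg_m f : itg f -> mfun f.
Proof. by move=> /measurable_int/measurable_EFinP. Qed.
Lemma itgP f : mfun f -> (\int[m]_x `|f x|%:E < +oo)%E -> itg f.
Proof. by move=> mf h; apply/integrableP; split => //; exact/measurable_EFinP. Qed.
Lemma itg_lt f : itg f -> (\int[m]_x `|f x|%:E < +oo)%E.
Proof. by move=> /integrableP[]. Qed.
Lemma itg_dom f g : mfun f -> (forall x, `|f x| <= g x) -> itg g -> itg f.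
Proof.
move=> mf fg ig; apply: (le_integrable measurableT _ _ ig); first exact/measurable_EFinP.
by move=> x _; rewrite !abse_EFin lee_fin (le_trans (fg x))// ler_norm.
Qed.
Lemma itgD f g : itg f -> itg g -> itg (fun x => f x + g x).
Proof. by move=> hf hg; exact: (integrableD measurableT hf hg). Qed.
Lemma itgZ c f : itg f -> itg (fun x => c * f x).
Proof. by move=> hf; exact: (integrableZl measurableT c hf). Qed.
Lemma itgN f : itg f -> itg (fun x => - f x).
Proof. by move=> hf; have := integrableN hf. Qed.
Lemma itgB f g : itg f -> itg g -> itg (fun x => f x - g x).
Proof. by move=> hf hg; exact: (itgD hf (itgN hg)). Qed.
Lemma itg_norm f : itg f -> itg (absf f).
Proof.
move=> hf; exact: (integrable_norm hf).
Qed.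
Lemma itg0 : itg (fun _ => 0). Proof. exact: integrable0. Qed.
Lemma itg_sum (I : Type) (s : seq I) (P : pred I) (F : I -> T -> R) :
 (forall i, itg (F i)) -> itg (fun x => \sum_(i <- s | P i) F i x).
Proof.
move=> hF; elim: s => [|a s IH].
 by under eq_fun do rewrite big_nil; exact: itg0.
by under eq_fun do rewrite big_cons; case: (P a) => //; exact: itgD.
Qed.
Lemma itgM c f g : itg f -> mfun g -> (forall x, `|g x| <= c) ->
 itg (fun x => f x * g x).
Proof.
move=> hf mg gc; apply: (itg_dom (g := fun x => c * `|f x|)).
- by apply: mf_mul => //; exact: itg_m.
- by move=> x; rewrite normrM mulrC ler_wpM2r.
- by apply: itgZ; exact: itg_norm.
Qed.
Lemma RiE f : itg f -> (Ri f)%:E = (\int[m]_x (f x)%:E)%E.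
Proof. by move=> hf; rewrite /Ri /Rintegral fineK//; exact: integrable_fin_num hf. Qed.
Lemma RiD f g : itg f -> itg g -> Ri (fun x => f x + g x) = Ri f + Ri g.
Proof. by move=> hf hg; exact: (RintegralD measurableT hf hg). Qed.
Lemma RiB f g : itg f -> itg g -> Ri (fun x => f x - g x) = Ri f - Ri g.
Proof. by move=> hf hg; exact: (RintegralB measurableT hf hg). Qed.
Lemma RiZ c f : itg f -> Ri (fun x => c * f x) = c * Ri f.
Proof. by move=> hf; exact: (RintegralZl c measurableT hf). Qed.
Lemma RiN f : itg f -> Ri (fun x => - f x) = - Ri f.
Proof.
by move=> hf; rewrite -mulN1r -RiZ//; congr Ri; apply/funext => x; rewrite mulN1r.
Qed.
Lemma Ri_eq f g : f =1 g -> Ri f = Ri g. Proof. by move=> /funext ->. Qed.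
Lemma Ri_le f g : itg f -> itg g -> (forall x, f x <= g x) -> Ri f <= Ri g.
Proof. by move=> hf hg fg; apply: le_Rintegral. Qed.
Lemma Ri_ge0 f : nneg f -> 0 <= Ri f.
Proof. by move=> f0; apply: Rintegral_ge0. Qed.
Lemma Ri_norm f : itg f -> `|Ri f| <= Ri (absf f).
Proof. by move=> hf; apply: le_normr_Rintegral. Qed.
Lemma Ri_norm_le f g : mfun f -> itg g -> (forall x, `|f x| <= g x) ->
 `|Ri f| <= Ri g.
Proof.
move=> mf hg fg; have hf := itg_dom mf fg hg.
by apply: (le_trans (Ri_norm hf)); apply: Ri_le => //; exact: itg_norm.
Qed.
Lemma Ri_sum (I : Type) (s : seq I) (P : pred I) (F : I -> T -> R) :
 (forall i, itg (F i)) -> Ri (fun x => \sum_(i <- s | P i) F i x) = \sum_(i <- s | P i) Ri (F i).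
Proof.
move=> hF; elim: s => [|a s IH].
 by rewrite big_nil /Ri; under eq_Rintegral do rewrite big_nil; rewrite Rintegral_cst// mul0r.
rewrite big_cons (Ri_eq (g := fun x => if P a then F a x + \sum_(j <- s | P j) F j x
  else \sum_(j <- s | P j) F j x)); last by move=> x; rewrite big_cons.
by case: (P a) => //; rewrite RiD ?IH//; exact: itg_sum.
Qed.
End itg.

Arguments Ri_eq {d T R m f} g _.
Arguments RiD {d T R m f g} _ _.
Arguments RiB {d T R m f g} _ _.
Arguments RiZ {d T R m} c {f} _.
Arguments RiE {d T R m f} _.
Arguments RiN {d T R m f} _.
Arguments itg_dom {d T R m f} g _ _ _.
Arguments itgZ {d T R m} c {f} _.
Arguments itgM {d T R m} c {f g} _ _ _.
Arguments Ri_le {d T R m f g} _ _ _.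
Arguments Ri_norm_le {d T R m f} g _ _ _.
Arguments Ri_sum {d T R m I} s P {F} _.
Arguments Ri_ge0 {d T R m f} _.

Section fubini_dom.
Context d1 d2 (T1 : measurableType d1) (T2 : measurableType d2) (R : realType).
Variables (m1 : {sigma_finite_measure set T1 -> \bar R}) (m2 : {sigma_finite_measure set T2 -> \bar R}).
Variables (F : T1 -> T2 -> R) (a : T1 -> R).
Hypotheses (mF : mfun (fun p => F p.1 p.2)) (ia : itg m1 a)
 (iF : forall y, itg m2 (F y)) (Fa : forall y, Ri m2 (fun w => `|F y w|) <= a y).

(** The form in which Fubini is used below: the L^1 norm of each slice [F y] is at most an
    integrable a(y). *)
Lemma fubini_fin : (\int[m1]_y \int[m2]_w (`|F y w|)%:E < +oo)%E.
Proof.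
rewrite (eq_integral (fun y => (Ri m2 (fun w => `|F y w|))%:E)); last first.
 by move=> y _; rewrite RiE//; exact: itg_norm.
apply: le_lt_trans (integrable_lty measurableT ia).
apply: ge0_le_integral => //.
- by move=> y _; rewrite lee_fin Ri_ge0.
- apply/measurable_EFinP; apply: (@measurable_Rint _ _ _ _ _ m2 (fun y w => `|F y w|)). exact: mf_norm.
- by apply/measurable_EFinP; exact: itg_m ia.
- by move=> y _; rewrite lee_fin.
Qed.

Lemma fubini_dom : (forall w, itg m1 (F^~ w)) ->
 Ri m1 (fun y => Ri m2 (F y)) = Ri m2 (fun w => Ri m1 (F^~ w)).
Proof. by move=> iF2; apply: fubiniR => //; exact: fubini_fin. Qed.

Lemma fubini_itg : itg m1 (fun y => Ri m2 (F y)).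
Proof. by apply: fubini_integrable => //; exact: fubini_fin. Qed.
End fubini_dom.

(** * A product weight that compares [iint] with the Lebesgue integral *)

Section dec.
Variable R : realType.
Notation mu := (@lebesgue_measure R).

Lemma itg_dec1 : itg mu (fun x : R => (1 + x ^+ 2)^-1).
Proof.
have p (x : R) : 0 < 1 + x ^+ 2 by rewrite ltr_pwDl// sqr_ge0.
apply: itgP => /=; first by mm.
under eq_integral do rewrite ger0_norm ?invr_ge0 ?ltW//.
rewrite (@ge0_symfun_integralT R (fun x => (1 + x ^+ 2)^-1)).
- rewrite (_ : [set x : R | 0 <= x] = `[0, +oo[%classic); last first.
  by apply/seteqP; split => x; rewrite /= in_itv andbT.
 have := @integral0y_oneDsqr R; rewrite /oneDsqr /= => ->. by rewrite -EFinM ltry.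
- by move=> x; rewrite invr_ge0 ltW.
- exact: continuous_oneDsqrV.
- by move=> x; rewrite /= sqrrN.
Qed.

(** A product of integrable one-variable weights: domination by a multiple of it passes to every
    slice, as the recursion of [iint] demands at each stage, and it is integrable in every
    dimension. *)
Definition dec n (x : 'rV[R]_n) : R := \prod_(i < n) (1 + x ord0 i ^+ 2)^-1.

Lemma dec_gt0 n (x : 'rV[R]_n) : 0 < dec x.
Proof. by apply: prodr_gt0 => i _; rewrite invr_gt0 ltr_pwDl// sqr_ge0. Qed.

Lemma dec_vcons n t (y : 'rV[R]_n) : dec (vcons t y) = (1 + t ^+ 2)^-1 * dec y.
Proof.
rewrite /dec big_ord_recl vcons0; congr (_ * _).
by apply: eq_bigr => i _; rewrite vconsS.
Qed.

Lemma measurable_dec n : mfun (@dec n).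
Proof. by rewrite /dec; apply: mf_prod => i; mm. Qed.

Lemma integral_prodS n (h : R -> R) (g : 'rV[R]_n -> R) :
 mfun h -> mfun g -> nneg h -> nneg g ->
 (\int[lebm R n.+1]_x (h (vhead x) * g (vtail x))%:E =
  (\int[mu]_t (h t)%:E) * (\int[lebm R n]_y (g y)%:E))%E.
Proof.
move=> mh mg h0 g0.
have mvh := @measurable_vhead R n; have mvt := @measurable_vtail R n.
rewrite (@integral_lebmS R n (fun x => h (vhead x) * g (vtail x))); last 2 first.
- by mm.
- by move=> x; rewrite mulr_ge0.
transitivity (\int[mu]_t ((h t)%:E * \int[lebm R n]_y (g y)%:E))%E.
 apply: eq_integral => t _; rewrite -ge0_integralZl_EFin//.
 - apply: eq_integral => y _; rewrite /vhead vcons0; congr EFin; congr (_ * g _). by apply/rowP => i; rewrite mxE vconsS.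
 - by move=> y _; rewrite lee_fin.
 - exact/measurable_EFinP.
rewrite ge0_integralZr//; first by apply/measurable_EFinP.
- by move=> t _; rewrite lee_fin.
- by apply: integral_ge0 => y _; rewrite lee_fin.
Qed.

Lemma itg_dec n : itg (lebm R n) (@dec n).
Proof.
apply: itgP; first exact: measurable_dec.
under eq_integral do rewrite ger0_norm ?ltW ?dec_gt0//.
elim: n => [|n IH].
 rewrite integral_lebm0; last exact: measurable_dec. by rewrite ltry.
rewrite (eq_integral (fun x => ((1 + vhead x ^+ 2)^-1 * dec (vtail x))%:E)); last first.
 by move=> x _; rewrite -{1}(vcons_eta x) dec_vcons.
rewrite (@integral_prodS n (fun t => (1 + t ^+ 2)^-1)); last 4 first.
- by mm.
- exact: measurable_dec.
- by move=> t; rewrite invr_ge0 addr_ge0 ?sqr_ge0.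
- by move=> y; rewrite ltW ?dec_gt0.
rewrite lte_mul_pinfty//.
- by apply: integral_ge0 => t _; rewrite lee_fin invr_ge0 addr_ge0 ?sqr_ge0.
- have h := itg_dec1; rewrite ge0_fin_numE.
  have := itg_lt h; under eq_integral do rewrite ger0_norm ?invr_ge0 ?addr_ge0 ?sqr_ge0//. by [].
 by apply: integral_ge0 => t _; rewrite lee_fin invr_ge0 addr_ge0 ?sqr_ge0.
Qed.

Lemma Ri_lebmS n (f : 'rV[R]_n.+1 -> R) : itg (lebm R n.+1) f ->
 (forall t, itg (lebm R n) (fun y => f (vcons t y))) ->
 Ri (lebm R n.+1) f = Ri mu (fun t => Ri (lebm R n) (fun y => f (vcons t y))).
Proof.
move=> hf hs; rewrite /Ri /Rintegral; congr fine.
transitivity (\int[mu]_t \int[lebm R n]_y (f (vcons t y))%:E)%E; last first.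
 by apply: eq_integral => t _; rewrite fineK//; exact: (integrable_fin_num measurableT (hs t)).
have mf := itg_m hf.
have i2 : (mu \x lebm R n)%E.-integrable setT (fun p => (f (ucons p))%:E).
 apply/integrable12ltyP.
  by apply/measurable_EFinP; exact: (measurableT_comp mf (@measurable_ucons R n)).
 have := itg_lt hf; rewrite (@integral_lebmS R n (absf f)) //. by mm.
rewrite [LHS](@integral_pushforward _ _ _ _ _ (@ucons R n) (@measurable_ucons R n)
  (mu \x lebm R n)%E setT (fun x => (f x)%:E)) //.
- by rewrite preimage_setT -(integral12_prod_meas1 i2).
- exact/measurable_EFinP.
Qed.

Lemma iintE n (f : 'rV[R]_n -> R) : mfun f ->
 (exists C, forall x, `|f x| <= C * dec x) -> iint f = Ri (lebm R n) f.
Proof.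
elim: n f => [f mf _|n IH f mf [C hC]].
 rewrite /= /Ri /Rintegral integral_lebm0//.
have hs t : itg (lebm R n) (fun y => f (vcons t y)).
 apply: (itg_dom (fun y => (C * (1 + t ^+ 2)^-1) * dec y)); first by mm.
 - by move=> y; rewrite (le_trans (hC _))// dec_vcons mulrA.
 - exact/itgZ/itg_dec.
rewrite Ri_lebmS//; last first.
 exact: (itg_dom _ mf hC (itgZ C (itg_dec n.+1))).
rewrite /=; congr Rintegral; apply/funext => t; apply: IH; first by mm.
exists (C * (1 + t ^+ 2)^-1) => y.
by rewrite (le_trans (hC _))// dec_vcons mulrA.
Qed.
End dec.

(** * Measurability of continuous functions *)

Section contmeas.
Variable R : realType.

Lemma continuous_rv_measurable n (f : 'rV[R]_n -> R) : continuous f -> mfun f.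
Proof.
move=> cf; apply: (measurability _ (RGenOInfty.measurableE R)) => //.
move=> _ [_ [a ->] <-]; rewrite setTI.
have oU : open (f @^-1` `]a, +oo[%classic).
 by apply: open_comp.
set U := _ @^-1` _ in oU *.
(* Rational boxes: an open set is the union of the countably many boxes that it contains. *)
pose bl (p : 'rV[rat]_n * rat) := \bigcap_(i in [set: 'I_n])
 [set x : 'rV[R]_n | `|x ord0 i - ratr (p.1 ord0 i)| < ratr p.2].
have -> : U = \bigcup_(p in [set p | bl p `<=` U]) bl p.
 apply/seteqP; split => [x Ux|x [p pU px]]; last exact: pU. have /nbhs_ballP[e e0 he] := open_nbhs_nbhs (conj oU Ux). have e20 : 0 < e / 2 by rewrite divr_gt0.
 have [r] := rat_in_itvoo e20; rewrite in_itv/= => /andP[r0 r1]. have /choice[q hq] : forall i, exists q : rat, `|x ord0 i - ratr q| < ratr r.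
  move=> i; have lt : x ord0 i - ratr r < x ord0 i + ratr r by lra. have [q] := rat_in_itvoo lt; rewrite in_itv/= => /andP[h1 h2].
  by exists q; rewrite ltr_norml; apply/andP; split; lra.
 exists (\row_i q i, r) => [|i _] /=; last by rewrite mxE. move=> y hy; apply: he; split => // i j; rewrite !ord1.
 have := hy j I; have := hq j; rewrite /= mxE => h1 h2. rewrite /ball/= (_ : _ - _ = (x ord0 j - ratr (q j)) - (y ord0 j - ratr (q j))); last by ring.
 by rewrite (le_lt_trans (ler_normB _ _)); lra.
rewrite bigcup_mkcond; apply: countable_bigcupT_measurable; first exact: countableP.
move=> p; case: ifP => // _; apply: fin_bigcap_measurable => // i _.
rewrite [X in measurable X](_ : _ = (fun x : 'rV[R]_n => `|x ord0 i - ratr (p.1 ord0 i)|) @^-1` `]-oo, ratr p.2[%classic).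
 rewrite -[X in measurable X]setTI. have m2 : mfun (fun x : 'rV[R]_n => `|x ord0 i - ratr (p.1 ord0 i)|) by mm. exact: (m2 measurableT _ (measurable_itv _)).
by [].
Qed.
End contmeas.

(** * The heat kernel *)

Section gauss1.
Variable R : realType.
Implicit Types s t r x y z : R.
Notation mu := (@lebesgue_measure R).

Definition g1 t x : R := expR (- x ^+ 2 / (4 * t)) / sqrt (4 * pi * t).

Lemma pit_gt0 t : 0 < t -> 0 < 4 * pi * t :> R.
Proof. by move=> t0; rewrite !mulr_gt0// pi_gt0. Qed.

Lemma sqpit_gt0 t : 0 < t -> 0 < sqrt (4 * pi * t).
Proof. by move=> t0; rewrite sqrtr_gt0 pit_gt0. Qed.

Lemma g1_gt0 t x : 0 < t -> 0 < g1 t x.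
Proof. by move=> t0; rewrite /g1 divr_gt0 ?expR_gt0 ?sqpit_gt0. Qed.

Lemma measurable_g1 t : mfun (g1 t).
Proof. by rewrite /g1; mm. Qed.

Lemma g1N t x : g1 t (- x) = g1 t x. Proof. by rewrite /g1 sqrrN. Qed.

Lemma g1_normal t : 0 < t -> g1 t = normal_pdf 0 (sqrt (2 * t)).
Proof.
move=> t0; have s0 : sqrt (2 * t) != 0 by rewrite sqrtr_eq0 -ltNge mulr_gt0.
rewrite normal_pdfE//; apply/funext => x.
rewrite /normal_peak /normal_fun sqr_sqrtr ?mulr_ge0 ?ltW// subr0 mulrC /g1.
by congr (expR (_ / _) / sqrt _); rewrite -mulr_natl; ring.
Qed.

Lemma int_g1 t : 0 < t -> (\int[mu]_x (g1 t x)%:E = 1)%E.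
Proof. by move=> t0; rewrite g1_normal//; exact: integral_normal_pdf. Qed.

(** Passing to a longer comparable time increases the exponential, and the normalisation loses at
    most sqrt K <= K. *)
Lemma g1_mono K r r' x : 0 < r -> r <= r' -> r' <= K * r -> 1 <= K ->
 g1 r x <= K * g1 r' x.
Proof.
move=> r0 rr Kr K1; have r'0 : 0 < r' by apply: lt_le_trans rr.
have h2 : expR (- x ^+ 2 / (4 * r)) <= expR (- x ^+ 2 / (4 * r')).
 rewrite ler_expR !mulNr lerN2 ler_wpM2l ?sqr_ge0// lef_pV2 ?posrE ?mulr_gt0//. lra.
have h1 : sqrt (4 * pi * r') <= K * sqrt (4 * pi * r).
 have K0 : 0 <= K by lra. rewrite -{1}(ger0_norm K0) -sqrtr_sqr -sqrtrM ?sqr_ge0//. have p0 := pi_gt0 R.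
 rewrite ler_sqrt; last by rewrite mulr_ge0 ?sqr_ge0 ?mulr_ge0 ?ltW. apply: (le_via (4 * pi * (K * r))).
  by rewrite ler_wpM2l// mulr_ge0 ?ltW.
 rewrite (_ : K ^+ 2 * _ = 4 * pi * (K * r) * K); last by ring. by apply: ler_peMr => //; rewrite mulr_ge0 ?mulr_ge0// ltW.
rewrite /g1; apply: (le_via (expR (- x ^+ 2 / (4 * r')) / sqrt (4 * pi * r))).
 by rewrite ler_wpM2r// invr_ge0 sqrtr_ge0.
rewrite mulrCA ler_wpM2l ?expR_ge0//.
by rewrite ler_pdivlMr ?sqpit_gt0// mulrC ler_pdivrMr ?sqpit_gt0.
Qed.

(** With y = |x| / sqrt t, the factor y / 2 is below exp(y^2 / 8), and exp(-y^2 / 4 + y^2 / 8) is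
    the Gaussian at time 2 t: a derivative costs t^(-1/2) and a doubling of the time. *)
Lemma g1_deriv_le t x : 0 < t ->
 `|x / (2 * t)| * g1 t x <= (sqrt t)^-1 * (2 * g1 (2 * t) x).
Proof.
move=> t0; have st : 0 < sqrt t by rewrite sqrtr_gt0.
have t20 : 0 < 2 * t by lra.
have h : `|x / (2 * t)| <= (sqrt t)^-1 * expR (x ^+ 2 / (8 * t)).
 set y := `|x| / sqrt t. have y2 : y ^+ 2 = x ^+ 2 / t.
  by rewrite /y exprMn exprVn sqr_sqrtr ?ltW// real_normK ?num_real.
 have -> : `|x / (2 * t)| = (sqrt t)^-1 * (y / 2).
  rewrite normrM normfV (ger0_norm (ltW t20)) /y -{1}(sqr_sqrtr (ltW t0)) expr2. lra.
 rewrite ler_wpM2l ?invr_ge0 ?ltW//. have -> : x ^+ 2 / (8 * t) = y ^+ 2 / 8 by lra. by apply: lt_le_trans (expR_ge1Dx _); nra.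
apply: le_trans (_ : (sqrt t)^-1 * expR (x ^+ 2 / (8 * t)) * g1 t x <= _).
 by apply: ler_wpM2r => //; exact/ltW/g1_gt0.
rewrite -mulrA; apply: ler_wpM2l; first by rewrite invr_ge0 ltW.
rewrite /g1 [X in X <= _]mulrA -expRD (_ : _ + _ = - x ^+ 2 / (4 * (2 * t))); last first.
 lra.
rewrite (_ : 4 * pi * (2 * t) = 2 * (4 * pi * t)); last by ring.
rewrite [X in _ <= X]mulrCA; apply: ler_wpM2l; first exact: expR_ge0.
have q0 := sqpit_gt0 t0.
have q1 : 0 < sqrt (2 * (4 * pi * t)) by rewrite sqrtr_gt0 mulr_gt0 ?pit_gt0.
rewrite ler_pdivlMr// mulrC ler_pdivrMr// sqrtrM//; apply: ler_wpM2r; first exact: ltW.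
rewrite -[X in _ <= X]ger0_norm// -sqrtr_sqr ler_sqrt// expr2; lra.
Qed.

(** Completing the square in y. Integration gives the semigroup law [G_G], and the mean of the
    second factor gives its analogue [dG_G] for the derivative. *)
Lemma g1_semi s t z y : 0 < s -> 0 < t ->
 g1 s y * g1 t (z - y) = g1 (s + t) z * g1 (s * t / (s + t)) (y - s / (s + t) * z).
Proof.
move=> s0 t0; have st : 0 < s + t by rewrite addr_gt0.
rewrite /g1 !mulf_div -!expRD -!sqrtrM ?ltW ?pit_gt0//.
congr (expR _ / sqrt _); first by field; rewrite !gt_eqF.
by field; rewrite gt_eqF.
Qed.
End gauss1.

Section gaussn.
Variables (R : realType) (n : nat).
Notation T := 'rV[R]_n.
Notation m := (lebm R n).
Implicit Types (s t r : R) (x y z : T).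

Definition G t x : R := \prod_(i < n) g1 t (x ord0 i).
(** Closed form of the derivative of [G t] in direction j; [G_qd] proves that it is one. *)
Definition dG (j : 'I_n) t x : R := - (x ord0 j / (2 * t)) * G t x.

Lemma G_gt0 t x : 0 < t -> 0 < G t x.
Proof. by move=> t0; apply: prodr_gt0 => i _; exact: g1_gt0. Qed.
Lemma G_ge0 t x : 0 < t -> 0 <= G t x.
Proof. by move=> t0; exact/ltW/G_gt0. Qed.

Lemma measurable_G t : mfun (G t).
Proof.
rewrite /G; apply: mf_prod => i; have := @measurable_g1 R t => mg.
exact: (measurableT_comp mg (@measurable_coord R n i)).
Qed.
Lemma measurable_dG j t : mfun (dG j t).
Proof.
have mG := measurable_G t; have mc := @measurable_coord R n j.
by rewrite /dG; mm.
Qed.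

Lemma GN t x : G t (- x) = G t x.
Proof. by apply: eq_bigr => i _; rewrite mxE g1N. Qed.

Lemma G_mono K r r' x : 0 < r -> r <= r' -> r' <= K * r -> 1 <= K ->
 G r x <= K ^+ n * G r' x.
Proof.
move=> r0 rr Kr K1; have r'0 : 0 < r' by apply: lt_le_trans rr.
rewrite /G -[in K ^+ _](card_ord n) -prodr_const -big_split /=.
by apply: ler_prod => i _; rewrite ltW ?g1_gt0//= g1_mono.
Qed.

(** The factor j is bounded by [g1_deriv_le], the others by [g1_mono] with K = 2. *)
Lemma dG_le j t x : 0 < t -> `|dG j t x| <= 2 ^+ n / sqrt t * G (2 * t) x.
Proof.
move=> t0; have t20 : 0 < 2 * t by rewrite mulr_gt0.
rewrite /dG normrM normrN (ger0_norm (G_ge0 _ t0)) /G.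
rewrite -[in 2 ^+ _](card_ord n) -prodr_const mulrAC -big_split /=.
rewrite [X in _ <= X / _](eq_bigl xpredT)// [X in _ * X <= _](bigD1 j)//= [X in _ <= X / _](bigD1 j)//=.
rewrite mulrA [X in _ <= X]mulrAC; apply: ler_pM.
- by rewrite mulr_ge0// ltW ?g1_gt0.
- by apply: prodr_ge0 => i _; exact/ltW/g1_gt0.
- by rewrite [X in _ <= X]mulrC; exact: g1_deriv_le.
- apply: ler_prod => i _; rewrite ltW ?g1_gt0//= g1_mono//; lra.
Qed.

Lemma G_semi s t z y : 0 < s -> 0 < t ->
 G s y * G t (z - y) = G (s + t) z * G (s * t / (s + t)) (y - (s / (s + t)) *: z).
Proof.
move=> s0 t0; rewrite /G -!big_split/=; apply: eq_bigr => i _.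
by rewrite !mxE g1_semi.
Qed.

End gaussn.

Lemma int_G (R : realType) n (t : R) : 0 < t -> (\int[lebm R n]_x (G t x)%:E = 1)%E.
Proof.
move=> t0; elim: n => [|n IH].
 by rewrite integral_lebm0/G ?big_ord0//; exact: measurable_G.
rewrite (eq_integral (fun x => (g1 t (vhead x) * G t (vtail x))%:E)); last first.
 move=> x _; rewrite /G big_ord_recl; congr (_ * _)%:E. by apply: eq_bigr => i _; rewrite mxE.
rewrite integral_prodS.
- by rewrite int_g1// IH mule1.
- exact: measurable_g1.
- exact: measurable_G.
- by move=> u; rewrite ltW// g1_gt0.
- by move=> y; exact: G_ge0.
Qed.

Section gaussint.
Variables (R : realType) (n : nat).
Notation T := 'rV[R]_n.
Notation m := (lebm R n).
Implicit Types (s t r : R) (x y z : T).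

Lemma itg_G t : 0 < t -> itg m (G t).
Proof.
move=> t0; apply: itgP; first exact: measurable_G.
under eq_integral do rewrite ger0_norm ?G_ge0//.
by rewrite int_G// ltry.
Qed.

Lemma Ri_G t : 0 < t -> Ri m (G t) = 1.
Proof. by move=> t0; rewrite /Ri /Rintegral int_G. Qed.

Lemma itg_dG j t : 0 < t -> itg m (dG j t).
Proof.
move=> t0; apply: (itg_dom _ (measurable_dG j t) (fun x => dG_le j x t0)).
by apply/itgZ/itg_G; rewrite mulr_gt0.
Qed.

Lemma itg_aff (f : T -> R) s (a : T) : s = 1 \/ s = -1 -> itg m f -> itg m (fun x => f (s *: x + a)).
Proof.
move=> hs hf; have mf := itg_m hf; apply: itgP; first by mm.
by rewrite (@lebm_affine R n s a (absf f) hs) ?(itg_lt hf); mm.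
Qed.

Lemma itg_shift (f : T -> R) (a : T) : itg m f -> itg m (fun x => f (x + a)).
Proof.
by move=> hf; have := itg_aff a (or_introl erefl) hf; under eq_fun do rewrite scale1r.
Qed.
Lemma itg_refl (f : T -> R) (a : T) : itg m f -> itg m (fun x => f (a - x)).
Proof.
move=> hf; have := itg_aff a (or_intror erefl) hf.
by under eq_fun do rewrite scaleN1r addrC.
Qed.
Lemma Ri_shift (f : T -> R) (a : T) : mfun f ->
 Ri m (fun x => f (x + a)) = Ri m f.
Proof.
move=> mf; rewrite -[RHS](lebm_integralR a (or_introl (erefl 1)) mf).
by congr Ri; apply/funext => x; rewrite scale1r.
Qed.
Lemma Ri_refl (f : T -> R) (a : T) : mfun f ->
 Ri m (fun x => f (a - x)) = Ri m f.
Proof.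
move=> mf; rewrite -[RHS](lebm_integralR a (or_intror (erefl (-1))) mf).
by congr Ri; apply/funext => x; rewrite scaleN1r addrC.
Qed.

(** The function y_j G(y) is odd, so the mean of a translated Gaussian is the translation vector. *)
Lemma Ri_G_mean t j (a : T) : 0 < t ->
 itg m (fun y => y ord0 j * G t (y - a)) /\ Ri m (fun y => y ord0 j * G t (y - a)) = a ord0 j.
Proof.
move=> t0; pose h y := y ord0 j * G t y.
have mG := @measurable_G R n t; have mc := @measurable_coord R n j.
have mh : mfun h by rewrite /h; mm.
have ih : itg m h.
 apply: (itg_dom (fun y => (2 * t) * (2 ^+ n / sqrt t * G (2 * t) y))) => //.
  move=> y; have t20 : 0 < 2 * t by rewrite mulr_gt0. rewrite -ler_pdivrMl//; apply: le_trans (dG_le j y t0).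
  rewrite /dG /h !normrM normrN normrM normfV (ger0_norm (ltW t20)); lra.
 by do 2 apply: itgZ; apply: itg_G; rewrite mulr_gt0.
have h0 : Ri m h = 0.
 have : Ri m h = - Ri m h.
  rewrite -[LHS](Ri_refl 0 mh) -RiN//; apply: Ri_eq => y. by rewrite /h sub0r mxE GN mulNr.
 lra.
have E : (fun y => y ord0 j * G t (y - a)) = (fun y => h (y - a) + a ord0 j * G t (y - a)).
 by apply/funext => y; rewrite /h !mxE; ring.
have i1 := itg_shift (- a) ih; have i2 := itgZ (a ord0 j) (itg_shift (- a) (itg_G t0)).
rewrite E; split; first exact: itgD.
rewrite RiD// RiZ ?Ri_shift ?h0 ?Ri_G// ?add0r ?mulr1//.
exact: itg_shift (itg_G t0).
Qed.

Lemma G_G s t z : 0 < s -> 0 < t -> Ri m (fun y => G s y * G t (z - y)) = G (s + t) z.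
Proof.
move=> s0 t0; have c0 : 0 < s * t / (s + t) by rewrite divr_gt0 ?mulr_gt0 ?addr_gt0.
rewrite (Ri_eq _ (fun y => G_semi z y s0 t0)) RiZ; last exact: itg_shift (itg_G c0).
by rewrite Ri_shift ?Ri_G ?mulr1//; exact: measurable_G.
Qed.

Lemma dG_G j s t z : 0 < s -> 0 < t -> Ri m (fun y => dG j s y * G t (z - y)) = dG j (s + t) z.
Proof.
move=> s0 t0; have c0 : 0 < s * t / (s + t) by rewrite divr_gt0 ?mulr_gt0 ?addr_gt0.
have st : 0 < s + t by lra.
have [i1 e1] := Ri_G_mean j ((s / (s + t)) *: z) c0.
rewrite (Ri_eq (fun y => (- (2 * s)^-1 * G (s + t) z) *
 (y ord0 j * G (s * t / (s + t)) (y - (s / (s + t)) *: z)))); last first.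
 move=> y; rewrite /dG (_ : _ * _ * _ = (- (y ord0 j / (2 * s))) * (G s y * G t (z - y))); last by ring. by rewrite G_semi//; ring.
rewrite RiZ// e1 mxE /dG; field; rewrite !gt_eqF//.
Qed.
End gaussint.

(** * Convolution on bounded measurable functions *)

Section conv.
Variables (R : realType) (n : nat).
Notation T := 'rV[R]_n.
Notation m := (lebm R n).
Implicit Types (s t r : R) (x y z : T) (k u v w : T -> R).

Definition conv k u x := Ri m (fun y => k y * u (x - y)).
(** The common domain of the heat operators: convolution with an integrable kernel is defined at
    every point and stays in this class. *)
Definition bm u := mfun u /\ exists M, forall x, `|u x| <= M.

Lemma bm_m u : bm u -> mfun u. Proof. by case. Qed.

Lemma conv_itg k u x : itg m k -> bm u -> itg m (fun y => k y * u (x - y)).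
Proof.
by move=> ik [mu [M uM]]; apply: (itgM M ik); mm.
Qed.

Lemma measurable_conv k u : mfun k -> mfun u ->
 mfun (conv k u).
Proof.
by move=> mk mu; apply: (@measurable_Rint _ _ _ _ _ _ (fun x y => k y * u (x - y))); mm.
Qed.

Lemma conv_bound k u x M : itg m k -> mfun u -> (forall x, `|u x| <= M) ->
 `|conv k u x| <= M * Ri m (absf k).
Proof.
move=> ik mu uM; rewrite -RiZ; last exact: itg_norm.
have mk := itg_m ik; apply: Ri_norm_le; [mm|exact/itgZ/itg_norm|].
by move=> y; rewrite normrM mulrC ler_wpM2r.
Qed.

Lemma bm_conv k u : itg m k -> bm u -> bm (conv k u).
Proof.
move=> ik [mu [M uM]]; split; first exact: (measurable_conv (itg_m ik)).
by exists (M * Ri m (absf k)) => x; exact: conv_bound.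
Qed.

Lemma bmB u v : bm u -> bm v -> bm (fun x => u x - v x).
Proof.
move=> [mu [M uM]] [mv [N vN]]; split; first by mm.
by exists (M + N) => x; rewrite (le_trans (ler_normB _ _))// lerD.
Qed.
Lemma bmD u v : bm u -> bm v -> bm (fun x => u x + v x).
Proof.
move=> [mu [M uM]] [mv [N vN]]; split; first by mm.
by exists (M + N) => x; rewrite (le_trans (ler_normD _ _))// lerD.
Qed.
Lemma bmM u v : bm u -> bm v -> bm (fun x => u x * v x).
Proof.
move=> [mu [M uM]] [mv [N vN]]; split; first by mm.
by exists (M * N) => x; rewrite normrM ler_pM.
Qed.
Lemma bm_norm u : bm u -> bm (absf u).
Proof.
move=> [mu [M uM]]; split; first by mm.
by exists M => x; rewrite normr_id.
Qed.
Lemma bm_cst c : bm (fun _ => c).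
Proof. by split; [exact: mf_cst|exists `|c|]. Qed.
Lemma bm_shift u a : bm u -> bm (fun x => u (x - a)).
Proof. by move=> [mu [M uM]]; split; [mm|exists M]. Qed.

Lemma conv_norm_le k k' u v x : itg m k -> bm u -> itg m k' -> bm v ->
 (forall y, `|k y| <= k' y) -> (forall y, `|u y| <= v y) -> `|conv k u x| <= conv k' v x.
Proof.
move=> ik bu ik' bv kk uv; apply: Ri_norm_le.
- exact: (itg_m (conv_itg x ik bu)).
- exact: conv_itg.
- by move=> y; rewrite normrM ler_pM.
Qed.

Lemma conv_le k u v x : itg m k -> bm u -> bm v -> nneg k ->
 (forall y, u y <= v y) -> conv k u x <= conv k v x.
Proof.
by move=> ik bu bv k0 uv; apply: Ri_le; rewrite//; [exact: conv_itg|exact: conv_itg|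
 move=> y; rewrite ler_wpM2l].
Qed.

Lemma convD k u v x : itg m k -> bm u -> bm v ->
 conv k (fun y => u y + v y) x = conv k u x + conv k v x.
Proof.
move=> ik bu bv; rewrite -RiD; [|exact: conv_itg|exact: conv_itg].
by apply: Ri_eq => y; rewrite mulrDr.
Qed.
Lemma convB k u v x : itg m k -> bm u -> bm v ->
 conv k (fun y => u y - v y) x = conv k u x - conv k v x.
Proof.
move=> ik bu bv; rewrite -RiB; [|exact: conv_itg|exact: conv_itg].
by apply: Ri_eq => y; rewrite mulrBr.
Qed.
Lemma convZ k u c x : itg m k -> bm u ->
 conv k (fun y => c * u y) x = c * conv k u x.
Proof.
move=> ik bu; rewrite -RiZ; last exact: conv_itg.
by apply: Ri_eq => y; rewrite mulrCA.
Qed.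
Lemma convG_cst t c x : 0 < t -> conv (G t) (fun _ => c) x = c.
Proof.
move=> t0; rewrite /conv (Ri_eq (fun y => c * G t y)) ?RiZ ?Ri_G ?mulr1//.
- exact: itg_G.
- by move=> y; rewrite mulrC.
Qed.

Lemma conv2_fubini k1 k2 u x : itg m k1 -> itg m k2 -> bm u ->
 Ri m (fun y => Ri m (fun z => k1 y * (k2 z * u (x - y - z)))) =
 Ri m (fun z => Ri m (fun y => k1 y * (k2 z * u (x - y - z)))).
Proof.
move=> i1 i2 bu; have [mu [M uM]] := bu; have m1 := itg_m i1; have m2 := itg_m i2.
apply: (@fubini_dom _ _ _ _ _ m m _ (fun y => (M * Ri m (absf k2)) * `|k1 y|)).
- by mm.
- exact/itgZ/itg_norm.
- by move=> y; apply: itgZ; exact: conv_itg.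
- move=> y; apply: (le_via (Ri m (fun z => (M * `|k1 y|) * `|k2 z|))).
  apply: Ri_le; [exact/itg_norm/itgZ/conv_itg|exact/itgZ/itg_norm|]. by move=> z; rewrite !normrM mulrA mulrC mulrA ler_wpM2r// ler_wpM2r.
 by rewrite RiZ; [lra|exact: itg_norm].
- move=> z; apply: (itg_dom (fun y => (`|k2 z| * M) * `|k1 y|)); first by mm.
  by move=> y; rewrite !normrM mulrC ler_wpM2r// ler_wpM2l.
 exact/itgZ/itg_norm.
Qed.

Lemma conv_comm2 k1 k2 u x : itg m k1 -> itg m k2 -> bm u ->
 conv k1 (conv k2 u) x = conv k2 (conv k1 u) x.
Proof.
move=> i1 i2 bu.
rewrite /conv (Ri_eq (fun y => Ri m (fun z => k1 y * (k2 z * u (x - y - z))))); last first.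
 by move=> y; rewrite RiZ//; exact: conv_itg.
rewrite conv2_fubini//; apply: Ri_eq => z; rewrite -RiZ; last exact: conv_itg.
by apply: Ri_eq => y; rewrite addrAC; ring.
Qed.

(** The composed kernel k3 is given by a pointwise identity, so that explicit Gaussian formulas can
    be supplied. Boundedness of k2 makes the slices in the first variable integrable. *)
Lemma conv_assoc k1 k2 k3 u x : itg m k1 -> itg m k2 -> bm u ->
 (forall z, Ri m (fun y => k1 y * k2 (z - y)) = k3 z) -> (exists M, forall z, `|k2 z| <= M) ->
 conv k1 (conv k2 u) x = conv k3 u x.
Proof.
move=> i1 i2 bu k3E [N kN]; have [mu [M uM]] := bu; have m1 := itg_m i1; have m2 := itg_m i2.
have iw y : itg m (fun z' => k2 (z' - y) * u (x - z')).
 by apply: (itgM M (itg_shift (- y) i2)); mm.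
rewrite /conv (Ri_eq (fun y => Ri m (fun z' => k1 y * (k2 (z' - y) * u (x - z'))))); last first.
 move=> y; rewrite RiZ//; congr (_ * _). rewrite -(Ri_shift (- y)); last by mm. by apply: Ri_eq => z'; congr (_ * u _); rewrite opprB addrA subrK.
rewrite (@fubini_dom _ _ _ _ _ m m _ (fun y => (M * Ri m (absf k2)) * `|k1 y|)).
- apply: Ri_eq => z'; rewrite -k3E mulrC -RiZ.
  by apply: Ri_eq => y; ring.
 by apply: (itgM N i1); mm.
- by mm.
- exact/itgZ/itg_norm.
- by move=> y; apply: itgZ.
- move=> y; apply: (le_via (Ri m (fun z => (M * `|k1 y|) * `|k2 (z - y)|))).
  apply: Ri_le; [exact/itg_norm/itgZ|exact/itgZ/itg_norm/itg_shift|]. by move=> z; rewrite !normrM mulrA mulrC mulrA ler_wpM2r// ler_wpM2r.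
 rewrite RiZ; last exact/itg_norm/itg_shift. by rewrite (@Ri_shift R n (absf k2)); [lra|mm].
- move=> z; apply: (itg_dom (fun y => (N * M) * `|k1 y|)); first by mm.
  by move=> y; rewrite !normrM mulrC ler_wpM2r// ler_pM.
 exact/itgZ/itg_norm.
Qed.

Lemma G_bounded t : 0 < t -> exists M, forall z : T, `|G t z| <= M.
Proof.
move=> t0; exists (\prod_(i < n) (sqrt (4 * pi * t))^-1) => z.
rewrite ger0_norm ?G_ge0//; apply: ler_prod => i _; rewrite ltW ?g1_gt0//= /g1.
apply: ler_piMl; first by rewrite invr_ge0 sqrtr_ge0.
by rewrite -expR0 ler_expR mulNr oppr_le0 divr_ge0 ?sqr_ge0// mulr_ge0// ltW.
Qed.

Lemma conv_GG s t u x : 0 < s -> 0 < t -> bm u -> conv (G s) (conv (G t) u) x = conv (G (s + t)) u x.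
Proof.
move=> s0 t0 bu; apply: conv_assoc => //; [exact: itg_G|exact: itg_G| |exact: G_bounded].
by move=> z; exact: G_G.
Qed.

Lemma conv_dGG j s t u x : 0 < s -> 0 < t -> bm u ->
 conv (dG j s) (conv (G t) u) x = conv (dG j (s + t)) u x.
Proof.
move=> s0 t0 bu; apply: conv_assoc => //; [exact: itg_dG|exact: itg_G| |exact: G_bounded].
by move=> z; exact: dG_G.
Qed.

Lemma int_conv k u : itg m k -> bm u -> nneg k -> nneg u ->
 (\int[m]_x (conv k u x)%:E = (Ri m k)%:E * \int[m]_x (u x)%:E)%E.
Proof.
move=> ik bu k0 u0; have mu := bm_m bu; have mk := itg_m ik.
rewrite (eq_integral (fun x => \int[m]_y (k y * u (x - y))%:E)%E); last first.
 by move=> x _; rewrite /conv RiE//; exact: conv_itg.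
rewrite (@tonelliE _ _ _ _ _ m m (fun x y => k y * u (x - y))); [|mm|by move=> *; rewrite mulr_ge0].
rewrite (eq_integral (fun y => (k y)%:E * \int[m]_x (u x)%:E)%E); last first.
 move=> y _; rewrite -(@lebm_shift R n (- y) u)// -ge0_integralZl_EFin//.
 - by move=> x _; rewrite lee_fin.
 - by apply/measurable_EFinP; mm.
rewrite ge0_integralZr//; first by rewrite RiE.
- exact/measurable_EFinP.
- by move=> y _; rewrite lee_fin.
- by apply: integral_ge0 => y _; rewrite lee_fin.
Qed.

(** Self-adjointness of convolution with an even kernel. Everything is nonnegative, so Tonelli
    applies and both sides may be infinite. *)
Lemma int_conv_adj k u v : itg m k -> bm u -> bm v -> nneg k ->
 (forall y, k (- y) = k y) ->
 nneg u -> nneg v ->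
 (\int[m]_x (v x * conv k u x)%:E = \int[m]_x (conv k v x * u x)%:E)%E.
Proof.
move=> ik bu bv k0 kN u0 v0; have mu := bm_m bu; have mv := bm_m bv; have mk := itg_m ik.
rewrite (eq_integral (fun x => \int[m]_y (v x * (k y * u (x - y)))%:E)%E); last first.
 by move=> x _; rewrite -RiZ ?RiE//; [exact/itgZ/conv_itg|exact: conv_itg].
rewrite (@tonelliE _ _ _ _ _ m m (fun x y => v x * (k y * u (x - y)))); [|mm|by move=> *; rewrite !mulr_ge0].
transitivity (\int[m]_y \int[m]_x (k y * v (x - y) * u x)%:E)%E; last first.
 rewrite -(@tonelliE _ _ _ _ _ m m (fun x y => k y * v (x - y) * u x)); [|mm|by move=> *; rewrite !mulr_ge0].
 apply: eq_integral => x _; rewrite mulrC -RiZ ?RiE//; [|exact/itgZ/conv_itg|exact: conv_itg]. by apply: eq_integral => y _; rewrite mulrC.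
transitivity (\int[m]_y \int[m]_x (v x * (k y * u (x + y)))%:E)%E.
 rewrite -(@tonelliE _ _ _ _ _ m m (fun x y => v x * (k y * u (x - y)))); [|mm|by move=> *; rewrite !mulr_ge0].
 rewrite -(@tonelliE _ _ _ _ _ m m (fun x y => v x * (k y * u (x + y)))); [|mm|by move=> *; rewrite !mulr_ge0]. apply: eq_integral => x _.
 rewrite -[LHS](@lebm_reflect R n 0 (fun y => v x * (k y * u (x - y)))); [|mm|by move=> *; rewrite !mulr_ge0]. by apply: eq_integral => y _; rewrite sub0r kN opprK.
apply: eq_integral => y _.
rewrite -[LHS](@lebm_shift R n (- y) (fun x => v x * (k y * u (x + y)))); [|mm|by move=> *; rewrite !mulr_ge0].
by apply: eq_integral => x _; rewrite subrK mulrCA mulrA.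
Qed.
End conv.

(** * Scalar convexity inequalities *)

Section scalar.
Variable R : realType.
Implicit Types a b c p q r s x y th : R.

Lemma powR_mono x y th : 0 <= th -> 0 <= x -> x <= y -> x `^ th <= y `^ th.
Proof.
by move=> t0 x0 xy; apply: ge0_ler_powR; rewrite ?nnegrE// (le_trans x0).
Qed.

Lemma amgm th x y : 0 < th < 1 -> 0 <= x -> 0 <= y ->
 x `^ th * y `^ (1 - th) <= th * x + (1 - th) * y.
Proof.
move=> /andP[t0 t1] x0 y0; have t1' : 0 < 1 - th by rewrite subr_gt0.
have i1 : 0 < th^-1 by rewrite invr_gt0.
have i2 : 0 < (1 - th)^-1 by rewrite invr_gt0.
have e : th^-1^-1 + (1 - th)^-1^-1 = 1 by lra.
have := conjugate_powR (powR_ge0 x th) (powR_ge0 y (1 - th)) i1 i2 e.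
rewrite !invrK -!powRrM !divff ?gt_eqF// !powRr1//.
lra.
Qed.

Lemma powRDp a r s : 0 < a -> a `^ (r + s) = a `^ r * a `^ s.
Proof. by move=> a0; rewrite powRD//; apply/implyP => _; rewrite gt_eqF. Qed.

Lemma powRBp a r s : 0 < a -> a `^ (r - s) = a `^ r / a `^ s.
Proof. by move=> a0; rewrite powRDp// powRN. Qed.

(** Young's inequality for x and y^(q-1), read as the tangent line of the power q at y. *)
Lemma powR_tangent q x y : 1 < q -> 0 <= x -> 0 <= y ->
 q * y `^ (q - 1) * x - (q - 1) * y `^ q <= x `^ q.
Proof.
move=> q1 x0 y0; have q0 : 0 < q by rewrite (lt_trans ltr01).
have q10 : 0 < q - 1 by lra.
have := @conjugate_powR R x (y `^ (q - 1)) q (q / (q - 1)) x0 (powR_ge0 _ _) q0 (divr_gt0 q0 q10).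
have -> : q^-1 + (q / (q - 1))^-1 = 1 by field; rewrite !gt_eqF.
move=> /(_ erefl); rewrite -powRrM (_ : (q - 1) * (q / (q - 1)) = q); last by field; rewrite gt_eqF.
move=> h; rewrite lerBlDr.
have {}h : q * (x * y `^ (q - 1)) <= q * (x `^ q / q + y `^ q / (q / (q - 1))) by rewrite ler_pM2l.
rewrite (_ : q * y `^ (q - 1) * x = q * (x * y `^ (q - 1))); last by ring.
rewrite (le_trans h)//; apply: le_of_eq; field; rewrite !gt_eqF//.
Qed.

(* joint convexity of the perspective [x ^ q y ^ (1 - q)], as a tangent plane inequality *)
Lemma persp_tangent q x y x0 y0 : 1 < q -> 0 <= x -> 0 <= x0 -> 0 < y -> 0 < y0 ->
 q * x0 `^ (q - 1) * y0 `^ (1 - q) * x - (q - 1) * x0 `^ q * y0 `^ (- q) * y <=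
 x `^ q * y `^ (1 - q).
Proof.
move=> q1 hx hx0 hy hy0.
have h := @powR_tangent q (x / y) (x0 / y0) q1 (divr_ge0 hx (ltW hy)) (divr_ge0 hx0 (ltW hy0)).
have iv a r : 0 < a -> (a^-1) `^ r = a `^ (- r).
 by move=> a0; rewrite -(powR_inv1 (ltW a0)) -powRrM mulN1r.
have {h} := ler_wpM2r (ltW hy) h.
rewrite !powRM ?invr_ge0 ?(ltW hy) ?(ltW hy0)// !iv// opprB.
have -> : y `^ (1 - q) = y `^ (- q) * y.
 by rewrite addrC powRDp// powRr1// ltW.
move=> h; rewrite mulrA; apply: le_trans h.
apply: le_of_eq; field; rewrite gt_eqF//.
Qed.

(** Right side minus left side vanishes at 1 and has derivative at most 0 on (0, 1), by Bernoulli's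
    inequality for the exponent p - 1 in (0, 1). *)
Lemma powR_taylor_aux p x : 1 < p < 2 -> 0 <= x <= 1 ->
 1 + p * (x - 1) + p * (p - 1) / 2 * (x - 1) ^+ 2 <= x `^ p.
Proof.
move=> /andP[p1 p2] /andP[x0 x1].
have [->|xn0] := eqVneq x 0.
 rewrite powR0; last by rewrite gt_eqF// (lt_trans ltr01). nra.
have xp : 0 < x by lra.
have [x1'|] := ltP x 1; last first.
 by move=> h; have -> : x = 1 by [apply/le_anti; rewrite x1 h]; rewrite powR1 subrr expr0n !mulr0 !addr0.
pose f (z : R) := z `^ p - (1 + p * (z - 1) + p * (p - 1) / 2 * (z - 1) ^+ 2).
pose df (z : R) := p * z `^ (p - 1) - (p + p * (p - 1) * (z - 1)).
have fd (z : R) : 0 < z -> is_derive z 1 f (df z).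
 move=> z0; rewrite /f /df. have h1 := is_derive1_powR p z0. apply: is_derive_eq. by rewrite /GRing.scale/=; field.
have cf : {within `[x, 1], continuous f}.
 apply: derivable_within_continuous => z; rewrite in_itv/= => /andP[xz _]. by have [] := fd z (lt_le_trans xp xz).
have [|c] := @MVT R f df x 1 x1' _ cf.
 by move=> z; rewrite in_itv => /andP[xz _]; apply: fd; rewrite (lt_trans xp).
rewrite in_itv/= => /andP[xc c1].
rewrite /f !subrr powR1 expr0n !mulr0 !addr0 subrr sub0r => h.
have c0 : 0 < c by lra.
have bern : c `^ (p - 1) <= 1 + (p - 1) * (c - 1).
 have := @amgm (p - 1) c 1; rewrite powR1 !mulr1 => H. lra.
have hdf : df c <= 0 by rewrite /df; nra.
have : df c * (1 - x) <= 0 by rewrite mulr_le0_ge0// subr_ge0.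
rewrite -h; lra.
Qed.

(** For p < 2 the second derivative of the power decreases, so the quadratic gain with the
    coefficient at a is available only for b < a; hence the positive part of a - b. By [normr_posE]
    this half is enough for deviations of mean zero. *)
Lemma powR_taylor p a b : 1 < p < 2 -> 0 < a -> 0 <= b ->
 a `^ p + p * a `^ (p - 1) * (b - a) +
  p * (p - 1) / 2 * a `^ (p - 2) * (Num.max (a - b) 0) ^+ 2 <= b `^ p.
Proof.
move=> hp a0 b0; have /andP[p1 p2] := hp.
have [ba|ab] := leP b a; last first.
 have -> : Num.max (a - b) 0 = 0 by apply/max_idPr; rewrite subr_le0 ltW. rewrite expr0n/= mulr0 addr0. apply: le_trans (powR_tangent p1 b0 (ltW a0)).
 have -> : a `^ p = a * a `^ (p - 1) by rewrite mulr_powRB1 ?(ltW a0)// (lt_trans ltr01). apply: le_of_eq; ring.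
have -> : Num.max (a - b) 0 = a - b by apply/max_idPl; rewrite subr_ge0.
have hx : 0 <= b / a <= 1 by rewrite divr_ge0 ?(ltW a0)//= ler_pdivrMr// mul1r.
have := powR_taylor_aux hp hx.
have ap : 0 < a `^ p by rewrite powR_gt0.
rewrite -(ler_pM2l ap) -powRM ?divr_ge0 ?(ltW a0)//.
rewrite (_ : a * (b / a) = b); last by field; rewrite gt_eqF.
apply: le_trans; apply: le_of_eq.
have E1 : a `^ (p - 1) = a `^ p / a by rewrite powRBp// powRr1// ltW.
have E2 : a `^ (p - 2) = a `^ p / a ^+ 2.
 by rewrite powRBp// (powR_mulrn 2)// ltW.
by rewrite E1 E2; field; rewrite gt_eqF.
Qed.

(** The step is two because the time [ta] at index i + 2 is 16 times that at index i. *)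
Lemma telescope2 M (e : nat -> R) : nneg e ->
 \sum_(i < M) (e i - e i.+2) <= e 0%N + e 1%N.
Proof.
move=> e0; suff -> : \sum_(i < M) (e i - e i.+2) = e 0%N + e 1%N - e M - e M.+1.
 by have := e0 M; have := e0 M.+1; lra.
by elim: M => [|M IH]; rewrite ?big_ord0 ?big_ord_recr/= ?IH; ring.
Qed.
End scalar.

(** * Hoelder's inequality over finitely many scales *)

Section Ifun.
Context d (T : measurableType d) (R : realType) (m : {measure set T -> \bar R}).
Implicit Types f g h : nat -> T -> R.

(** The integral over the product of the space with {0, ..., M-1}. All bounds on it are uniform in
    M. *)
Definition II M f : \bar R := (\sum_(i < M) \int[m]_x (f i x)%:E)%E.

Lemma II_le M f g : (forall i, mfun (f i)) -> (forall i, mfun (g i)) ->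
 (forall i x, 0 <= f i x) -> (forall i x, f i x <= g i x) -> (II M f <= II M g)%E.
Proof.
move=> mf mg f0 fg; apply: lee_sum => i _; apply: ge0_le_integral => //=.
- by move=> x _; rewrite lee_fin.
- exact/measurable_EFinP.
- exact/measurable_EFinP.
- by move=> x _; rewrite lee_fin.
Qed.

Lemma II_add M f g : (forall i, mfun (f i)) -> (forall i, mfun (g i)) ->
 (forall i x, 0 <= f i x) -> (forall i x, 0 <= g i x) ->
 II M (fun i x => f i x + g i x) = (II M f + II M g)%E.
Proof.
move=> mf mg f0 g0; rewrite /II -big_split/=; apply: eq_bigr => i _.
under eq_integral do rewrite EFinD.
by rewrite ge0_integralD//=; [move=> x _; rewrite lee_fin|exact/measurable_EFinP|
 move=> x _; rewrite lee_fin|exact/measurable_EFinP].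
Qed.

Lemma II_scale M c f : 0 <= c -> (forall i, mfun (f i)) -> (forall i x, 0 <= f i x) ->
 II M (fun i x => c * f i x) = (c%:E * II M f)%E.
Proof.
move=> c0 mf f0; rewrite /II ge0_sume_distrr; last first.
 by move=> i _; apply: integral_ge0 => x _; rewrite lee_fin.
apply: eq_bigr => i _; under eq_integral do rewrite EFinM.
by rewrite ge0_integralZl_EFin//; [move=> x _; rewrite lee_fin|exact/measurable_EFinP].
Qed.

(** After division by a and b the pointwise inequality [amgm] is integrated; only upper bounds for
    the two integrals enter. *)
Lemma II_holder M f g h th a b : 0 < th < 1 -> 0 < a -> 0 < b ->
 (forall i, mfun (f i)) -> (forall i, mfun (g i)) ->
 (forall i, mfun (h i)) ->
 (forall i x, 0 <= f i x) -> (forall i x, 0 <= g i x) -> (forall i x, 0 <= h i x) ->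
 (forall i x, h i x <= f i x `^ th * g i x `^ (1 - th)) ->
 (II M f <= a%:E)%E -> (II M g <= b%:E)%E -> (II M h <= (a `^ th * b `^ (1 - th))%:E)%E.
Proof.
move=> hth a0 b0 mf mg mh f0 g0 h0 hfg fa gb; have /andP[t0 t1] := hth.
set c := a `^ th * b `^ (1 - th).
have c0 : 0 < c by rewrite mulr_gt0 ?powR_gt0.
have ca : 0 <= c * th / a by rewrite divr_ge0 ?(ltW a0)// mulr_ge0// ltW.
have cb : 0 <= c * (1 - th) / b by rewrite divr_ge0 ?(ltW b0)// mulr_ge0 ?(ltW c0)// subr_ge0 ltW.
apply: (le_via (II M (fun i x => (c * th / a) * f i x + (c * (1 - th) / b) * g i x))).
 apply: II_le => // i; first by have := mf i; have := mg i => ? ?; mm. move=> x; apply: (le_trans (hfg i x)). have := @amgm _ th (f i x / a) (g i x / b) hth.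
 rewrite !divr_ge0 ?(ltW a0) ?(ltW b0)// => /(_ isT isT) H. have {H} := ler_wpM2l (ltW c0) H; rewrite {1}/c.
 rewrite mulrACA -!powRM ?(ltW a0) ?(ltW b0) ?divr_ge0 ?(ltW a0) ?(ltW b0)//. have -> : a * (f i x / a) = f i x by field; rewrite gt_eqF.
 have -> : b * (g i x / b) = g i x by field; rewrite gt_eqF. lra.
rewrite II_add; last 4 first.
- by move=> i; have := mf i => ?; mm.
- by move=> i; have := mg i => ?; mm.
- by move=> i x; rewrite mulr_ge0.
- by move=> i x; rewrite mulr_ge0.
rewrite !II_scale//.
apply: (le_via ((c * th / a)%:E * a%:E + (c * (1 - th) / b)%:E * b%:E)%E).
 by apply: leeD; apply: lee_wpmul2l.
rewrite -!EFinM -EFinD lee_fin; apply: le_of_eq.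
by field; rewrite !gt_eqF.
Qed.
End Ifun.

(** * Heat flow, Jensen's inequality and oscillations *)

Section heat.
Variables (R : realType) (n : nat).
Notation T := 'rV[R]_n.
Notation m := (lebm R n).
Implicit Types (s t r : R) (x y z : T) (k u v w : T -> R).

Definition He t u := conv (G t) u.

Lemma bm_He t u : 0 < t -> bm u -> bm (He t u).
Proof. by move=> t0 bu; apply: bm_conv => //; exact: itg_G. Qed.
Lemma He_ge0 t u x : 0 < t -> nneg u -> 0 <= He t u x.
Proof. by move=> t0 u0; apply: Ri_ge0 => y; rewrite mulr_ge0 ?G_ge0. Qed.
Lemma HeHe s t u : 0 < s -> 0 < t -> bm u -> He s (He t u) = He (s + t) u.
Proof. by move=> s0 t0 bu; apply/funext => x; exact: conv_GG. Qed.
Lemma He_le t u v x : 0 < t -> bm u -> bm v -> (forall y, u y <= v y) -> He t u x <= He t v x.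
Proof. by move=> t0 bu bv uv; apply: conv_le => //; [exact: itg_G|move=> y; exact: G_ge0]. Qed.
Lemma He_cst t c x : 0 < t -> He t (fun _ => c) x = c.
Proof. exact: convG_cst. Qed.
Lemma HeD t u v x : 0 < t -> bm u -> bm v -> He t (fun y => u y + v y) x = He t u x + He t v x.
Proof. by move=> t0 bu bv; apply: convD => //; exact: itg_G. Qed.
Lemma HeB t u v x : 0 < t -> bm u -> bm v -> He t (fun y => u y - v y) x = He t u x - He t v x.
Proof. by move=> t0 bu bv; apply: convB => //; exact: itg_G. Qed.
Lemma HeZ t c u x : 0 < t -> bm u -> He t (fun y => c * u y) x = c * He t u x.
Proof. by move=> t0 bu; apply: convZ => //; exact: itg_G. Qed.
Lemma He_norm t u v x : 0 < t -> bm u -> bm v -> (forall y, `|u y| <= v y) -> `|He t u x| <= He t v x.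
Proof.
move=> t0 bu bv uv; apply: conv_norm_le => //; [exact: itg_G|exact: itg_G|].
by move=> y; rewrite ger0_norm// G_ge0.
Qed.
Lemma He_mono K r r' u x : 0 < r -> r <= r' -> r' <= K * r -> 1 <= K -> bm u -> nneg u ->
 He r u x <= K ^+ n * He r' u x.
Proof.
move=> r0 rr Kr K1 bu u0; have r'0 : 0 < r' by apply: lt_le_trans rr.
have i1 := conv_itg x (itg_G n r0) bu; have i2 := conv_itg x (itg_G n r'0) bu.
rewrite /He /conv -RiZ//; apply: Ri_le => //; first exact: itgZ.
by move=> y; rewrite mulrA ler_wpM2r// G_mono.
Qed.

Lemma bmZ c u : bm u -> bm (fun x => c * u x).
Proof. by move=> bu; exact: bmM (bm_cst _ c) bu. Qed.
Lemma bm_sqr u : bm u -> bm (fun x => u x ^+ 2).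
Proof. by move=> bu; under eq_fun do rewrite expr2; exact: bmM. Qed.
Lemma bm_powR p u : 0 <= p -> bm u -> nneg u -> bm (fun x => u x `^ p).
Proof.
move=> p0 [mu [M uM]] u0; split; first by mm.
exists (M `^ p) => x; rewrite ger0_norm ?powR_ge0//; apply: powR_mono => //.
by apply: le_trans (uM x); exact: ler_norm.
Qed.
Lemma bm_max u v : bm u -> bm v -> bm (fun x => Num.max (u x) (v x)).
Proof.
move=> [mu [M uM]] [mv [N vN]]; split; first by mm.
exists (M + N) => x; have := uM x; have := vN x.
have hM : 0 <= M by rewrite (le_trans _ (uM x)).
have hN : 0 <= N by rewrite (le_trans _ (vN x)).
by rewrite maxEle; case: ifP => _; lra.
Qed.

End heat.

Ltac bmt := repeat (lazymatch goal with
 | |- bm (fun x => @GRing.add _ (@?f x) (@GRing.opp _ (@?g x))) => refine (@bmB _ _ f g _ _)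
 | |- bm (fun x => @GRing.add _ (@?f x) (@?g x)) => refine (@bmD _ _ f g _ _)
 | |- bm (fun x => @GRing.mul _ (@?f x) (@?g x)) => refine (@bmM _ _ f g _ _)
 | |- bm (fun x => @GRing.exp _ (@?f x) _) => refine (@bm_sqr _ _ f _)
 | |- bm (fun x => Num.norm (@?f x)) => refine (@bm_norm _ _ f _)
 | |- bm (fun x => Order.max (@?f x) (@?g x)) => refine (@bm_max _ _ f g _ _)
 | |- bm (fun x => He _ _ x) => apply: bm_He
 | |- bm (He _ _) => apply: bm_He
 | _ => first [assumption | exact: bm_cst]
 end).

Section heat2.
Variables (R : realType) (n : nat).
Notation T := 'rV[R]_n.
Notation m := (lebm R n).
Implicit Types (s t r : R) (x y z : T) (k u v w : T -> R).

Lemma itg_conv k u : itg m k -> bm u -> itg m u -> itg m (conv k u).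
Proof.
move=> ik bu iu; have mk := itg_m ik; have mu := itg_m iu.
apply: (itg_dom (conv (absf k) (absf u))).
- exact: measurable_conv.
- move=> x; apply: conv_norm_le => //; [exact: itg_norm|exact: bm_norm].
- apply: itgP; first by apply: measurable_conv; mm. under eq_integral do rewrite ger0_norm ?(Ri_ge0 (fun y => mulr_ge0 (normr_ge0 _) (normr_ge0 _)))//.
 rewrite int_conv//; [|exact: itg_norm|exact: bm_norm]. by rewrite lte_mul_pinfty ?lee_fin ?Ri_ge0//; exact: itg_lt.
Qed.
Lemma itg_He t u : 0 < t -> bm u -> itg m u -> itg m (He t u).
Proof. by move=> t0; apply: itg_conv; exact: itg_G. Qed.
Lemma Ri_He t u : 0 < t -> bm u -> itg m u -> nneg u -> Ri m (He t u) = Ri m u.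
Proof.
move=> t0 bu iu u0; rewrite /Ri /Rintegral int_conv//; [|exact: itg_G|by move=> y; exact: G_ge0].
by rewrite Ri_G// mul1e.
Qed.
Lemma itg_sqr u : bm u -> itg m u -> itg m (fun x => u x ^+ 2).
Proof.
move=> [mu [M uM]] iu; under eq_fun do rewrite expr2.
exact: (itgM M iu mu uM).
Qed.

(** Discriminant of the quadratic l -> He t ((f - l g)^2), which is nonnegative. If its leading
    coefficient vanishes it is affine and still nonnegative, which forces the slope to vanish. *)
Lemma He_CS t f g x : 0 < t -> bm f -> bm g -> 
 (He t (fun y => f y * g y) x) ^+ 2 <= He t (fun y => f y ^+ 2) x * He t (fun y => g y ^+ 2) x.
Proof.
move=> t0 bf bg; set A := He _ _ x; set B := He t (fun y => f y ^+ 2) x; set C := He t (fun y => g y ^+ 2) x.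
have q l : 0 <= B - 2 * l * A + l ^+ 2 * C.
 have -> : B - 2 * l * A + l ^+ 2 * C = He t (fun y => (f y - l * g y) ^+ 2) x.
  have bfg := bmM bf bg; have bf2 := bm_sqr bf; have bg2 := bm_sqr bg.
  rewrite (_ : (fun y => _) = fun y => f y ^+ 2 + ((- (2 * l)) * (f y * g y) + l ^+ 2 * g y ^+ 2)).
   by rewrite HeD ?HeD ?HeZ; bmt; rewrite /A /B /C; ring.
  by apply/funext => y; ring.
 by apply: He_ge0 => // y; exact: sqr_ge0.
have C0 : 0 <= C by apply: He_ge0 => // y; exact: sqr_ge0.
have [C1|Cn0] := eqVneq C 0; last first.
 have Cp : 0 < C by lra. have := q (A / C); rewrite -(pmulr_rge0 _ Cp). rewrite (_ : C * _ = B * C - A ^+ 2); last by field; rewrite gt_eqF. by rewrite subr_ge0.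
have [->|An0] := eqVneq A 0; first by rewrite expr0n C1 mulr0.
have := q ((B + 1) / (2 * A)); rewrite C1 mulr0 addr0.
rewrite (_ : B - _ = -1); last by field.
lra.
Qed.

Lemma He_sqr t f x : 0 < t -> bm f -> (He t f x) ^+ 2 <= He t (fun y => f y ^+ 2) x.
Proof.
move=> t0 bf; have := He_CS x t0 bf (bm_cst _ 1).
under eq_fun do rewrite mulr1; rewrite (_ : (fun y : T => 1 ^+ 2) = (fun _ => 1)).
 by rewrite He_cst// mulr1.
by apply/funext => y; rewrite expr1n.
Qed.

Lemma He_powR_ge t q w x : 1 < q -> 0 < t -> bm w -> nneg w ->
 (He t w x) `^ q <= He t (fun y => w y `^ q) x.
Proof.
move=> q1 t0 bw w0; set W := He t w x; have W0 : 0 <= W by exact: He_ge0.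
have q0 : 0 <= q by lra.
have bq := bm_powR q0 bw w0.
(* The tangent line at W averages to W^q, since its linear part averages to W. *)
have -> : W `^ q = He t (fun y => q * W `^ (q - 1) * w y - (q - 1) * W `^ q) x.
 rewrite HeB ?HeZ ?He_cst//; bmt. rewrite -/W -mulrA (mulrC _ W) mulr_powRB1// ?(lt_trans ltr01)//; ring.
apply: He_le => //; bmt.
by move=> y; exact: powR_tangent.
Qed.

(** The concave case of Jensen, from the convex one applied to w^th with exponent 1 / th. *)
Lemma He_powR_le t th w x : 0 < th < 1 -> 0 < t -> bm w -> nneg w ->
 He t (fun y => w y `^ th) x <= (He t w x) `^ th.
Proof.
move=> hth t0 bw w0; have /andP[th0 th1] := hth; have q1 : 1 < th^-1 by rewrite invf_gt1.
have bq := bm_powR (ltW th0) bw w0.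
have := He_powR_ge x q1 t0 bq (fun y => powR_ge0 _ _).
have -> : (fun y => (w y `^ th) `^ th^-1) = w.
 by apply/funext => y; rewrite -powRrM divff ?gt_eqF// powRr1.
move=> h; have := powR_mono (ltW th0) (powR_ge0 _ _) h.
by rewrite -powRrM mulVf ?gt_eqF// powRr1// He_ge0// => y; exact: powR_ge0.
Qed.

Lemma II_Ri M (f : nat -> T -> R) : (forall i, itg m (f i)) -> II m M f = (\sum_(i < M) Ri m (f i))%:E.
Proof.
by move=> hf; rewrite /II -sumEFin; apply: eq_bigr => i _; rewrite RiE.
Qed.

(** Under the probability kernel [G (15 * tau)] the function [He tau u] has mean
    [He (16 * tau) u x]; [Lop] and [Dop] are its mean deviation and its variance. They play the part
    of a martingale difference between the times tau and 16 tau. [Var] is the variance of u itself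
    under the kernel at time t. *)
Definition Lop tau u x := conv (G (15 * tau)) (fun y => `|He tau u y - He (16 * tau) u x|) x.
Definition Dop tau u x := conv (G (15 * tau)) (fun y => (He tau u y - He (16 * tau) u x) ^+ 2) x.
Definition Var t u x := He t (fun y => u y ^+ 2) x - (He t u x) ^+ 2.

Section fixtau.
Variable tau : R.
Hypothesis tau0 : 0 < tau.
Let t15 : 0 < 15 * tau. Proof. by rewrite mulr_gt0. Qed.
Let t16 : 0 < 16 * tau. Proof. by rewrite mulr_gt0. Qed.
Let t7 : 0 < 7 * tau. Proof. by rewrite mulr_gt0. Qed.

Lemma He16 u : bm u -> He (15 * tau) (He tau u) = He (16 * tau) u.
Proof. by move=> bu; rewrite HeHe//; congr (He _ u); ring. Qed.

Lemma bm_LD u x : bm u -> bm (fun y => He tau u y - He (16 * tau) u x).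
Proof. by move=> bu; apply: bmB; [exact: bm_He|exact: bm_cst]. Qed.

Lemma Lop_ge0 u x : 0 <= Lop tau u x.
Proof. by apply: Ri_ge0 => y; rewrite mulr_ge0 ?G_ge0. Qed.
Lemma Dop_ge0 u x : 0 <= Dop tau u x.
Proof. by apply: Ri_ge0 => y; rewrite mulr_ge0 ?G_ge0 ?sqr_ge0. Qed.

Lemma DopE u x : bm u -> Dop tau u x = He (15 * tau) (fun y => (He tau u y) ^+ 2) x - (He (16 * tau) u x) ^+ 2.
Proof.
move=> bu; set c := He (16 * tau) u x; rewrite /Dop -/c -/(He _ _).
have bh := bm_He tau0 bu; have bh2 := bm_sqr bh.
rewrite (_ : (fun y => _) = fun y => (He tau u y ^+ 2 + (- (2 * c)) * He tau u y) + c ^+ 2); last first.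
 by apply/funext => y; ring.
by rewrite HeD ?HeD ?HeZ ?He_cst ?He16; bmt; rewrite -/c; ring.
Qed.

Lemma LopD u x : bm u -> Lop tau u x ^+ 2 <= Dop tau u x.
Proof.
move=> bu; have := He_sqr x t15 (bm_norm (bm_LD x bu)).
by under [X in _ <= He _ X x]eq_fun do rewrite real_normK ?num_real//.
Qed.

(** Law of total variance: the variance at time 16 tau is the mean of the variances at time tau plus
    the variance of the means. *)
Lemma DopVar u x : bm u -> He (15 * tau) (Var tau u) x = Var (16 * tau) u x - Dop tau u x.
Proof.
move=> bu; have bu2 := bm_sqr bu.
rewrite DopE// /Var HeB//; [|exact: bm_He|exact/bm_sqr/bm_He].
by rewrite He16//; ring.
Qed.

Lemma bm_Dop u : bm u -> bm (Dop tau u).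
Proof.
move=> bu; rewrite (_ : Dop tau u = fun x => He (15 * tau) (fun y => (He tau u y) ^+ 2) x - (He (16 * tau) u x) ^+ 2).
 by apply: bmB; [apply: bm_He => //; exact/bm_sqr/bm_He|exact/bm_sqr/bm_He].
by apply/funext => x; exact: DopE.
Qed.

Lemma bm_Lop u : bm u -> bm (Lop tau u).
Proof.
move=> bu; split.
 have mG := @measurable_G R n (15 * tau). have [m1 _] := bm_He tau0 bu; have [m2 _] := bm_He t16 bu.
 apply: (@measurable_Rint _ _ _ _ _ m (fun x y => G (15 * tau) y * `|He tau u (x - y) - He (16 * tau) u x|)). by mm.
have [_ [M DM]] := bm_Dop bu; exists (sqrt M) => x.
rewrite ger0_norm ?Lop_ge0// -[X in X <= _]ger0_norm ?Lop_ge0// -sqrtr_sqr ler_wsqrtr//.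
by apply: le_trans (LopD x bu) _; apply: le_trans (DM x); exact: ler_norm.
Qed.

Lemma Lop_add u v x : bm u -> bm v -> Lop tau (fun y => u y + v y) x <= Lop tau u x + Lop tau v x.
Proof.
move=> bu bv; rewrite /Lop -convD; [|exact: itg_G|exact/bm_norm/bm_LD|exact/bm_norm/bm_LD].
apply: conv_le; [exact: itg_G| | |by move=> y; exact: G_ge0|].
- exact/bm_norm/bm_LD/bmD.
- by apply: bmD; exact/bm_norm/bm_LD.
- move=> y; rewrite !HeD//; apply: le_trans (ler_normD _ _). by apply: le_of_eq; congr `|_|; ring.
Qed.

Lemma conv_dG_cst j t c x : 0 < t -> conv (dG j t) (fun _ => c) x = 0.
Proof.
move=> t0; rewrite /conv (Ri_eq (fun y => c * dG j t y)); last by move=> y; rewrite mulrC.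
rewrite RiZ; last exact: itg_dG.
suff -> : Ri m (dG j t) = 0 by rewrite mulr0.
have : Ri m (dG j t) = - Ri m (dG j t).
 rewrite -[LHS](Ri_refl 0 (measurable_dG j t)) -RiN; last exact: itg_dG. by apply: Ri_eq => y; rewrite sub0r /dG mxE GN; ring.
lra.
Qed.

(** The kernel [dG j s] has integral 0, so any constant c may be subtracted. Then [dG_le] applies,
    followed by [He_mono] with ratio at most 15 between the times 2 s and 15 tau. *)
Lemma grad_small j s v c x : 0 < s -> 2 * s <= 15 * tau -> tau <= 2 * s -> bm v ->
 `|conv (dG j s) v x| <= 2 ^+ n * 15 ^+ n / sqrt s * conv (G (15 * tau)) (fun y => `|v y - c|) x.
Proof.
move=> s0 s1 s2 bv; have s20 : 0 < 2 * s by rewrite mulr_gt0.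
have bvc : bm (fun y => v y - c) by apply: bmB => //; exact: bm_cst.
have -> : conv (dG j s) v x = conv (dG j s) (fun y => v y - c) x.
 by rewrite convB ?conv_dG_cst ?subr0//; [exact: itg_dG|exact: bm_cst].
have ss : 0 <= 2 ^+ n / sqrt s :> R by [].
rewrite (_ : _ / _ = (2 ^+ n / sqrt s) * 15 ^+ n); last by ring.
rewrite -mulrA; apply: (le_via (2 ^+ n / sqrt s * He (2 * s) (fun y => `|v y - c|) x)).
 have ic := conv_itg x (itg_G n s20) (bm_norm bvc). rewrite /He /conv -RiZ//. apply: Ri_norm_le.
 - by apply: itg_m; exact: (conv_itg x (itg_dG j s0) bvc).
 - exact: itgZ.
 - by move=> y; rewrite normrM mulrA ler_wpM2r// dG_le.
apply: ler_wpM2l => //; apply: He_mono => //; [lra|lra|exact: bm_norm].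
Qed.

(** Of the time t, tau is spent on smoothing u and t - tau on the derivative. Since t - tau >= t / 2
    the factor t^(-1/2) survives; 30 is 2 times 15. *)
Lemma grad1 j t u x : 2 * tau <= t <= 8 * tau -> bm u ->
 `|conv (dG j t) u x| <= 2 * 30 ^+ n / sqrt t * Lop tau u x.
Proof.
move=> /andP[t1 t2] bu; have t0 : 0 < t by rewrite (lt_le_trans _ t1)// mulr_gt0.
have tt : 0 < t - tau by lra.
have -> : conv (dG j t) u x = conv (dG j (t - tau)) (He tau u) x.
 by rewrite conv_dGG// subrK.
have h := grad_small j (He (16 * tau) u x) x tt _ _ (bm_He tau0 bu).
apply: (le_trans (h _ _)); [lra|lra|].
apply: ler_wpM2r; first exact: Lop_ge0.
rewrite -exprMn (_ : 2 * 15 = 30 :> R); last by ring.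
rewrite [X in _ <= X]mulrAC [X in _ <= X]mulrC; apply: ler_wpM2l; first exact: exprn_ge0.
have st : 0 < sqrt t by rewrite sqrtr_gt0.
have st' : 0 < sqrt (t - tau) by rewrite sqrtr_gt0.
rewrite ler_pdivlMr// mulrC ler_pdivrMr//.
rewrite -[X in X * _]ger0_norm// -sqrtr_sqr -sqrtrM ?sqr_ge0// ler_sqrt ?mulr_ge0 ?sqr_ge0 ?(ltW tt)//.
rewrite expr2; lra.
Qed.

(** The oscillation averaged once more. The extra heat operator can be moved by duality onto a
    weight that does not depend on the scale, such as a maximal function; [II_Lp_weight] does so. *)
Definition Lp u := He (7 * tau) (Lop tau u).

Lemma Lp_ge0 u x : 0 <= Lp u x.
Proof. by apply: He_ge0 => // y; exact: Lop_ge0. Qed.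

(** As [grad1], with one more split: the time r = 3 tau / 2 carries the derivative, and the rest t -
    r lies between tau / 2 and 7 tau, a ratio of at most 14. *)
Lemma grad2 j t u x : 2 * tau <= t <= 8 * tau -> bm u ->
 `|conv (dG j t) u x| <= 4 * 30 ^+ n * 14 ^+ n / sqrt t * Lp u x.
Proof.
move=> /andP[t1 t2] bu; have t0 : 0 < t by rewrite (lt_le_trans _ t1)// mulr_gt0.
pose r := 3 / 2 * tau; have r0 : 0 < r by rewrite mulr_gt0// divr_gt0.
have tr : 0 < t - r by rewrite /r; lra.
have th0 : 0 < tau / 2 by lra.
have rt : 0 < r - tau by rewrite /r; lra.
have bg : bm (conv (dG j r) u) by apply: bm_conv => //; exact: itg_dG.
have -> : conv (dG j t) u x = He (t - r) (conv (dG j r) u) x.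
 rewrite /He conv_comm2//; [|exact: itg_G|exact: itg_dG]. by rewrite conv_dGG// addrC subrK.
have pt z : `|conv (dG j r) u z| <= 30 ^+ n / sqrt (tau / 2) * Lop tau u z.
 have -> : conv (dG j r) u z = conv (dG j (r - tau)) (He tau u) z.
  by rewrite conv_dGG// subrK.
 have := grad_small j (He (16 * tau) u z) z rt _ _ (bm_He tau0 bu). rewrite -exprMn (_ : 2 * 15 = 30 :> R); last by ring.
 rewrite (_ : r - tau = tau / 2); last by rewrite /r; field. by apply; lra.
have bL := bm_Lop bu.
apply: (le_trans (He_norm x tr bg (bmZ _ bL) pt)).
rewrite HeZ//; apply: (le_via (30 ^+ n / sqrt (tau / 2) * (14 ^+ n * Lp u x))).
 apply: ler_wpM2l => //; apply: He_mono => //; try by rewrite /r; lra. by move=> y; exact: Lop_ge0.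
rewrite (_ : _ * (_ * _) = 30 ^+ n * 14 ^+ n * Lp u x * (sqrt (tau / 2))^-1); last by ring.
rewrite (_ : _ / _ * _ = 30 ^+ n * 14 ^+ n * Lp u x * (4 / sqrt t)); last by ring.
apply: ler_wpM2l; first by rewrite !mulr_ge0 ?exprn_ge0 ?Lp_ge0.
have st : 0 < sqrt t by rewrite sqrtr_gt0.
have st' : 0 < sqrt (tau / 2) by rewrite sqrtr_gt0.
rewrite ler_pdivlMr// mulrC ler_pdivrMr//.
rewrite -[X in X * _]ger0_norm// -sqrtr_sqr -sqrtrM ?sqr_ge0// ler_sqrt ?mulr_ge0 ?sqr_ge0 ?(ltW th0)//.
rewrite expr2; lra.
exact: ltW.
Qed.

End fixtau.
End heat2.

(** If c has mean a the second summand averages out, so the mean deviation is twice the mean of the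
    positive part of a - c. *)
Lemma normr_posE (R : realType) (a c : R) : `|c - a| = 2 * Num.max (a - c) 0 + (c - a).
Proof.
by case: (leP (a - c) 0) => h; [rewrite ger0_norm|rewrite ler0_norm]; lra.
Qed.

Lemma ler_scaleAC (R : realType) (a c d h : R) : 0 <= d -> a <= c * h -> a * d <= c * (d * h).
Proof. by move=> d0 ah; rewrite mulrCA mulrC; exact: ler_wpM2l. Qed.

(** * Carleson embedding, square functions and the maximal function *)

Section square.
Variables (R : realType) (n : nat).
Notation T := 'rV[R]_n.
Notation m := (lebm R n).
Implicit Types (s t r p q : R) (x y z : T) (k u v w : T -> R).

Definition ta (tau0 : R) (i : nat) := tau0 * 4 ^+ i.

Lemma ta_gt0 tau0 i : 0 < tau0 -> 0 < ta tau0 i.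
Proof. by move=> t0; rewrite mulr_gt0. Qed.

Lemma ta2 tau0 i : ta tau0 i.+2 = 16 * ta tau0 i.
Proof. by rewrite /ta !exprS; ring. Qed.

Lemma itg_powR p v : 1 <= p -> bm v -> itg m v -> nneg v -> itg m (fun x => v x `^ p).
Proof.
move=> p1 [mv [M vM]] iv v0.
have M0 : 0 <= M by rewrite (le_trans _ (vM 0)).
apply: (itg_dom (fun x => M `^ (p - 1) * v x)); [mm| |exact: itgZ].
move=> x; rewrite ger0_norm ?powR_ge0// -mulr_powRB1 ?(lt_le_trans ltr01)// mulrC.
apply: ler_wpM2r => //; apply: powR_mono; rewrite ?subr_ge0//.
by apply: le_trans (vM x); exact: ler_norm.
Qed.

Lemma itg_He_powR t q w : 1 < q -> 0 < t -> bm w -> nneg w ->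
 itg m (fun x => w x `^ q) -> itg m (fun x => He t w x `^ q).
Proof.
move=> q1 t0 bw w0 iq; have q0 : 0 <= q by rewrite (le_trans ler01)// ltW.
have bq := bm_powR q0 bw w0; have bh := bm_He t0 bw.
apply: (itg_dom (He t (fun x => w x `^ q))).
- by have := bm_m bh => ?; mm.
- move=> x; rewrite ger0_norm ?powR_ge0//; exact: He_powR_ge.
- exact: itg_He.
Qed.

Lemma Ri_He_powR t q w : 1 < q -> 0 < t -> bm w -> nneg w ->
 itg m (fun x => w x `^ q) -> Ri m (fun x => He t w x `^ q) <= Ri m (fun x => w x `^ q).
Proof.
move=> q1 t0 bw w0 iq; have q0 : 0 <= q by rewrite (le_trans ler01)// ltW.
have bq := bm_powR q0 bw w0.
rewrite -(Ri_He t0 bq iq (fun y => powR_ge0 _ _)); apply: Ri_le.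
- exact: itg_He_powR.
- exact: itg_He.
- by move=> x; exact: He_powR_ge.
Qed.

Section carleson.
Variables (tau0 q N b : R) (u w : T -> R).
Hypotheses (t0 : 0 < tau0) (q1 : 1 < q) (N0 : 0 < N) (bu : bm u) (bw : bm w) (w0 : nneg w).
Hypotheses (iw : itg m (fun x => w x `^ q)) (wb : Ri m (fun x => w x `^ q) <= b).
Hypothesis VN : forall t x, 0 < t -> Var t u x <= N.

Let V0 t x : 0 < t -> 0 <= Var t u x.
Proof. by move=> t0'; rewrite subr_ge0; exact: He_sqr. Qed.
Let q0 : 0 < q. Proof. exact: lt_trans q1. Qed.
Let bVar t : 0 < t -> bm (Var t u).
Proof. by move=> t0'; rewrite /Var; bmt. Qed.

(** The Bellman function X^q Y^(1-q) at X = He w and Y = Var u + N. It is jointly convex, and adding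
    N keeps Y between N and 2 N, away from the singularity at 0. *)
Let B i x := He (ta tau0 i) w x `^ q * (Var (ta tau0 i) u x + N) `^ (1 - q).

Let AN i x : N <= Var (ta tau0 i) u x + N <= 2 * N.
Proof.
have h1 := V0 x (ta_gt0 i t0); have h2 := VN x (ta_gt0 i t0).
rewrite lerDr h1/= (_ : 2 * N = N + N) ?lerD2r//; ring.
Qed.
Let ANp i x : 0 < Var (ta tau0 i) u x + N.
Proof. by have /andP[h _] := AN i x; exact: lt_le_trans h. Qed.

Let B0 i x : 0 <= B i x. Proof. by rewrite mulr_ge0 ?powR_ge0. Qed.

Let BN i x : B i x <= N `^ (1 - q) * He (ta tau0 i) w x `^ q.
Proof.
rewrite /B mulrC ler_wpM2r ?powR_ge0// -opprB !powRN lef_pV2 ?posrE ?powR_gt0//.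
by apply: powR_mono; [rewrite subr_ge0 ltW|exact: ltW|have /andP[] := AN i x].
Qed.

Let bB i : bm (B i).
Proof.
have tp := ta_gt0 i t0; have bh := bm_He tp bw; have bv := bVar tp.
split; first by have := bm_m bh => ?; have := bm_m bv => ?; rewrite /B; mm.
have [_ [M hM]] := bm_powR (ltW q0) bh (fun y => He_ge0 y tp w0).
exists (N `^ (1 - q) * M) => x; rewrite (ger0_norm (B0 i x)).
apply: (le_trans (BN i x)); rewrite ler_wpM2l ?powR_ge0//.
by apply: le_trans (hM x); exact: ler_norm.
Qed.

Let iB i : itg m (B i).
Proof.
have tp := ta_gt0 i t0; apply: (itg_dom (fun x => N `^ (1 - q) * He (ta tau0 i) w x `^ q)).
- exact: bm_m (bB i).
- by move=> x; rewrite ger0_norm.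
- exact/itgZ/itg_He_powR.
Qed.

(** Jensen's inequality in the form of the tangent plane at time 16 tau. The mean of X is its value
    at 16 tau, but the mean of Y falls short of it by [Dop] ([DopVar]); as the function decreases in
    Y, this deficit is the gain. *)
Let step i x : B i.+2 x + (q - 1) * (2 * N) `^ (- q) * (He (16 * ta tau0 i) w x `^ q * Dop (ta tau0 i) u x)
  <= He (15 * ta tau0 i) (B i) x.
Proof.
set tau := ta tau0 i; have tp : 0 < tau := ta_gt0 i t0.
have tp15 : 0 < 15 * tau by lra.
have tp16 : 0 < 16 * tau by lra.
set W0 := He (16 * tau) w x; set Y0 := Var (16 * tau) u x + N; set D := Dop tau u x.
have W00 : 0 <= W0 by exact: He_ge0.
have Y0p : 0 < Y0 by have := ANp i.+2 x; rewrite ta2.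
have bh := bm_He tp bw; have bv := bVar tp.
have E : He (15 * tau) (fun y => q * W0 `^ (q - 1) * Y0 `^ (1 - q) * He tau w y
  - (q - 1) * W0 `^ q * Y0 `^ (- q) * (Var tau u y + N)) x
 = W0 `^ q * Y0 `^ (1 - q) + (q - 1) * Y0 `^ (- q) * (W0 `^ q * D). have bVN := bmD bv (bm_cst _ N). rewrite HeB; [|by []|by bmt|by apply: bmZ].
 rewrite HeZ// HeZ// (HeD x tp15 bv (bm_cst _ N)) He_cst//. rewrite He16// DopVar// -/W0 -/D. have EW : W0 `^ q = W0 `^ (q - 1) * W0 by rewrite mulrC mulr_powRB1.
 have EY : Y0 `^ (1 - q) = Y0 `^ (- q) * Y0 by rewrite addrC powRDp// powRr1// ltW.
 rewrite EY EW (_ : Var (16 * tau) u x - D + N = Y0 - D); last by rewrite /Y0; ring. ring.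
apply: (le_via (W0 `^ q * Y0 `^ (1 - q) + (q - 1) * Y0 `^ (- q) * (W0 `^ q * D))).
 rewrite /B ta2 -/tau -/W0 -/Y0 lerD2l; apply: ler_wpM2r.
  by rewrite mulr_ge0 ?powR_ge0 ?Dop_ge0.
 apply: ler_wpM2l; first by rewrite subr_ge0 ltW. rewrite !powRN lef_pV2 ?posrE ?powR_gt0 ?mulr_gt0//. apply: powR_mono; rewrite ?(ltW q0) ?(ltW Y0p)//.
 by have /andP[_] := AN i.+2 x; rewrite ta2 -/tau -/Y0.
rewrite -E; apply: He_le => //.
- apply: bmB; first by bmt. by apply: bmZ; exact: bmD bv (bm_cst _ N).
- by move=> y; apply: persp_tangent => //; [exact: He_ge0|exact: ANp].
Qed.

(** The gains of [step] telescope with step two. What remains are the integrals of B at the first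
    two scales, each at most N^(1-q) b. *)
Lemma carleson M : (II m M (fun i x => Dop (ta tau0 i) u x * He (16 * ta tau0 i) w x `^ q)%R
  <= (2 * 2 `^ q / (q - 1) * N * b)%:E)%E.
Proof.
have qq : 0 < q - 1 by rewrite subr_gt0.
have bp i : 0 < ta tau0 i by exact: ta_gt0.
have iD i : itg m (fun x => Dop (ta tau0 i) u x * He (16 * ta tau0 i) w x `^ q).
 have [mD [K DK]] := bm_Dop (bp i) bu. have t16 : 0 < 16 * ta tau0 i by rewrite mulr_gt0. under eq_fun do rewrite mulrC.
 exact: (itgM K (itg_He_powR q1 t16 bw w0 iw) mD DK).
rewrite II_Ri// lee_fin.
have st i : (q - 1) * (2 * N) `^ (- q) * Ri m (fun x => Dop (ta tau0 i) u x * He (16 * ta tau0 i) w x `^ q)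
  <= Ri m (B i) - Ri m (B i.+2).
 rewrite lerBrDl -RiZ// -RiD//; last exact: itgZ. have t15 : 0 < 15 * ta tau0 i by rewrite mulr_gt0. rewrite -(Ri_He t15 (bB i) (iB i) (B0 i)); apply: Ri_le.
 - by apply: itgD => //; exact: itgZ.
 - exact: itg_He.
 - by move=> x; rewrite [Dop _ _ _ * _]mulrC.
have c0 : 0 < (q - 1) * (2 * N) `^ (- q) by rewrite mulr_gt0 ?powR_gt0 ?mulr_gt0.
rewrite -(ler_pM2l c0) mulr_sumr.
apply: (le_via (\sum_(i < M) (Ri m (B i) - Ri m (B i.+2)))).
 by apply: ler_sum => i _.
apply: (le_trans (telescope2 M (fun i => Ri_ge0 (B0 i)))).
have hB i : Ri m (B i) <= N `^ (1 - q) * b.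
 apply: (le_via (Ri m (fun x => N `^ (1 - q) * He (ta tau0 i) w x `^ q))).
  by apply: Ri_le; [exact: iB|exact/itgZ/itg_He_powR|exact: BN].
 rewrite RiZ; last exact: itg_He_powR. apply: ler_wpM2l; first exact: powR_ge0. by apply: le_trans wb; exact: Ri_He_powR.
apply: (le_trans (lerD (hB 0%N) (hB 1%N))).
apply: le_of_eq.
rewrite powRM ?(ltW N0)// addrC powRDp// powRr1 ?(ltW N0)// [2 `^ (- q)]powRN.
by field; rewrite !gt_eqF// powR_gt0.
Qed.
End carleson.

(** Orthogonality of martingale differences: the integral of [Dop] is the drop of the squared L^2
    norm of the flow from time tau to 16 tau. *)
Lemma II_Dop tau0 u M : 0 < tau0 -> bm u -> itg m u ->
 (II m M (fun i => Dop (ta tau0 i) u) <= (2 * Ri m (fun x => u x ^+ 2))%:E)%E.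
Proof.
move=> t0 bu iu; pose e i := Ri m (fun x => He (ta tau0 i) u x ^+ 2).
have bp i : 0 < ta tau0 i by exact: ta_gt0.
have bh i := bm_He (bp i) bu; have ih i : itg m (fun x => He (ta tau0 i) u x ^+ 2).
 by apply: itg_sqr => //; exact: itg_He.
have DE i : Dop (ta tau0 i) u = fun x => He (15 * ta tau0 i) (fun y => He (ta tau0 i) u y ^+ 2) x
   - He (ta tau0 i.+2) u x ^+ 2.
 by apply/funext => x; rewrite DopE// ta2.
have t15 i : 0 < 15 * ta tau0 i by rewrite mulr_gt0.
have i15 i : itg m (He (15 * ta tau0 i) (fun y => He (ta tau0 i) u y ^+ 2)).
 by apply: itg_He; bmt.
rewrite II_Ri; last by move=> i; rewrite DE; exact: itgB.
rewrite lee_fin (eq_bigr (fun i : 'I_M => e i - e i.+2)); last first.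
 move=> i _; rewrite DE RiB// Ri_He//; first by bmt. by move=> y; exact: sqr_ge0.
apply: (le_trans (telescope2 M (fun i => Ri_ge0 (fun x => sqr_ge0 _)))).
have h i : e i <= Ri m (fun x => u x ^+ 2).
 rewrite -(Ri_He (bp i) (bm_sqr bu) (itg_sqr bu iu) (fun y => sqr_ge0 _)). apply: Ri_le => //; first by apply: itg_He => //; [bmt|exact: itg_sqr].
 by move=> x; exact: He_sqr.
by rewrite mulr_natl mulr2n; exact: lerD (h 0%N) (h 1%N).
Qed.

(* Jensen gap of the power [p] between times [tau] and [16 tau] *)
Definition gap p tau v x := He (15 * tau) (fun y => He tau v y `^ p) x - He (16 * tau) v x `^ p.

Section energy.
Variables (p : R) (v : T -> R).
Hypotheses (hp : 1 < p < 2) (bv : bm v) (iv : itg m v) (v0 : nneg v).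
Let p1 : 1 < p. Proof. by case/andP: hp. Qed.
Let p0 : 0 <= p. Proof. by rewrite (le_trans ler01)// ltW. Qed.

Lemma gap_ge0 tau x : 0 < tau -> 0 <= gap p tau v x.
Proof.
move=> t0; have t15 : 0 < 15 * tau by rewrite mulr_gt0.
rewrite subr_ge0 -He16//; apply: He_powR_ge => //; first by bmt.
by move=> y; exact: He_ge0.
Qed.

Lemma bm_gap tau : 0 < tau -> bm (gap p tau v).
Proof.
move=> t0; have t15 : 0 < 15 * tau by rewrite mulr_gt0.
have t16 : 0 < 16 * tau by lra.
apply: bmB; first apply: bm_He => //.
 by apply: bm_powR => //; [bmt|move=> y; exact: He_ge0].
by apply: bm_powR => //; [bmt|move=> y; exact: He_ge0].
Qed.

Lemma II_gap tau0 M : 0 < tau0 ->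
 (II m M (fun i => gap p (ta tau0 i) v) <= (2 * Ri m (fun x => v x `^ p))%:E)%E.
Proof.
move=> t0; pose e i := Ri m (fun x => He (ta tau0 i) v x `^ p).
have bp i : 0 < ta tau0 i by exact: ta_gt0.
have t15 i : 0 < 15 * ta tau0 i by rewrite mulr_gt0.
have ip : itg m (fun x => v x `^ p) by apply: itg_powR => //; exact: ltW.
have bh i : bm (fun x => He (ta tau0 i) v x `^ p).
 by apply: bm_powR => //; [apply: bm_He|move=> y; exact: He_ge0].
have ih i : itg m (fun x => He (ta tau0 i) v x `^ p) by exact: itg_He_powR.
have GE i : gap p (ta tau0 i) v = fun x => He (15 * ta tau0 i) (fun y => He (ta tau0 i) v y `^ p) x
   - He (ta tau0 i.+2) v x `^ p.
 by apply/funext => x; rewrite ta2.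
have i15 i : itg m (He (15 * ta tau0 i) (fun y => He (ta tau0 i) v y `^ p)) by exact: itg_He.
rewrite II_Ri; last by move=> i; rewrite GE; exact: itgB.
rewrite lee_fin (eq_bigr (fun i : 'I_M => e i - e i.+2)); last first.
 move=> i _; rewrite GE RiB// Ri_He//. by move=> y; exact: powR_ge0.
apply: (le_trans (telescope2 M (fun i => Ri_ge0 (fun x => powR_ge0 _ _)))).
have h i : e i <= Ri m (fun x => v x `^ p) by exact: Ri_He_powR.
by rewrite mulr_natl mulr2n; exact: lerD (h 0%N) (h 1%N).
Qed.

(** The energy available at the exponent p < 2 is the Jensen gap of the power p. It controls the
    squared deviation at the price of a factor a^(2-p), a being the mean, to be absorbed later by a
    maximal function or by a weight. Only deviations below a are estimated, through [powR_taylor];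
    they carry half of the mean deviation. *)
Lemma Lop_gap tau x : 0 < tau ->
 Lop tau v x ^+ 2 <= 8 / (p * (p - 1)) * (gap p tau v x * He (16 * tau) v x `^ (2 - p)).
Proof.
move=> t0; have t15 : 0 < 15 * tau by rewrite mulr_gt0.
have t16 : 0 < 16 * tau by lra.
have pp : 0 < p * (p - 1) by rewrite mulr_gt0 ?subr_gt0// (lt_trans ltr01).
set a := He (16 * tau) v x; have a0 : 0 <= a by exact: He_ge0.
have bh := bm_He t0 bv; have h0 y : 0 <= He tau v y by exact: He_ge0.
have mean : He (15 * tau) (He tau v) x = a by rewrite He16.
(* If a = 0, then v being nonnegative the deviation is the mean itself, hence 0. *)
have [aE|an0] := eqVneq a 0.
 suff -> : Lop tau v x = 0.
  by rewrite expr0n/= mulr_ge0 ?divr_ge0 ?(ltW pp)// mulr_ge0 ?gap_ge0 ?powR_ge0.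
 rewrite /Lop -/a aE -/(He _ _) -[RHS]aE -mean; congr (He _ _ x). by apply/funext => y; rewrite subr0 ger0_norm.
have ap : 0 < a by rewrite lt_neqAle eq_sym an0.
pose P y := Num.max (a - He tau v y) 0.
have bP : bm P by rewrite /P; bmt.
have LE : Lop tau v x = 2 * He (15 * tau) P x.
 have bc : bm (fun _ : T => a) by exact: bm_cst. have -> : Lop tau v x = He (15 * tau) (fun y => 2 * P y + (He tau v y - a)) x.
  by congr (He _ _ x); apply/funext => y; rewrite /P -normr_posE.
 rewrite HeD//; [|exact: bmZ|by bmt]. by rewrite HeZ// HeB// He_cst// mean subrr addr0.
have P2 : p * (p - 1) / 2 * a `^ (p - 2) * He (15 * tau) (fun y => P y ^+ 2) x <= gap p tau v x.
 have bpp : bm (fun y => He tau v y `^ p) by exact: bm_powR. rewrite -HeZ//; bmt; rewrite /gap -/a lerBrDl.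
 have -> : a `^ p = He (15 * tau) (fun y => a `^ p + p * a `^ (p - 1) * (He tau v y - a)) x.
  have bc c : bm (fun _ : T => c) by exact: bm_cst. have bB : bm (fun y => He tau v y - a) by exact: bmB.
  rewrite (HeD x t15 (bc _) (bmZ _ bB)) HeZ// HeB// !He_cst// mean subrr mulr0 addr0//.
 have bP2 : bm (fun y => P y ^+ 2) by exact: bm_sqr. have bc c : bm (fun _ : T => c) by exact: bm_cst. have bB : bm (fun y => He tau v y - a) by exact: bmB.
 rewrite -(HeD x t15 (bmD (bc _) (bmZ _ bB)) (bmZ _ bP2)). apply: He_le => //; [exact: bmD (bmD (bc _) (bmZ _ bB)) (bmZ _ bP2)|]. by move=> y; exact: powR_taylor.
have e2 : a `^ (p - 2) * a `^ (2 - p) = 1.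
 by rewrite -powRDp// (_ : p - 2 + (2 - p) = 0) ?powRr0; ring.
have h := He_sqr x t15 bP.
rewrite LE exprMn.
apply: (le_via (8 / (p * (p - 1)) * ((p * (p - 1) / 2 * a `^ (p - 2) * He (15 * tau) (fun y => P y ^+ 2) x) * a `^ (2 - p)))).
 rewrite (_ : 8 / _ * _ = 2 ^+ 2 * He (15 * tau) (fun y => P y ^+ 2) x * (a `^ (p - 2) * a `^ (2 - p))).
  by rewrite e2 mulr1 ler_wpM2l.
 by field; rewrite subr_eq0 !gt_eqF// (lt_trans ltr01).
by rewrite ler_wpM2l ?divr_ge0 ?(ltW pp)// ler_wpM2r ?powR_ge0.
Qed.

(** Cauchy-Schwarz for the outer heat operator separates the gap from the power, and concavity (0 <
    2 - p < 1) moves that operator inside the power; 23 = 7 + 16. *)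
Lemma Lp_gap tau x : 0 < tau ->
 Lp tau v x ^+ 2 <= 8 / (p * (p - 1)) *
   (He (7 * tau) (gap p tau v) x * He (23 * tau) v x `^ (2 - p)).
Proof.
move=> t0; have t7 : 0 < 7 * tau by rewrite mulr_gt0.
have t16 : 0 < 16 * tau by lra.
have pp : 0 < p * (p - 1) by rewrite mulr_gt0 ?subr_gt0// (lt_trans ltr01).
have c0 : 0 <= 8 / (p * (p - 1)) by rewrite divr_ge0 ?(ltW pp).
set c := 8 / _ in c0 *.
have /andP[p1' p2] := hp; have pp2 : 0 < 2 - p < 1 by apply/andP; split; lra.
have bg := bm_gap t0; have bh := bm_He t16 bv; have h0 y : 0 <= He (16 * tau) v y by exact: He_ge0.
have bhp : bm (fun y => He (16 * tau) v y `^ (2 - p)) by apply: bm_powR => //; lra.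
pose f y := sqrt (c * gap p tau v y); pose g y := sqrt (He (16 * tau) v y `^ (2 - p)).
have bsq (h : T -> R) : bm h -> nneg h -> bm (fun y => sqrt (h y)).
 move=> bh' h0'; rewrite (_ : (fun y => _) = (fun y => h y `^ 2^-1)).
  by apply: bm_powR.
 by apply/funext => y; rewrite powR12_sqrt.
have f2 y : f y ^+ 2 = c * gap p tau v y by rewrite sqr_sqrtr// mulr_ge0// gap_ge0.
have g2 y : g y ^+ 2 = He (16 * tau) v y `^ (2 - p) by rewrite sqr_sqrtr// powR_ge0.
have bf : bm f by apply: bsq; [exact: bmZ|move=> y; rewrite mulr_ge0// gap_ge0].
have bg' : bm g by apply: bsq => // y; exact: powR_ge0.
have Lfg y : Lop tau v y <= f y * g y.
 rewrite -[X in X <= _]ger0_norm ?Lop_ge0// -sqrtr_sqr -sqrtrM; last by rewrite mulr_ge0// gap_ge0. by rewrite ler_wsqrtr// -mulrA; exact: Lop_gap.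
have : Lp tau v x ^+ 2 <= (He (7 * tau) (fun y => f y * g y) x) ^+ 2.
 rewrite ler_sqr ?nnegrE ?Lp_ge0//; last first.
  by apply: He_ge0 => // z; rewrite mulr_ge0 ?sqrtr_ge0.
 by apply: He_le => //; [exact: bm_Lop|bmt].
move=> /le_trans; apply; apply: (le_trans (He_CS x t7 bf bg')).
rewrite (_ : (fun y => f y ^+ 2) = fun y => c * gap p tau v y); last by apply/funext.
rewrite (_ : (fun y => g y ^+ 2) = fun y => He (16 * tau) v y `^ (2 - p)); last by apply/funext.
rewrite HeZ// -mulrA ler_wpM2l// ler_wpM2l//.
 by apply: He_ge0 => // y; exact: gap_ge0.
have -> : He (23 * tau) v = He (7 * tau) (He (16 * tau) v).
 by rewrite HeHe//; congr (He _ v); ring.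
exact: He_powR_le.
Qed.
End energy.

(* transfer of a time-independent weight to the heat flow *)
Lemma II_Lp_weight tau0 u k M : 0 < tau0 -> bm u -> bm k -> nneg k ->
 (II m M (fun i x => k x * Lp (ta tau0 i) u x ^+ 2)%R <=
  (3 ^+ n)%:E * II m M (fun i x => Dop (ta tau0 i) u x * He (16 * ta tau0 i) k x)%R)%E.
Proof.
move=> t0 bu bk k0; have bp i : 0 < ta tau0 i by exact: ta_gt0.
have t7 i : 0 < 7 * ta tau0 i by rewrite mulr_gt0.
have t16 i : 0 < 16 * ta tau0 i by rewrite mulr_gt0.
have h716 i : 7 * ta tau0 i <= 16 * ta tau0 i by have := bp i; lra.
have h163 i : 16 * ta tau0 i <= 3 * (7 * ta tau0 i) by have := bp i; lra.
have h13 : 1 <= 3 :> R by lra.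
have bD i := bm_Dop (bp i) bu; have D0 i x : 0 <= Dop (ta tau0 i) u x by exact: Dop_ge0.
have mk := bm_m bk.
have mHe t : 0 < t -> mfun (He t k) by move=> t0'; exact: (bm_m (bm_He t0' bk)).
rewrite -II_scale ?exprn_ge0//; last 2 first.
- by move=> i; have := mHe _ (t16 i); have := bm_m (bD i) => ? ?; mm.
- by move=> i x; apply: mulr_ge0; [exact: D0|exact: He_ge0].
apply: (le_via (II m M (fun i x => k x * He (7 * ta tau0 i) (Dop (ta tau0 i) u) x)%R)).
 apply: II_le => i.
 - by have := bm_m (bm_He (t7 i) (bm_Lop (bp i) bu)) => ?; rewrite /Lp; mm.
 - by have := bm_m (bm_He (t7 i) (bD i)) => ?; mm.
 - by move=> x; rewrite mulr_ge0 ?sqr_ge0.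
 - move=> x; rewrite ler_wpM2l//; have bL := bm_Lop (bp i) bu. apply: (le_trans (He_sqr x (t7 i) bL)); apply: He_le => //; bmt. by move=> y; exact: LopD.
rewrite /II; apply: lee_sum => i _.
rewrite int_conv_adj//; [|exact: itg_G|by move=> y; exact: G_ge0|by move=> y; exact: GN].
apply: ge0_le_integral => //=.
- by move=> x _; rewrite lee_fin mulr_ge0// He_ge0.
- by apply/measurable_EFinP; have := mHe _ (t7 i); have := bm_m (bD i) => ? ?; rewrite -/(He _ _); mm.
- by apply/measurable_EFinP; have := mHe _ (t16 i); have := bm_m (bD i) => ? ?; mm.
- move=> x _; rewrite lee_fin; apply: ler_scaleAC (D0 i x) _. exact: (He_mono x (t7 i) (h716 i) (h163 i) h13 bk k0).
Qed.

Lemma Ri_indic (A : set T) : measurable A -> (\int[m]_x (\1_A x)%:E)%E = m A.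
Proof. by move=> mA; rewrite integral_indic// setIT. Qed.

Section garsia.
Variables (sg lam : R) (w : T -> R).
Hypotheses (sg0 : 0 < sg) (lam0 : 0 < lam) (bw : bm w) (iw : itg m w) (w0 : nneg w).

(* the random walk with increments [w - lam], reflected at 0 *)
Fixpoint walk N : T -> R := if N is N'.+1 then
 fun x => Num.max (w x - lam + He sg (walk N') x) 0 else fun _ => 0.

Lemma bm_walk N : bm (walk N).
Proof.
elim: N => [|N IH] /=; first exact: bm_cst.
apply: bm_max; last exact: bm_cst.
apply: bmD; last exact: bm_He.
by apply: bmB => //; exact: bm_cst.
Qed.

Let bwalk := bm_walk.

Let walk_ge0 N x : 0 <= walk N x.
Proof. by case: N => [|N] //=; rewrite le_max lexx orbT. Qed.

Let iwalk N : itg m (walk N).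
Proof.
elim: N => [|N IH]; first exact: itg0.
apply: (itg_dom (fun x => w x + He sg (walk N) x)); first exact: (bm_m (bm_walk N.+1)).
 move=> x; rewrite (ger0_norm (walk_ge0 N.+1 x)) /=. have h : 0 <= He sg (walk N) x by exact: He_ge0. by rewrite ge_max addr_ge0// andbT lerD2r lerBlDr lerDl ltW.
by apply: itgD => //; exact: itg_He.
Qed.

Let walk_mono N x : walk N x <= walk N.+1 x.
Proof.
elim: N x => [|N IH] x; first exact: walk_ge0.
have h : He sg (walk N) x <= He sg (walk N.+1) x by exact: He_le.
rewrite -[leLHS]/(Num.max (w x - lam + He sg (walk N) x) 0) -[leRHS]/(Num.max (w x - lam + He sg (walk N.+1) x) 0).
by rewrite ge_max !le_max lexx orbT lerD2l h.
Qed.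

Let walk_le N N' x : (N <= N')%N -> walk N x <= walk N' x.
Proof.
move=> NN'; rewrite -(subnKC NN'); elim: (N' - N)%N => [|d IH]; first by rewrite addn0.
by rewrite addnS (le_trans IH).
Qed.

(** The maximal ergodic lemma by Garsia's argument: where the walk is positive, lam is at most w -
    walk + He walk, and elsewhere that expression is nonnegative. Its integral is that of w because
    the heat flow preserves integrals. *)
Lemma walk_pos N : (lam%:E * m [set x | 0 < walk N x]%R <= (Ri m w)%:E)%E.
Proof.
set E := [set x | _]; have mE : measurable E.
 rewrite (_ : E = walk N @^-1` `]0, +oo[%classic); last first.
  by apply/seteqP; split => x; rewrite /E/= in_itv andbT.
 by rewrite -[X in measurable X]setTI; exact: (bm_m (bm_walk N)).
rewrite -(Ri_indic mE) -ge0_integralZl//=; last first.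
- by rewrite lee_fin ltW.
- by apply/measurable_EFinP.
have iH : itg m (He sg (walk N)) by exact: itg_He.
have ir : itg m (fun x => w x - walk N x + He sg (walk N) x) by apply: itgD => //; exact: itgB.
have <- : Ri m (fun x => w x - walk N x + He sg (walk N) x) = Ri m w.
 by rewrite RiD ?RiB ?(Ri_He sg0) ?subrK//; exact: itgB.
rewrite RiE//; have h x : lam * \1_E x <= w x - walk N x + He sg (walk N) x.
 have [xE|xE] := pselect (E x); last first.
  have -> : walk N x = 0 by apply/eqP; rewrite eq_le walk_ge0 leNgt andbT; exact/negP. by rewrite indicE memNset// mulr0 subr0 addr_ge0// He_ge0.
 rewrite indicE mem_set// mulr1; move: xE; rewrite /E/=. case: N {E mE iH ir} => [|N] /=; first by rewrite ltxx. rewrite lt_max ltxx orbF => xp.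
 have hN : He sg (walk N) x <= He sg (walk N.+1) x by exact: He_le. rewrite (max_idPl (ltW xp)); move: hN; rewrite -/(walk N.+1).
 move: (He sg (walk N) x) (He sg (walk N.+1) x) => a b ab; lra.
apply: ge0_le_integral => //=.
- by move=> x _; rewrite lee_fin mulr_ge0// ltW.
- rewrite (_ : (fun x => _) = (fun x => (lam * \1_E x)%:E))//; apply/measurable_EFinP; apply: mf_mul; [by mm|exact: measurable_indic].
- by apply/measurable_EFinP; exact: itg_m ir.
- by move=> x _; rewrite lee_fin.
Qed.

(** Without reflection the walk would be the sum of the flows of w at the times 0, sg, 2 sg, ...
    minus lam per step; reflection only increases it. *)
Lemma walk_ge N x : w x + \sum_(j < N) He (j.+1%:R * sg) w x - N.+1%:R * lam <= walk N.+1 x.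
Proof.
have js (j : nat) : 0 < j.+1%:R * sg by rewrite mulr_gt0.
have bq N' : bm (fun y => \sum_(j < N') He (j.+1%:R * sg) w y).
 elim: N' => [|N' IH]; first by under eq_fun do rewrite big_ord0; exact: bm_cst. by under eq_fun do rewrite big_ord_recr; apply: bmD => //; exact: bm_He.
elim: N x => [|N IH] x.
 by rewrite big_ord0 addr0 mul1r le_max He_cst// addr0 lexx.
have H1 : He sg (fun y => w y + \sum_(j < N) He (j.+1%:R * sg) w y - N.+1%:R * lam) x
  = \sum_(j < N.+1) He (j.+1%:R * sg) w x - N.+1%:R * lam.
 rewrite (HeB x sg0 (bmD bw (bq N)) (bm_cst _ _)) (HeD x sg0 bw (bq N)) He_cst//. congr (_ - _); rewrite big_ord_recl/= mul1r; congr (_ + _).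
 elim: N {IH} => [|N' IH']; first by rewrite !big_ord0; under eq_fun do rewrite big_ord0; exact: He_cst. under eq_fun do rewrite big_ord_recr/=.
 rewrite (HeD x sg0 (bq N') (bm_He (js N') bw)) IH' big_ord_recr/=; congr (_ + _). rewrite HeHe//; congr (He _ _ x).
 by rewrite /bump add1n -[N'.+2%:R]natr1 mulrDl mul1r addrC.
have H2 : He sg (fun y => w y + \sum_(j < N) He (j.+1%:R * sg) w y - N.+1%:R * lam) x
  <= He sg (walk N.+1) x.
 apply: (He_le x sg0 (bmB (bmD bw (bq N)) (bm_cst _ _)) (bwalk N.+1)) => y; exact: IH.
rewrite [walk N.+2]/= le_max; apply/orP; left.
rewrite -[leRHS]/(w x - lam + He sg (walk N.+1) x).
move: H2; rewrite H1 -[N.+2%:R]natr1 mulrDl mul1r.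
move: (\sum_(j < N.+1) _) (He sg (walk N.+1) x) (N.+1%:R * lam) => a b c; lra.
Qed.

(** A large value at time 4^i sg forces large values, up to 2^n, at the 4^i times j sg with 4^i <= j
    < 2 4^i, hence a large sum over 2 4^i steps. The remaining factor 2 is the ratio of the two
    counts. *)
Lemma walk_max i K x : (i < K)%N -> 2 * 2 ^+ n * lam < He (sg * 4 ^+ i) w x ->
 0 < walk (2 * 4 ^ K) x.
Proof.
move=> iK h; set N := (2 * 4 ^ i)%N.
have N0 : (0 < N)%N by rewrite muln_gt0 expn_gt0.
apply: (@lt_le_trans _ _ (walk N x)); last first.
 by apply: walk_le; rewrite leq_mul2l leq_pexp2l// ltnW.
rewrite -(prednK N0); apply: lt_le_trans (walk_ge _ _); rewrite (prednK N0).
have js (j : nat) : 0 < j.+1%:R * sg by rewrite mulr_gt0.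
have s4 : 0 < sg * 4 ^+ i by rewrite mulr_gt0.
suff : N%:R * lam < \sum_(j < N.-1) He (j.+1%:R * sg) w x.
 by have := w0 x; move: (\sum_(j < _) _) (N%:R * lam) => a b; lra.
have e2 : 0 < (2:R) ^+ n by [].
have hj (j : nat) : (4 ^ i <= j.+1)%N -> (j < N.-1)%N ->
  He (sg * 4 ^+ i) w x <= 2 ^+ n * He (j.+1%:R * sg) w x.
 move=> ij jN; have {}jN : (j.+1 <= 2 * 4 ^ i)%N by rewrite -/N -(prednK N0) ltnS ltnW. apply: He_mono => //; last by rewrite ler1n.
  by rewrite mulrC; apply: ler_wpM2r; [exact: ltW|rewrite -natrX ler_nat].
 rewrite mulrCA mulrC; apply: ler_wpM2l; first exact: ltW. by rewrite -natrX -natrM ler_nat.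
have lb : (4 ^ i)%:R * He (sg * 4 ^+ i) w x <= 2 ^+ n * \sum_(j < N.-1) He (j.+1%:R * sg) w x.
 have i0 : (0 < 4 ^ i)%N by rewrite expn_gt0. have iN : ((4 ^ i).-1 <= N.-1)%N by rewrite -ltnS !prednK// /N leq_pmull.
 rewrite mulr_sumr -(big_mkord xpredT (fun j => 2 ^+ n * He (j.+1%:R * sg) w x)). rewrite (big_cat_nat _ iN)//= -[leLHS]add0r; apply: lerD.
  by apply: sumr_ge0 => j _; apply: mulr_ge0; [exact: ltW|exact: He_ge0].
 have -> : (4 ^ i)%:R * He (sg * 4 ^+ i) w x = \sum_((4 ^ i).-1 <= j < N.-1) He (sg * 4 ^+ i) w x.
  rewrite sumr_const_nat -[LHS]/(_ * _) mulr_natl; congr (_ *+ _). by rewrite /N mul2n -addnn -subn1 -subn1 subnBA// subnK ?addnK// ltn_addl.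
 rewrite big_seq [leRHS]big_seq; apply: ler_sum => j; rewrite mem_index_iota => /andP[j1 j2]. by apply: hj => //; rewrite -(prednK i0).
rewrite -(ltr_pM2l e2); apply: lt_le_trans lb.
have i0 : 0 < (4 ^ i)%:R :> R by [].
rewrite (_ : _ * (N%:R * lam) = (4 ^ i)%:R * (2 * 2 ^+ n * lam)); first by rewrite (ltr_pM2l i0).
by rewrite /N natrM; ring.
Qed.
End garsia.

Lemma lebm_fin_pos (A : set T) (c e : R) : 0 < c -> (c%:E * m A <= e%:E)%E -> (m A <= (e / c)%:E)%E.
Proof.
by move=> c0; rewrite EFinM lee_pdivlMr// muleC.
Qed.

Definition mx K sg u x := \big[Num.max/0]_(i < K) He (sg * 4 ^+ i) u x.

Lemma mx_ge0 K sg u x : 0 <= mx K sg u x.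
Proof. by rewrite /mx; elim/big_rec: _ => // i y _ y0; rewrite le_max y0 orbT. Qed.

Lemma mx_ge K sg u i x : (i < K)%N -> He (sg * 4 ^+ i) u x <= mx K sg u x.
Proof. by move=> iK; rewrite /mx (bigD1 (Ordinal iK))//= le_max lexx. Qed.

Lemma mx_le K sg u x c : 0 <= c -> (forall i, (i < K)%N -> He (sg * 4 ^+ i) u x <= c) -> mx K sg u x <= c.
Proof.
move=> c0 h; rewrite /mx; elim/big_ind: _ => // [y z yc zc|i _]; first by rewrite ge_max yc.
exact: h.
Qed.

Lemma bm_mx K sg u : 0 < sg -> bm u -> bm (mx K sg u).
Proof.
move=> s0 bu; rewrite /mx; elim: (index_enum _) => [|i s IH].
 by under eq_fun do rewrite big_nil; exact: bm_cst.
under eq_fun do rewrite big_cons/=; apply: bm_max => //.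
by apply: bm_He => //; rewrite mulr_gt0.
Qed.

Lemma mx_weak K sg u lam : 0 < sg -> 0 < lam -> bm u -> itg m u -> nneg u ->
 (m [set x | lam < mx K sg u x]%R <= (2 * 2 ^+ n * Ri m u / lam)%:E)%E.
Proof.
move=> s0 l0 bu iu u0; have c0 : 0 < 2 * 2 ^+ n :> R by rewrite mulr_gt0 ?exprn_gt0.
set l := lam / (2 * 2 ^+ n); have lp : 0 < l by rewrite divr_gt0.
have -> : 2 * 2 ^+ n * Ri m u / lam = Ri m u / l by rewrite /l; field; rewrite !gt_eqF// exprn_gt0.
have := walk_pos s0 lp bu iu u0 (2 * 4 ^ K)%N; move=> /(lebm_fin_pos lp); apply: le_trans.
apply: le_measure; rewrite ?inE.
- rewrite (_ : [set x | _] = mx K sg u @^-1` `]lam, +oo[%classic).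
  by rewrite -[X in measurable X]setTI; exact: (bm_m (bm_mx K s0 bu)).
 by apply/seteqP; split => x; rewrite /= in_itv andbT.
- rewrite (_ : [set x | _] = walk sg l u (2 * 4 ^ K)%N @^-1` `]0, +oo[%classic).
  by rewrite -[X in measurable X]setTI; exact: (bm_m (bm_walk l s0 bu _)).
 by apply/seteqP; split => x; rewrite /= in_itv andbT.
move=> x /= h; have [[i iK]|hn] := pselect (exists2 i, (i < K)%N & lam < He (sg * 4 ^+ i) u x).
 move=> hi; apply: walk_max iK _ => //. by rewrite (_ : 2 * 2 ^+ n * l = lam)// /l mulrC divfK// gt_eqF.
suff : mx K sg u x <= lam by rewrite leNgt h.
apply: mx_le; first exact: ltW.
by move=> i iK; rewrite leNgt; apply/negP => hi; apply: hn; exists i.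
Qed.

Lemma min_powR_step r (L : nat) (y : R) : 1 < r -> 0 <= y ->
 Num.min y (2^-1 ^+ L) `^ r <= (2^-1 ^+ L) `^ r * \1_[set z : R | 2^-1 ^+ L.+1 < z] y
  + Num.min y (2^-1 ^+ L.+1) `^ r.
Proof.
move=> r1 y0; have r0 : 0 <= r by rewrite (le_trans ler01)// ltW.
have e (k : nat) : 0 < (2^-1 : R) ^+ k by [].
have [h|h] := ltP (2^-1 ^+ L.+1) y.
 rewrite indicE mem_set// mulr1 -[leLHS]addr0 lerD ?powR_ge0//. by apply: powR_mono; rewrite ?le_min ?y0 ?(ltW (e _))// ge_min lexx orbT.
rewrite indicE memNset/=; last by rewrite ltNge h.
rewrite mulr0 add0r; apply: powR_mono; rewrite ?le_min ?y0 ?(ltW (e _))//.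
by rewrite ge_min lexx.
Qed.

(** Dyadic layer cake. Only levels below 1 occur, and the tail is linear in y, so that integrability
    of the maximal function controls it. *)
Lemma powR_layer r (L : nat) (y : R) : 1 < r -> 0 <= y <= 1 ->
 y `^ r <= \sum_(l < L) (2^-1 ^+ l) `^ r * \1_[set z : R | 2^-1 ^+ l.+1 < z] y
   + (2^-1 ^+ L) `^ (r - 1) * y.
Proof.
move=> r1 /andP[y0 y1]; have r0 : 0 <= r by rewrite (le_trans ler01)// ltW.
have e (k : nat) : 0 < (2^-1 : R) ^+ k by [].
have -> : y `^ r = Num.min y (2^-1 ^+ 0) `^ r by rewrite expr0 (min_idPl y1).
apply: (le_via (\sum_(l < L) (2^-1 ^+ l) `^ r * \1_[set z : R | 2^-1 ^+ l.+1 < z] y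
   + Num.min y (2^-1 ^+ L) `^ r)).
 elim: L => [|L IH]; first by rewrite big_ord0 add0r. apply: (le_trans IH); rewrite big_ord_recr/= -addrA lerD2l; exact: min_powR_step.
rewrite lerD2l -mulr_powRB1 ?le_min ?y0 ?(ltW (e _))//; last exact: lt_trans r1.
rewrite mulrC; apply: ler_pM; rewrite ?powR_ge0 ?le_min ?y0 ?(ltW (e _))//.
 by apply: powR_mono; rewrite ?subr_ge0 ?(ltW r1) ?le_min ?y0 ?(ltW (e _))// ge_min lexx orbT.
by rewrite ge_min lexx.
Qed.

Lemma itg_mx K sg u : 0 < sg -> bm u -> itg m u -> nneg u -> itg m (mx K sg u).
Proof.
move=> s0 bu iu u0; have sk i : 0 < sg * 4 ^+ i by rewrite mulr_gt0 ?exprn_gt0.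
apply: (itg_dom (fun x => \sum_(i < K) He (sg * 4 ^+ i) u x)).
- exact: (bm_m (bm_mx K s0 bu)).
- move=> x; rewrite ger0_norm ?mx_ge0//; apply: mx_le => [|i iK].
  by apply: sumr_ge0 => i _; exact: He_ge0.
 rewrite (bigD1 (Ordinal iK))//= lerDl; apply: sumr_ge0 => j _; exact: He_ge0.
- by apply: itg_sum => i; exact: (itg_He (sk i) bu iu).
Qed.

(** Restricted strong type: for 0 <= u <= 1 the weak bound over the levels below 1 sums as a
    geometric series. The remainder is rho^L times an integral that may depend on K; L tends to
    infinity with K fixed. *)
Lemma mx_strong r : 1 < r -> exists2 C, 0 < C & forall K sg u e, 0 < sg -> bm u -> itg m u ->
 (forall x, 0 <= u x <= 1) -> Ri m u <= e ->
 itg m (fun x => mx K sg u x `^ r) /\ Ri m (fun x => mx K sg u x `^ r) <= C * e.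
Proof.
move=> r1; have r0 : 0 <= r by rewrite (le_trans ler01)// ltW.
have rm : 0 < r - 1 by lra.
have h0 : 0 < 2^-1 :> R by [].
set rho : R := 2^-1 `^ (r - 1).
have rho0 : 0 < rho by exact: powR_gt0.
have rho1 : rho < 1.
 have h1 : 2^-1 < 1 :> R by lra. have := gt0_ltr_powR rm; move=> /(_ (2^-1 : R) 1); rewrite powR1; apply => //; rewrite nnegrE ?ler01 ?(ltW h0)//.
have rho1' : 0 < 1 - rho by lra.
exists (4 * 2 ^+ n / (1 - rho)) => [|K sg u e s0 bu iu u01 ue].
 by rewrite divr_gt0// mulr_gt0.
have u0 x : 0 <= u x by case/andP: (u01 x).
have sk i : 0 < sg * 4 ^+ i by rewrite mulr_gt0.
have m0 x : 0 <= mx K sg u x by exact: mx_ge0.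
have m1 x : mx K sg u x <= 1.
 apply: mx_le => // i iK; have le1 y : u y <= 1 by case/andP: (u01 y). by apply: (le_trans (He_le x (sk i) bu (bm_cst _ 1) le1)); rewrite He_cst.
have im := itg_mx K s0 bu iu u0; have bM := bm_mx K s0 bu.
have mM := bm_m bM.
have ir : itg m (fun x => mx K sg u x `^ r).
 apply: (itg_dom (mx K sg u)) => //; first by mm. move=> x; rewrite ger0_norm ?powR_ge0// -[leRHS]powRr1//. have [->|n0] := eqVneq (mx K sg u x) 0.
  by rewrite !powR0// gt_eqF// (lt_trans _ r1).
 by apply: ger_powR; [rewrite lt_neqAle eq_sym n0 m0 m1|exact: ltW].
split => //.
pose E l : set T := [set x | 2^-1 ^+ l.+1 < mx K sg u x]%R.
have mE l : measurable (E l).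
 rewrite (_ : E l = mx K sg u @^-1` `]2^-1 ^+ l.+1, +oo[%classic).
  by rewrite -[X in measurable X]setTI; exact: mM.
 by apply/seteqP; split => x; rewrite /E/= in_itv andbT.
have Ru0 : 0 <= Ri m u by exact: Ri_ge0.
have e0 : 0 <= e by lra.
have ek (k : nat) : 0 < (2^-1 : R) ^+ k by [].
have mE_le l : (m (E l) <= (2 * 2 ^+ n * e / 2^-1 ^+ l.+1)%:E)%E.
 apply: (le_trans (mx_weak K s0 (ek _) bu iu u0)); rewrite lee_fin. by rewrite ler_pM2r ?invr_gt0// ler_pM2l.
have iE l : itg m (\1_(E l)).
 apply: itgP; first exact: measurable_indic. under eq_integral do rewrite ger0_norm//. by rewrite Ri_indic//; apply: (le_lt_trans (mE_le l)); rewrite ltry.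
have RE l : Ri m (\1_(E l)) <= 2 * 2 ^+ n * e / 2^-1 ^+ l.+1.
 by rewrite -lee_fin RiE// Ri_indic.
have main L : Ri m (fun x => mx K sg u x `^ r) <= 4 * 2 ^+ n / (1 - rho) * e + rho ^+ L * Ri m (mx K sg u).
 apply: (le_via (Ri m (fun x => \sum_(l < L) (2^-1 ^+ l) `^ r * \1_(E l) x
   + (2^-1 ^+ L) `^ (r - 1) * mx K sg u x))).
  apply: Ri_le => //.
   by apply: itgD; [apply: itg_sum => l; exact: itgZ|exact: itgZ].
  move=> x; have m01 : 0 <= mx K sg u x <= 1 by rewrite m0 m1. apply: (le_trans (powR_layer L r1 m01)); rewrite lerD2r; apply: ler_sum => l _.
  apply: ler_wpM2l; first exact: powR_ge0. lra.
 have rE (k : nat) : (2^-1 ^+ k) `^ (r - 1) = rho ^+ k.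
  by rewrite /rho -!powR_mulrn ?powR_ge0 ?(ltW h0)// -!powRrM mulrC.
 rewrite RiD; [|by apply: itg_sum => l; exact: itgZ|exact: itgZ]. rewrite RiZ// rE; apply: lerD => //. rewrite Ri_sum; last by move=> l; exact: itgZ.
 (* The layer l has height 2^(-l) to the power r and measure at most 2 2^n e 2^(l+1), which leaves
    rho^l. *)
 apply: (le_via (\sum_(l < L) (4 * 2 ^+ n * e) * rho ^+ l)).
  apply: ler_sum => l _; rewrite RiZ//. apply: (le_via ((2^-1 ^+ l) `^ r * (2 * 2 ^+ n * e / 2^-1 ^+ l.+1))).
   by apply: ler_wpM2l.
  rewrite -rE -mulr_powRB1 ?(ltW (ek _))//; last exact: lt_trans r1. by rewrite le_eqVlt exprS; apply/orP; left; apply/eqP; field.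
 have -> : 4 * 2 ^+ n / (1 - rho) * e = 4 * 2 ^+ n * e * (1 - rho)^-1 by lra. rewrite -mulr_sumr; apply: ler_wpM2l; first by rewrite !mulr_ge0// exprn_ge0.
 rewrite -(ler_pM2l rho1') mulfV ?gt_eqF//. have := subrX1 rho L; rewrite -opprB => /eqP; rewrite eqr_oppLR => /eqP.
 by rewrite -mulNr opprB => <-; rewrite lerBlDr lerDl exprn_ge0// (ltW rho0).
move: main; set A := Ri m _; set B := _ * e; set D := Ri m (mx K sg u) => main.
apply/ler_addgt0Pr => eps eps0.
have cv : rho ^+ k * D @[k --> \oo] --> (0 * D : R).
 by apply: cvgMl; apply: cvg_expr; rewrite ger0_norm// ltW.
rewrite mul0r in cv; move/cvgrPdist_lt : cv => /(_ _ eps0) [k _ /(_ k (leqnn _))].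
rewrite /= sub0r normrN => hk; apply: (le_trans (main k)); rewrite lerD2l.
by apply: (le_trans (ler_norm _)); exact: ltW.
Qed.

(** Writing positive constants as exponentials turns identities between products of powers into
    identities between exponents, which [field] decides. *)
Lemma pos_expR (a : R) : 0 < a -> exists b, a = expR b.
Proof. by move=> a0; exists (ln a); rewrite lnK. Qed.

Lemma expR_powR (a x : R) : expR a `^ x = expR (x * a).
Proof. by rewrite /powR gt_eqF ?expR_gt0// expRK. Qed.

(** The pointwise hypothesis is asked only for i < M, because the maximal function [mx] dominates
    only finitely many scales. *)
Lemma II_CS M (f g h : nat -> T -> R) a b : 0 < a -> 0 < b ->
 (forall i, bm (f i)) -> (forall i, bm (g i)) -> (forall i, bm (h i)) ->
 (forall i x, 0 <= f i x) -> (forall i x, 0 <= g i x) -> (forall i x, 0 <= h i x) ->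
 (forall i x, (i < M)%N -> h i x ^+ 2 <= f i x * g i x) ->
 (II m M f <= a%:E)%E -> (II m M g <= b%:E)%E ->
 (II m M h <= (a `^ 2^-1 * b `^ 2^-1)%:E)%E.
Proof.
move=> a0 b0 bf bg bh f0 g0 h0 hfg fa gb.
have h2 : 0 < (2^-1 : R) < 1 by lra.
rewrite (_ : b `^ 2^-1 = b `^ (1 - 2^-1)); last by congr (_ `^ _); field.
pose h' i x := if (i < M)%N then h i x else 0.
have -> : II m M h = II m M h'.
 by apply: eq_bigr => i _; apply: eq_integral => x _; rewrite /h' ltn_ord.
have bh' i : bm (h' i) by rewrite /h'; case: ltnP => _ //; exact: bm_cst.
have h0' i x : 0 <= h' i x by rewrite /h'; case: ltnP.
apply: (II_holder h2 a0 b0 (fun i => bm_m (bf i)) (fun i => bm_m (bg i)) (fun i => bm_m (bh' i)) f0 g0 h0') => //.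
move=> i x; rewrite /h'; case: ltnP => iM; last by rewrite mulr_ge0 ?powR_ge0.
rewrite (_ : 1 - 2^-1 = 2^-1 :> R); last by field.
rewrite -powRM// -[leLHS](_ : (h i x ^+ 2) `^ 2^-1 = h i x); last first.
 by rewrite -powR_mulrn// -powRrM mulfV ?powRr1// pnatr_eq0.
by apply: powR_mono; rewrite ?sqr_ge0//; exact: hfg.
Qed.

Lemma powR_split (a b q : R) : 0 < q -> 0 <= a -> 0 <= b -> a * b = (a * b `^ q) `^ q^-1 * a `^ (1 - q^-1).
Proof.
move=> q0 a0 b0; have [->|an0] := eqVneq a 0.
 by have qn : q^-1 != 0 by [rewrite invr_eq0 gt_eqF]; rewrite !mul0r (powR0 qn) mul0r.
have ap : 0 < a by lra.
rewrite powRM ?powR_ge0// -powRrM mulfV ?gt_eqF// powRr1// mulrAC -powRDp//.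
by rewrite addrC subrK powRr1.
Qed.

(** Restricted type: the model is a function dominated by the indicator of a set of measure e, such
    as an atom of the Lorentz decomposition. *)
Definition rs e u := [/\ bm u, itg m u, forall x, `|u x| <= 1 & Ri m (absf u) <= e].

Lemma rs_norm e u : rs e u -> rs e (absf u).
Proof.
move=> [bu iu u1 ue]; split; [exact: bm_norm|exact: itg_norm| |].
- by move=> x; rewrite normr_id.
- by under eq_fun do rewrite normr_id.
Qed.

Lemma rs_pos e u : rs e u -> rs e (fun x => Num.max (u x) 0).
Proof.
move=> [bu iu u1 ue].
have bp : bm (fun x => Num.max (u x) 0) by apply: bm_max => //; exact: bm_cst.
have le x : `|Num.max (u x) 0| <= `|u x|.
 by rewrite maxEle; case: ifP => _; rewrite ?normr0.
have ip : itg m (fun x => Num.max (u x) 0).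
 by apply: (itg_dom (absf u)); [exact: bm_m bp|exact: le|exact: itg_norm].
split => //; first by move=> x; apply: le_trans (le x) _.
by apply: le_trans ue; apply: Ri_le => //; exact: itg_norm.
Qed.

Lemma rsN e u : rs e u -> rs e (fun x => - u x).
Proof.
move=> [bu iu u1 ue]; split.
- by under eq_fun do rewrite -mulN1r; exact: bmZ.
- exact: itgN.
- by move=> x; rewrite normrN.
- by under eq_fun do rewrite normrN.
Qed.

Lemma rs_Dop e u tau0 M : 0 < tau0 -> rs e u -> (II m M (fun i => Dop (ta tau0 i) u) <= (2 * e)%:E)%E.
Proof.
move=> t0 [bu iu u1 ue]; apply: (le_trans (II_Dop M t0 bu iu)).
rewrite lee_fin ler_wpM2l//; apply: le_trans ue; apply: Ri_le; [exact: itg_sqr|exact: itg_norm|].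
by move=> x; rewrite -real_normK ?num_real// expr2 ler_piMl.
Qed.

Lemma rs_var e u t x : 0 < t -> rs e u -> Var t u x <= 1.
Proof.
move=> t0 [bu _ u1 _]; have b2 := bm_sqr bu.
have h : He t (fun y => u y ^+ 2) x <= 1.
 rewrite -[leRHS](He_cst 1 x t0); apply: (He_le x t0 b2 (bm_cst _ 1)) => y. by rewrite -real_normK ?num_real// exprn_ile1.
by apply: le_trans h; rewrite /Var lerBlDr lerDl sqr_ge0.
Qed.

Lemma rs_powR e u q : 1 < q -> rs e u -> nneg u ->
 itg m (fun x => u x `^ q) /\ Ri m (fun x => u x `^ q) <= e.
Proof.
move=> q1 [bu iu u1 ue] u0; have iq := itg_powR (ltW q1) bu iu u0; split => //.
apply: le_trans ue; apply: Ri_le => //; first exact: itg_norm.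
move=> x; rewrite ger0_norm//; have ux1 : u x <= 1 by apply: le_trans (u1 x); exact: ler_norm.
have [->|n0] := eqVneq (u x) 0; first by rewrite powR0// gt_eqF// (lt_trans _ q1).
rewrite -[leRHS]powRr1//; apply: ger_powR; last exact: ltW.
by rewrite lt_neqAle eq_sym n0 u0.
Qed.

(* [c_car q] is the constant in the Carleson embedding *)
Definition c_car q := 2 * 2 `^ q / (q - 1).

Lemma c_car_gt0 q : 1 < q -> 0 < c_car q.
Proof. by move=> q1; rewrite /c_car divr_gt0 ?subr_gt0// mulr_gt0 powR_gt0. Qed.

(** A function bounded by 1 has variance at most 1, so [carleson] applies with N = 1. *)
Lemma rs_car e u w q b tau0 M : 0 < tau0 -> 1 < q -> rs e u -> bm w -> nneg w ->
 itg m (fun x => w x `^ q) -> Ri m (fun x => w x `^ q) <= b ->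
 (II m M (fun i x => Dop (ta tau0 i) u x * He (16 * ta tau0 i) w x `^ q)%R <= (c_car q * b)%:E)%E.
Proof.
move=> t0 q1 ru bw w0 iw wb; have [bu _ _ _] := ru.
have V t x : 0 < t -> Var t u x <= 1 by move=> t0'; exact: rs_var ru.
by have := carleson t0 q1 ltr01 bu bw w0 iw wb V M; rewrite mulr1.
Qed.

(** Hoelder between the Carleson bound with weight k^q and the square function bound without weight,
    after [II_Lp_weight] has moved the average onto k. *)
Lemma rs_Lp_weight q : 1 < q -> exists2 C, 0 < C & forall e b u k tau0 M,
 0 < e -> 0 < b -> 0 < tau0 -> rs e u -> bm k -> nneg k ->
 itg m (fun x => k x `^ q) -> Ri m (fun x => k x `^ q) <= b ->
 (II m M (fun i x => k x * Lp (ta tau0 i) u x ^+ 2)%R <= (C * (b `^ q^-1 * e `^ (1 - q^-1)))%:E)%E.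
Proof.
move=> q1; have q0 : 0 < q by exact: lt_trans q1.
have cc := c_car_gt0 q1.
exists (3 ^+ n * (c_car q `^ q^-1 * 2 `^ (1 - q^-1))) => [|e b u k tau0 M e0 b0 t0 ru bk k0 ik kb].
 by rewrite !mulr_gt0 ?powR_gt0.
have [bu _ _ _] := ru.
have bp i : 0 < ta tau0 i by exact: ta_gt0.
have t16 i : 0 < 16 * ta tau0 i by rewrite mulr_gt0.
have bD i := bm_Dop (bp i) bu; have D0 i x : 0 <= Dop (ta tau0 i) u x by exact: Dop_ge0.
have bH i := bm_He (t16 i) bk; have H0 i x : 0 <= He (16 * ta tau0 i) k x by exact: He_ge0.
have bHq i := bm_powR (ltW q0) (bH i) (H0 i).
apply: (le_trans (II_Lp_weight M t0 bu bk k0)).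
rewrite -mulrA EFinM; apply: lee_wpmul2l; first by rewrite lee_fin exprn_ge0.
have th : 0 < q^-1 < 1 by rewrite invr_gt0 q0 invf_lt1.
have := II_holder (m := m) (M := M) th (mulr_gt0 cc b0) (mulr_gt0 (ltr0Sn R 1) e0)
  (fun i => bm_m (bmM (bD i) (bHq i))) (fun i => bm_m (bD i)) (fun i => bm_m (bmM (bD i) (bH i))).
move=> /(_ (fun i x => mulr_ge0 (D0 i x) (powR_ge0 _ _)) D0 (fun i x => mulr_ge0 (D0 i x) (H0 i x))).
move=> H; apply: (le_trans (H _ (rs_car M t0 q1 ru bk k0 ik kb) (rs_Dop M t0 ru))).
 by move=> i x; rewrite -powR_split.
rewrite lee_fin (powRM _ (ltW cc) (ltW b0)) (powRM _ (ltW (ltr0Sn R 1)) (ltW e0)).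
lra.
Qed.

Lemma bm_Lp tau u : 0 < tau -> bm u -> bm (Lp tau u).
Proof. by move=> t0 bu; apply: bm_He; [rewrite mulr_gt0|exact: bm_Lop]. Qed.

Lemma Lp_add tau u v x : 0 < tau -> bm u -> bm v ->
 Lp tau (fun y => u y + v y) x <= Lp tau u x + Lp tau v x.
Proof.
move=> t0 bu bv; have t7 : 0 < 7 * tau by rewrite mulr_gt0.
have b1 := bm_Lop t0 bu; have b2 := bm_Lop t0 bv.
rewrite /Lp -(HeD x t7 b1 b2); apply: (He_le x t7 _ (bmD b1 b2)) => [|y]; last exact: Lop_add.
by apply: bm_Lop => //; exact: bmD.
Qed.

Lemma maxpmE (a : R) : a = Num.max a 0 + - Num.max (- a) 0.
Proof. by case: (leP a 0) => h; case: leP => h'; lra. Qed.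

Lemma Lop_N tau u x : 0 < tau -> bm u -> Lop tau (fun y => - u y) x = Lop tau u x.
Proof.
move=> t0 bu; rewrite /Lop.
have HN t y : 0 < t -> He t (fun y => - u y) y = - He t u y.
 by move=> t0'; under eq_fun do rewrite -mulN1r; rewrite HeZ// mulN1r.
have t16 : 0 < 16 * tau by lra.
congr (conv _ _ x); apply/funext => y.
by rewrite !HN// -opprD normrN.
Qed.

Lemma Lp_N tau u x : 0 < tau -> bm u -> Lp tau (fun y => - u y) x = Lp tau u x.
Proof.
by move=> t0 bu; exact: (f_equal (fun F => He (7 * tau) F x) (funext (fun z => Lop_N z t0 bu))).
Qed.

Lemma powR_split2 (a b r th : R) : 0 < th -> 0 <= a -> 0 <= b ->
 a * b `^ (r * th) = (a * b `^ r) `^ th * a `^ (1 - th).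
Proof.
move=> t0 a0 b0; have [->|an0] := eqVneq a 0.
 by rewrite !mul0r (powR0 (lt0r_neq0 t0)) mul0r.
have ap : 0 < a by lra.
rewrite powRM ?powR_ge0// -powRrM mulrAC -powRDp//.
by rewrite addrC subrK powRr1.
Qed.

Lemma powR_mul2 (r a : R) : 0 < r < 2 -> 0 <= a -> a `^ r * a `^ (2 - r) = a ^+ 2.
Proof.
move=> /andP[r0 r2] a0; have [->|an0] := eqVneq a 0.
 by rewrite (powR0 (lt0r_neq0 r0)) mul0r expr0n.
have ap : 0 < a by lra.
by rewrite -powRDp// addrC subrK powR_mulrn.
Qed.

Lemma itg_gap p tau v : 1 < p < 2 -> 0 < tau -> bm v -> itg m v -> nneg v -> itg m (gap p tau v).
Proof.
move=> hp t0 bv iv v0; have /andP[p1 _] := hp.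
have p0 : 0 <= p by lra.
have t15 : 0 < 15 * tau by lra.
have t16 : 0 < 16 * tau by lra.
have ip : itg m (fun x => v x `^ p) by apply: itg_powR => //; exact: ltW.
have bh : bm (fun x => He tau v x `^ p).
 by apply: bm_powR => //; [apply: bm_He|move=> y; exact: He_ge0].
have ih t : 0 < t -> itg m (fun x => He t v x `^ p) by move=> ?; exact: itg_He_powR.
by apply: itgB; [apply: itg_He => //; exact: ih|exact: ih].
Qed.

Lemma algA (C1 Cm e1 e2 e3 iq : R) : 0 < C1 -> 0 < Cm -> 0 < e1 -> 0 < e2 -> 0 < e3 ->
 (C1 * ((Cm * e1) `^ iq * e2 `^ (1 - iq))) `^ 2^-1 * (C1 * ((Cm * e1) `^ iq * e3 `^ (1 - iq))) `^ 2^-1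
 = C1 * Cm `^ iq * (e1 `^ iq * (e2 `^ ((1 - iq) / 2) * e3 `^ ((1 - iq) / 2))).
Proof.
move=> /pos_expR[c1 ->] /pos_expR[cm ->] /pos_expR[a1 ->] /pos_expR[a2 ->] /pos_expR[a3 ->].
by rewrite !(expR_powR, =^~ expRD); congr expR; field.
Qed.

(* vertex of the interpolation at which the maximal function is dominant *)
Lemma vertex_max q : 1 < q -> exists2 C, 0 < C & forall e1 e2 e3 u1 u2 u3 sg t2 t3 K M,
 0 < e1 -> 0 < e2 -> 0 < e3 -> 0 < sg -> 0 < t2 -> 0 < t3 -> rs e1 u1 -> rs e2 u2 -> rs e3 u3 ->
 (II m M (fun i x => mx K sg (absf u1) x * Lp (ta t2 i) u2 x * Lp (ta t3 i) u3 x)%R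
  <= (C * (e1 `^ q^-1 * (e2 `^ ((1 - q^-1) / 2) * e3 `^ ((1 - q^-1) / 2))))%:E)%E.
Proof.
move=> q1; have [Cm Cm0 HM] := mx_strong q1; have [C1 C10 HW] := rs_Lp_weight q1.
exists (C1 * Cm `^ q^-1) => [|e1 e2 e3 u1 u2 u3 sg t2 t3 K M e10 e20 e30 s0 t20 t30 r1 r2 r3].
 by rewrite mulr_gt0 ?powR_gt0.
have [bu1 iu1 u11 ue1] := rs_norm r1; have [bu2 _ _ _] := r2; have [bu3 _ _ _] := r3.
have h01 x : 0 <= `|u1 x| <= 1 by rewrite normr_ge0; have := u11 x; rewrite normr_id.
have ue1' : Ri m (absf u1) <= e1 by case: r1.
have [ik kb] := HM K sg _ e1 s0 bu1 iu1 h01 ue1'.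
set k := mx K sg _ in ik kb *.
have bk : bm k by exact: bm_mx. have k0 x : 0 <= k x by exact: mx_ge0.
have b0 : 0 < Cm * e1 by rewrite mulr_gt0.
have bL t i u : 0 < t -> bm u -> bm (Lp (ta t i) u) by move=> ?; apply: bm_Lp; exact: ta_gt0.
have L0 t i u x : 0 < t -> 0 <= Lp (ta t i) u x by move=> ?; apply: Lp_ge0; exact: ta_gt0.
have p1 : 0 < C1 * ((Cm * e1) `^ q^-1 * e2 `^ (1 - q^-1)) by rewrite !mulr_gt0 ?powR_gt0.
have p2 : 0 < C1 * ((Cm * e1) `^ q^-1 * e3 `^ (1 - q^-1)) by rewrite !mulr_gt0 ?powR_gt0.
have := II_CS p1 p2 (fun i => bmM bk (bm_sqr (bL t2 i u2 t20 bu2))) (fun i => bmM bk (bm_sqr (bL t3 i u3 t30 bu3)))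
 (fun i => bmM (bmM bk (bL t2 i u2 t20 bu2)) (bL t3 i u3 t30 bu3)).
rewrite algA//; apply.
- by move=> i x; rewrite mulr_ge0 ?sqr_ge0.
- by move=> i x; rewrite mulr_ge0 ?sqr_ge0.
- by move=> i x; rewrite !mulr_ge0 ?L0.
- move=> i x _; move: (k x) (Lp _ _ x) (Lp _ _ x) => a b c; apply: le_of_eq; ring.
- exact: HW.
- exact: HW.
Qed.

Lemma algB (C1 Cm c e2 e3 iq : R) : 0 < C1 -> 0 < Cm -> 0 < c -> 0 < e2 -> 0 < e3 ->
 (c * e2) `^ 2^-1 * (C1 * ((Cm * e2) `^ iq * e3 `^ (1 - iq))) `^ 2^-1
 = (c `^ 2^-1 * C1 `^ 2^-1 * Cm `^ (iq / 2)) * (e2 `^ (1 - (1 - iq) / 2) * e3 `^ ((1 - iq) / 2)).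
Proof.
move=> /pos_expR[c1 ->] /pos_expR[cm ->] /pos_expR[a1 ->] /pos_expR[a2 ->] /pos_expR[a3 ->].
by rewrite !(expR_powR, =^~ expRD); congr expR; field.
Qed.

(** The vertex at which the energy of u2 dominates. The exponent p = 2 q / (1 + q) satisfies (2 - p)
    q = p, so the weight k = V^(2-p) produced by [Lp_gap] has k^q = V^p, which the maximal bound
    controls. *)
Lemma vertex_sq_pos q : 1 < q -> exists2 C, 0 < C & forall e2 e3 (k1 u2 u3 : T -> R) t2 t3 M,
 0 < e2 -> 0 < e3 -> 0 < t2 -> 0 < t3 -> bm k1 -> (forall x, 0 <= k1 x <= 1) ->
 rs e2 u2 -> nneg u2 -> rs e3 u3 ->
 (II m M (fun i x => k1 x * Lp (ta t2 i) u2 x * Lp (ta t3 i) u3 x)%R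
  <= (C * (e2 `^ (1 - (1 - q^-1) / 2) * e3 `^ ((1 - q^-1) / 2)))%:E)%E.
Proof.
move=> q1; have q0 : 0 < q by exact: lt_trans q1.
have q1' : 0 < 1 + q by lra.
pose p := 2 * q / (1 + q).
have p1 : 1 < p by rewrite /p ltr_pdivlMr// mul1r; lra.
have p2 : p < 2 by rewrite /p ltr_pdivrMr; lra.
have hp : 1 < p < 2 by rewrite p1.
have p20 : 0 <= 2 - p by lra.
have pq : (2 - p) * q = p by rewrite /p; field; rewrite gt_eqF.
pose c := 8 / (p * (p - 1)).
have c0 : 0 < c by rewrite divr_gt0// mulr_gt0 ?subr_gt0// (lt_trans ltr01).
have [Cm Cm0 HM] := mx_strong p1; have [C1 C10 HW] := rs_Lp_weight q1.
have c20 : 0 < c * 2 by lra.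
exists ((c * 2) `^ 2^-1 * C1 `^ 2^-1 * Cm `^ (q^-1 / 2)) => [|e2 e3 k1 u2 u3 t2 t3 M e20 e30 t20 t30 bk1 k1_01 r2 u20 r3].
 by rewrite !mulr_gt0 ?powR_gt0.
have [bu2 iu2 u21 ue2] := r2; have [bu3 _ _ _] := r3.
have s0 : 0 < 23 * t2 by lra.
have h01 x : 0 <= u2 x <= 1 by rewrite u20 (le_trans (ler_norm _) (u21 x)).
have ue2' : Ri m u2 <= e2 by apply: le_trans ue2; apply: Ri_le => //; [exact: itg_norm|move=> x; exact: ler_norm].
have [ik kb] := HM M (23 * t2) _ e2 s0 bu2 iu2 h01 ue2'.
set V := mx M _ _ in ik kb *.
have bV : bm V by exact: bm_mx. have V0 x : 0 <= V x by exact: mx_ge0.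
pose k x := V x `^ (2 - p).
have bk : bm k by exact: bm_powR. have k0 x : 0 <= k x by exact: powR_ge0.
have kE : (fun x => k x `^ q) = (fun x => V x `^ p) by apply/funext => x; rewrite /k -powRrM pq.
have tp i : 0 < ta t2 i by exact: ta_gt0.
have t7 i : 0 < 7 * ta t2 i by rewrite mulr_gt0.
have bg i := bm_gap hp bu2 u20 (tp i).
have g0 i x : 0 <= gap p (ta t2 i) u2 x by exact: gap_ge0.
have ig i := itg_gap hp (tp i) bu2 iu2 u20.
have bHg i := bm_He (t7 i) (bg i).
have Hg0 i x : 0 <= He (7 * ta t2 i) (gap p (ta t2 i) u2) x by exact: He_ge0.
have bL t i u : 0 < t -> bm u -> bm (Lp (ta t i) u) by move=> ?; apply: bm_Lp; exact: ta_gt0.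
have L0 t i u x : 0 < t -> 0 <= Lp (ta t i) u x by move=> ?; apply: Lp_ge0; exact: ta_gt0.
have b0 : 0 < Cm * e2 by rewrite mulr_gt0.
have pa : 0 < c * 2 * e2 by rewrite mulr_gt0.
have pb : 0 < C1 * ((Cm * e2) `^ q^-1 * e3 `^ (1 - q^-1)) by rewrite !mulr_gt0 ?powR_gt0.
have := II_CS pa pb (fun i => bmM (bm_cst _ c) (bHg i)) (fun i => bmM bk (bm_sqr (bL t3 i u3 t30 bu3)))
 (fun i => bmM (bmM bk1 (bL t2 i u2 t20 bu2)) (bL t3 i u3 t30 bu3)).
rewrite algB//; apply.
- by move=> i x; rewrite mulr_ge0 ?(ltW c0).
- by move=> i x; rewrite mulr_ge0 ?sqr_ge0.
- by move=> i x; have /andP[? _] := k1_01 x; rewrite !mulr_ge0 ?L0.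
- move=> i x iM; have /andP[a0 a1] := k1_01 x. have h1 := Lp_gap hp bu2 u20 x (tp i). have h2 : He (23 * ta t2 i) u2 x `^ (2 - p) <= k x.
  apply: powR_mono => //; first by apply: He_ge0 => //; rewrite mulr_gt0. by rewrite /ta mulrA; exact: mx_ge.
 rewrite !exprMn -mulrA [leRHS]mulrA; apply: (le_via (1 * (Lp (ta t2 i) u2 x ^+ 2 * Lp (ta t3 i) u3 x ^+ 2))).
  by apply: ler_wpM2r; [rewrite mulr_ge0 ?sqr_ge0|rewrite exprn_ile1].
 rewrite mul1r; apply: ler_wpM2r; first exact: sqr_ge0. apply: (le_trans h1); rewrite -/c -mulrA; apply: ler_wpM2l; first exact: ltW. by apply: ler_wpM2l.
- rewrite II_scale ?(ltW c0)//; last by move=> i; exact: bm_m (bHg i). rewrite (_ : c * 2 * e2 = c * (2 * e2)); last by rewrite mulrA.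
 rewrite (EFinM c (2 * e2)); apply: lee_wpmul2l; first by rewrite lee_fin ltW.
 have -> : II m M (fun i => He (7 * ta t2 i) (gap p (ta t2 i) u2)) = II m M (fun i => gap p (ta t2 i) u2).
  by rewrite !II_Ri//; [congr (_%:E); apply: eq_bigr => i _; exact: Ri_He|move=> i; exact: itg_He].
 apply: (le_trans (II_gap hp bu2 iu2 u20 M t20)); rewrite lee_fin ler_wpM2l//. by have [] := rs_powR p1 r2 u20.
- have ik' : itg m (fun x => k x `^ q) by rewrite kE. have kb' : Ri m (fun x => k x `^ q) <= Cm * e2 by rewrite kE.
 exact: (HW _ _ _ _ _ M e30 b0 t30 r3 bk k0 ik' kb').
Qed.

Lemma rs_split e u : rs e u -> exists u1 u2, [/\ rs e u1, rs e u2, nneg u1, forall x, 0 <= u2 x &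
 u = fun x => u1 x + - u2 x].
Proof.
move=> ru; exists (fun x => Num.max (u x) 0), (fun x => Num.max (- u x) 0); split.
- exact: rs_pos.
- exact: (rs_pos (rsN ru)).
- by move=> x; rewrite le_max lexx orbT.
- by move=> x; rewrite le_max lexx orbT.
- by apply/funext => x; exact: maxpmE.
Qed.

(** The gap estimates concern nonnegative functions; positive and negative parts are added by
    subadditivity of [Lp], which doubles the constant. *)
Lemma vertex_sq q : 1 < q -> exists2 C, 0 < C & forall e2 e3 (k1 u2 u3 : T -> R) t2 t3 M,
 0 < e2 -> 0 < e3 -> 0 < t2 -> 0 < t3 -> bm k1 -> (forall x, 0 <= k1 x <= 1) ->
 rs e2 u2 -> rs e3 u3 ->
 (II m M (fun i x => k1 x * Lp (ta t2 i) u2 x * Lp (ta t3 i) u3 x)%R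
  <= (C * (e2 `^ (1 - (1 - q^-1) / 2) * e3 `^ ((1 - q^-1) / 2)))%:E)%E.
Proof.
move=> q1; have [C C0 H] := vertex_sq_pos q1.
exists (C + C) => [|e2 e3 k1 u2 u3 t2 t3 M e20 e30 t20 t30 bk1 k01 r2 r3]; first exact: addr_gt0.
have [a [b [ra rb a0 b0 uE]]] := rs_split r2.
have [ba _ _ _] := ra; have [bb _ _ _] := rb; have [bu3 _ _ _] := r3; have [bu2 _ _ _] := r2.
have bL t i u : 0 < t -> bm u -> bm (Lp (ta t i) u) by move=> ?; apply: bm_Lp; exact: ta_gt0.
have L0 t i u x : 0 < t -> 0 <= Lp (ta t i) u x by move=> ?; apply: Lp_ge0; exact: ta_gt0.
have k0 x : 0 <= k1 x by case/andP: (k01 x).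
have bP u i : bm u -> bm (fun x => k1 x * Lp (ta t2 i) u x * Lp (ta t3 i) u3 x).
 by move=> bu; exact: bmM (bmM bk1 (bL t2 i u t20 bu)) (bL t3 i u3 t30 bu3).
have P0 u i x : 0 <= k1 x * Lp (ta t2 i) u x * Lp (ta t3 i) u3 x by rewrite !mulr_ge0 ?L0.
apply: (le_via (II m M (fun i x => k1 x * Lp (ta t2 i) a x * Lp (ta t3 i) u3 x
  + k1 x * Lp (ta t2 i) b x * Lp (ta t3 i) u3 x)%R)).
 apply: II_le => //; first by move=> i; exact: (bm_m (bP _ _ bu2)).
  by move=> i; exact: (bm_m (bmD (bP _ _ ba) (bP _ _ bb))).
 move=> i x; rewrite -mulrDl -mulrDr; apply: ler_wpM2r; first exact: L0. apply: ler_wpM2l => //; rewrite uE -(Lp_N x (ta_gt0 i t20) bb).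
 by apply: Lp_add => //; [exact: ta_gt0|under eq_fun do rewrite -mulN1r; exact: bmZ].
rewrite II_add//; [|by move=> i; exact: (bm_m (bP _ _ ba))|by move=> i; exact: (bm_m (bP _ _ bb))].
by rewrite mulrDl EFinD; apply: leeD; exact: H.
Qed.

(** * The two extreme exponents for BMO *)

Section BMO.
Variables (phi : T -> R) (N : R).
Hypotheses (bphi : bm phi) (N0 : 0 < N) (VN : forall t x, 0 < t -> Var t phi x <= N).

Let bmo_car w q b tau0 M : 0 < tau0 -> 1 < q -> bm w -> nneg w ->
 itg m (fun x => w x `^ q) -> Ri m (fun x => w x `^ q) <= b ->
 (II m M (fun i x => Dop (ta tau0 i) phi x * He (16 * ta tau0 i) w x `^ q)%R <= (c_car q * N * b)%:E)%E.
Proof. by move=> t0 q1 bw w0 iw wb; exact: (carleson t0 q1 N0 bphi bw w0 iw wb VN M). Qed.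

Let X1 M t0 v w := II m M (fun i x => Lop (ta t0 i) phi x * Lop (ta t0 i) v x *
 He (16 * ta t0 i) (absf w) x)%R.

Lemma algW (c d e f q N' : R) : 0 < d -> 0 < c -> 0 < e -> 0 < f -> 0 < q -> 0 < N' ->
 (c * N' * f) `^ 2^-1 * ((c * f) `^ ((2 - q) / q) * (d * e) `^ (1 - (2 - q) / q)) `^ 2^-1
 = c `^ q^-1 * d `^ (1 - q^-1) * N' `^ 2^-1 * (f `^ q^-1 * e `^ (1 - q^-1)).
Proof.
move=> /pos_expR[z ->] /pos_expR[c1 ->] /pos_expR[cm ->] /pos_expR[a1 ->] q0 /pos_expR[a2 ->].
rewrite !(expR_powR, =^~ expRD); congr expR.
by field; rewrite gt_eqF.
Qed.

Lemma algWx (L1 L2 D1 D2 W q : R) : L1 ^+ 2 <= D1 -> L2 ^+ 2 <= D2 -> 0 <= W -> 0 <= D1 ->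
 1 < q -> q < 2 -> (L1 * L2 * W) ^+ 2 <= D1 * W `^ q * (D2 * W `^ (2 - q)).
Proof.
move=> h1 h2 W0 D10 q1 q2; rewrite [leRHS]mulrACA powR_mul2//; last by rewrite q2 (lt_trans ltr01).
rewrite exprMn; apply: ler_wpM2r; first exact: sqr_ge0.
by rewrite exprMn; apply: ler_pM; rewrite ?sqr_ge0.
Qed.

Lemma algVx (L1 L2 D1 g V c W : R) : L1 ^+ 2 <= D1 -> L2 ^+ 2 <= c * (g * V) ->
 (L1 * L2 * W) ^+ 2 <= c * g * (D1 * V * W ^+ 2).
Proof.
move=> h1 h2; rewrite exprMn [leRHS]mulrA; apply: ler_wpM2r; first exact: sqr_ge0.
rewrite exprMn (_ : c * g * (D1 * V) = D1 * (c * (g * V))); last by ring.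
by apply: ler_pM; rewrite ?sqr_ge0.
Qed.

(** Exponent 1 / q, close to 1, on w. The squared product splits as (D phi W^q)(D v W^(2-q)). The
    first factor is a Carleson sum for phi; the second is interpolated between D v W^q, a Carleson
    sum for v, and D v. *)
Lemma vertex_bmo_w q e f v w t0 M : 1 < q < 2 -> 0 < e -> 0 < f -> 0 < t0 -> rs e v -> rs f w ->
 (X1 M t0 v w <= (c_car q `^ q^-1 * 2 `^ (1 - q^-1) * N `^ 2^-1 * (f `^ q^-1 * e `^ (1 - q^-1)))%:E)%E.
Proof.
move=> /andP[q1 q2] e0 f0 t00 rv rw; have q0 : 0 < q by exact: lt_trans q1.
have cc := c_car_gt0 q1; have rw' := rs_norm rw.
have w0 x : 0 <= `|w x| by [].
have [iw wb] := rs_powR q1 rw' w0.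
have [bw _ _ _] := rw'; have [bv _ _ _] := rv.
have tp i : 0 < ta t0 i by exact: ta_gt0.
have t16 i : 0 < 16 * ta t0 i by rewrite mulr_gt0.
have bW i := bm_He (t16 i) bw. have W0 i x : 0 <= He (16 * ta t0 i) (absf w) x by exact: He_ge0.
have bDp i := bm_Dop (tp i) bphi. have Dp0 i x : 0 <= Dop (ta t0 i) phi x by exact: Dop_ge0.
have bDv i := bm_Dop (tp i) bv. have Dv0 i x : 0 <= Dop (ta t0 i) v x by exact: Dop_ge0.
have q20 : 0 <= 2 - q by lra.
have bWq i := bm_powR (ltW q0) (bW i) (W0 i).
have bW2q i := bm_powR q20 (bW i) (W0 i).
(* The Hoelder parameter th solves q th = 2 - q. *)
have th : 0 < (2 - q) / q < 1.
 by rewrite divr_gt0 ?subr_gt0//= ltr_pdivrMr; lra.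
have pa : 0 < c_car q * N * f := mulr_gt0 (mulr_gt0 cc N0) f0.
have pae : 0 < c_car q * f := mulr_gt0 cc f0.
have p2e : 0 < 2 * e :=  mulr_gt0 (ltr0Sn R 1) e0.
have pb : 0 < (c_car q * f) `^ ((2 - q) / q) * (2 * e) `^ (1 - (2 - q) / q) := mulr_gt0 (powR_gt0 _ pae) (powR_gt0 _ p2e).
rewrite -(algW (ltr0Sn R 1) cc e0 f0 q0 N0).
apply: (II_CS pa pb (fun i => bmM (bDp i) (bWq i)) (fun i => bmM (bDv i) (bW2q i))
 (fun i => bmM (bmM (bm_Lop (tp i) bphi) (bm_Lop (tp i) bv)) (bW i))).
- by move=> i x; rewrite mulr_ge0 ?powR_ge0.
- by move=> i x; rewrite mulr_ge0 ?powR_ge0.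
- by move=> i x; exact: (mulr_ge0 (mulr_ge0 (Lop_ge0 _ _ _) (Lop_ge0 _ _ _)) (W0 i x)).
- move=> i x _; exact: (algWx (LopD (tp i) x bphi) (LopD (tp i) x bv) (W0 i x) (Dp0 i x) q1 q2).
- exact: bmo_car.
- apply: (II_holder th _ _ (fun i => bm_m (bmM (bDv i) (bWq i))) (fun i => bm_m (bDv i))
  (fun i => bm_m (bmM (bDv i) (bW2q i)))).
 + exact: pae.
 + exact: p2e.
 + by move=> i x; rewrite mulr_ge0 ?powR_ge0.
 + by [].
 + by move=> i x; rewrite mulr_ge0 ?powR_ge0.
 + move=> i x; rewrite -powR_split2//; last by case/andP: th. by rewrite (_ : q * ((2 - q) / q) = 2 - q)//; field; rewrite gt_eqF.
 + exact: (rs_car M t00 q1 rv bw w0 iw wb).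
 + exact: (rs_Dop M t00 rv).
Qed.

Lemma algV (c c' e f q N' : R) : 0 < c -> 0 < c' -> 0 < e -> 0 < f -> 0 < q -> 0 < N' ->
 (c' * e) `^ 2^-1 * ((c * N' * e) `^ ((2 - q) / q) * (c * N' * f) `^ (1 - (2 - q) / q)) `^ 2^-1
 = c `^ 2^-1 * c' `^ 2^-1 * N' `^ 2^-1 * (e `^ q^-1 * f `^ (1 - q^-1)).
Proof.
move=> /pos_expR[c1 ->] /pos_expR[cm ->] /pos_expR[a1 ->] /pos_expR[a3 ->] q0 /pos_expR[a2 ->].
rewrite !(expR_powR, =^~ expRD); congr expR.
by field; rewrite gt_eqF.
Qed.

(** After Hoelder the weight W carries the power 2 q - 2 < 2; lowering the exponent is allowed
    because W <= 1. *)
Lemma vertex_alg (q D V W : R) : 1 < q < 2 -> 0 <= D -> 0 <= V -> 0 <= W -> W <= 1 ->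
 D * V `^ (2 - q) * W ^+ 2 <=
 D `^ ((2 - q) / q) * V `^ (2 - q) * (D `^ (1 - (2 - q) / q) * W `^ (2 * q - 2)).
Proof.
move=> /andP[q1 q2] D0 V0 W0 W1; have [->|Dn0] := eqVneq D 0.
 by rewrite !mul0r !mulr_ge0 ?powR_ge0.
have Dp : 0 < D by lra.
have E1 : (2 - q) / q + (1 - (2 - q) / q) = 1 by lra.
rewrite [leRHS]mulrACA -powRDp// E1 powRr1// [leRHS]mulrA; apply: ler_wpM2l.
 by rewrite mulr_ge0 ?powR_ge0.
have [->|Wn0] := eqVneq W 0; first by rewrite expr0n powR_ge0.
rewrite -powR_mulrn//; apply: ger_powR; first by rewrite lt_neqAle eq_sym Wn0 W0.
by lra.
Qed.

Definition c_gap q : R := 8 / (q * (q - 1)) * 2.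

Lemma c_gap_gt0 q : 1 < q -> 0 < c_gap q.
Proof. by move=> q1; rewrite mulr_gt0// divr_gt0// mulr_gt0 ?subr_gt0// (lt_trans ltr01). Qed.

(** Exponent 1 / q on v. Here [Lop_gap] supplies the energy of v with a factor V^(2-q), and the
    rest, D phi V^(2-q) W^2, is interpolated between the Carleson sums of phi with the weights V^q
    and W^q. *)
Let vertex_bmo_v_pos q e f v w t0 M : 1 < q < 2 -> 0 < e -> 0 < f -> 0 < t0 ->
 rs e v -> nneg v -> rs f w ->
 (X1 M t0 v w <= (c_car q `^ 2^-1 * c_gap q `^ 2^-1 * N `^ 2^-1 * (e `^ q^-1 * f `^ (1 - q^-1)))%:E)%E.
Proof.
move=> hq e0 f0 t00 rv v0 rw; have /andP[q1 q2] := hq; have q0 : 0 < q by exact: lt_trans q1.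
have cc := c_car_gt0 q1; have cg := c_gap_gt0 q1; have rw' := rs_norm rw.
have w0 x : 0 <= `|w x| by [].
have [iw wb] := rs_powR q1 rw' w0; have [iv vb] := rs_powR q1 rv v0.
have [bw _ w1 _] := rw'; have [bv iv1 _ _] := rv.
have tp i : 0 < ta t0 i by exact: ta_gt0.
have t16 i : 0 < 16 * ta t0 i by rewrite mulr_gt0.
have bW i := bm_He (t16 i) bw. have W0 i x : 0 <= He (16 * ta t0 i) (absf w) x by exact: He_ge0.
have W1 i x : He (16 * ta t0 i) (absf w) x <= 1.
 have le1 y : `|w y| <= 1 by rewrite -[X in X <= _]normr_id. by apply: (le_trans (He_le x (t16 i) bw (bm_cst _ 1) le1)); rewrite He_cst.
have bV i := bm_He (t16 i) bv. have V0 i x : 0 <= He (16 * ta t0 i) v x by exact: He_ge0.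
have bDp i := bm_Dop (tp i) bphi. have Dp0 i x : 0 <= Dop (ta t0 i) phi x by exact: Dop_ge0.
have q20 : 0 <= 2 - q by rewrite subr_ge0 ltW.
have bWq i := bm_powR (ltW q0) (bW i) (W0 i).
have bVq i := bm_powR (ltW q0) (bV i) (V0 i).
have bV2q i := bm_powR q20 (bV i) (V0 i).
have bg i := bm_gap hq bv v0 (tp i).
have g0 i x : 0 <= gap q (ta t0 i) v x by exact: gap_ge0.
have th : 0 < (2 - q) / q < 1.
 by rewrite divr_gt0 ?subr_gt0//= ltr_pdivrMr//; lra.
have /andP[th0 th1] := th.
have pa : 0 < c_gap q * e := mulr_gt0 cg e0.
have pe : 0 < c_car q * N * e := mulr_gt0 (mulr_gt0 cc N0) e0.
have pf : 0 < c_car q * N * f := mulr_gt0 (mulr_gt0 cc N0) f0.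
have pb : 0 < (c_car q * N * e) `^ ((2 - q) / q) * (c_car q * N * f) `^ (1 - (2 - q) / q) := mulr_gt0 (powR_gt0 _ pe) (powR_gt0 _ pf).
have c0 : 0 <= 8 / (q * (q - 1)) by rewrite divr_ge0// mulr_ge0 ?subr_ge0 ?(ltW q0) ?(ltW q1).
rewrite -(algV cc cg e0 f0 q0 N0).
apply: (II_CS pa pb (fun i => bmM (bm_cst _ (8 / (q * (q - 1)))) (bg i)) (fun i => bmM (bmM (bDp i) (bV2q i)) (bm_sqr (bW i)))
 (fun i => bmM (bmM (bm_Lop (tp i) bphi) (bm_Lop (tp i) bv)) (bW i))).
- by move=> i x; rewrite mulr_ge0.
- by move=> i x; exact: (mulr_ge0 (mulr_ge0 (Dp0 i x) (powR_ge0 _ _)) (sqr_ge0 _)).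
- by move=> i x; exact: (mulr_ge0 (mulr_ge0 (Lop_ge0 _ _ _) (Lop_ge0 _ _ _)) (W0 i x)).
- move=> i x _; exact: (algVx (He _ _ x) (LopD (tp i) x bphi) (Lop_gap hq bv v0 x (tp i))).
- rewrite II_scale//; last by move=> i; exact: bm_m (bg i). rewrite (_ : c_gap q * e = 8 / (q * (q - 1)) * (2 * e)); last by exact: (esym (mulrA _ _ _)).
 rewrite (EFinM (8 / (q * (q - 1))) (2 * e)); apply: lee_wpmul2l; first by rewrite lee_fin.
 by apply: (le_trans (II_gap hq bv iv1 v0 M t00)); rewrite lee_fin ler_wpM2l.
- apply: (II_holder th _ _ (fun i => bm_m (bmM (bDp i) (bVq i))) (fun i => bm_m (bmM (bDp i) (bWq i)))
  (fun i => bm_m (bmM (bmM (bDp i) (bV2q i)) (bm_sqr (bW i))))).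
 + exact: pe.
 + exact: pf.
 + by move=> i x; rewrite mulr_ge0 ?powR_ge0.
 + by move=> i x; rewrite mulr_ge0 ?powR_ge0.
 + by move=> i x; exact: (mulr_ge0 (mulr_ge0 (Dp0 i x) (powR_ge0 _ _)) (sqr_ge0 _)).
 + move=> i x; rewrite !powRM ?powR_ge0// -!powRrM. rewrite (_ : q * ((2 - q) / q) = 2 - q); last by field; rewrite gt_eqF.
  rewrite (_ : q * (1 - (2 - q) / q) = 2 * q - 2); last by field; rewrite gt_eqF. exact: (vertex_alg hq (Dp0 i x) (V0 i x) (W0 i x) (W1 i x)).
 + exact: bmo_car.
 + exact: bmo_car.
Qed.

Lemma vertex_bmo_v q e f v w t0 M : 1 < q < 2 -> 0 < e -> 0 < f -> 0 < t0 ->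
 rs e v -> rs f w ->
 (X1 M t0 v w <= (2 * (c_car q `^ 2^-1 * c_gap q `^ 2^-1 * N `^ 2^-1 * (e `^ q^-1 * f `^ (1 - q^-1))))%:E)%E.
Proof.
move=> hq e0 f0 t00 rv rw; have [bw _ _ _] := rs_norm rw; have [bv _ _ _] := rv.
have [a [b [ra rb a0 b0 vE]]] := rs_split rv.
have [ba _ _ _] := ra; have [bb _ _ _] := rb.
have tp i : 0 < ta t0 i by exact: ta_gt0.
have t16 i : 0 < 16 * ta t0 i by rewrite mulr_gt0.
have P0 i x u : 0 <= Lop (ta t0 i) phi x * Lop (ta t0 i) u x * He (16 * ta t0 i) (absf w) x.
 by apply: mulr_ge0; [apply: mulr_ge0; exact: Lop_ge0|exact: He_ge0].
have bP i u : bm u -> bm (fun x => Lop (ta t0 i) phi x * Lop (ta t0 i) u x * He (16 * ta t0 i) (absf w) x).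
 by move=> bu; exact: (bmM (bmM (bm_Lop (tp i) bphi) (bm_Lop (tp i) bu)) (bm_He (t16 i) bw)).
apply: (le_via (X1 M t0 a w + X1 M t0 b w)%E).
 rewrite -II_add//; [|by move=> i; exact: (bm_m (bP i _ ba))|by move=> i; exact: (bm_m (bP i _ bb))].
 apply: II_le => //; first by move=> i; exact: (bm_m (bP i _ bv)).
  by move=> i; exact: (bm_m (bmD (bP i _ ba) (bP i _ bb))).
 move=> i x; rewrite -mulrDl -mulrDr; apply: ler_wpM2r; first exact: He_ge0. apply: ler_wpM2l; first exact: Lop_ge0.
 rewrite vE -(Lop_N x (tp i) bb); apply: Lop_add => //. by under eq_fun do rewrite -mulN1r; exact: bmZ.
by rewrite mulr_natl mulr2n EFinD; apply: leeD; exact: vertex_bmo_v_pos.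
Qed.
End BMO.
End square.

(** A ball of the sequence space with exponent 1 / th. The factor th matches the weights of [young3]
    and lets th = 0 stand for bounded sequences: the sum is then multiplied by 0 and only b k <= 1
    remains. *)
Definition qunit (R : realType) (th : R) (N : nat) (b : nat -> R) :=
 (forall k, (k < N)%N -> 0 <= b k <= 1) /\ th * \sum_(k < N) b k `^ th^-1 <= 1.

Definition tdy (R : realType) (K j : nat) : R := 2 `^ (j%:R - K%:R).

(** * Atomic decomposition in Lorentz spaces *)

Section lorentz.
Variables (R : realType) (n : nat) (g : 'rV[R]_n -> R) (B : R).
Notation T := 'rV[R]_n.
Notation m := (lebm R n).
Hypotheses (mg : mfun g) (g0 : nneg g) (gB : forall x, g x <= B).

Lemma measurable_gt (f : T -> R) (l : R) : mfun f -> measurable [set x | l < f x].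
Proof.
move=> mf; rewrite (_ : [set x | _] = f @^-1` `]l, +oo[%classic).
 by rewrite -[X in measurable X]setTI; exact: mf.
by apply/seteqP; split => x; rewrite /= in_itv andbT.
Qed.

Let B0 : 0 <= B. Proof. exact: le_trans (g0 0) (gB 0). Qed.

Let distE l : distfun g l = m [set x | l < g x].
Proof.
rewrite /distfun (_ : [set x | _] = [set x | l < g x]); last first.
 by apply/seteqP; split => x /=; rewrite ger0_norm.
by apply: lebnE; exact: measurable_gt.
Qed.

Let rearr_ge0 t : (0 <= rearr g t)%E.
Proof. by apply: le_ereal_inf_tmp => _ [l [l0 _] <-]; rewrite lee_fin ltW. Qed.

Let rearr_leB t : 0 < t -> (rearr g t <= (B + 1)%:E)%E.
Proof.
move=> t0; apply: ereal_inf_lbound; exists (B + 1) => //; split.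
 by rewrite ltr_wpDl.
rewrite distE (_ : [set x | _] = set0) ?measure0 ?lee_fin ?ltW//.
apply/seteqP; split => // x /=; apply/negP; rewrite -leNgt.
by apply: (le_trans (gB x)); rewrite lerDl.
Qed.

Definition rr t := fine (rearr g t).

Lemma rrE t : 0 < t -> rearr g t = (rr t)%:E.
Proof.
move=> t0; rewrite /rr fineK// fin_numE; apply/andP; split.
 by rewrite gt_eqF// (lt_le_trans _ (rearr_ge0 t))// ltNy0.
by rewrite lt_eqF// (le_lt_trans (rearr_leB t0))// ltry.
Qed.

Lemma rr_ge0 t : 0 <= rr t. Proof. exact/fine_ge0/rearr_ge0. Qed.

Let rr_leB t : 0 < t -> rr t <= B + 1.
Proof. by move=> t0; rewrite -lee_fin -rrE// rearr_leB. Qed.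

Lemma rr_mono s t : 0 < s -> s <= t -> rr t <= rr s.
Proof.
move=> s0 st; rewrite -lee_fin -!rrE//; last exact: lt_le_trans st.
apply: le_ereal_inf => _ [l [l0 ls] <-]; exists l => //; split => //.
by apply: le_trans ls _.
Qed.

(** The infimum defining the rearrangement need not be reached, so the set is exhausted by the sets
    where g > rr t + 1 / (k+1), each of which lies above an admissible level. *)
Lemma rr_dist t : 0 < t -> (m [set x | rr t < g x]%R <= t%:E)%E.
Proof.
move=> t0; pose F (k : nat) := [set x | rr t + k.+1%:R^-1 < g x]%R.
have mF k : measurable (F k) by exact: measurable_gt.
have FE : \bigcup_k F k = [set x | rr t < g x]%R.
 apply/seteqP; split => x /=.
  by move=> [k _]; apply: le_lt_trans; rewrite lerDl invr_ge0.
 move=> h; have d0 : 0 < g x - rr t by rewrite subr_gt0. have [k _ hk] := (near_infty_natSinv_lt (PosNum d0)); exists k => //=.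
 by rewrite /F/= -ltrBrDl; apply: hk => /=.
rewrite -FE.
have nF : nondecreasing_seq F.
 apply/nondecreasing_seqP => k; apply/subsetPset => x /=; apply: le_lt_trans. by rewrite lerD2l lef_pV2 ?posrE// ler_nat.
have cv := nondecreasing_cvg_mu (mu := m) mF (bigcup_measurable (fun k _ => mF k)) nF.
rewrite -(cvg_lim _ cv)//; apply: lime_le; first by apply/cvg_ex; eexists; exact: cv.
apply: nearW => k /=.
have : (rearr g t < (rr t + k.+1%:R^-1)%:E)%E by rewrite rrE// lte_fin ltrDl invr_gt0.
move=> /ereal_inf_lt[_ [l [l0 lt] <-]]; rewrite lte_fin => lk.
rewrite distE in lt; apply: le_trans lt; apply: le_measure; rewrite ?inE//.
 exact: measurable_gt.
by move=> x; apply: lt_trans.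
Qed.

Section bounds.
Variables (p A : R) (p1 : 1 < p) (A0 : 0 < A) (K : nat).
Let t := @tdy R K.
Let t0 j : 0 < t j. Proof. by rewrite /t /tdy powR_gt0. Qed.
Let p0 : 0 < p. Proof. exact: lt_trans p1. Qed.
Let p0i : 0 <= p^-1. Proof. by rewrite invr_ge0 ltW. Qed.

Lemma tdyS j : t j.+1 = 2 * t j.
Proof. by rewrite /t /tdy -(natr1 j) addrAC powRDp// powRr1// mulrC. Qed.

(** Extended by an upper bound to nonpositive arguments, so as to be monotone on the whole line and
    therefore measurable. *)
Let r' s := if 0 < s then rr s else B + 1.
Let r'_mono : nonincreasing_fun r'.
Proof.
move=> s s' ss; rewrite /r'; case: ifP => s'0; case: ifP => s0 //.
- exact: rr_mono.
- exact: rr_leB.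
- lra.
Qed.

(** On [t_j / 2, t_j[ the rearrangement is at least its value at t_j, so this interval contributes
    at least c_j / 2 to the Lorentz integral, and the intervals are disjoint. The 4 in 4 A absorbs
    the two losses 2^(1/p) <= 2 and 2 <= 2^r. *)
Lemma lorentz_qunit_fin r : 1 <= r -> (lorentz p r%:E g <= A%:E)%E -> 
 forall N, \sum_(j < N) (rr (t j) * t j `^ p^-1 / (4 * A)) `^ r <= 1.
Proof.
move=> r1 h N; have r0 : 0 < r by exact: lt_le_trans r1.
have rn : r != 0 by lra.
pose D : set R := [set s | 0 < s].
have mD : measurable D.
 by rewrite (_ : D = `]0, +oo[%classic)//; apply/seteqP; split => x; rewrite /D/= in_itv andbT.
pose F s := (((s `^ p^-1)%:E * rearr g s) `^ r * (s^-1)%:E)%E.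
have FE s : D s -> F s = ((s `^ p^-1 * r' s) `^ r * s^-1)%:E.
 by move=> s0; rewrite /F /r' s0 rrE// -EFinM poweR_EFin -EFinM.
have F0 s : D s -> (0 <= F s)%E.
 by move=> s0; rewrite FE// lee_fin mulr_ge0 ?powR_ge0// invr_ge0 ltW.
have mF : measurable_fun D F.
 apply: (eq_measurable_fun (fun s => ((s `^ p^-1 * r' s) `^ r * s^-1)%:E)).
  by move=> s; rewrite inE => ?; rewrite FE.
 apply/measurable_EFinP; apply: measurable_funTS. have mr : mfun r' by exact: nonincreasing_measurable. by mm.
have hI : (\int[lebesgue_measure]_(s in D) F s <= (A `^ r)%:E)%E.
 have I0 : (0 <= \int[lebesgue_measure]_(s in D) F s)%E by exact: integral_ge0. move: h; rewrite /lorentz -/D -/(F _) => h.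
 rewrite -[leLHS]poweRe1// -(mulVf rn) poweRrM -poweR_EFin. by apply: gt0_ler_poweR; rewrite ?(ltW r0)// in_itv/= ?poweR_ge0 ?leey//= lee_fin ltW.
pose c j := ((t j / 2) `^ p^-1 * rr (t j)) `^ r.
have c0 j : 0 <= c j by exact: powR_ge0.
pose I j : set R := `[t j / 2, t j[%classic.
have tj2 j : t j / 2 < t j by rewrite ltr_pdivrMr// ltr_pMr// ltr1n.
have disj s i j : I i s -> I j s -> i = j.
 wlog ij : i j / (i <= j)%N.
  by move=> H hi hj; case/orP: (leq_total i j) => ?; [|apply/esym]; exact: H.
 rewrite /I/= !in_itv/= => /andP[_ si] /andP[js _]. apply/eqP; rewrite eqn_leq ij/= leqNgt; apply/negP => ij'.
 suff : t i <= t j / 2 by move=> /le_lt_trans /(_ (le_lt_trans js si)); rewrite ltxx. have -> : t j / 2 = t j.-1 by rewrite -{1}(ltn_predK ij') tdyS; field.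
 rewrite /t /tdy; apply: ler_powR; rewrite ?ler1n// lerD2r ler_nat -ltnS. by rewrite (ltn_predK ij').
have hS : (\sum_(j < N) (c j / 2)%:E <= \int[lebesgue_measure]_(s in D) F s)%E.
 have mI j : measurable (I j) by exact: measurable_itv. have mInd j : mfun (\1_(I j) : R -> R) by [].
 apply: (le_via (\int[lebesgue_measure]_(s in D) \sum_(j < N) ((c j / t j) * \1_(I j) s)%:E)%E).
  rewrite ge0_integral_sum//; last 2 first.
  - by move=> j; apply/measurable_EFinP; apply: measurable_funTS; apply: mf_mul; [exact: mf_cst|exact: mInd].
  - by move=> j s _; rewrite lee_fin mulr_ge0// divr_ge0// ltW.
  apply: lee_sum => j _; under eq_integral do rewrite EFinM. rewrite ge0_integralZl//=; last 2 first.
  - by apply/measurable_EFinP; apply: measurable_funTS; exact: mInd.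
  - by rewrite lee_fin divr_ge0// ltW.
  have ID : I j `<=` D.
   by move=> s; rewrite /I /D/= in_itv => /andP[+ _]; apply: lt_le_trans; rewrite divr_gt0.
  rewrite integral_indic; [|exact: mD|exact: mI]; rewrite (setIidl ID). have lm : lebesgue_measure (I j) = (t j - t j / 2)%:E.
   by rewrite /I lebesgue_measure_itv lte_fin tj2 EFinB.
  apply: (le_via ((c j / t j)%:E * (t j - t j / 2)%:E)%E).
   rewrite -EFinM lee_fin; apply: le_of_eq; field. by rewrite gt_eqF.
  by apply: lee_wpmul2l; [rewrite lee_fin divr_ge0// ltW|rewrite -lm; exact: lexx].
 apply: ge0_le_integral => //.
 - by move=> s _; apply: sume_ge0 => j _; rewrite lee_fin mulr_ge0// divr_ge0// ltW.
 - by apply: emeasurable_sum => j; apply/measurable_EFinP; apply: measurable_funTS; apply: mf_mul; [exact: mf_cst|exact: mInd].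
 move=> s s0; have [[j jN js]|no] := pselect (exists2 j, (j < N)%N & I j s); last first.
  rewrite big1 ?F0// => j _; rewrite indicE memNset ?mulr0// => js; apply: no. by exists (nat_of_ord j).
 rewrite (bigD1 (Ordinal jN))//= big1 ?adde0; last first.
  move=> i /eqP ij; rewrite indicE memNset ?mulr0// => is_; apply: ij. by apply: val_inj => /=; exact: disj is_ js.
 rewrite indicE mem_set// mulr1 FE// lee_fin. have := js; rewrite /I/= in_itv/= => /andP[s1 s2]. apply: ler_pM => //; first by rewrite invr_ge0 ltW.
  apply: powR_mono; rewrite ?(ltW r0)//; first by rewrite mulr_ge0 ?powR_ge0 ?rr_ge0. apply: ler_pM; rewrite ?powR_ge0 ?rr_ge0//.
   by apply: powR_mono => //; rewrite divr_ge0// ltW.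
  by rewrite /r' s0; apply: rr_mono => //; exact: ltW.
 by rewrite lef_pV2 ?posrE// ltW.
have Ar : 0 < A `^ r by exact: powR_gt0.
have {hS hI} : \sum_(j < N) c j / 2 <= A `^ r.
 by rewrite -lee_fin -sumEFin; exact: le_trans hI.
move=> hs; apply: (le_via (\sum_(j < N) (c j / 2) / A `^ r)); last first.
 by rewrite -mulr_suml ler_pdivrMr// mul1r.
apply: ler_sum => j _; pose x := (t j / 2) `^ p^-1 * rr (t j).
have x0 : 0 <= x by rewrite mulr_ge0 ?powR_ge0 ?rr_ge0.
apply: (le_via ((x / (2 * A)) `^ r)).
 apply: powR_mono; rewrite ?(ltW r0)//.
  by rewrite divr_ge0 ?mulr_ge0 ?rr_ge0 ?powR_ge0// ltW.
 have -> : t j `^ p^-1 = (t j / 2) `^ p^-1 * 2 `^ p^-1.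
  by rewrite -powRM ?divfK// divr_ge0// ltW.
 have h2 : 2 `^ p^-1 <= 2 :> R.
  rewrite -[leRHS]powRr1//; apply: ler_powR; rewrite ?ler1n//. by rewrite invf_le1// ltW.
 rewrite (_ : _ / (4 * A) = x / (2 * A) * (2 `^ p^-1 / 2)); last first.
  by rewrite /x; field; rewrite gt_eqF.
 rewrite ler_piMr//; first by rewrite divr_ge0// mulr_ge0// ltW. lra.
have A20 : 0 < 2 * A by rewrite mulr_gt0.
rewrite powRM//; last by rewrite invr_ge0 ltW.
rewrite /c -/x -mulrA; apply: ler_wpM2l; first exact: powR_ge0.
rewrite -invfM -powR_inv1 ?mulr_ge0 ?(ltW A0)// -powRrM mulN1r powRN lef_pV2 ?posrE ?mulr_gt0 ?powR_gt0//.
rewrite powRM ?(ltW A0)//; apply: ler_wpM2r; first exact: ltW.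
by rewrite -[leLHS]powRr1//; apply: ler_powR; rewrite ?ler1n.
Qed.

Lemma lorentz_qunit q : (1 <= q)%E -> (lorentz p q g <= A%:E)%E -> 
 forall N, qunit (qinv q) N (fun j => rr (t j) * t j `^ p^-1 / (4 * A)).
Proof.
move=> q1 h N.
have b0 j : 0 <= rr (t j) * t j `^ p^-1 / (4 * A).
 by rewrite divr_ge0 ?mulr_ge0 ?rr_ge0 ?powR_ge0// ltW.
move: q q1 h => [r| |] //= r1 h.
 have r1' : 1 <= r by []. have r0 : 0 < r by lra. have hs := lorentz_qunit_fin r1' h; split => [k kN|].
  rewrite b0/= leNgt; apply/negP => bk. have := hs N; rewrite leNgt => /negP; apply. apply: (@lt_le_trans _ _ ((rr (t k) * t k `^ p^-1 / (4 * A)) `^ r)).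
   have := gt0_ltr_powR r0; move=> /(_ 1 (rr (t k) * t k `^ p^-1 / (4 * A))). by rewrite powR1; apply => //; rewrite nnegrE.
  by rewrite (bigD1 (Ordinal kN))//= lerDl; apply: sumr_ge0 => j _; exact: powR_ge0.
 rewrite invrK -[leRHS]mul1r; apply: ler_pM => //; rewrite ?invr_ge0 ?(ltW r0)//.
  by apply: sumr_ge0 => j _; exact: powR_ge0.
 by rewrite invf_le1.
split => [k kN|]; last by rewrite mul0r.
rewrite b0/= ler_pdivrMr ?mulr_gt0// mul1r.
have : ((t k `^ p^-1)%:E * rearr g (t k) <= A%:E)%E.
 by apply: le_trans h; apply: ereal_sup_ubound; exists (t k) => //=.
rewrite rrE// -EFinM lee_fin mulrC => /le_trans; apply.
by rewrite ler_peMl ?(ltW A0)// ler1n.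
Qed.

Lemma tdy_gt0 j : 0 < t j. Proof. exact: t0. Qed.

Lemma tdy_mono i j : (i <= j)%N -> t i <= t j.
Proof. by move=> ij; rewrite /t /tdy; apply: ler_powR; rewrite ?ler1n// lerD2r ler_nat. Qed.

Section atoms.
Variable v : T -> R.
Hypotheses (bv : bm v) (vg : forall x, `|v x| <= g x).
Let h j := rr (t j).
Let S j := [set x | h j.+1 < g x] `\` [set x | h j < g x].

(** The part of v carried between two consecutive dyadic levels of the rearrangement of g,
    normalised to size 1. The carrier has measure at most t_(j+1) = 2 t_j. If the level [h j] is 0
    the carrier is empty, so the division by 0 is harmless. *)
Definition atom j x := v x * \1_(S j) x / h j.

Let mS j : measurable (S j).
Proof. by apply: measurableD; exact: measurable_gt. Qed.

Let atom_le j x : `|atom j x| <= \1_(S j) x.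
Proof.
rewrite /atom indicE; have [/set_mem[/= h1 /negP h2]|xS] := boolP (x \in S j); last first.
 by rewrite mulr0 mul0r normr0.
rewrite -leNgt in h2; rewrite mulr1.
have h0 : 0 < h j by apply: lt_le_trans h2; apply: le_lt_trans h1; exact: rr_ge0.
by rewrite normrM normfV (ger0_norm (ltW h0)) ler_pdivrMr// mul1r (le_trans (vg x)).
Qed.

Let mS_le j : (m (S j) <= (2 * t j)%:E)%E.
Proof.
rewrite -tdyS; apply: le_trans (rr_dist (t0 j.+1)); apply: le_measure; rewrite ?inE//.
 exact: measurable_gt.
by move=> x [].
Qed.

Let iS j : itg m (\1_(S j)).
Proof.
apply: itgP; first exact: measurable_indic.
under eq_integral do rewrite ger0_norm//.
by rewrite Ri_indic//; apply: (le_lt_trans (mS_le j)); rewrite ltry.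
Qed.

Lemma rs_atom j : rs (2 * t j) (atom j).
Proof.
have ma : mfun (atom j).
 have mv := bm_m bv; rewrite /atom; apply: mf_mul; last exact: mf_cst. by apply: mf_mul.
have le1 x : `|atom j x| <= 1.
 by apply: le_trans (atom_le j x) _.
have ia : itg m (atom j) by apply: (itg_dom (\1_(S j))).
split => //; first by split => //; exists 1.
apply: (le_via (Ri m (\1_(S j)))).
 by apply: Ri_le => //; exact: itg_norm.
by rewrite -lee_fin RiE// Ri_indic.
Qed.

Lemma sum_atomE L x : \sum_(j < L) h j * atom j x = if h L < g x <= h 0%N then v x else 0.
Proof.
elim: L => [|L IH].
 by rewrite big_ord0; case: ifP => // /andP[a b]; move: (lt_le_trans a b); rewrite ltxx.
rewrite big_ord_recr/= IH {IH}.
have hS : h L.+1 <= h L by apply: rr_mono => //; exact: tdy_mono.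
have h0L : h L <= h 0%N by apply: rr_mono => //; exact: tdy_mono.
have hp : 0 <= h L.+1 by exact: rr_ge0.
rewrite /atom indicE; have [/set_mem[/= h1 /negP h2]|xS] := boolP (x \in S L).
 rewrite -leNgt in h2; rewrite h1 (le_trans h2 h0L) ltNge h2/= add0r mulr1. by rewrite mulrC divfK// gt_eqF// (lt_le_trans _ h2)// (le_lt_trans hp).
rewrite mulr0 mul0r mulr0 addr0.
have [h1|h1] := ltP (h L) (g x); first by rewrite (le_lt_trans hS h1).
have [h2|//] := ltP (h L.+1) (g x).
by exfalso; move/negP: xS; apply; apply/mem_set; split => //=; apply/negP; rewrite -leNgt.
Qed.

(** Two errors: where g is small v is at most the last level, and where g exceeds the first level v
    is at most B, on a set of small measure. *)
Lemma atom_approx L x : `|v x - \sum_(j < L) h j * atom j x| <= h L + B * \1_[set x | h 0%N < g x] x.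
Proof.
rewrite sum_atomE indicE; case: ifP => [_|]; first by rewrite subrr normr0 addr_ge0 ?rr_ge0// mulr_ge0.
rewrite subr0; have [h1|h1] := ltP (h L) (g x); last first.
 by move=> _; apply: (le_trans (vg x)); apply: (le_trans h1); rewrite lerDl mulr_ge0.
move=> /negbT; rewrite -ltNge => h2; rewrite mem_set// mulr1.
by apply: (le_trans (vg x)); apply: (le_trans (gB x)); rewrite lerDr rr_ge0.
Qed.
End atoms.
End bounds.
End lorentz.

(** * Young's inequality for sequences with off-diagonal decay *)

Section sums.
Variable R : realType.
Implicit Types (b : nat -> R).

(** Weighted arithmetic-geometric mean inequality, through the tangent of exp at Z. Zero weights are
    allowed: for them x <= 1 is used and the auxiliary z is 0. *)
Lemma young3 (t1 t2 t3 x1 x2 x3 : R) : 0 <= t1 -> 0 <= t2 -> 0 <= t3 -> t1 + t2 + t3 = 1 ->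
 0 <= x1 <= 1 -> 0 <= x2 <= 1 -> 0 <= x3 <= 1 ->
 x1 * x2 * x3 <= t1 * x1 `^ t1^-1 + t2 * x2 `^ t2^-1 + t3 * x3 `^ t3^-1.
Proof.
move=> t10 t20 t30 t1e /andP[x10 x11] /andP[x20 x21] /andP[x30 x31].
have R0 : 0 <= t1 * x1 `^ t1^-1 + t2 * x2 `^ t2^-1 + t3 * x3 `^ t3^-1.
 by rewrite !addr_ge0// mulr_ge0// powR_ge0.
have [->|n1] := eqVneq (x1 * x2 * x3) 0; first exact: R0.
move: n1; rewrite !mulf_eq0 !negb_or => /andP[/andP[n1 n2] n3].
have p1 : 0 < x1 by lra.
have p2 : 0 < x2 by lra.
have p3 : 0 < x3 by lra.
have key (t x : R) : 0 <= t -> 0 < x -> x <= 1 -> exists2 z, ln x <= t * z & x `^ t^-1 = expR z.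
 move=> t0 x0 x1'; have [->|tn] := eqVneq t 0.
  by exists 0; rewrite ?mul0r ?ln_le0// invr0 powRr0 expR0.
 exists (t^-1 * ln x); first by rewrite mulrA mulfV// mul1r. by rewrite /powR gt_eqF.
have [z1 h1 ->] := key _ _ t10 p1 x11.
have [z2 h2 ->] := key _ _ t20 p2 x21.
have [z3 h3 ->] := key _ _ t30 p3 x31.
rewrite -[leLHS]lnK; last by rewrite posrE !mulr_gt0.
rewrite lnM ?posrE ?mulr_gt0// lnM ?posrE//.
set Z := t1 * z1 + t2 * z2 + t3 * z3.
apply: (le_via (expR Z)); first by rewrite ler_expR /Z !lerD.
have tg z : expR Z * (1 + (z - Z)) <= expR z.
 have -> : expR z = expR Z * expR (z - Z) by rewrite -expRD addrCA subrr addr0. by apply: ler_wpM2l; [exact: expR_ge0|exact: expR_ge1Dx].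
apply: (le_via (t1 * (expR Z * (1 + (z1 - Z))) + t2 * (expR Z * (1 + (z2 - Z))) + t3 * (expR Z * (1 + (z3 - Z))))).
 rewrite (_ : t1 * _ + _ + _ = expR Z * ((t1 + t2 + t3) + (Z - (t1 + t2 + t3) * Z))).
  by rewrite t1e mul1r subrr addr0 mulr1.
 by move: (expR Z) => E; rewrite /Z; ring.
by rewrite !lerD// ler_wpM2l.
Qed.

Lemma qunit_ge0 th N b k : qunit th N b -> (k < N)%N -> 0 <= b k <= 1.
Proof. by case=> h _ /h. Qed.

(** A Schur test: after [young3] each summand involves one of the three sequences, and the kernel
    summed over the other two indices is at most S. *)
Lemma sum3_young (N : nat) (K : nat -> nat -> nat -> R) (S t1 t2 t3 : R) b1 b2 b3 :
 0 <= t1 -> 0 <= t2 -> 0 <= t3 -> t1 + t2 + t3 = 1 -> 0 <= S ->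
 (forall i j k, 0 <= K i j k) ->
 (forall i, \sum_(j < N) \sum_(k < N) K i j k <= S) ->
 (forall j, \sum_(i < N) \sum_(k < N) K i j k <= S) ->
 (forall k, \sum_(i < N) \sum_(j < N) K i j k <= S) ->
 qunit t1 N b1 -> qunit t2 N b2 -> qunit t3 N b3 ->
 \sum_(i < N) \sum_(j < N) \sum_(k < N) K i j k * (b1 i * b2 j * b3 k) <= 3 * S.
Proof.
move=> t10 t20 t30 te S0 K0 K1 K2 K3 q1 q2 q3.
pose y t (b : nat -> R) i := t * b i `^ t^-1.
have y0 t b i : 0 <= t -> 0 <= y t b i by move=> ?; rewrite mulr_ge0 ?powR_ge0.
have sy t b : qunit t N b -> \sum_(i < N) y t b i <= 1 by case=> _; rewrite mulr_sumr.
apply: (le_via (\sum_(i < N) \sum_(j < N) \sum_(k < N)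
  (K i j k * y t1 b1 i + K i j k * y t2 b2 j + K i j k * y t3 b3 k))).
 apply: ler_sum => i _; apply: ler_sum => j _; apply: ler_sum => k _. rewrite -!mulrDr; apply: ler_wpM2l => //; apply: young3 => //;
 [exact: qunit_ge0 q1 _|exact: qunit_ge0 q2 _|exact: qunit_ge0 q3 _].
have fin (a : nat -> R) : nneg a -> \sum_(i < N) a i <= 1 -> \sum_(i < N) a i * S <= S.
 by move=> _ h; rewrite -mulr_suml -[leRHS]mul1r ler_wpM2r.
under eq_bigr => i _ do under eq_bigr => j _ do rewrite !big_split/=.
under eq_bigr => i _ do rewrite !big_split/=.
rewrite !big_split/= (_ : 3 * S = S + S + S); last by ring.
rewrite !lerD//.
- apply: le_trans (fin _ (fun i => y0 _ b1 i t10) (sy _ _ q1)). apply: ler_sum => i _; rewrite mulrC; under eq_bigr => j _ do rewrite -mulr_suml.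
 by rewrite -mulr_suml ler_wpM2r// y0.
- apply: le_trans (fin _ (fun i => y0 _ b2 i t20) (sy _ _ q2)).
 rewrite exchange_big/=; apply: ler_sum => j _; rewrite mulrC; under eq_bigr => i _ do rewrite -mulr_suml. by rewrite -mulr_suml ler_wpM2r// y0.
- apply: le_trans (fin _ (fun i => y0 _ b3 i t30) (sy _ _ q3)). under eq_bigr => i _ do rewrite exchange_big/=.
 rewrite exchange_big/=; apply: ler_sum => k _; rewrite mulrC; under eq_bigr => i _ do rewrite -mulr_suml. by rewrite -mulr_suml ler_wpM2r// y0.
Qed.

(** The distance of two naturals; one of the truncated differences is 0. *)
Definition dn (i j : nat) := ((i - j) + (j - i))%N.

Lemma dnC i j : dn i j = dn j i. Proof. by rewrite /dn addnC. Qed.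

Section geometric.
Variable rho : R.
Hypotheses (r0 : 0 < rho) (r1 : rho < 1).
Let s : R := (1 - rho)^-1.
Let s0 : 0 < s. Proof. by rewrite invr_gt0 subr_gt0. Qed.
Let sE : 1 + rho * s = s.
Proof. by rewrite /s; field; rewrite subr_eq0 gt_eqF. Qed.

Let geo (N : nat) : \sum_(k < N) rho ^+ k <= s.
Proof.
elim: N => [|N IH]; first by rewrite big_ord0 ltW.
rewrite big_ord_recl expr0 -sE lerD2l; under eq_bigr => k _ do rewrite lift0 exprS.
by rewrite -mulr_sumr ler_pM2l.
Qed.

(** Both sides of the diagonal are geometric series; the induction strips the index 0 from the two
    variables together. *)
Lemma geo_dn (N i : nat) : \sum_(k < N) rho ^+ dn i k <= 2 * s.
Proof.
have key (j : nat) : \sum_(k < N) rho ^+ dn j k <= s + \sum_(k < j) rho ^+ k.+1.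
 elim: N j => [|M IH] j.
  by rewrite big_ord0 addr_ge0 ?(ltW s0)//; apply: sumr_ge0 => k _; rewrite exprn_ge0// (ltW r0).
 case: j => [|j].
  rewrite big_ord0 addr0; apply: le_trans (geo M.+1). by apply: ler_sum => k _; rewrite /dn sub0n subn0 add0n.
 rewrite big_ord_recl big_ord_recr/= {1}/dn subn0 sub0n addn0 addrA [leRHS]addrC lerD2l.
 apply: le_trans (IH j); apply: ler_sum => k _; by rewrite (_ : bump 0 k = k.+1)// /dn !subSS.
apply: le_trans (key i) _; rewrite mulr_natl mulr2n lerD2l.
apply: le_trans (geo i.+1); rewrite [leRHS]big_ord_recl expr0; under [X in _ <= _ + X]eq_bigr => k _ do rewrite lift0.
by rewrite lerDr.
Qed.

Lemma sum3_dn (N : nat) (t1 t2 t3 : R) b1 b2 b3 :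
 0 <= t1 -> 0 <= t2 -> 0 <= t3 -> t1 + t2 + t3 = 1 ->
 qunit t1 N b1 -> qunit t2 N b2 -> qunit t3 N b3 ->
 \sum_(i < N) \sum_(j < N) \sum_(k < N) rho ^+ (dn i j + dn i k) * (b1 i * b2 j * b3 k) <= 3 * (2 * s) ^+ 2.
Proof.
move=> t10 t20 t30 te q1 q2 q3.
have s20 : 0 <= 2 * s by rewrite mulr_ge0// ltW.
have rk (k : nat) : 0 <= rho ^+ k by rewrite exprn_ge0// ltW.
have g0 i : 0 <= \sum_(k < N) rho ^+ dn i k by apply: sumr_ge0.
have geoC j : \sum_(i < N) rho ^+ dn i j <= 2 * s by under eq_bigr => i _ do rewrite dnC; exact: geo_dn.
have two (F : nat -> R) : nneg F -> \sum_(i < N) F i <= 2 * s ->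
  \sum_(i < N) F i * \sum_(k < N) rho ^+ dn i k <= (2 * s) ^+ 2.
 move=> F0 hF; apply: (le_via (\sum_(i < N) F i * (2 * s))).
  by apply: ler_sum => i _; apply: ler_wpM2l => //; exact: geo_dn.
 by rewrite -mulr_suml expr2 ler_wpM2r.
apply: (@sum3_young N (fun i j k => rho ^+ (dn i j + dn i k)) _ _ _ _ _ _ _ t10 t20 t30 te _ _ _ _ _ q1 q2 q3).
- exact: sqr_ge0.
- by [].
- move=> i; under eq_bigr => j _ do under eq_bigr => k _ do rewrite exprD. under eq_bigr => j _ do rewrite -mulr_sumr.
 by rewrite -mulr_suml expr2; apply: ler_pM => //; exact: geo_dn.
- move=> j; under eq_bigr => i _ do under eq_bigr => k _ do rewrite exprD. under eq_bigr => i _ do rewrite -mulr_sumr. exact: (two (fun i => rho ^+ dn i j)).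
- move=> k; under eq_bigr => i _ do under eq_bigr => j _ do rewrite exprD mulrC. under eq_bigr => i _ do rewrite -mulr_sumr. exact: (two (fun i => rho ^+ dn i k)).
Qed.

Lemma sum2_dn (N : nat) (t1 t2 : R) b1 b2 : 0 <= t1 -> 0 <= t2 -> t1 + t2 = 1 ->
 qunit t1 N b1 -> qunit t2 N b2 ->
 \sum_(i < N) \sum_(j < N) rho ^+ dn i j * (b1 i * b2 j) <= 2 * (2 * s).
Proof.
move=> t10 t20 te q1 q2; have rk (k : nat) : 0 <= rho ^+ k by rewrite exprn_ge0// ltW.
have s20 : 0 <= 2 * s by rewrite mulr_ge0// ltW.
pose y t (b : nat -> R) i := t * b i `^ t^-1.
have y0 t b i : 0 <= t -> 0 <= y t b i by move=> ?; rewrite mulr_ge0 ?powR_ge0.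
have sy t b : qunit t N b -> \sum_(i < N) y t b i <= 1 by case=> _; rewrite mulr_sumr.
apply: (le_via (\sum_(i < N) \sum_(j < N) (y t1 b1 i * rho ^+ dn i j + y t2 b2 j * rho ^+ dn i j))).
 apply: ler_sum => i _; apply: ler_sum => j _. rewrite -mulrDl mulrC; apply: ler_wpM2r => //. have te' : t1 + t2 + 0 = 1 by lra. have h1 : 0 <= (1 : R) <= 1 by lra.
 have := young3 t10 t20 (lexx 0) te' (qunit_ge0 q1 (ltn_ord i)) (qunit_ge0 q2 (ltn_ord j)) h1. by rewrite mulr1 mul0r addr0.
under eq_bigr => i _ do rewrite big_split/= -mulr_sumr.
rewrite big_split/= [X in _ + X]exchange_big/=; under [X in _ + X]eq_bigr => i _ do rewrite -mulr_sumr.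
rewrite (_ : 2 * (2 * s) = 2 * s + 2 * s); last by ring.
have fin (a c : nat -> R) : nneg a -> (forall i, c i <= 2 * s) -> \sum_(i < N) a i <= 1 ->
  \sum_(i < N) a i * c i <= 2 * s.
 move=> a0 hc h; apply: (le_via (\sum_(i < N) a i * (2 * s))).
  by apply: ler_sum => i _; exact: ler_wpM2l.
 by rewrite -mulr_suml -[leRHS]mul1r ler_wpM2r.
apply: lerD.
 by apply: (fin _ (fun i => \sum_(j < N) rho ^+ dn i j)); [move=> i; exact: y0|move=> i; exact: geo_dn|exact: sy].
apply: (fin _ (fun j => \sum_(i < N) rho ^+ dn i j)); [move=> i; exact: y0| |exact: sy].
by move=> j; under eq_bigr => i _ do rewrite dnC; exact: geo_dn.
Qed.
End geometric.

End sums.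

(** * Passage from atomic sums to functions *)

Section limits.
Variables (R : realType) (n : nat).
Notation T := 'rV[R]_n.
Notation m := (lebm R n).
Implicit Types (s t r p : R) (x y z : T) (u v w g : T -> R).

Lemma cvg_bound (a : R) (s e : nat -> R) : e k @[k --> \oo] --> 0 -> (forall k, `|a - s k| <= e k) ->
 s k @[k --> \oo] --> a.
Proof.
move=> e0 h; apply/cvgrPdist_le => eps eps0; move/cvgrPdist_le : e0 => /(_ _ eps0).
apply: filterS => k; rewrite sub0r normrN => hk.
by apply: le_trans (h k) _; apply: le_trans hk; exact: ler_norm.
Qed.

(** Fatou's lemma, applied to the sum over the scales. *)
Lemma II_lim M (f : nat -> T -> R) (F : nat -> nat -> T -> R) (b : R) :
 (forall K i, bm (F K i)) -> (forall K i x, 0 <= F K i x) ->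
 (forall i x, F K i x @[K --> \oo] --> f i x) ->
 (forall K, (II m M (F K) <= b%:E)%E) -> (II m M f <= b%:E)%E.
Proof.
move=> bF F0 cF hb; have mF K i := bm_m (bF K i).
have f0 i x : 0 <= f i x.
 rewrite -(cvg_lim _ (cF i x))//; apply: limr_ge; first by apply/cvg_ex; exists (f i x); exact: cF. by apply: nearW => K.
pose g K x := (\sum_(i < M) (F K i x)%:E)%E.
have mg K : mfun (g K).
 by apply: emeasurable_sum => i; apply/measurable_EFinP.
have g0 K x : (0 <= g K x)%E by apply: sume_ge0 => i _; rewrite lee_fin.
have gI K : (\int[m]_x g K x = II m M (F K))%E.
 rewrite ge0_integral_sum//; first by move=> i; apply/measurable_EFinP. by move=> i x _; rewrite lee_fin.
have cg x : g K x @[K --> \oo] --> (\sum_(i < M) (f i x)%:E)%E.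
 rewrite /g sumEFin; under eq_fun do rewrite sumEFin. apply: cvg_EFin; first by apply: nearW => K. rewrite (_ : fine \o _ = fun K => \sum_(i < M) F K i x)//.
 elim: (index_enum _) => [|i l IH].
  by rewrite big_nil; under eq_fun do rewrite big_nil; exact: cvg_cst.
 by rewrite big_cons; under eq_fun do rewrite big_cons; apply: cvgD.
have mf i : mfun (f i).
 exact: (measurable_fun_cvg (fun K => mF K i) (fun x _ => cF i x)).
have -> : II m M f = (\int[m]_x limn_einf (g ^~ x))%E.
 under eq_integral => x _ do rewrite (cvg_limn_einf_sup (cg x)).1. rewrite ge0_integral_sum//; first by move=> i; apply/measurable_EFinP.
 by move=> i x _; rewrite lee_fin.
have := fatou m measurableT mg (fun K x _ => g0 K x).
move=> /le_trans; apply; rewrite limn_einf_lim; apply: lime_le; first exact: is_cvg_einfs.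
apply: nearW => K; apply: le_trans (hb K); rewrite -gI.
by apply: ereal_inf_lbound; exists K => /=.
Qed.

(** Heat averages of |v - V K| tend to 0 uniformly in x, for each positive time. Uniform convergence
    fails in general, as the largest values of v are cut off on small sets, but this weaker mode
    passes to [He], [Lop], [Lp] and [mx]. *)
Definition happ v (V : nat -> T -> R) := [/\ bm v, forall K, bm (V K) &
 forall t, 0 < t -> exists2 e : nat -> R, e K @[K --> \oo] --> 0 &
  forall K x, He t (fun y => `|v y - V K y|) x <= e K].

Lemma happ_abs v V : happ v V -> happ (absf v) (fun K x => `|V K x|).
Proof.
move=> [bv bV h]; split; [exact: bm_norm|by move=> K; exact: bm_norm|move=> t t0].
have [e e0 he] := h t t0; exists e => // K x; apply: le_trans (he K x).
have b1 : bm (fun y => `|(`|v y| - `|V K y|)|) by apply: bm_norm; apply: bmB; exact: bm_norm.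
have b2 : bm (fun y => `|v y - V K y|) by apply: bm_norm; exact: bmB.
by apply: (He_le x t0 b1 b2) => y; exact: ler_dist_dist.
Qed.

Lemma happ_He v V t x : happ v V -> 0 < t -> He t (V K) x @[K --> \oo] --> He t v x.
Proof.
move=> [bv bV h] t0; have [e e0 he] := h t t0; apply: (cvg_bound e0) => K.
rewrite -HeB//; apply: le_trans (he K x).
by apply: He_norm => //; [exact: bmB|apply: bm_norm; exact: bmB].
Qed.

Lemma Lop_bound tau u x a b : 0 < tau -> bm u -> (forall y, `|He tau u y| <= a) ->
 `|He (16 * tau) u x| <= b -> Lop tau u x <= a + b.
Proof.
move=> t0 br ha hb; have t15 : 0 < 15 * tau by rewrite mulr_gt0.
rewrite -[leRHS](He_cst (a + b) x t15); apply: (He_le x t15).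
- exact/bm_norm/bm_LD.
- exact: bm_cst.
- by move=> y; apply: le_trans (ler_normB _ _) _; exact: lerD.
Qed.

Lemma happ_Lop_aux v V tau : happ v V -> 0 < tau -> exists2 e : nat -> R, e K @[K --> \oo] --> 0 &
 forall K x, `|Lop tau v x - Lop tau (V K) x| <= e K.
Proof.
move=> [bv bV h] t0; have t16 : 0 < 16 * tau by rewrite mulr_gt0.
have [e e0 he] := h _ t0; have [e' e'0 he'] := h _ t16.
exists (fun K => e K + e' K); first by rewrite -(addr0 0); exact: cvgD.
move=> K x; have bd : bm (fun y => v y - V K y) by exact: bmB.
have bn : bm (fun y => `|v y - V K y|) by exact: bm_norm.
have hL : Lop tau (fun y => v y - V K y) x <= e K + e' K.
 apply: Lop_bound => //; first by move=> y; apply: le_trans (he K y); exact: He_norm. by apply: le_trans (he' K x); exact: He_norm.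
have bnV : bm (fun y => - V K y) by under eq_fun do rewrite -mulN1r; exact: bmZ.
have bnv : bm (fun y => - (v y - V K y)) by under eq_fun do rewrite -mulN1r; exact: bmZ.
have h1 : Lop tau v x <= Lop tau (V K) x + Lop tau (fun y => v y - V K y) x.
 rewrite -[X in Lop tau X x <= _](_ : (fun y => V K y + (v y - V K y)) = v); first exact: Lop_add. by apply/funext => y; rewrite addrC subrK.
have h2 : Lop tau (V K) x <= Lop tau v x + Lop tau (fun y => v y - V K y) x.
 rewrite -(Lop_N x t0 bd). rewrite -[X in Lop tau X x <= _](_ : (fun y => v y + - (v y - V K y)) = V K); first exact: Lop_add.
 by apply/funext => y; rewrite opprB addrC subrK.
move: hL h1 h2; move: (Lop tau v x) (Lop tau (V K) x) (Lop tau _ x) => a b c hc h1 h2.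
by rewrite ler_norml; apply/andP; split; lra.
Qed.

Lemma happ_Lop v V tau x : happ v V -> 0 < tau -> Lop tau (V K) x @[K --> \oo] --> Lop tau v x.
Proof.
by move=> hv t0; have [e e0 he] := happ_Lop_aux hv t0; apply: (cvg_bound e0) => K.
Qed.

Lemma happ_Lp v V tau x : happ v V -> 0 < tau -> Lp tau (V K) x @[K --> \oo] --> Lp tau v x.
Proof.
move=> hv t0; have [e e0 he] := happ_Lop_aux hv t0; apply: (cvg_bound e0) => K.
have [bv bV _] := hv; have t7 : 0 < 7 * tau by rewrite mulr_gt0.
have b1 := bm_Lop t0 bv; have b2 := bm_Lop t0 (bV K).
rewrite /Lp -(HeB x t7 b1 b2) -[leRHS](He_cst (e K) x t7).
by apply: He_norm => //; [exact: bmB|exact: bm_cst].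
Qed.

Lemma cvg_maxr (a b : nat -> R) (l l' : R) : a k @[k --> \oo] --> l -> b k @[k --> \oo] --> l' ->
 Num.max (a k) (b k) @[k --> \oo] --> Num.max l l'.
Proof.
move=> ha hb; under eq_fun do rewrite maxr_absE; rewrite maxr_absE.
apply: cvgMl; apply: cvgD; first exact: cvgD.
by apply: cvg_norm; exact: cvgB.
Qed.

Lemma happ_mx v V sg N x : happ v V -> 0 < sg -> mx N sg (V K) x @[K --> \oo] --> mx N sg v x.
Proof.
move=> hv s0; rewrite /mx; elim: (index_enum _) => [|i l IH].
 by rewrite big_nil; under eq_fun do rewrite big_nil; exact: cvg_cst.
rewrite big_cons; under eq_fun do rewrite big_cons; apply: cvg_maxr => //.
by apply: happ_He => //; rewrite mulr_gt0.
Qed.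

Section approx.
Variables (v g : T -> R) (p : R) (q : \bar R) (A : R).
Hypotheses (bv : bm v) (bg : bm g) (g0 : nneg g) (vg : forall x, `|v x| <= g x).
Hypotheses (p1 : 1 < p) (q1 : (1 <= q)%E) (A0 : 0 < A) (lA : (lorentz p q g <= A%:E)%E).

Definition lapp K x := \sum_(j < 2 * K) rr g (tdy R K j) * atom g K v j x.

(** The last level is at most 4 A rho^K because its time is 2^K, and the set of dropped large values
    has measure at most 2^(-K), to which the bounded heat kernel assigns a small average. *)
Lemma lapp_happ : happ v lapp.
Proof.
have [mg [B' gB']] := bg; pose B := `|B'|.
have gB x : g x <= B by apply: (le_trans (ler_norm _)); apply: (le_trans (gB' x)); exact: ler_norm.
have B0 : 0 <= B by exact: normr_ge0.
have rs K j := rs_atom mg g0 gB K bv vg j.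
have blapp K : bm (lapp K).
 rewrite /lapp; elim: (2 * K)%N => [|L IH].
  by under eq_fun do rewrite big_ord0; exact: bm_cst.
 under eq_fun do rewrite big_ord_recr/=; apply: bmD => //. by apply: bmZ; have [] := rs K L.
split => // t t0; have [c hc] := G_bounded n t0.
have c0 : 0 <= c by exact: le_trans (normr_ge0 _) (hc 0).
have p0 : 0 < p by exact: lt_trans p1.
pose rho : R := 2 `^ (- p^-1).
have rho0 : 0 < rho by exact: powR_gt0.
have rho1 : rho < 1.
 rewrite /rho powRN invf_lt1 ?powR_gt0// /powR gt_eqF// expR_gt1 mulr_gt0 ?invr_gt0//. by rewrite ln_gt0// ltr1n.
exists (fun K => 4 * A * rho ^+ K + B * c * 2^-1 ^+ K).
 rewrite (_ : 0 = 4 * A * 0 + B * c * 0); last by rewrite !mulr0 addr0. apply: cvgD; apply: cvgMr; apply: cvg_expr.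
  by rewrite ger0_norm// ltW.
 by rewrite ger0_norm// invf_lt1// ltr1n.
move=> K x; set E := [set x | rr g (tdy R K 0) < g x].
have mE : measurable E by exact: measurable_gt.
have bE : bm (\1_E : T -> R).
 by split; [exact: measurable_indic|exists 1 => y; rewrite indicE; case: (_ \in _); rewrite ?normr1 ?normr0].
have b1 : bm (fun y => `|v y - lapp K y|) by apply: bm_norm; exact: bmB.
have b2 : bm (fun y => rr g (tdy R K (2 * K)) + B * \1_E y).
 by apply: bmD; [exact: bm_cst|exact: bmZ].
apply: (le_trans (He_le x t0 b1 b2 (atom_approx mg g0 gB K vg (2 * K)))).
rewrite (HeD x t0 (bm_cst _ _) (bmZ _ bE)) He_cst// HeZ//.
have mEK : (m E <= (2^-1 ^+ K)%:E)%E.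
 have h := rr_dist mg g0 gB (tdy_gt0 R K 0); apply: (le_trans h); rewrite lee_fin /tdy sub0r powRN. by rewrite powR_mulrn// exprVn.
apply: lerD.
 have [hq _] := lorentz_qunit mg g0 gB p1 A0 K q1 lA (2 * K).+1. have := hq (2 * K)%N (ltnSn _); rewrite ler_pdivrMr ?mulr_gt0// mul1r => /andP[_].
 have -> : tdy R K (2 * K) `^ p^-1 = rho ^- K.
  rewrite /tdy natrM mulr_natl mulr2n addrK -powRrM -exprVn /rho -powRN opprK. by rewrite -powR_mulrn// -powRrM mulrC.
 by rewrite ler_pdivrMr// exprn_gt0.
rewrite -mulrA; apply: ler_wpM2l => //.
have iE : itg m (\1_E : T -> R).
 apply: itgP; first exact: measurable_indic. under eq_integral do rewrite ger0_norm//. by rewrite Ri_indic//; apply: (le_lt_trans mEK); rewrite ltry.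
have mE' : mfun (\1_E : T -> R) by [].
apply: (le_via (Ri m (fun y => c * \1_E (x - y)))).
 apply: Ri_le.
 - by apply: conv_itg => //; exact: itg_G.
 - by apply: itgZ; exact: itg_refl.
 - by move=> y; apply: ler_wpM2r => //; apply: le_trans (hc y); exact: ler_norm.
rewrite RiZ; last exact: itg_refl.
rewrite Ri_refl//; apply: ler_wpM2l => //.
by rewrite -lee_fin RiE// Ri_indic.
Qed.
End approx.

(** One induction for all the sublinear functionals at hand: [Lop], [Lp], and [He] and [mx] of the
    modulus. *)
Lemma subadd_sum (S : (T -> R) -> R) :
 (forall u v, bm u -> bm v -> S (fun y => u y + v y) <= S u + S v) ->
 (forall c u, 0 <= c -> bm u -> S (fun y => c * u y) <= c * S u) ->
 forall (c : nat -> R) (w : nat -> T -> R), nneg c -> (forall j, bm (w j)) ->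
 forall L, S (fun y => \sum_(j < L) c j * w j y) <= \sum_(j < L) c j * S (w j).
Proof.
move=> SD SZ c w c0 bw.
have bs L : bm (fun y => \sum_(j < L) c j * w j y).
 elim: L => [|L IH]; first by under eq_fun do rewrite big_ord0; exact: bm_cst. by under eq_fun do rewrite big_ord_recr; apply: bmD => //; exact: bmZ.
elim=> [|L IH].
 rewrite big_ord0 (_ : (fun y : T => _) = fun y => 0 * w 0%N y); last first.
  by apply/funext => y; rewrite big_ord0 mul0r.
 by apply: le_trans (SZ _ _ (lexx 0) (bw _)) _; rewrite mul0r.
rewrite big_ord_recr/= (_ : (fun y : T => _) = fun y => \sum_(j < L) c j * w j y + c L * w L y); last first.
 by apply/funext => y; rewrite big_ord_recr.
apply: le_trans (SD _ _ (bs L) (bmZ _ (bw L))) _; apply: lerD => //.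
exact: SZ.
Qed.

Section subadd.
Variables (c : nat -> R) (w : nat -> T -> R).
Hypotheses (c0 : nneg c) (bw : forall j, bm (w j)).

Let LopZ tau a u x : 0 < tau -> 0 <= a -> bm u -> Lop tau (fun y => a * u y) x <= a * Lop tau u x.
Proof.
move=> t0 a0 bu; have t15 : 0 < 15 * tau by rewrite mulr_gt0.
have t16 : 0 < 16 * tau by lra.
have bL := bm_norm (bm_LD t0 x bu).
rewrite -[a * _](HeZ a x t15 bL); apply: le_of_eq.
congr (conv _ _ x); apply/funext => y.
by rewrite !HeZ// -mulrBr normrM (ger0_norm a0).
Qed.

Lemma Lop_sum tau L x : 0 < tau ->
 Lop tau (fun y => \sum_(j < L) c j * w j y) x <= \sum_(j < L) c j * Lop tau (w j) x.
Proof.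
move=> t0; apply: (subadd_sum (S := fun u => Lop tau u x)) => //.
- by move=> u v bu bv; exact: Lop_add.
- by move=> a u a0 bu; exact: LopZ.
Qed.

Lemma Lp_sum tau L x : 0 < tau ->
 Lp tau (fun y => \sum_(j < L) c j * w j y) x <= \sum_(j < L) c j * Lp tau (w j) x.
Proof.
move=> t0; apply: (subadd_sum (S := fun u => Lp tau u x)) => //.
- by move=> u v bu bv; exact: Lp_add.
- move=> a u a0 bu; have t7 : 0 < 7 * tau by rewrite mulr_gt0. have bL := bm_Lop t0 bu; rewrite /Lp -(HeZ a x t7 bL).
 apply: (He_le x t7 _ (bmZ a bL)); first by apply: bm_Lop => //; exact: bmZ. by move=> y; exact: LopZ.
Qed.

Let Heabs_D t u v x : 0 < t -> bm u -> bm v ->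
 He t (fun z => `|u z + v z|) x <= He t (absf u) x + He t (absf v) x.
Proof.
move=> t0 bu bv; have bu' := bm_norm bu; have bv' := bm_norm bv.
rewrite -(HeD x t0 bu' bv'); apply: (He_le x t0 (bm_norm (bmD bu bv)) (bmD bu' bv')) => y.
exact: ler_normD.
Qed.

Let Heabs_Z t a u x : 0 < t -> 0 <= a -> bm u ->
 He t (fun z => `|a * u z|) x <= a * He t (absf u) x.
Proof.
move=> t0 a0 bu; have bu' := bm_norm bu.
rewrite -(HeZ a x t0 bu'); apply: le_of_eq.
by congr (conv _ _ x); apply/funext => y; rewrite normrM (ger0_norm a0).
Qed.

Lemma Heabs_sum t L x : 0 < t ->
 He t (fun z => `|\sum_(j < L) c j * w j z|) x <= \sum_(j < L) c j * He t (fun z => `|w j z|) x.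
Proof.
move=> t0; apply: (subadd_sum (S := fun u => He t (absf u) x)) => //.
- by move=> u v bu bv; exact: Heabs_D.
- by move=> a u a0 bu; exact: Heabs_Z.
Qed.

Lemma mxabs_sum N sg L x : 0 < sg ->
 mx N sg (fun z => `|\sum_(j < L) c j * w j z|) x <= \sum_(j < L) c j * mx N sg (fun z => `|w j z|) x.
Proof.
move=> s0; have sk i : 0 < sg * 4 ^+ i by rewrite mulr_gt0 ?exprn_gt0.
apply: (subadd_sum (S := fun u => mx N sg (absf u) x)) => //.
- move=> u v bu bv; apply: mx_le => [|i iN]; first by rewrite addr_ge0 ?mx_ge0. by apply: le_trans (Heabs_D x (sk i) bu bv) _; apply: lerD; exact: mx_ge.
- move=> a u a0 bu; apply: mx_le => [|i iN]; first by rewrite mulr_ge0 ?mx_ge0. by apply: le_trans (Heabs_Z x (sk i) a0 bu) _; apply: ler_wpM2l => //; exact: mx_ge.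
Qed.
End subadd.

Lemma II_sum_le M L (F : nat -> nat -> T -> R) (B : nat -> R) :
 (forall j i, bm (F j i)) -> (forall j i x, 0 <= F j i x) ->
 (forall j, (j < L)%N -> (II m M (F j) <= (B j)%:E)%E) ->
 (II m M (fun i x => \sum_(j < L) F j i x)%R <= (\sum_(j < L) B j)%:E)%E.
Proof.
move=> bF F0.
have bs L' i : bm (fun y => \sum_(j < L') F j i y).
 elim: L' => [|L' IH]; first by under eq_fun do rewrite big_ord0; exact: bm_cst. by under eq_fun do rewrite big_ord_recr; exact: bmD.
elim: L => [|L IH] hB.
 rewrite big_ord0 /II big1// => i _; under eq_integral do rewrite big_ord0. by rewrite integral0.
rewrite big_ord_recr/= EFinD.
rewrite (_ : (fun i x => _) = fun i x => \sum_(j < L) F j i x + F L i x); last first.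
 by apply/funext => i; apply/funext => x; rewrite big_ord_recr.
rewrite II_add//; last 3 first.
- by move=> i; exact: bm_m (bs L i).
- by move=> i; exact: bm_m.
- by move=> i x; apply: sumr_ge0.
by apply: leeD; [apply: IH => j jL; apply: hB; exact: ltnW|exact: hB].
Qed.

Lemma bm_sum L (F : nat -> T -> R) : (forall j, bm (F j)) -> bm (fun x => \sum_(j < L) F j x).
Proof.
move=> bF; elim: L => [|L IH]; first by under eq_fun do rewrite big_ord0; exact: bm_cst.
by under eq_fun do rewrite big_ord_recr; exact: bmD.
Qed.

Lemma II_sum2 M L (P Q : nat -> nat -> T -> R) (f g : nat -> T -> R) (C : nat -> T -> R) (B : nat -> nat -> R) :
 (forall j i, bm (P j i)) -> (forall j i, bm (Q j i)) -> (forall i, bm (C i)) ->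
 (forall j i x, 0 <= P j i x) -> (forall j i x, 0 <= Q j i x) -> (forall i x, 0 <= C i x) ->
 (forall i, bm (f i)) -> (forall i, bm (g i)) ->
 (forall i x, 0 <= f i x) -> (forall i x, 0 <= g i x) ->
 (forall i x, f i x <= \sum_(j < L) P j i x) -> (forall i x, g i x <= \sum_(j < L) Q j i x) ->
 (forall j k, (j < L)%N -> (k < L)%N -> (II m M (fun i x => C i x * P j i x * Q k i x)%R <= (B j k)%:E)%E) ->
 (II m M (fun i x => C i x * f i x * g i x)%R <= (\sum_(j < L) \sum_(k < L) B j k)%:E)%E.
Proof.
move=> bP bQ bC P0 Q0 C0 bf bg f0 g0 hf hg hB.
have bCPQ j k i : bm (fun x => C i x * P j i x * Q k i x) by apply: bmM => //; exact: bmM.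
have CPQ0 j k i x : 0 <= C i x * P j i x * Q k i x by apply: mulr_ge0 => //; exact: mulr_ge0.
apply: (le_via (II m M (fun i x => \sum_(j < L) \sum_(k < L) C i x * P j i x * Q k i x)%R)).
 apply: II_le.
 - by move=> i; apply: (bm_m (n := n)); apply: bmM => //; exact: bmM.
 - move=> i; apply: (bm_m (n := n)). by apply: (bm_sum L (F := fun j x => \sum_(k < L) C i x * P j i x * Q k i x)) => j;
   exact: (bm_sum L (F := fun k x => C i x * P j i x * Q k i x)).
 - by move=> i x; apply: mulr_ge0 => //; exact: mulr_ge0.
 - move=> i x; under eq_bigr => j _ do rewrite -mulr_sumr. rewrite -mulr_suml -mulr_sumr; apply: ler_pM => //; first exact: mulr_ge0. exact: ler_wpM2l.
apply: (II_sum_le (F := fun j i x => \sum_(k < L) C i x * P j i x * Q k i x) (B := fun j => \sum_(k < L) B j k)).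
- by move=> j i; exact: (bm_sum L (F := fun k x => C i x * P j i x * Q k i x)).
- by move=> j i x; apply: sumr_ge0.
- by move=> j jL; apply: (II_sum_le (F := fun k i x => C i x * P j i x * Q k i x) (B := B j)) => // k kL; exact: hB.
Qed.
End limits.

(** * Interpolation between the extreme exponents *)

Section main.
Variables (R : realType) (n : nat).
Notation T := 'rV[R]_n.
Notation m := (lebm R n).
Implicit Types (u : T -> R) (i : nat).

Lemma cvg_prod3 (a b c : nat -> R) (la lb lc : R) : a k @[k --> \oo] --> la -> b k @[k --> \oo] --> lb ->
 c k @[k --> \oo] --> lc -> a k * b k * c k @[k --> \oo] --> la * lb * lc.
Proof. by move=> ha hb hc; apply: cvgM => //; exact: cvgM. Qed.

(** Here a1, a2 are logarithms of the sizes of the atoms and s1, s2 the reciprocal Lebesgue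
    exponents. The vertex to choose is the one with the large weight on the smaller of a1, a2; its
    exponent then lies below s1 a1 + s2 a2 by a multiple of their distance. *)
Lemma expo2 (a1 a2 s1 s2 s0 d : R) : s1 + s2 = 1 -> 0 < s0 -> s0 <= s1 -> s0 <= s2 -> 0 < d -> d <= s0 / 2 ->
 (1 - d) * a1 + d * a2 - (s1 * a1 + s2 * a2) <= - (s0 / 2) * `|a1 - a2| \/
 (1 - d) * a2 + d * a1 - (s1 * a1 + s2 * a2) <= - (s0 / 2) * `|a1 - a2|.
Proof.
move=> e s00 h1 h2 d0 ds; have [a|a] := leP a1 a2; [left|right].
 rewrite ler0_norm ?subr_le0//; have x0 : 0 <= a2 - a1 by rewrite subr_ge0. have -> : (1 - d) * a1 + d * a2 - (s1 * a1 + s2 * a2) = (d - s2) * (a2 - a1).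
  by rewrite (_ : s1 = 1 - s2); [ring|lra].
 by rewrite opprB; apply: ler_wpM2r; lra.
rewrite gtr0_norm ?subr_gt0//; have x0 : 0 <= a1 - a2 by rewrite subr_ge0 ltW.
have -> : (1 - d) * a2 + d * a1 - (s1 * a1 + s2 * a2) = (d - s1) * (a1 - a2).
 by rewrite (_ : s2 = 1 - s1); [ring|lra].
by apply: ler_wpM2r; lra.
Qed.

(** The same choice among three sizes. The first alternative is the exponent of [vertex_max]; the
    two others are those of [vertex_sq], where the first atom enters only through its bound 1. *)
Lemma expo3 (a1 a2 a3 s1 s2 s3 s0 d : R) : s1 + s2 + s3 = 1 -> 0 < s0 -> s0 <= s1 -> s0 <= s2 -> s0 <= s3 ->
 0 < d -> d <= s0 / 4 ->
 let D := - (s0 / 4) * (`|a1 - a2| + `|a1 - a3|) in let S := s1 * a1 + s2 * a2 + s3 * a3 in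
 [\/ (1 - 2 * d) * a1 + d * a2 + d * a3 - S <= D, (1 - d) * a2 + d * a3 - S <= D |
  (1 - d) * a3 + d * a2 - S <= D].
Proof.
move=> e s00 h1 h2 h3 d0 ds D S.
have key (x y z : R) : 0 <= x -> 0 <= y -> s0 / 4 * z <= (s0 / 2) * (x + y) -> forall v : R, v <= d * (x + y) - s0 * (x + y) -> v <= - (s0 / 4) * z.
 move=> x0 y0 hz v hv; have : d * (x + y) <= s0 / 4 * (x + y) by apply: ler_wpM2r => //; exact: addr_ge0.
 have : 0 <= s0 * (x + y) by rewrite mulr_ge0 ?addr_ge0// ltW. rewrite mulNr; move: (s0 / 4 * z) hz => Z hz.
 rewrite (_ : s0 / 4 * (x + y) = s0 * (x + y) / 4); last by rewrite mulrAC. move: hz; rewrite (_ : s0 / 2 * (x + y) = s0 * (x + y) / 2); last by rewrite mulrAC.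
 move: hv; move: (s0 * (x + y)) (d * (x + y)) => X Y; lra.
have mono (s x : R) : s0 <= s -> 0 <= x -> s0 * x <= s * x by move=> ? ?; exact: ler_wpM2r.
have [m1|m1] := boolP ((a1 <= a2) && (a1 <= a3)).
 case/andP: m1 => u v; apply: Or31. have x0 : 0 <= a2 - a1 by lra. have y0 : 0 <= a3 - a1 by lra. apply: (key (a2 - a1) (a3 - a1)) => //.
  rewrite !ler0_norm ?subr_le0// !opprB; apply: ler_wpM2r; first exact: addr_ge0. lra.
 have := mono _ _ h2 x0; have := mono _ _ h3 y0. rewrite /S (_ : s1 = 1 - s2 - s3); last by lra. nra.
have [u|u] := leP a2 a3.
 have v : a2 < a1 by lra. apply: Or32; have x0 : 0 <= a1 - a2 by rewrite subr_ge0 ltW. have y0 : 0 <= a3 - a2 by lra. apply: (key (a1 - a2) (a3 - a2)) => //.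
  have : `|a1 - a3| <= (a1 - a2) + (a3 - a2).
   by rewrite ler_norml; apply/andP; split; lra.
  rewrite (ger0_norm x0) => h; rewrite (_ : s0 / 2 = s0 / 4 * 2); last by field. rewrite -[leRHS]mulrA; apply: ler_wpM2l; [lra|lra].
 have := mono _ _ h1 x0. rewrite /S (_ : s2 = 1 - s1 - s3); last by lra. nra.
have v : a3 < a1 by lra.
apply: Or33; have x0 : 0 <= a1 - a3 by rewrite subr_ge0 ltW. have y0 : 0 <= a2 - a3 by lra.
apply: (key (a1 - a3) (a2 - a3)) => //.
 have : `|a1 - a2| <= (a1 - a3) + (a2 - a3).
  by rewrite ler_norml; apply/andP; split; lra.
 rewrite (ger0_norm x0) => h; rewrite (_ : s0 / 2 = s0 / 4 * 2); last by field. rewrite -[leRHS]mulrA; apply: ler_wpM2l; [lra|lra].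
have := mono _ _ h1 x0.
rewrite /S (_ : s3 = 1 - s1 - s2); last by lra.
nra.
Qed.

Lemma dnE (i j : nat) : `|i%:R - j%:R : R| = (dn i j)%:R.
Proof.
rewrite /dn; have [h|h] := leqP i j.
 by rewrite (eqP h) add0n ler0_norm ?subr_le0 ?ler_nat// opprB natrB.
by rewrite (eqP (ltnW h)) addn0 gtr0_norm ?subr_gt0 ?ltr_nat// natrB// ltnW.
Qed.

Lemma powR_tdy (K i : nat) (x : R) : (2 * tdy R K i) `^ x = 2 `^ (x * (1 + (i%:R - K%:R))).
Proof. by rewrite /tdy -{1}(powRr1 (ler0n R 2)) -powRDp// -powRrM mulrC. Qed.

Lemma powR_2_le (x y : R) : x <= y -> 2 `^ x <= 2 `^ y.
Proof. by move=> xy; apply: ler_powR; rewrite ?ler1n. Qed.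

Lemma rho_lt1 (c : R) : 0 < c -> 2 `^ (- c) < 1 :> R.
Proof.
move=> c0; rewrite powRN invf_lt1 ?powR_gt0// /powR gt_eqF// expR_gt1 mulr_gt0//.
by rewrite ln_gt0// ltr1n.
Qed.

Lemma min3_gt0 (a b c : R) : 0 < a -> 0 < b -> 0 < c -> exists s0, [/\ 0 < s0, s0 <= a, s0 <= b & s0 <= c].
Proof.
move=> a0 b0 c0; exists (Num.min a (Num.min b c)); split.
- by rewrite !lt_min a0 b0 c0.
- by rewrite ge_min lexx.
- by rewrite !ge_min lexx orbT.
- by rewrite !ge_min lexx !orbT.
Qed.

Lemma main_bmo (p1 p2 : R) (q1 q2 : \bar R) : 1 < p1 -> 1 < p2 -> (1 <= q1)%E -> (1 <= q2)%E ->
 p1^-1 + p2^-1 = 1 -> qinv q1 + qinv q2 = 1 ->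
 exists2 C, 0 < C & forall (phi v w gv gw : T -> R) (N A B t0 : R) M,
  bm phi -> 0 < N -> (forall t x, 0 < t -> Var t phi x <= N) ->
  bm v -> bm gv -> nneg gv -> (forall x, `|v x| <= gv x) ->
  bm w -> bm gw -> nneg gw -> (forall x, `|w x| <= gw x) ->
  0 < A -> 0 < B -> (lorentz p1 q1 gv <= A%:E)%E -> (lorentz p2 q2 gw <= B%:E)%E -> 0 < t0 ->
  (II m M (fun i x => Lop (ta t0 i) phi x * Lop (ta t0 i) v x *
    He (16 * ta t0 i) (absf w) x)%R <= (C * N `^ 2^-1 * A * B)%:E)%E.
Proof.
move=> p11 p21 q11 q21 pe qe.
have p10 : 0 < p1 by lra. have p20 : 0 < p2 by lra.
have i1 : 0 < p1^-1 by rewrite invr_gt0. have i2 : 0 < p2^-1 by rewrite invr_gt0.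
have [s0 [s00 s1 s2 _]] := min3_gt0 i1 i2 i2.
have s0h : s0 <= 2^-1 by lra.
(* Small enough for [expo2], which wants d <= s0 / 2, and for q = 1 / (1 - d) to lie between 1 and
   2. *)
pose d := s0 / 4; have d0 : 0 < d by rewrite divr_gt0.
have d14 : d <= 4^-1 by rewrite /d; lra.
pose q := (1 - d)^-1; have qi : q^-1 = 1 - d by rewrite /q invrK.
have dlt : 0 < 1 - d by lra.
have hq : 1 < q < 2.
 apply/andP; split; first by rewrite /q invf_gt1//; lra. by rewrite /q -[ltRHS]invrK ltf_pV2 ?posrE; lra.
have /andP[hq1 hq2] := hq.
have cc := c_car_gt0 hq1; have cg := c_gap_gt0 hq1.
pose C1 := c_car q `^ q^-1 * 2 `^ (1 - q^-1); pose C2 := 2 * (c_car q `^ 2^-1 * c_gap q `^ 2^-1).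
have C10 : 0 < C1 by exact: (mulr_gt0 (powR_gt0 _ cc) (powR_gt0 _ (ltr0Sn R 1))).
have C20 : 0 < C2 by exact: (mulr_gt0 (ltr0Sn R 1) (mulr_gt0 (powR_gt0 _ cc) (powR_gt0 _ cg))).
pose rho : R := 2 `^ (- (s0 / 2)).
have rho0 : 0 < rho by exact: powR_gt0.
have s02 : 0 < s0 / 2 by lra.
have rho1 : rho < 1 by exact: rho_lt1.
have c10 : 0 < 1 - rho by lra.
(* 32 is 4 times 4 from the normalisations 4 A and 4 B, times 2 from the atom sizes 2 t_j; the last
   factor is the constant of [sum2_dn]. *)
exists (32 * (C1 + C2) * (2 * (2 * (1 - rho)^-1))).
 by rewrite !mulr_gt0 ?invr_gt0// addr_gt0.
move=> phi v w gv gw N A B t0 M bphi N0 VN bv bgv gv0 vgv bw bgw gw0 wgw A0 B0 lA lB t00.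
have N2 : 0 < N `^ 2^-1 by exact: powR_gt0.
pose V := lapp v gv; pose W := lapp w gw.
have hV : happ v V by exact: (lapp_happ bv bgv gv0 vgv p11 q11 A0 lA).
have hW : happ w W by exact: (lapp_happ bw bgw gw0 wgw p21 q21 B0 lB).
have [_ bV _] := hV; have [_ bW _] := hW.
have [mgv [Bv gvB']] := bgv; have [mgw [Bw gwB']] := bgw.
have gvB x : gv x <= Bv by apply: le_trans (gvB' x); exact: ler_norm.
have gwB x : gw x <= Bw by apply: le_trans (gwB' x); exact: ler_norm.
have tp i : 0 < ta t0 i by exact: ta_gt0.
have t16 i : 0 < 16 * ta t0 i by rewrite mulr_gt0.
have bL u i : bm u -> bm (Lop (ta t0 i) u) by move=> ?; exact: bm_Lop.
have bH u i : bm u -> bm (He (16 * ta t0 i) (absf u)) by move=> ?; apply: bm_He => //; exact: bm_norm.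
have L0 u i x : 0 <= Lop (ta t0 i) u x by exact: Lop_ge0.
have H0 u i x : 0 <= He (16 * ta t0 i) (absf u) x by exact: He_ge0.
apply: (@II_lim _ _ M _ (fun K i x => Lop (ta t0 i) phi x * Lop (ta t0 i) (V K) x * He (16 * ta t0 i) (fun y => `|W K y|) x)).
- by move=> K i; exact: (bmM (bmM (bL _ i bphi) (bL _ i (bV K))) (bH _ i (bW K))).
- by move=> K i x; exact: (mulr_ge0 (mulr_ge0 (L0 _ _ _) (L0 _ _ _)) (H0 _ _ _)).
- move=> i x; exact: (cvg_prod3 (cvg_cst _) (happ_Lop hV (tp i)) (happ_He (happ_abs hW) (t16 i))).
move=> K; set L := (2 * K)%N.
pose hv j := rr gv (tdy R K j); pose hw j := rr gw (tdy R K j).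
have hv0 j : 0 <= hv j by exact: rr_ge0. have hw0 j : 0 <= hw j by exact: rr_ge0.
have rv j := rs_atom mgv gv0 gvB K bv vgv j. have rw j := rs_atom mgw gw0 gwB K bw wgw j.
have bav j : bm (atom gv K v j) by have [] := rv j.
have baw j : bm (atom gw K w j) by have [] := rw j.
pose bb j := hv j * tdy R K j `^ p1^-1 / (4 * A); pose bb' j := hw j * tdy R K j `^ p2^-1 / (4 * B).
have Q1 : qunit (qinv q1) L bb by exact: (lorentz_qunit mgv gv0 gvB p11 A0 K q11 lA).
have Q2 : qunit (qinv q2) L bb' by exact: (lorentz_qunit mgw gw0 gwB p21 B0 K q21 lB).
have qi0 (q' : \bar R) : (1 <= q')%E -> 0 <= qinv q'.
 by case: q' => [r| |]//= r1; rewrite invr_ge0 (le_trans ler01)// -lee_fin.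
(* One pair of atoms: the better of the two vertices, together with the powers of the times
   contained in the levels, leaves the decay rho^|j-k|. *)
have key j k : (j < L)%N -> (k < L)%N -> (II m M (fun i x => Lop (ta t0 i) phi x *
   (hv j * Lop (ta t0 i) (atom gv K v j) x) * (hw k * He (16 * ta t0 i) (fun y => `|atom gw K w k y|) x))%R <=
  (32 * (C1 + C2) * N `^ 2^-1 * A * B * (rho ^+ dn j k * (bb j * bb' k)))%:E)%E.
 move=> jL kL. have e1 : 0 < 2 * tdy R K j by rewrite mulr_gt0 ?tdy_gt0. have e2 : 0 < 2 * tdy R K k by rewrite mulr_gt0 ?tdy_gt0.
 rewrite (_ : (fun i x => _) = fun i x => hv j * hw k * (Lop (ta t0 i) phi x * Lop (ta t0 i) (atom gv K v j) x *
   He (16 * ta t0 i) (fun y => `|atom gw K w k y|) x)); last first.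
  apply/funext => i; apply/funext => x. move: (Lop _ _ _) (Lop _ _ _) (He _ _ _) => a b c; ring.
 have b3 i := bmM (bmM (bL _ i bphi) (bL _ i (bav j))) (bH _ i (baw k)). rewrite II_scale//; first last.
 - by move=> i x; exact: (mulr_ge0 (mulr_ge0 (L0 _ _ _) (L0 _ _ _)) (H0 _ _ _)).
 - by move=> i; exact: bm_m (b3 i).
 - exact: mulr_ge0.
 set a1 : R := j%:R - K%:R; set a2 : R := k%:R - K%:R. have hvE : hv j = 4 * A * bb j * 2 `^ (- (p1^-1 * a1)).
  have h : 0 < 2 `^ (p1^-1 * a1) :> R by []. rewrite /bb /tdy -powRrM [_ * p1^-1]mulrC -/a1 powRN; field. by rewrite !gt_eqF.
 have hwE : hw k = 4 * B * bb' k * 2 `^ (- (p2^-1 * a2)).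
  have h : 0 < 2 `^ (p2^-1 * a2) :> R by []. rewrite /bb' /tdy -powRrM [_ * p2^-1]mulrC -/a2 powRN; field. by rewrite !gt_eqF.
 have bbk : 0 <= bb j * bb' k.
  by apply: mulr_ge0; [case/andP: (qunit_ge0 Q1 jL)|case/andP: (qunit_ge0 Q2 kL)].
 have X : exists2 E, (II m M (fun i x => Lop (ta t0 i) phi x * Lop (ta t0 i) (atom gv K v j) x *
   He (16 * ta t0 i) (fun y => `|atom gw K w k y|) x)%R <= ((C1 + C2) * N `^ 2^-1 * (2 * 2 `^ E))%:E)%E &
   E - (p1^-1 * a1 + p2^-1 * a2) <= - (s0 / 2) * `|a1 - a2|.
  have ds : d <= s0 / 2 by rewrite /d; lra. have [hE|hE] := expo2 a1 a2 pe s00 s1 s2 d0 ds.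
   exists ((1 - d) * a1 + d * a2) => //. apply: (le_trans (vertex_bmo_v bphi N0 VN M hq e1 e2 t00 (rv j) (rw k))).
   rewrite lee_fin qi !powR_tdy -powRDp// -/a1 -/a2 (_ : (1 - d) * (1 + a1) + _ = 1 + ((1 - d) * a1 + d * a2)); last by ring.
   rewrite powRDp// powRr1// mulrA; apply: ler_wpM2r; first by rewrite mulr_ge0 ?powR_ge0.
   by rewrite mulrA; apply: ler_wpM2r; [exact: ltW|rewrite -/C2 lerDr ltW].
  exists ((1 - d) * a2 + d * a1) => //. apply: (le_trans (vertex_bmo_w bphi N0 VN M hq e1 e2 t00 (rv j) (rw k))).
  rewrite lee_fin qi !powR_tdy -powRDp// -/a1 -/a2 (_ : (1 - d) * (1 + a2) + _ = 1 + ((1 - d) * a2 + d * a1)); last by ring.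
  rewrite [2 `^ (1 + (_ + _))]powRDp// powRr1//; apply: ler_wpM2r; first by rewrite mulr_ge0 ?powR_ge0.
  by apply: ler_wpM2r; [exact: ltW|rewrite -qi -/C1 lerDl ltW].
 have [E hE1 hE2] := X. apply: (le_via ((hv j * hw k)%:E * ((C1 + C2) * N `^ 2^-1 * (2 * 2 `^ E))%:E)%E).
  by apply: lee_wpmul2l => //; rewrite lee_fin mulr_ge0.
 rewrite -EFinM lee_fin hvE hwE. have aE : a1 - a2 = j%:R - k%:R by rewrite /a1 /a2; ring. have rE : rho ^+ dn j k = 2 `^ (- (s0 / 2) * `|a1 - a2|).
  by rewrite aE dnE -powR_mulrn ?powR_ge0// -powRrM.
 have pE : 2 `^ (- (p1^-1 * a1)) * 2 `^ (- (p2^-1 * a2)) * 2 `^ E <= rho ^+ dn j k :> R.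
  rewrite rE -!powRDp//; apply: powR_2_le; apply: le_trans hE2; apply: le_of_eq; ring.
 rewrite [leLHS](_ : _ = (32 * (C1 + C2) * N `^ 2^-1 * A * B * (bb j * bb' k)) *
  (2 `^ (- (p1^-1 * a1)) * 2 `^ (- (p2^-1 * a2)) * 2 `^ E)); last by ring.
 rewrite [X in _ <= _ * X]mulrC [leRHS]mulrA; apply: ler_wpM2l => //. by rewrite mulr_ge0// !mulr_ge0 ?(ltW A0) ?(ltW B0) ?(ltW N2) ?addr_ge0 ?(ltW C10) ?(ltW C20).
have bPs j i : bm (fun x => hv j * Lop (ta t0 i) (atom gv K v j) x) by apply: bmZ; exact: bL.
have bQs k i : bm (fun x => hw k * He (16 * ta t0 i) (fun y => `|atom gw K w k y|) x) by apply: bmZ; exact: bH.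
have := @II_sum2 R n M L (fun j i x => hv j * Lop (ta t0 i) (atom gv K v j) x)
 (fun k i x => hw k * He (16 * ta t0 i) (fun y => `|atom gw K w k y|) x)
 (fun i => Lop (ta t0 i) (V K)) (fun i => He (16 * ta t0 i) (fun y => `|W K y|)) (fun i => Lop (ta t0 i) phi)
 (fun j k => 32 * (C1 + C2) * N `^ 2^-1 * A * B * (rho ^+ dn j k * (bb j * bb' k))) bPs bQs (fun i => bL _ i bphi).
move=> /(_ (fun j i x => mulr_ge0 (hv0 j) (L0 _ i x)) (fun j i x => mulr_ge0 (hw0 j) (H0 _ i x)) (fun i x => L0 _ i x)).
move=> /(_ (fun i => bL _ i (bV K)) (fun i => bH _ i (bW K)) (fun i x => L0 _ i x) (fun i x => H0 _ i x)).
move=> /(_ (fun i x => Lop_sum hv0 bav L x (tp i)) (fun i x => Heabs_sum hw0 baw L x (t16 i)) key).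
move=> /le_trans; apply; rewrite lee_fin.
under eq_bigr => j _ do rewrite -mulr_sumr.
rewrite -mulr_sumr.
have := sum2_dn rho0 rho1 (qi0 _ q11) (qi0 _ q21) qe Q1 Q2.
set S := \sum_(i < L) _; set s' := 2 * (2 * _) => hS.
rewrite (_ : 32 * (C1 + C2) * s' * N `^ 2^-1 * A * B = 32 * (C1 + C2) * N `^ 2^-1 * A * B * s'); last by ring.
apply: ler_wpM2l => //.
by rewrite !mulr_ge0 ?(ltW A0) ?(ltW B0) ?(ltW N2) ?addr_ge0 ?(ltW C10) ?(ltW C20).
Qed.

Lemma II_sum3 M L (P Q S : nat -> nat -> T -> R) (f g h : nat -> T -> R) (B : nat -> nat -> nat -> R) :
 (forall j i, bm (P j i)) -> (forall j i, bm (Q j i)) -> (forall j i, bm (S j i)) ->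
 (forall j i x, 0 <= P j i x) -> (forall j i x, 0 <= Q j i x) -> (forall j i x, 0 <= S j i x) ->
 (forall i, bm (f i)) -> (forall i, bm (g i)) -> (forall i, bm (h i)) ->
 (forall i x, 0 <= f i x) -> (forall i x, 0 <= g i x) -> (forall i x, 0 <= h i x) ->
 (forall i x, f i x <= \sum_(j < L) P j i x) -> (forall i x, g i x <= \sum_(j < L) Q j i x) ->
 (forall i x, h i x <= \sum_(j < L) S j i x) ->
 (forall j k l, (j < L)%N -> (k < L)%N -> (l < L)%N ->
   (II m M (fun i x => P j i x * Q k i x * S l i x)%R <= (B j k l)%:E)%E) ->
 (II m M (fun i x => f i x * g i x * h i x)%R <= (\sum_(j < L) \sum_(k < L) \sum_(l < L) B j k l)%:E)%E.
Proof.
move=> bP bQ bS P0 Q0 S0 bf bg bh f0 g0 h0 hf hg hh hB.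
have b3 j i : bm (fun x => P j i x * g i x * h i x) by apply: bmM => //; exact: bmM.
apply: (le_via (II m M (fun i x => \sum_(j < L) P j i x * g i x * h i x)%R)).
 apply: II_le.
 - by move=> i; apply: (bm_m (n := n)); apply: bmM => //; exact: bmM.
 - by move=> i; apply: (bm_m (n := n)); exact: (bm_sum L (F := fun j x => P j i x * g i x * h i x)).
 - by move=> i x; apply: mulr_ge0 => //; exact: mulr_ge0.
 - move=> i x; rewrite -!mulr_suml; apply: ler_wpM2r => //; exact: ler_wpM2r.
apply: (II_sum_le (F := fun j i x => P j i x * g i x * h i x) (B := fun j => \sum_(k < L) \sum_(l < L) B j k l)).
- by [].
- by move=> j i x; apply: mulr_ge0 => //; exact: mulr_ge0.
- move=> j jL; apply: (@II_sum2 R n M L Q S g h (P j) (B j)) => // k l kL lL; exact: hB.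
Qed.

Lemma mxabs_le1 N (sg e : R) u x : 0 < sg -> rs e u -> 0 <= mx N sg (absf u) x <= 1.
Proof.
move=> s0 ru; have [bu _ u1 _] := rs_norm ru; rewrite mx_ge0/=; apply: mx_le => // i iN.
have sk : 0 < sg * 4 ^+ i by rewrite mulr_gt0.
have le1 y : `|u y| <= 1 by rewrite -[X in X <= _]normr_id.
by apply: (le_trans (He_le x sk bu (bm_cst _ 1) le1)); rewrite He_cst.
Qed.

Lemma main_sob (p1 p2 p3 : R) (q1 q2 q3 : \bar R) : 1 < p1 -> 1 < p2 -> 1 < p3 ->
 (1 <= q1)%E -> (1 <= q2)%E -> (1 <= q3)%E ->
 p1^-1 + p2^-1 + p3^-1 = 1 -> qinv q1 + qinv q2 + qinv q3 = 1 ->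
 exists2 C, 0 < C & forall (u1 u2 u3 g1 g2 g3 : T -> R) (A1 A2 A3 sg t2 t3 : R) N M,
  bm u1 -> bm g1 -> nneg g1 -> (forall x, `|u1 x| <= g1 x) ->
  bm u2 -> bm g2 -> nneg g2 -> (forall x, `|u2 x| <= g2 x) ->
  bm u3 -> bm g3 -> nneg g3 -> (forall x, `|u3 x| <= g3 x) ->
  0 < A1 -> 0 < A2 -> 0 < A3 -> (lorentz p1 q1 g1 <= A1%:E)%E -> (lorentz p2 q2 g2 <= A2%:E)%E ->
  (lorentz p3 q3 g3 <= A3%:E)%E -> 0 < sg -> 0 < t2 -> 0 < t3 ->
  (II m M (fun i x => mx N sg (absf u1) x * Lp (ta t2 i) u2 x * Lp (ta t3 i) u3 x)%R
   <= (C * A1 * A2 * A3)%:E)%E.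
Proof.
move=> p11 p21 p31 q11 q21 q31 pe qe.
have p10 : 0 < p1 by lra. have p20 : 0 < p2 by lra.
have p30 : 0 < p3 by lra.
have i1 : 0 < p1^-1 by rewrite invr_gt0. have i2 : 0 < p2^-1 by rewrite invr_gt0.
have i3 : 0 < p3^-1 by rewrite invr_gt0.
have [s0 [s00 s1 s2 s3]] := min3_gt0 i1 i2 i3.
have s0h : s0 <= 3^-1 by lra.
pose d := s0 / 4; have d0 : 0 < d by rewrite divr_gt0.
have ds : d <= s0 / 4 by [].
(* With this q the exponents of [vertex_max] are (1 - 2 d, d, d) and those of [vertex_sq] are (1 -
   d, d). *)
pose q := (1 - 2 * d)^-1; have qi : q^-1 = 1 - 2 * d by rewrite /q invrK.
have dlt : 0 < 1 - 2 * d by lra.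
have hq : 1 < q by rewrite /q invf_gt1; rewrite /d; lra.
have [C1 C10 HA] := vertex_max n hq; have [C2 C20 HB] := vertex_sq n hq.
have qd : (1 - q^-1) / 2 = d by lra.
pose rho : R := 2 `^ (- (s0 / 4)).
have rho0 : 0 < rho by exact: powR_gt0.
have rho1 : rho < 1 by apply: rho_lt1.
have c10 : 0 < 1 - rho by lra.
exists (128 * (C1 + C2) * (3 * (2 * (1 - rho)^-1) ^+ 2)).
 by rewrite !mulr_gt0 ?invr_gt0// addr_gt0.
move=> u1 u2 u3 g1 g2 g3 A1 A2 A3 sg t2 t3 N M bu1 bg1 g10 ug1 bu2 bg2 g20 ug2 bu3 bg3 g30 ug3
 A10 A20 A30 l1 l2 l3 sg0 t20 t30.
pose V1 := lapp u1 g1; pose V2 := lapp u2 g2; pose V3 := lapp u3 g3.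
have hV1 : happ u1 V1 by exact: (lapp_happ bu1 bg1 g10 ug1 p11 q11 A10 l1).
have hV2 : happ u2 V2 by exact: (lapp_happ bu2 bg2 g20 ug2 p21 q21 A20 l2).
have hV3 : happ u3 V3 by exact: (lapp_happ bu3 bg3 g30 ug3 p31 q31 A30 l3).
have [_ bV1 _] := hV1; have [_ bV2 _] := hV2; have [_ bV3 _] := hV3.
have [mg1 [B1 gB1']] := bg1; have [mg2 [B2 gB2']] := bg2; have [mg3 [B3 gB3']] := bg3.
have gB1 x : g1 x <= B1 by apply: le_trans (gB1' x); exact: ler_norm.
have gB2 x : g2 x <= B2 by apply: le_trans (gB2' x); exact: ler_norm.
have gB3 x : g3 x <= B3 by apply: le_trans (gB3' x); exact: ler_norm.
have bL (t : R) i u : 0 < t -> bm u -> bm (Lp (ta t i) u) by move=> ?; apply: bm_Lp; exact: ta_gt0.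
have L0 (t : R) i u x : 0 < t -> 0 <= Lp (ta t i) u x by move=> ?; apply: Lp_ge0; exact: ta_gt0.
have bX u : bm u -> bm (mx N sg (absf u)) by move=> bu; apply: bm_mx => //; exact: bm_norm.
have X0 u x : 0 <= mx N sg (absf u) x by exact: mx_ge0.
apply: (@II_lim _ _ M _ (fun K i x => mx N sg (fun y => `|V1 K y|) x * Lp (ta t2 i) (V2 K) x * Lp (ta t3 i) (V3 K) x)).
- by move=> K i; exact: (bmM (bmM (bX _ (bV1 K)) (bL _ i _ t20 (bV2 K))) (bL _ i _ t30 (bV3 K))).
- by move=> K i x; exact: (mulr_ge0 (mulr_ge0 (X0 _ _) (L0 _ _ _ _ t20)) (L0 _ _ _ _ t30)).
- move=> i x. exact: (cvg_prod3 (happ_mx (happ_abs hV1) sg0) (happ_Lp hV2 (ta_gt0 i t20)) (happ_Lp hV3 (ta_gt0 i t30))).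
move=> K; set L := (2 * K)%N.
pose h1 j := rr g1 (tdy R K j); pose h2 j := rr g2 (tdy R K j); pose h3 j := rr g3 (tdy R K j).
have h10 j : 0 <= h1 j by exact: rr_ge0. have h20 j : 0 <= h2 j by exact: rr_ge0.
have h30 j : 0 <= h3 j by exact: rr_ge0.
have r1 j := rs_atom mg1 g10 gB1 K bu1 ug1 j. have r2 j := rs_atom mg2 g20 gB2 K bu2 ug2 j.
have r3 j := rs_atom mg3 g30 gB3 K bu3 ug3 j.
have ba1 j : bm (atom g1 K u1 j) by have [] := r1 j.
have ba2 j : bm (atom g2 K u2 j) by have [] := r2 j.
have ba3 j : bm (atom g3 K u3 j) by have [] := r3 j.
pose b1 j := h1 j * tdy R K j `^ p1^-1 / (4 * A1); pose b2 j := h2 j * tdy R K j `^ p2^-1 / (4 * A2).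
pose b3 j := h3 j * tdy R K j `^ p3^-1 / (4 * A3).
have Q1 : qunit (qinv q1) L b1 by exact: (lorentz_qunit mg1 g10 gB1 p11 A10 K q11 l1).
have Q2 : qunit (qinv q2) L b2 by exact: (lorentz_qunit mg2 g20 gB2 p21 A20 K q21 l2).
have Q3 : qunit (qinv q3) L b3 by exact: (lorentz_qunit mg3 g30 gB3 p31 A30 K q31 l3).
have qi0 (q' : \bar R) : (1 <= q')%E -> 0 <= qinv q'.
 by case: q' => [r| |]//= r1'; rewrite invr_ge0 (le_trans ler01)// -lee_fin.
pose Cf := 128 * (C1 + C2) * A1 * A2 * A3.
have Cf0 : 0 <= Cf by rewrite /Cf !mulr_ge0// ?(ltW A10) ?(ltW A20) ?(ltW A30) ?addr_ge0 ?(ltW C10) ?(ltW C20).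
have key j k l : (j < L)%N -> (k < L)%N -> (l < L)%N -> (II m M (fun i x =>
   (h1 j * mx N sg (fun y => `|atom g1 K u1 j y|) x) * (h2 k * Lp (ta t2 i) (atom g2 K u2 k) x) *
   (h3 l * Lp (ta t3 i) (atom g3 K u3 l) x))%R <=
  (Cf * (rho ^+ (dn j k + dn j l) * (b1 j * b2 k * b3 l)))%:E)%E.
 move=> jL kL lL. have e1 : 0 < 2 * tdy R K j by rewrite mulr_gt0 ?tdy_gt0. have e2 : 0 < 2 * tdy R K k by rewrite mulr_gt0 ?tdy_gt0.
 have e3 : 0 < 2 * tdy R K l by rewrite mulr_gt0 ?tdy_gt0.
 pose F i x := mx N sg (fun y => `|atom g1 K u1 j y|) x * Lp (ta t2 i) (atom g2 K u2 k) x * Lp (ta t3 i) (atom g3 K u3 l) x.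
 rewrite (_ : (fun i x => _) = fun i x => h1 j * h2 k * h3 l * F i x); last first.
  apply/funext => i; apply/funext => x; rewrite /F. move: (mx _ _ _ _) (Lp _ _ _) (Lp _ _ _) => a b c; ring.
 have bF i : bm (F i) := bmM (bmM (bX _ (ba1 j)) (bL _ i _ t20 (ba2 k))) (bL _ i _ t30 (ba3 l)).
 have F0 i x : 0 <= F i x := mulr_ge0 (mulr_ge0 (X0 _ _) (L0 _ _ _ _ t20)) (L0 _ _ _ _ t30).
 have hh0 : 0 <= h1 j * h2 k * h3 l := mulr_ge0 (mulr_ge0 (h10 j) (h20 k)) (h30 l). rewrite (II_scale m M hh0 (fun i => bm_m (bF i)) F0).
 set a1 : R := j%:R - K%:R; set a2 : R := k%:R - K%:R; set a3 : R := l%:R - K%:R.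
 have hE (h A b p a : R) (t : R) : 0 < A -> b = h * t `^ p^-1 / (4 * A) -> t = 2 `^ a -> h = 4 * A * b * 2 `^ (- (p^-1 * a)).
  move=> A0 -> ->; have hp : 0 < 2 `^ (p^-1 * a) :> R by exact: powR_gt0. by rewrite -powRrM [_ * p^-1]mulrC powRN; field; rewrite !gt_eqF.
 have h1E := hE (h1 j) A1 (b1 j) p1 a1 (tdy R K j) A10 (erefl _) (erefl _). have h2E := hE (h2 k) A2 (b2 k) p2 a2 (tdy R K k) A20 (erefl _) (erefl _).
 have h3E := hE (h3 l) A3 (b3 l) p3 a3 (tdy R K l) A30 (erefl _) (erefl _). have bbk : 0 <= b1 j * b2 k * b3 l.
  apply: mulr_ge0; last by case/andP: (qunit_ge0 Q3 lL). by apply: mulr_ge0; [case/andP: (qunit_ge0 Q1 jL)|case/andP: (qunit_ge0 Q2 kL)].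
 have X : exists2 E, (II m M F <= ((C1 + C2) * (2 * 2 `^ E))%:E)%E &
   E - (p1^-1 * a1 + p2^-1 * a2 + p3^-1 * a3) <= - (s0 / 4) * (`|a1 - a2| + `|a1 - a3|).
  have le1 : C1 <= C1 + C2 by rewrite lerDl ltW. have le2 : C2 <= C1 + C2 by rewrite lerDr ltW. have bk := bX _ (ba1 j); have k01 x := mxabs_le1 N x sg0 (r1 j).
  have [hE'|hE'|hE'] := expo3 a1 a2 a3 pe s00 s1 s2 s3 d0 ds.
  - exists ((1 - 2 * d) * a1 + d * a2 + d * a3) => //. apply: (le_trans (HA _ _ _ _ _ _ sg t2 t3 N M e1 e2 e3 sg0 t20 t30 (r1 j) (r2 k) (r3 l))).
   rewrite lee_fin qd qi !powR_tdy -!powRDp// -/a1 -/a2 -/a3. rewrite (_ : (1 - 2 * d) * (1 + a1) + _ = 1 + ((1 - 2 * d) * a1 + d * a2 + d * a3)); last by ring.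
   by rewrite powRDp// powRr1//; apply: ler_wpM2r.
  - exists ((1 - d) * a2 + d * a3) => //. apply: (le_trans (HB _ _ _ _ _ t2 t3 M e2 e3 t20 t30 bk k01 (r2 k) (r3 l))).
   rewrite lee_fin qd !powR_tdy -!powRDp// -/a2 -/a3. rewrite (_ : (1 - d) * (1 + a2) + _ = 1 + ((1 - d) * a2 + d * a3)); last by ring.
   by rewrite powRDp// powRr1//; apply: ler_wpM2r.
  - exists ((1 - d) * a3 + d * a2) => //. rewrite (_ : F = fun i x => mx N sg (fun y => `|atom g1 K u1 j y|) x * Lp (ta t3 i) (atom g3 K u3 l) x *
    Lp (ta t2 i) (atom g2 K u2 k) x); last by apply/funext => i; apply/funext => x; exact: mulrAC.
   apply: (le_trans (HB _ _ _ _ _ t3 t2 M e3 e2 t30 t20 bk k01 (r3 l) (r2 k))). rewrite lee_fin qd !powR_tdy -!powRDp// -/a2 -/a3.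
   rewrite (_ : (1 - d) * (1 + a3) + _ = 1 + ((1 - d) * a3 + d * a2)); last by ring. by rewrite powRDp// powRr1//; apply: ler_wpM2r.
 have [E hE1 hE2] := X. apply: (le_via ((h1 j * h2 k * h3 l)%:E * ((C1 + C2) * (2 * 2 `^ E))%:E)%E).
  by apply: lee_wpmul2l.
 rewrite -EFinM lee_fin h1E h2E h3E. have aE : a1 - a2 = j%:R - k%:R by rewrite /a1 /a2; ring. have aE' : a1 - a3 = j%:R - l%:R by rewrite /a1 /a3; ring.
 have rE : rho ^+ (dn j k + dn j l) = 2 `^ (- (s0 / 4) * (`|a1 - a2| + `|a1 - a3|)).
  by rewrite aE aE' !dnE -natrD -powR_mulrn ?powR_ge0// -powRrM.
 have pE : 2 `^ (- (p1^-1 * a1)) * 2 `^ (- (p2^-1 * a2)) * 2 `^ (- (p3^-1 * a3)) * 2 `^ E <= rho ^+ (dn j k + dn j l) :> R.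
  rewrite rE -!powRDp//; apply: powR_2_le; apply: le_trans hE2; apply: le_of_eq; ring.
 have e4 : 0 <= 2 `^ (- (p1^-1 * a1)) * 2 `^ (- (p2^-1 * a2)) * 2 `^ (- (p3^-1 * a3)) * 2 `^ E :> R.
  by [].
 rewrite [leLHS](_ : _ = (Cf * (b1 j * b2 k * b3 l)) *
  (2 `^ (- (p1^-1 * a1)) * 2 `^ (- (p2^-1 * a2)) * 2 `^ (- (p3^-1 * a3)) * 2 `^ E)); last by rewrite /Cf; ring.
 rewrite [X in _ <= Cf * X]mulrC [leRHS]mulrA; apply: ler_wpM2l => //; exact: mulr_ge0.
have bP1 j i : bm (fun x => h1 j * mx N sg (fun y => `|atom g1 K u1 j y|) x) by apply: bmZ; exact: bX.
have bP2 j i : bm (fun x => h2 j * Lp (ta t2 i) (atom g2 K u2 j) x) by apply: bmZ; exact: bL.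
have bP3 j i : bm (fun x => h3 j * Lp (ta t3 i) (atom g3 K u3 j) x) by apply: bmZ; exact: bL.
have H := @II_sum3 M L (fun j i x => h1 j * mx N sg (fun y => `|atom g1 K u1 j y|) x)
 (fun j i x => h2 j * Lp (ta t2 i) (atom g2 K u2 j) x) (fun j i x => h3 j * Lp (ta t3 i) (atom g3 K u3 j) x)
 (fun i => mx N sg (fun y => `|V1 K y|)) (fun i => Lp (ta t2 i) (V2 K)) (fun i => Lp (ta t3 i) (V3 K))
 (fun j k l => Cf * (rho ^+ (dn j k + dn j l) * (b1 j * b2 k * b3 l))) bP1 bP2 bP3
 (fun j i x => mulr_ge0 (h10 j) (X0 _ x)) (fun j i x => mulr_ge0 (h20 j) (L0 _ i _ x t20))
 (fun j i x => mulr_ge0 (h30 j) (L0 _ i _ x t30)) (fun i => bX _ (bV1 K)) (fun i => bL _ i _ t20 (bV2 K))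
 (fun i => bL _ i _ t30 (bV3 K)) (fun i x => X0 _ x) (fun i x => L0 _ i _ x t20) (fun i x => L0 _ i _ x t30)
 (fun i x => mxabs_sum h10 ba1 N L x sg0) (fun i x => Lp_sum h20 ba2 L x (ta_gt0 i t20))
 (fun i x => Lp_sum h30 ba3 L x (ta_gt0 i t30)) key.
apply: (le_trans H); rewrite lee_fin.
under eq_bigr => j _ do under eq_bigr => k _ do rewrite -mulr_sumr.
under eq_bigr => j _ do rewrite -mulr_sumr.
rewrite -mulr_sumr.
have := sum3_dn rho0 rho1 (qi0 _ q11) (qi0 _ q21) (qi0 _ q31) qe Q1 Q2 Q3.
set S := \sum_(i < L) _; set s' := 3 * _ => hS.
rewrite (_ : 128 * (C1 + C2) * s' * A1 * A2 * A3 = Cf * s'); last by rewrite /Cf; ring.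
exact: ler_wpM2l.
Qed.
End main.

(** * Calculus with quadratic remainders *)

Section onedim.
Variable R : realType.
Implicit Types (a b s t x y : R) (f : R -> R).

Lemma mvt_sym f f' a b : (forall x, is_derive x 1 f (f' x)) ->
 exists2 c, `|c - a| <= `|b - a| & f b - f a = f' c * (b - a).
Proof.
move=> df; have cf (A : set R) : {within A, continuous f}.
 by apply/continuous_subspaceT => x; apply/differentiable_continuous; rewrite -derivable1_diffP.
have [ab|ba] := leP a b.
 have [c cab e] := MVT_segment ab (fun x _ => df x) (cf _). move: cab; rewrite in_itv/= => /andP[c1 c2]; exists c => //. by rewrite !ger0_norm ?subr_ge0// lerD2r.
have [c cab e] := MVT_segment (ltW ba) (fun x _ => df x) (cf _).
move: cab; rewrite in_itv/= => /andP[c1 c2]; exists c.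
 by rewrite !ler0_norm ?subr_le0 ?(ltW ba)// !opprB lerD2l lerN2.
lra.
Qed.

Lemma taylor2 f f' f'' a s C : (forall x, is_derive x 1 f (f' x)) -> (forall x, is_derive x 1 f' (f'' x)) ->
 (forall y, `|y| <= `|s| -> `|f'' (a + y)| <= C) -> `|f (a + s) - f a - s * f' a| <= s ^+ 2 * C.
Proof.
move=> df df' hC; have [c hc e1] := mvt_sym a (a + s) df.
have [d hd e2] := mvt_sym a c df'.
have as' : a + s - a = s by lra.
rewrite as' in hc e1.
rewrite e1 [s * _]mulrC -mulrBl e2 -mulrA normrM [leRHS]mulrC; apply: ler_pM => //.
 by rewrite -[d](subrK a) addrC; apply: hC; exact: le_trans hc.
by rewrite normrM -real_normK ?num_real// expr2; apply: ler_wpM2r.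
Qed.

End onedim.

Section qd.
Variables (R : realType) (n : nat).
Notation T := 'rV[R]_n.
Notation m := (lebm R n).
Implicit Types (s t : R) (x y z : T) (g k : T -> R) (j : 'I_n).

Definition ee j : T := delta_mx 0 j.

(* [g'] is the derivative of [g] in direction [j], with a quadratic remainder controlled by [M] *)
Definition qd j (M g g' : T -> R) := [/\ forall x, `|g x| <= M x, forall x, `|g' x| <= M x &
 forall s x, `|s| <= 1 -> `|g (x + s *: ee j) - g x - s * g' x| <= s ^+ 2 * M x].

Lemma qd_ge0 j M g g' x : qd j M g g' -> 0 <= M x.
Proof. by case=> h _ _; exact: le_trans (h x). Qed.

Lemma qd_le j M M' g g' : (forall x, M x <= M' x) -> qd j M g g' -> qd j M' g g'.
Proof.
move=> MM [h1 h2 h3]; split=> [x|x|s x s1]; [exact: le_trans (MM x)|exact: le_trans (MM x)|].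
by apply: le_trans (h3 s x s1) _; apply: ler_wpM2l; rewrite ?sqr_ge0.
Qed.

(** Translation invariance: integrating g(x + s e_j) - g(x) - s g'(x) bounds s times the integral of
    g' by s^2 times the integral of M, and s tends to 0. Every integration by parts on R^n below is
    this lemma applied to a product. *)
Lemma qd_int0 j M g g' : itg m M -> mfun g -> mfun g' ->
 qd j M g g' -> Ri m g' = 0.
Proof.
move=> iM mg mg' q; have [h1 h2 h3] := q.
have ig : itg m g by exact: itg_dom iM. have ig' : itg m g' by exact: itg_dom iM.
have RM0 : 0 <= Ri m M by apply: Ri_ge0 => x; exact: qd_ge0 q.
have key s : 0 < s -> s <= 1 -> `|Ri m g'| <= s * Ri m M.
 move=> s0 s1; have igs := itg_shift (s *: ee j) ig. rewrite -(ler_pM2l s0) -{1}(gtr0_norm s0) -normrM -normrN.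
 rewrite (_ : - (s * Ri m g') = Ri m (fun x => g (x + s *: ee j) - g x - s * g' x)); last first.
  by rewrite RiB; [rewrite RiB// RiZ// Ri_shift// subrr sub0r|exact: itgB|exact: itgZ].
 rewrite mulrA -expr2 -RiZ//; apply: Ri_norm_le.
 - by have := itg_m igs => ?; mm.
 - exact: itgZ.
 - by move=> x; apply: h3; rewrite gtr0_norm.
apply/eqP; rewrite -normr_le0; apply/ler_addgt0Pr => e e0; rewrite add0r.
pose s := Num.min 1 (e / (Ri m M + 1)).
have p0 : 0 < Ri m M + 1 by lra.
have s0 : 0 < s by rewrite lt_min ltr01 divr_gt0.
have s1 : s <= 1 by rewrite ge_min lexx.
apply: le_trans (key s s0 s1) _.
apply: (le_via (e / (Ri m M + 1) * (Ri m M + 1))); last by rewrite divfK// gt_eqF.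
by apply: ler_pM => //; [exact: ltW|rewrite ge_min lexx orbT|rewrite lerDl].
Qed.

Lemma qd_mul j M c g g' k k' : qd j M g g' -> qd j (fun _ => c) k k' ->
 qd j (fun x => 4 * c * M x) (fun x => g x * k x) (fun x => g' x * k x + g x * k' x).
Proof.
move=> q r; have M0 x := qd_ge0 x q; have c0 := qd_ge0 (0 : T) r.
have [h1 h2 h3] := q; have [r1 r2 r3] := r.
have Mc x : 0 <= M x * c by rewrite mulr_ge0.
split=> [x|x|s x s1].
- rewrite normrM; apply: (le_via (M x * c)); first exact: ler_pM. by have := Mc x; rewrite (_ : 4 * c * M x = 4 * (M x * c)); [lra|ring].
- apply: (le_trans (ler_normD _ _)); rewrite !normrM. have a1 : `|g' x| * `|k x| <= M x * c by exact: ler_pM. have a2 : `|g x| * `|k' x| <= M x * c by exact: ler_pM.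
 by have := Mc x; rewrite (_ : 4 * c * M x = 4 * (M x * c)); [lra|ring].
- set y := x + s *: ee j. have -> : g y * k y - g x * k x - s * (g' x * k x + g x * k' x) =
  (g y - g x - s * g' x) * k y + (g x + s * g' x) * (k y - k x - s * k' x) + s ^+ 2 * (g' x * k' x) by ring.
 have a1 : `|(g y - g x - s * g' x) * k y| <= s ^+ 2 * M x * c.
  by rewrite normrM; apply: ler_pM => //; exact: h3.
 have a2 : `|g x + s * g' x| <= 2 * M x.
  apply: (le_trans (ler_normD _ _)); rewrite normrM (_ : 2 * M x = M x + M x); last by ring. by apply: lerD => //; rewrite -[leRHS]mul1r; exact: ler_pM.
 have a3 : `|(g x + s * g' x) * (k y - k x - s * k' x)| <= 2 * M x * (s ^+ 2 * c).
  by rewrite normrM; apply: ler_pM => //; exact: r3.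
 have a4 : `|s ^+ 2 * (g' x * k' x)| <= s ^+ 2 * (M x * c).
  rewrite normrM ger0_norm ?sqr_ge0//; apply: ler_wpM2l; first exact: sqr_ge0. by rewrite normrM; exact: ler_pM.
 apply: (le_trans (ler_normD _ _)); apply: (le_trans (lerD (ler_normD _ _) (lexx _))). apply: (le_trans (lerD (lerD a1 a3) a4)); apply: le_of_eq; ring.
Qed.

(** The relation survives averaging, with the flow of M as new bound; this takes the place of
    differentiation under the integral sign. *)
Lemma qd_He j t M g g' : 0 < t -> bm M -> bm g -> bm g' -> qd j M g g' ->
 qd j (He t M) (He t g) (He t g').
Proof.
move=> t0 bM bg bg' [h1 h2 h3]; split=> [x|x|s x s1]; [exact: He_norm|exact: He_norm|].
have bs : bm (fun y => g (y + s *: ee j)).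
 by have := bm_shift (- (s *: ee j)) bg; under eq_fun do rewrite opprK.
have -> : He t g (x + s *: ee j) = He t (fun y => g (y + s *: ee j)) x.
 by rewrite /He /conv; apply: Ri_eq => y; rewrite addrAC.
rewrite -(HeB x t0 bs bg) -(HeZ s x t0 bg') -(HeB x t0 (bmB bs bg) (bmZ s bg')).
rewrite -(HeZ _ x t0 bM); apply: He_norm => //.
- by apply: bmB; [exact: bmB|exact: bmZ].
- exact: bmZ.
- by move=> y; exact: h3.
Qed.

Lemma dec_le1 x : dec x <= 1.
Proof.
suff /andP[] : 0 <= dec x <= 1 by [].
rewrite /dec; elim/big_ind: _ => [|a b /andP[a0 a1] /andP[b0 b1]|i _]; first by rewrite ler01 lexx.
 by rewrite mulr_ge0// mulr_ile1.
by rewrite invr_ge0 addr_ge0 ?sqr_ge0//= invf_le1 ?ltr_pwDl ?sqr_ge0// lerDl sqr_ge0.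
Qed.

Lemma bm_dec : bm (@dec R n).
Proof. by split; [exact: measurable_dec|exists 1 => x; rewrite ger0_norm ?dec_le1// ltW ?dec_gt0]. Qed.

(** Only the factor j moves, and 1 + x^2 <= 3 (1 + (x + s)^2) for |s| <= 1. *)
Lemma dec_shift j s x : `|s| <= 1 -> dec (x + s *: ee j) <= 3 * dec x.
Proof.
move=> s1; rewrite /dec (bigD1 j)//= [\prod_(i < n) _](bigD1 j)//= mulrA.
have p (y : R) : 0 < 1 + y ^+ 2 by rewrite ltr_pwDl// sqr_ge0.
rewrite (eq_bigr (fun i => (1 + x ord0 i ^+ 2)^-1)); last first.
 by move=> i ij; rewrite !mxE eqxx (negbTE ij) mulr0 addr0.
apply: ler_wpM2r; first by apply: prodr_ge0 => i _; rewrite invr_ge0 ltW.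
rewrite !mxE !eqxx mulr1 ler_pdivlMr// mulrC ler_pdivrMr//.
have : s ^+ 2 <= 1 by rewrite -real_normK ?num_real// exprn_ile1.
have := sqr_ge0 (x ord0 j + 2 * s); have := sqr_ge0 (x ord0 j).
nra.
Qed.

Lemma continuous_idec : continuous (fun x : T => \prod_(i < n) (1 + x ord0 i ^+ 2)).
Proof.
elim: (index_enum _) => [|i l IH].
 by under eq_fun do rewrite big_nil; exact: cst_continuous.
rewrite (_ : (fun x => _) = (fun x : T => 1 + x ord0 i ^+ 2) \* (fun x => \prod_(i0 <- l) (1 + x ord0 i0 ^+ 2))); last first.
 by apply/funext => x; rewrite big_cons.
move=> x; apply: continuousM; last exact: IH.
apply: (@continuous_comp _ _ _ (fun y : T => y ord0 i) (fun r : R => 1 + r ^+ 2)); first exact: coord_continuous.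
by apply: cvgD; [exact: cvg_cst|exact: exprn_continuous].
Qed.

Lemma decV x : dec x = (\prod_(i < n) (1 + x ord0 i ^+ 2))^-1.
Proof. by rewrite /dec prodfV. Qed.

Lemma line_derive g v x s : (forall y, derivable g y v) ->
 is_derive s 1 (fun r => g (x + r *: v)) ('D_v g (x + s *: v)).
Proof.
move=> dg; set f := fun r => _; set y := x + s *: v.
have E : (fun h : R => h^-1 *: (f (h *: 1 + s) - f s)) = (fun h : R => h^-1 *: (g (h *: v + y) - g y)).
 apply/funext => h; congr (_ *: (_ - _)); rewrite /f; congr (g _). by rewrite /y scalerDl [_%:A]mulr1 addrCA.
split; first by have := dg y; rewrite /derivable -E.
by rewrite /derive -E.
Qed.

Lemma scc_derivable g v x : smooth_cc g -> derivable g x v.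
Proof. by move=> [sg _]; apply: diff_derivable; exact: (sg [::]). Qed.

Lemma scc_continuous g : smooth_cc g -> continuous g.
Proof. by move=> [sg _] x; apply: differentiable_continuous; exact: (sg [::]). Qed.

Lemma scc_m g : smooth_cc g -> mfun g.
Proof. by move=> /scc_continuous; exact: continuous_rv_measurable. Qed.

Lemma iterD_rcons vs v g : Defs.iterD (rcons vs v) g = Defs.iterD vs ('D_v g).
Proof. by elim: vs => //= w vs ->. Qed.

Lemma scc_partial j g : smooth_cc g -> smooth_cc (partial j g).
Proof.
move=> [sg cg]; split; first by move=> vs x; rewrite /partial -iterD_rcons; exact: sg.
apply: (subclosed_compact _ cg); first exact: closed_closure.
have -> : closure [set x | g x != 0] = closure (closure [set x | g x != 0]).
 by apply/closure_id; exact: closed_closure.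
apply: closureS => x /= dx; apply: contrapT => nx; move: dx; apply/negP; rewrite negbK; apply/eqP.
have nz : nbhs x (~` closure [set x | g x != 0]).
 by apply: open_nbhs_nbhs; split => //; apply: closed_openC; exact: closed_closure.
rewrite /partial (_ : 'D_(delta_mx 0 j) g x = 'D_(delta_mx 0 j) (cst 0) x); last first.
 apply: near_eq_derive; apply: filterS nz => y ny; apply/eqP; apply: contrapT => gy; apply: ny. by apply: subset_closure; exact/negP.
exact: derive_cst.
Qed.

(** The quotient of g by the weight is continuous, hence bounded on the compact support. *)
Lemma scc_bound g : smooth_cc g -> exists2 C, 0 <= C & forall x, `|g x| <= C * dec x.
Proof.
move=> hg; have cg := scc_continuous hg; have [_ kg] := hg.
have cq : continuous (g \* (fun x => \prod_(i < n) (1 + x ord0 i ^+ 2))).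
 by move=> x; apply: continuousM; [exact: cg|exact: continuous_idec].
have := compact_bounded (continuous_compact (continuous_subspaceT cq) kg).
move=> [M [_ hM]]; exists (`|M| + 1) => [|x]; first by rewrite addr_ge0.
have M1 : M < `|M| + 1 by rewrite (le_lt_trans (ler_norm _))// ltrDl.
have [->|gx] := eqVneq (g x) 0; first by rewrite normr0 mulr_ge0 ?addr_ge0// ltW ?dec_gt0.
have p (y : T) : 0 < \prod_(i < n) (1 + y ord0 i ^+ 2) by apply: prodr_gt0 => i _; rewrite ltr_pwDl// sqr_ge0.
have := hM _ M1 (g x * \prod_(i < n) (1 + x ord0 i ^+ 2)).
rewrite /= normrM (gtr0_norm (p x)) decV ler_pdivlMr//; apply.
by exists x => //; exact: subset_closure.
Qed.

Lemma scc_qd j g : smooth_cc g -> exists2 C, 0 <= C & qd j (fun x => C * dec x) g (partial j g).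
Proof.
move=> hg; have hg1 := scc_partial j hg; have hg2 := scc_partial j hg1.
have [C0 C00 h0] := scc_bound hg; have [C1 C10 h1] := scc_bound hg1; have [C2 C20 h2] := scc_bound hg2.
exists (C0 + C1 + 3 * C2) => [|]; first by rewrite !addr_ge0// mulr_ge0.
have d0 x : 0 <= dec x by rewrite ltW ?dec_gt0.
have le x c : 0 <= c -> c <= C0 + C1 + 3 * C2 -> c * dec x <= (C0 + C1 + 3 * C2) * dec x.
 by move=> _; exact: ler_wpM2r.
split=> [x|x|s x s1].
- by apply: (le_trans (h0 x)); apply: ler_wpM2r => //; lra.
- by apply: (le_trans (h1 x)); apply: ler_wpM2r => //; lra.
have dl k (r : R) : smooth_cc k -> is_derive r 1 (fun r => k (x + r *: ee j)) (partial j k (x + r *: ee j)).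
 by move=> hk; apply: line_derive => y; exact: scc_derivable.
have := @taylor2 R _ _ _ 0 s ((C0 + C1 + 3 * C2) * dec x) (fun r => dl g r hg) (fun r => dl _ r hg1).
rewrite add0r scale0r addr0; apply => y ys; rewrite add0r.
apply: (le_trans (h2 _)); apply: (le_via (C2 * (3 * dec x))).
 by apply: ler_wpM2l => //; apply: dec_shift; exact: le_trans s1.
rewrite mulrA; apply: ler_wpM2r => //; lra.
Qed.

Lemma scc_bm g : smooth_cc g -> bm g.
Proof.
move=> hg; split; first exact: scc_m.
have [C C0 h] := scc_bound hg; exists C => x; apply: (le_trans (h x)).
by rewrite ler_piMr// dec_le1.
Qed.

Lemma scc_itg g : smooth_cc g -> itg m g.
Proof.
move=> hg; have [C C0 h] := scc_bound hg.
by apply: (itg_dom _ (scc_m hg) h); apply: itgZ; exact: itg_dec.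
Qed.

Section gaussian.
Variables (t : R) (t0 : 0 < t).
Let A := (sqrt (4 * pi * t))^-1 : R.
Let A0 : 0 < A. Proof. by rewrite invr_gt0 sqpit_gt0. Qed.
Let c : R := 1 + 12 * t.
Let c1 : 1 <= c. Proof. by rewrite /c lerDl mulr_ge0// ltW. Qed.
Let g1' (x : R) : R := - (x / (2 * t)) * g1 t x.
Let g1'' (x : R) : R := ((x / (2 * t)) ^+ 2 - (2 * t)^-1) * g1 t x.

Let dg1 (x : R) : is_derive x 1 (g1 t) (g1' x).
Proof.
pose k : R := - (4 * t)^-1.
have E (y : R) : g1 t y = A * expR (k * (y * y)).
 rewrite /g1 /A mulrC; congr (_ * expR _). by rewrite expr2 mulNr mulNr mulrC.
have -> : g1 t = (fun y : R => A * expR (k * (y * y))) by apply/funext => y.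
have D1 : is_derive x 1 (fun y : R => k * (y * y)) (2 * k * x).
 by apply: trigger_derive; rewrite /GRing.scale/=; ring.
apply: trigger_derive; rewrite /GRing.scale/= /g1' E /k.
lra.
Qed.

Let dg1' (x : R) : is_derive x 1 g1' (g1'' x).
Proof.
have D := dg1 x; pose k : R := - (2 * t)^-1.
have -> : g1' = (fun y : R => k * y * g1 t y) by apply/funext => y; rewrite /g1' /k; ring.
have D1 : is_derive x 1 (fun y : R => k * y) k.
 by apply: trigger_derive; rewrite /GRing.scale/=; ring.
apply: trigger_derive; rewrite /GRing.scale/= /g1'' /g1' /k.
lra.
Qed.

(** The factor exp(-x^2 / 4 t) is the inverse cube of exp(x^2 / 12 t), which is at least 1 + x^2 /
    12 t; this pays for three powers of 1 + x^2. *)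
Let poly_exp (x : R) : (1 + x ^+ 2) ^+ 3 * g1 t x <= c ^+ 3 * A.
Proof.
rewrite /g1 -/A mulrA; apply: ler_wpM2r; first exact: ltW.
set e := expR _.
have e0 : 0 < e by exact: expR_gt0.
have h : (1 + x ^+ 2 / (12 * t)) ^+ 3 * e <= 1.
 have E1 : expR (x ^+ 2 / (12 * t)) ^+ 3 * e = 1.
  by rewrite /e -expRM_natl -expRD [X in expR X](_ : _ = 0) ?expR0//; field; rewrite gt_eqF.
 rewrite -[leRHS]E1. apply: ler_wpM2r; first exact: ltW. apply: lerXn2r; rewrite ?nnegrE ?expR_ge0 ?expR_ge1Dx//.
 by rewrite addr_ge0// divr_ge0 ?sqr_ge0// mulr_ge0// ltW.
have c0 : 0 <= c by rewrite (le_trans ler01).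
apply: (le_via (c ^+ 3 * ((1 + x ^+ 2 / (12 * t)) ^+ 3 * e))); last first.
 by rewrite ler_piMr// exprn_ge0.
rewrite mulrA -exprMn; apply: ler_wpM2r; first exact: ltW.
have hh : 0 <= x ^+ 2 / (12 * t) by rewrite divr_ge0 ?sqr_ge0// mulr_ge0// ltW.
have t120 : 0 <= 12 * t by rewrite mulr_ge0// ltW.
apply: lerXn2r; rewrite ?nnegrE ?addr_ge0 ?sqr_ge0 ?mulr_ge0 ?addr_ge0//.
have -> : c * (1 + x ^+ 2 / (12 * t)) = 1 + 12 * t + x ^+ 2 / (12 * t) + x ^+ 2.
 by rewrite /c; field; rewrite gt_eqF.
have := sqr_ge0 x; lra.
Qed.

Let K := c ^+ 3 * A * (1 + (2 * t)^-1 + (2 * t)^-1 ^+ 2) : R.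

Let bounds (x : R) : [/\ `|g1 t x| <= K / (1 + x ^+ 2), `|g1' x| <= K / (1 + x ^+ 2) & `|g1'' x| <= K / (1 + x ^+ 2)].
Proof.
have p : 1 <= 1 + x ^+ 2 by rewrite lerDl sqr_ge0.
have p0 : 0 < 1 + x ^+ 2 by lra.
have g0 : 0 <= g1 t x by rewrite ltW ?g1_gt0.
have h := poly_exp x; set q := 1 + x ^+ 2 in p p0 h *.
set i := (2 * t)^-1; have i0 : 0 <= i by rewrite invr_ge0 mulr_ge0// ltW.
have B0 : 0 <= q * g1 t x by rewrite mulr_ge0// ltW.
have B1 : q * g1 t x <= c ^+ 3 * A.
 by apply: le_trans h; apply: ler_wpM2r => //; rewrite -{1}(expr1 q); apply: ler_weXn2l.
have B2 : q ^+ 2 * g1 t x <= c ^+ 3 * A.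
 by apply: le_trans h; apply: ler_wpM2r => //; apply: ler_weXn2l.
have xq : `|x| <= q.
 have e : x ^+ 2 = `|x| ^+ 2 by rewrite real_normK ?num_real. rewrite /q e; have := sqr_ge0 (`|x| - 1); have := normr_ge0 x; nra.
have x2q : x ^+ 2 <= q by rewrite /q lerDr.
have cA : 0 <= c ^+ 3 * A by lra.
have KE : K = c ^+ 3 * A + c ^+ 3 * A * i + c ^+ 3 * A * i ^+ 2 by rewrite /K /i; ring.
have k1 : 0 <= c ^+ 3 * A * i by exact: mulr_ge0.
have k2 : 0 <= c ^+ 3 * A * i ^+ 2 by apply: mulr_ge0 => //; exact: sqr_ge0.
split; rewrite ler_pdivlMr// mulrC KE.
- by rewrite (ger0_norm g0); lra.
- have n2t : `|2 * t| = 2 * t by rewrite gtr0_norm ?mulr_gt0. rewrite normrM normrN normrM normfV (ger0_norm g0) n2t -/i.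
 have : q * (`|x| * i * g1 t x) <= c ^+ 3 * A * i.
  rewrite (_ : q * _ = (q * `|x| * g1 t x) * i); last by ring. apply: ler_wpM2r => //; apply: le_trans B2; apply: ler_wpM2r => //.
  by rewrite expr2; apply: ler_wpM2l => //; exact: ltW.
 lra.
- rewrite normrM (ger0_norm g0). have : `|(x / (2 * t)) ^+ 2 - (2 * t)^-1| <= x ^+ 2 * i ^+ 2 + i.
  apply: (le_trans (ler_normB _ _)); rewrite -/i exprMn (ger0_norm i0) ger0_norm//. by rewrite mulr_ge0 ?sqr_ge0.
 move=> hb; have : q * (`|(x / (2 * t)) ^+ 2 - (2 * t)^-1| * g1 t x) <= q * ((x ^+ 2 * i ^+ 2 + i) * g1 t x).
  by apply: ler_wpM2l; [exact: ltW|exact: ler_wpM2r].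
 rewrite (_ : q * ((x ^+ 2 * i ^+ 2 + i) * g1 t x) = (q * x ^+ 2 * g1 t x) * i ^+ 2 + (q * g1 t x) * i); last by ring.
 have : (q * x ^+ 2 * g1 t x) * i ^+ 2 <= c ^+ 3 * A * i ^+ 2.
  apply: ler_wpM2r; first exact: sqr_ge0. apply: le_trans B2; apply: ler_wpM2r => //; rewrite expr2; apply: ler_wpM2l => //; exact: ltW.
 have : (q * g1 t x) * i <= c ^+ 3 * A * i by exact: ler_wpM2r. lra.
Qed.

Let K0 : 0 <= K. Proof. by have [h _ _] := bounds 0; move: h; rewrite expr0n addr0 divr1; exact: le_trans. Qed.

(** Only the factor j moves and [taylor2] handles it; the other factors are bounded by K times the
    weight. The 3 comes from shifting the weight, as in [dec_shift]. *)
Lemma G_qd j : exists2 C, 0 <= C & qd j (fun x => C * dec x) (G t) (dG j t).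
Proof.
exists (3 * K ^+ n) => [|]; first by rewrite mulr_ge0// exprn_ge0.
have p (y : R) : 0 < 1 + y ^+ 2 by rewrite ltr_pwDl// sqr_ge0.
pose r x := \prod_(i < n | i != j) g1 t (x ord0 i).
pose d x := \prod_(i < n | i != j) (1 + x ord0 i ^+ 2)^-1 : R.
have d0 x : 0 <= d x by apply: prodr_ge0 => i _; rewrite invr_ge0 ltW.
have decE x : dec x = (1 + x ord0 j ^+ 2)^-1 * d x by rewrite /dec (bigD1 j).
have GE x : G t x = g1 t (x ord0 j) * r x by rewrite /G (bigD1 j).
have n0 : (0 < n)%N by exact: leq_ltn_trans (leq0n j) (ltn_ord j).
have r0 x : 0 <= r x by apply: prodr_ge0 => i _; rewrite ltW ?g1_gt0.
have rd x : r x <= K ^+ n.-1 * d x.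
 have -> : K ^+ n.-1 = \prod_(i < n | i != j) K.
  by rewrite prodr_const cardC1 card_ord.
 rewrite /r /d -big_split/=; apply: ler_prod => i _; rewrite ltW ?g1_gt0//=. by have [h _ _] := bounds (x ord0 i); apply: le_trans h; exact: ler_norm.
have Kn : K ^+ n = K * K ^+ n.-1 by rewrite -exprS prednK.
have main a x : `|a| <= K / (1 + x ord0 j ^+ 2) -> `|a * r x| <= K ^+ n * dec x.
 move=> ha; rewrite normrM (ger0_norm (r0 x)) decE Kn. rewrite (_ : K * K ^+ n.-1 * _ = (K / (1 + x ord0 j ^+ 2)) * (K ^+ n.-1 * d x)); last by ring. exact: ler_pM.
have Kd x : 0 <= K ^+ n * dec x by rewrite mulr_ge0 ?exprn_ge0// ltW ?dec_gt0.
have K3 x : K ^+ n * dec x <= 3 * K ^+ n * dec x by rewrite -mulrA ler_peMl// ler1n.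
split=> [x|x|s x s1].
- by apply: le_trans (K3 x); rewrite GE; apply: main; have [] := bounds (x ord0 j).
- apply: le_trans (K3 x); rewrite /dG GE mulrA; apply: main. by have [_ h _] := bounds (x ord0 j).
have rs : r (x + s *: ee j) = r x.
 by apply: eq_bigr => i ij; rewrite !mxE eqxx (negbTE ij) mulr0 addr0.
rewrite !GE rs /dG GE.
have -> : (x + s *: ee j) ord0 j = x ord0 j + s by rewrite !mxE !eqxx mulr1.
rewrite (_ : _ - _ - _ = (g1 t (x ord0 j + s) - g1 t (x ord0 j) - s * g1' (x ord0 j)) * r x); last first.
 by rewrite /g1'; move: (g1 t _) (g1 t _) (r x) => ? ? ?; ring.
rewrite normrM (ger0_norm (r0 x)).
have h : `|g1 t (x ord0 j + s) - g1 t (x ord0 j) - s * g1' (x ord0 j)| <= s ^+ 2 * (3 * K / (1 + x ord0 j ^+ 2)).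
 apply: taylor2 dg1 dg1' _ => y ys; have [_ _ h] := bounds (x ord0 j + y).
 apply: (le_trans h); rewrite (_ : 3 * K / (1 + x ord0 j ^+ 2) = K * (3 / (1 + x ord0 j ^+ 2))); last by ring. apply: ler_wpM2l => //.
 have y1 : y ^+ 2 <= 1 by rewrite -real_normK ?num_real// exprn_ile1//; exact: le_trans s1. rewrite ler_pdivlMr// mulrC ler_pdivrMr//.
 have := sqr_ge0 (x ord0 j + 2 * y); have := sqr_ge0 (x ord0 j). nra.
apply: (le_via (s ^+ 2 * (3 * K / (1 + x ord0 j ^+ 2)) * (K ^+ n.-1 * d x))).
 by apply: ler_pM.
rewrite decE Kn; apply: le_of_eq; ring.
Qed.
End gaussian.

(** Integration by parts in z for the product of g(z) and G(x - z). It puts the derivative on the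
    kernel, where the oscillation bounds [grad1] and [grad2] apply. *)
Lemma He_partial j t g x : 0 < t -> smooth_cc g -> He t (partial j g) x = conv (dG j t) g x.
Proof.
move=> t0 hg; have [C C0 q1] := scc_qd j hg; have [D D0 [d1 d2 d3]] := G_qd t0 j.
have mg := scc_m hg; have mg' := scc_m (scc_partial j hg).
have q2 : qd j (fun _ => D) (fun z => G t (x - z)) (fun z => - dG j t (x - z)).
 have le1 y : D * dec y <= D by rewrite ler_piMr// dec_le1.
 split=> [z|z|s z s1]; [exact: le_trans (d1 _) (le1 _)|by rewrite normrN; exact: le_trans (d2 _) (le1 _)|].
 have := d3 (- s) (x - z); rewrite normrN sqrrN => /(_ s1) h. rewrite opprD addrA -scaleNr mulrN -mulNr; apply: (le_trans h).
 by apply: ler_wpM2l; [exact: sqr_ge0|exact: le1].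
have mG : mfun (G t : T -> R) by exact: measurable_G.
have mdG : mfun (dG j t : T -> R) by exact: measurable_dG.
have mxz : mfun (fun z : T => x - z).
 by apply: measurable_rvB.
have m1 : mfun (fun z => G t (x - z)) by exact: (measurableT_comp mG mxz).
have m2 : mfun (fun z => dG j t (x - z)) by exact: (measurableT_comp mdG mxz).
have iM : itg m (fun y => 4 * D * (C * dec y)) by apply: itgZ; apply: itgZ; exact: itg_dec.
have := qd_int0 iM _ _ (qd_mul q1 q2).
have i1 : itg m (fun z => G t z * partial j g (x - z)) by apply: conv_itg; [exact: itg_G|exact/scc_bm/scc_partial].
have i2 : itg m (fun z => dG j t z * g (x - z)) by apply: conv_itg; [exact: itg_dG|exact: scc_bm].
have E1 : Ri m (fun z => partial j g z * G t (x - z)) = He t (partial j g) x.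
 rewrite /He /conv -(Ri_refl x (itg_m i1)); apply: Ri_eq => z. by rewrite opprB addrCA subrr addr0 mulrC.
have E2 : Ri m (fun z => g z * - dG j t (x - z)) = - conv (dG j t) g x.
 rewrite /conv -(RiN i2). rewrite -(Ri_refl x (f := fun z => - (dG j t z * g (x - z)))); last by have := itg_m i2 => ?; mm.
 apply: Ri_eq => z; by rewrite opprB addrCA subrr addr0 mulrN mulrC.
have i3 : itg m (fun z => partial j g z * G t (x - z)).
 have -> : (fun z => partial j g z * G t (x - z)) = (fun z => G t (x - z) * partial j g (x - (x - z))).
  by apply/funext => z; rewrite opprB addrCA subrr addr0 mulrC.
 exact: (itg_refl x i1).
have i4 : itg m (fun z => g z * - dG j t (x - z)).
 have -> : (fun z => g z * - dG j t (x - z)) = (fun z => - (dG j t (x - z) * g (x - (x - z)))).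
  by apply/funext => z; rewrite opprB addrCA subrr addr0 mulrN mulrC.
 exact: (itg_refl x (itgN i2)).
rewrite RiD//.
rewrite E1 E2 => h; apply/eqP; rewrite -subr_eq0; apply/eqP; apply: h; by mm.
Qed.
End qd.

(** * Fourier representation of the heat flow *)

Section fourier.
Variables (R : realType) (n : nat).
Notation T := 'rV[R]_n.
Notation m := (lebm R n).
Implicit Types (s t : R) (x y z xi : T) (g k : T -> R) (j : 'I_n).

Lemma dotvC x y : dotv x y = dotv y x.
Proof. by apply: eq_bigr => i _; rewrite mulrC. Qed.

Lemma dotvDl x y z : dotv (x + y) z = dotv x z + dotv y z.
Proof. by rewrite /dotv -big_split; apply: eq_bigr => i _; rewrite mxE mulrDl. Qed.

Lemma dotvNl x z : dotv (- x) z = - dotv x z.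
Proof. by rewrite /dotv -sumrN; apply: eq_bigr => i _; rewrite mxE mulNr. Qed.

Lemma dotvBl x y z : dotv (x - y) z = dotv x z - dotv y z.
Proof. by rewrite dotvDl dotvNl. Qed.

Lemma dotvZl s x z : dotv (s *: x) z = s * dotv x z.
Proof. by rewrite /dotv mulr_sumr; apply: eq_bigr => i _; rewrite mxE mulrA. Qed.

Lemma dotvee j z : dotv (ee R j) z = z ord0 j.
Proof.
rewrite /dotv (bigD1 j)//= big1 => [|i ij]; first by rewrite !mxE !eqxx mul1r addr0.
by rewrite !mxE (negbTE ij) andbF mul0r.
Qed.

Lemma dotv_ge0 x : 0 <= dotv x x.
Proof. by apply: sumr_ge0 => i _; rewrite -expr2 sqr_ge0. Qed.

Lemma mf_dotv d (U : measurableType d) (f g : U -> T) : mfun f -> mfun g ->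
 mfun (fun u => dotv (f u) (g u)).
Proof. by move=> mf mg; rewrite /dotv; mm. Qed.

Definition cosx xi x := cos (2 * pi * dotv x xi).

Lemma mf_cosx d (U : measurableType d) (f g : U -> T) : mfun f -> mfun g ->
 mfun (fun u => cosx (g u) (f u)).
Proof.
by move=> mf mg; rewrite /cosx; apply: mf_cos; apply: mf_mul; [exact: mf_cst|exact: mf_dotv].
Qed.

Lemma cos_le1 (r : R) : `|cos r| <= 1.
Proof. by rewrite ler_norml cos_geN1 cos_le1. Qed.

Lemma sin_le1 (r : R) : `|sin r| <= 1.
Proof. by rewrite ler_norml sin_geN1 sin_le1. Qed.

Lemma bm_cosx xi : bm (cosx xi).
Proof.
split; last by exists 1 => x; exact: cos_le1.
by apply: mf_cosx.
Qed.

Lemma dcos (b k y : R) : is_derive y 1 (fun r => cos (b + r * k)) (- k * sin (b + y * k)).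
Proof. by apply: trigger_derive; rewrite /GRing.scale/=; ring. Qed.

Lemma dsin (b k y : R) : is_derive y 1 (fun r => sin (b + r * k)) (k * cos (b + y * k)).
Proof. by apply: trigger_derive; rewrite /GRing.scale/=; ring. Qed.

Lemma trig_rem (b k s : R) :
 `|cos (b + s * k) - cos b - s * (- k * sin b)| <= s ^+ 2 * k ^+ 2 /\
 `|sin (b + s * k) - sin b - s * (k * cos b)| <= s ^+ 2 * k ^+ 2.
Proof.
have b0 : b = b + 0 * k by lra.
have kk (r : R) : `|r| <= 1 -> `|k * (k * r)| <= k ^+ 2.
 move=> r1; rewrite !normrM mulrA -normrM -expr2 (ger0_norm (sqr_ge0 _)). by rewrite ler_piMr// sqr_ge0.
split.
 have := @taylor2 R (fun r => cos (b + r * k)) (fun r => - k * sin (b + r * k))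
  (fun r => - k * (k * cos (b + r * k))) 0 s (k ^+ 2) (dcos b k).
 rewrite add0r -b0; apply => [y|y _].
  by have D := dsin b k y; apply: trigger_derive.
 by rewrite mulNr normrN; apply: kk; exact: cos_le1.
have := @taylor2 R (fun r => sin (b + r * k)) (fun r => k * cos (b + r * k))
 (fun r => k * (- k * sin (b + r * k))) 0 s (k ^+ 2) (dsin b k).
rewrite add0r -b0; apply => [y|y _].
 by have D := dcos b k y; apply: trigger_derive.
by rewrite mulNr mulrN normrN; apply: kk; exact: sin_le1.
Qed.

Lemma ibp j C c g g' k k' : qd j (fun x => C * dec x) g g' -> qd j (fun _ => c) k k' ->
 mfun g -> mfun g' -> mfun k -> mfun k' ->
 Ri m (fun x => g' x * k x) = - Ri m (fun x => g x * k' x).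
Proof.
move=> qg qk mg mg' mk mk'; have [g1 g2 _] := qg; have [k1 k2 _] := qk.
have id : itg m (fun x => C * dec x) by apply: itgZ; exact: itg_dec.
have ig : itg m g by exact: itg_dom id. have ig' : itg m g' by exact: itg_dom id.
have i1 : itg m (fun x => g' x * k x) by exact: (itgM c ig').
have i2 : itg m (fun x => g x * k' x) by exact: (itgM c ig).
have iM : itg m (fun y => 4 * c * (C * dec y)) by exact: itgZ.
have := qd_int0 iM _ _ (qd_mul qg qk); rewrite RiD// => h.
by apply/eqP; rewrite -addr_eq0; apply/eqP; apply: h; mm.
Qed.

Lemma trig_qd j (k : R) (f : T -> R) : (forall s x, f (x + s *: ee R j) = f x + s * k) ->
 qd j (fun _ => 1 + `|k| + k ^+ 2) (fun x => cos (f x)) (fun x => - k * sin (f x)) /\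
 qd j (fun _ => 1 + `|k| + k ^+ 2) (fun x => sin (f x)) (fun x => k * cos (f x)).
Proof.
move=> hf; have k0 := normr_ge0 k; have k2 := sqr_ge0 k.
have b1 (r : R) : `|r| <= 1 -> `|r| <= 1 + `|k| + k ^+ 2 by lra.
have b2 (a r : R) : `|a| = `|k| -> `|r| <= 1 -> `|a * r| <= 1 + `|k| + k ^+ 2.
 move=> ak r1; rewrite normrM ak; have : `|k| * `|r| <= `|k| by rewrite ler_piMr. by lra.
have b3 s (a : R) : a <= s ^+ 2 * k ^+ 2 -> a <= s ^+ 2 * (1 + `|k| + k ^+ 2).
 by move=> h; apply: (le_trans h); apply: ler_wpM2l; [exact: sqr_ge0|lra].
split; split=> [x|x|s x _].
- by apply: b1; exact: cos_le1.
- by apply: b2; [rewrite normrN|exact: sin_le1].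
- by rewrite hf; apply: b3; have [] := trig_rem (f x) k s.
- by apply: b1; exact: sin_le1.
- by apply: b2 => //; exact: cos_le1.
- by rewrite hf; apply: b3; have [] := trig_rem (f x) k s.
Qed.

Lemma ph_ee s j x xi : 2 * pi * dotv (x + s *: ee R j) xi = 2 * pi * dotv x xi + s * (2 * pi * xi ord0 j).
Proof. by rewrite dotvDl dotvZl dotvee; ring. Qed.

Lemma quad_derive (f : R -> R) (x d C : R) : (forall s, `|s| <= 1 -> `|f (x + s) - f x - s * d| <= s ^+ 2 * C) ->
 is_derive x 1 f d.
Proof.
move=> h; have C0 : 0 <= C.
 by have := h 1; rewrite normr1 lexx expr1n !mul1r => /(_ isT); exact: le_trans (normr_ge0 _).
suff cv : (fun r => r^-1 *: (f (r *: 1 + x) - f x)) @ 0^' --> d.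
 by split; [apply/cvg_ex; exists d|exact: cvg_lim].
apply/cvgrPdist_le => e e0.
pose q : R := Num.min 1 (e / (C + 1)).
have p0 : 0 < C + 1 by lra.
have q0 : 0 < q by rewrite lt_min ltr01 divr_gt0.
near=> r.
have r0 : r != 0 by near: r; exact: nbhs_dnbhs_neq.
have rq : `|r| < q.
 near: r; exists q => //= r /=; rewrite sub0r normrN => *; assumption.
have -> : d - r^-1 *: (f (r *: 1 + x) - f x) = - (r^-1 * (f (x + r) - f x - r * d)).
 by rewrite -[r *: 1]/(r * 1) mulr1 [r + x]addrC -[_ *: _]/(_ * _); field.
rewrite normrN normrM normfV ler_pdivrMl ?normr_gt0//.
have r1 : `|r| <= 1 by apply: (le_trans (ltW rq)); rewrite ge_min lexx.
apply: (le_trans (h r r1)); rewrite -real_normK ?num_real// expr2 -mulrA; apply: ler_wpM2l => //.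
apply: (le_via (e / (C + 1) * (C + 1))); last by rewrite divfK ?gt_eqF.
apply: ler_pM => //; last by rewrite lerDl.
by apply: (le_trans (ltW rq)); rewrite ge_min lexx orbT.
Unshelve. all: by end_near.
Qed.

(** The Fourier symbol of minus the Laplacian, (2 pi |xi|)^2. *)
Definition lam xi : R := (2 * pi) ^+ 2 * dotv xi xi.

Lemma lam_ge0 xi : 0 <= lam xi.
Proof. by rewrite mulr_ge0 ?sqr_ge0 ?dotv_ge0. Qed.

Section gauss_ft.
Variable (xi : T).
Let ph y : R := 2 * pi * dotv y xi.

Let mph : mfun ph.
Proof. by apply: mf_mul; [exact: mf_cst|apply: mf_dotv; [exact: measurable_id|exact: measurable_cst]]. Qed.

Let GxdG t j y : 0 < t -> G t y * y ord0 j = - (2 * t) * dG j t y.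
Proof. by move=> t0; rewrite /dG; field; rewrite gt_eqF. Qed.

Let Gph t y : 0 < t -> G t y * ph y = \sum_(j < n) (- (2 * t) * (2 * pi * xi ord0 j)) * dG j t y.
Proof.
move=> t0; rewrite /ph /dotv !mulr_sumr; apply: eq_bigr => j _.
by rewrite [RHS]mulrAC -GxdG//; ring.
Qed.

Let itgGph t : 0 < t -> itg m (fun y => G t y * ph y).
Proof.
move=> t0; under eq_fun do rewrite Gph//.
by apply: itg_sum => j; apply: itgZ; exact: itg_dG.
Qed.

Let itgGph2 t : 0 < t -> itg m (fun y => G t y * ph y ^+ 2).
Proof.
move=> t0; have mG := measurable_G t : mfun (G t : T -> R).
have t20 : 0 < 2 * t by lra.
apply: (itg_dom (fun y => \sum_(j < n) (2 * t * `|2 * pi * xi ord0 j| * (2 ^+ n / sqrt t)) * `|G (2 * t) y * ph y|)).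
- by mm.
- move=> y; rewrite expr2 mulrA Gph// mulr_suml; apply: (le_trans (ler_norm_sum _ _ _)). have e : `|- (2 * t)| = 2 * t by rewrite normrN gtr0_norm.
 apply: ler_sum => j _; set c := 2 * pi * xi ord0 j. have -> : `|- (2 * t) * c * dG j t y * ph y| = 2 * t * `|c| * (`|dG j t y| * `|ph y|).
  by rewrite normrM (normrM (_ * c)) (normrM (- _)) e mulrA.
 rewrite -[leRHS]mulrA; apply: ler_wpM2l; first by rewrite mulr_ge0// ltW.
 rewrite [`|G _ _ * _|]normrM [`|G _ _|]gtr0_norm ?G_gt0// mulrA; apply: ler_wpM2r => //; exact: dG_le.
- by apply: itg_sum => j; apply/itgZ/itg_norm/itgGph.
Qed.

(** Along the ray s xi the transform satisfies f' = -2 lam t s f: y_j G is a multiple of dG, and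
    integration by parts turns the sine back into the cosine. Hence f(s) exp(lam t s^2) is constant,
    with value 1 at s = 0. *)
Lemma gauss_ft t : 0 < t -> Ri m (fun y => G t y * cosx xi y) = expR (- (lam xi * t)).
Proof.
move=> t0; have mG := measurable_G t : mfun (G t : T -> R).
pose f s := Ri m (fun y => G t y * cos (s * ph y)).
have mdG j := measurable_dG j t : mfun (dG j t : T -> R).
have ic s : itg m (fun y => G t y * cos (s * ph y)).
 by apply: (itgM 1 (itg_G n t0)) => [|y]; [mm|exact: cos_le1].
have is' s : itg m (fun y => G t y * (- ph y * sin (s * ph y))).
 have -> : (fun y => G t y * (- ph y * sin (s * ph y))) = (fun y => - (G t y * ph y * sin (s * ph y))).
  by apply/funext => y; ring.
 by apply: itgN; apply: (itgM 1 (itgGph t0)) => [|y]; [mm|exact: sin_le1].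
have df (s : R) : is_derive s 1 f (Ri m (fun y => G t y * (- ph y * sin (s * ph y)))).
 apply: (@quad_derive _ _ _ (Ri m (fun y => G t y * ph y ^+ 2))) => r _. rewrite -RiZ// -RiB// -RiB//; [|exact: itgB|exact: itgZ].
 rewrite -RiZ; last exact: itgGph2. apply: Ri_norm_le; [by mm|exact/itgZ/itgGph2|move=> y].
 rewrite (_ : _ - _ - _ = G t y * (cos (s * ph y + r * ph y) - cos (s * ph y) - r * (- ph y * sin (s * ph y)))); last first.
  by rewrite mulrDl; ring.
 rewrite normrM (ger0_norm (G_ge0 _ t0)) [leRHS]mulrCA; apply: ler_wpM2l; first exact: G_ge0. by have [] := trig_rem (s * ph y) (ph y) r.
have dE (s : R) : Ri m (fun y => G t y * (- ph y * sin (s * ph y))) = - (2 * lam xi * t) * s * f s.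
 have E j : Ri m (fun y => dG j t y * sin (s * ph y)) = - (s * (2 * pi * xi ord0 j)) * f s.
  have [C C0 q] := G_qd t0 j. have h (r : R) x : s * ph (x + r *: ee R j) = s * ph x + r * (s * (2 * pi * xi ord0 j)).
   by rewrite /ph ph_ee; ring.
  have [_ q2] := @trig_qd j (s * (2 * pi * xi ord0 j)) (fun x => s * ph x) h. rewrite (ibp q q2)//; [|by mm|by mm].
  rewrite (Ri_eq (fun y => (s * (2 * pi * xi ord0 j)) * (G t y * cos (s * ph y)))) => [|y]; last by ring. by rewrite RiZ// mulNr.
 have idG j : itg m (fun y => dG j t y * sin (s * ph y)).
  by apply: (itgM 1 (itg_dG j t0)) => [|y]; [mm|exact: sin_le1].
 rewrite (Ri_eq (fun y => \sum_(j < n) (2 * t * (2 * pi * xi ord0 j)) * (dG j t y * sin (s * ph y)))).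
  rewrite Ri_sum => [|j]; last exact: itgZ. rewrite (eq_bigr (fun j => - (2 * t * s * f s * (2 * pi) ^+ 2) * (xi ord0 j * xi ord0 j))).
   by rewrite -mulr_sumr /lam /dotv; ring.
  by move=> j _; rewrite RiZ// E; ring.
 move=> y; rewrite mulrA mulrN Gph// -sumrN mulr_suml; apply: eq_bigr => j _; ring.
pose F s := f s * expR (lam xi * t * (s * s)).
have dF (s : R) : is_derive s 1 F 0.
 have D1 := df s; rewrite dE in D1. have D2 : is_derive s 1 (fun r => lam xi * t * (r * r)) (2 * (lam xi * t) * s).
  by apply: trigger_derive; rewrite /GRing.scale/=; ring.
 have D3 : is_derive (lam xi * t * (s * s)) 1 expR (expR (lam xi * t * (s * s))) by exact: is_derive_expR.
 rewrite /F; apply: trigger_derive; rewrite /GRing.scale/=. lra.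
have F01 : F 1 = F 0 by apply: is_derive_0_is_cst.
have f0 : f 0 = 1.
 by rewrite /f -(Ri_G n t0); apply: Ri_eq => y; rewrite mul0r cos0 mulr1.
move: F01; rewrite /F f0 !mulr0 expR0 !mulr1 => h.
have -> : Ri m (fun y => G t y * cosx xi y) = f 1 by apply: Ri_eq => y; rewrite mul1r.
apply: (@mulIf _ (expR (lam xi * t))); first by rewrite gt_eqF ?expR_gt0.
by rewrite h -expRD addNr expR0.
Qed.

Lemma gauss_ft_sin t : 0 < t -> Ri m (fun y => G t y * sin (ph y)) = 0.
Proof.
move=> t0; have mG := measurable_G t : mfun (G t : T -> R).
have i : itg m (fun y => G t y * sin (ph y)).
 by apply: (itgM 1 (itg_G n t0)) => [|y]; [mm|exact: sin_le1].
have : Ri m (fun y => G t y * sin (ph y)) = - Ri m (fun y => G t y * sin (ph y)).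
 rewrite -[LHS](Ri_refl 0 (itg_m i)) -RiN//; apply: Ri_eq => y. by rewrite sub0r GN /ph dotvNl mulrN sinN mulrN.
lra.
Qed.
End gauss_ft.

(** The real part of the transform of g at xi times exp(2 pi i x.xi), the integrand of the inversion
    formula. Written as a convolution, it lets kernels act on it by commutation. *)
Definition PP g x xi := conv g (cosx xi) x.

Lemma mf_PP g d (U : measurableType d) (f h : U -> T) : mfun g ->
 mfun f -> mfun h -> mfun (fun u => PP g (f u) (h u)).
Proof.
move=> mg mf mh; apply: (@measurable_Rint _ _ _ _ _ m (fun u y => g y * cosx (h u) (f u - y))).
apply: mf_mul; first by mm.
by apply: mf_cosx; mm.
Qed.

Lemma conv_G_cosx t xi x : 0 < t -> conv (G t) (cosx xi) x = expR (- (lam xi * t)) * cosx xi x.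
Proof.
move=> t0; have mG := measurable_G t : mfun (G t : T -> R).
have mc : mfun (cosx xi) by exact: bm_m (bm_cosx xi).
pose sx y := sin (2 * pi * dotv y xi).
have ms : mfun sx.
 apply: mf_sin; apply: mf_mul; first exact: mf_cst. by apply: mf_dotv.
have i1 : itg m (fun y => G t y * cosx xi y) by apply: (itgM 1 (itg_G n t0)) => [|y]; [mm|exact: cos_le1].
have i2 : itg m (fun y => G t y * sx y) by apply: (itgM 1 (itg_G n t0)) => [|y]; [mm|exact: sin_le1].
rewrite /conv (Ri_eq (fun y => cosx xi x * (G t y * cosx xi y) + sx x * (G t y * sx y))).
 rewrite RiD; [|exact: itgZ|exact: itgZ]. by rewrite !RiZ// gauss_ft// gauss_ft_sin// mulr0 addr0 mulrC.
by move=> y; rewrite /cosx dotvBl mulrBr cosB -/(sx x) -/(sx y); ring.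
Qed.

Lemma G_expR t y : 0 < t -> G t y = expR (- (dotv y y / (4 * t))) * (sqrt (4 * pi * t))^-1 ^+ n.
Proof.
move=> t0; rewrite /G /g1 big_split/= prodr_const card_ord; congr (_ * _).
rewrite -expR_sum; congr expR; rewrite /dotv mulr_suml -sumrN; apply: eq_bigr => i _.
lra.
Qed.

Let gscal (q d r : R) : 0 < q -> 0 < r -> (2 * q) ^+ 2 * d * r = d / (4 * (16 * q ^+ 2 * r)^-1).
Proof. lra. Qed.

Let gscal' (q d r : R) : 0 < q -> 0 < r -> (2 * q) ^+ 2 * d * (16 * q ^+ 2 * r)^-1 = d / (4 * r).
Proof. by move=> q0 r0; field; rewrite !gt_eqF. Qed.

Let gscal1 (q r : R) : 0 < q -> 0 < r -> 4 * q * (16 * q ^+ 2 * r)^-1 * (4 * q * r) = 1.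
Proof. by move=> q0 r0; field; rewrite !gt_eqF. Qed.

Lemma itg_gauss t : 0 < t -> itg m (fun xi => expR (- (lam xi * t))).
Proof.
move=> t0; pose s := (16 * pi ^+ 2 * t)^-1 : R.
have pi0 : 0 < pi :> R by exact: pi_gt0.
have s0 : 0 < s by rewrite invr_gt0 mulr_gt0// mulr_gt0// exprn_gt0.
have -> : (fun xi => expR (- (lam xi * t))) = (fun xi => (sqrt (4 * pi * s)) ^+ n * G s xi).
 apply/funext => xi; rewrite G_expR// mulrCA exprVn mulfV ?mulr1; last by rewrite expf_neq0// gt_eqF ?sqpit_gt0. congr (expR (- _)); rewrite /lam; exact: gscal.
by apply: itgZ; exact: itg_G.
Qed.

(** As a function of xi the Gaussian is a multiple of the heat kernel at time 1 / (16 pi^2 t), so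
    [gauss_ft] applies a second time. *)
Lemma gauss_inv t y : 0 < t -> Ri m (fun xi => expR (- (lam xi * t)) * cosx xi y) = G t y.
Proof.
move=> t0; pose s := (16 * pi ^+ 2 * t)^-1 : R.
have pi0 : 0 < pi :> R by exact: pi_gt0.
have s0 : 0 < s by rewrite invr_gt0 mulr_gt0// mulr_gt0// exprn_gt0.
rewrite (Ri_eq (fun xi => (sqrt (4 * pi * s)) ^+ n * (G s xi * cosx y xi))); last first.
 move=> xi; rewrite mulrA /cosx dotvC; congr (_ * _). rewrite G_expR// mulrCA exprVn mulfV ?mulr1; last by rewrite expf_neq0// gt_eqF ?sqpit_gt0.
 congr (expR (- _)); rewrite /lam; exact: gscal.
rewrite RiZ; last first.
 apply: (itgM 1 (itg_G n s0)) => [|z]; last exact: cos_le1. by apply: mf_cosx.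
rewrite gauss_ft// G_expR// mulrC; congr (_ * _).
 congr (expR (- _)); rewrite /lam; exact: gscal'.
congr (_ ^+ n); apply: (@mulIf _ (sqrt (4 * pi * t))); first by rewrite gt_eqF ?sqpit_gt0.
rewrite mulVf ?gt_eqF ?sqpit_gt0// -sqrtrM; last by rewrite mulr_ge0 ?(ltW s0)// mulr_ge0 ?(ltW pi0).
by rewrite gscal1// sqrtr1.
Qed.

Lemma PP_le g x xi : itg m g -> `|PP g x xi| <= Ri m (absf g).
Proof.
move=> ig; have mg := itg_m ig; apply: Ri_norm_le; [|exact: itg_norm|].
 by apply: mf_mul => //; apply: mf_cosx; mm.
by move=> y; rewrite normrM ler_piMr//; exact: cos_le1.
Qed.

Lemma bm_PP g xi : itg m g -> bm (fun x => PP g x xi).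
Proof. by move=> ig; apply: bm_conv => //; exact: bm_cosx. Qed.

(** Inversion for the heat flow: with [gauss_inv] substituted for the kernel, it is an exchange of
    integrals. *)
Lemma He_four g t x : 0 < t -> itg m g -> He t g x = Ri m (fun xi => expR (- (lam xi * t)) * PP g x xi).
Proof.
move=> t0 ig; have mg := itg_m ig; have mG := measurable_G t : mfun (G t : T -> R).
have ie := itg_gauss t0; have me := itg_m ie.
have mc (f h : T * T -> T) := @mf_cosx _ _ f h.
have ic xi : itg m (fun z => g z * cosx xi (x - z)).
 by apply: (itgM 1 ig) => [|z]; [by apply: mf_cosx; mm|exact: cos_le1].
rewrite (Ri_eq (fun xi => Ri m (fun z => expR (- (lam xi * t)) * (g z * cosx xi (x - z))))); last first.
 by move=> xi; rewrite RiZ.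
rewrite (@fubini_dom _ _ _ _ _ m m _ (fun xi => Ri m (absf g) * expR (- (lam xi * t)))).
- rewrite (Ri_eq (fun z => g z * G t (x - z))) => [|z]; last first.
  rewrite -gauss_inv// -RiZ; last first.
   by apply: (itgM 1 ie) => [|z']; [by apply: mf_cosx; mm|exact: cos_le1].
  by apply: Ri_eq => xi; rewrite mulrCA.
 rewrite /He /conv -[RHS](Ri_refl x); last by mm. by apply: Ri_eq => z; rewrite mulrC opprB addrCA subrr addr0.
- apply: mf_mul; first exact: (measurableT_comp me (@measurable_fst _ _ _ _)). by apply: mf_mul; [mm|apply: mf_cosx; mm].
- exact: itgZ.
- by move=> xi; apply: itgZ.
- move=> xi; rewrite [leRHS]mulrC -RiZ; last exact: itg_norm. apply: Ri_le; [exact/itg_norm/itgZ|exact/itgZ/itg_norm|move=> z].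
 rewrite !normrM (ger0_norm (expR_ge0 _)); apply: ler_wpM2l; first exact: expR_ge0. by rewrite ler_piMr//; exact: cos_le1.
- move=> z; apply: (itg_dom (fun xi => `|g z| * expR (- (lam xi * t)))); last exact: itgZ.
  by apply: mf_mul => //; apply: mf_mul; [mm|apply: mf_cosx; mm].
 move=> xi; rewrite !normrM (ger0_norm (expR_ge0 _)) mulrC mulrAC. by rewrite ler_piMr//; exact: cos_le1.
Qed.

Lemma PP_partial2 j g x xi : smooth_cc g -> PP (partial j (partial j g)) x xi = - (2 * pi * xi ord0 j) ^+ 2 * PP g x xi.
Proof.
move=> hg; have hg1 := scc_partial j hg; have hg2 := scc_partial j hg1.
set k := 2 * pi * xi ord0 j.
have h (r : R) z : 2 * pi * dotv (x - (z + r *: ee R j)) xi = 2 * pi * dotv (x - z) xi + r * (- k).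
 by rewrite opprD addrA -scaleNr ph_ee /k; ring.
have [qc qs] := @trig_qd j (- k) (fun z => 2 * pi * dotv (x - z) xi) h.
have mp : mfun (fun z => 2 * pi * dotv (x - z) xi) by apply: mf_mul; [mm|apply: mf_dotv; mm].
have [C1 C10 q1] := scc_qd j hg1; have [C0 C00 q0] := scc_qd j hg.
have mg := scc_m hg; have mg1 := scc_m hg1; have mg2 := scc_m hg2.
rewrite /PP /conv /cosx (ibp q1 qc)//; [|exact: mf_cos|by apply: mf_mul; [mm|exact: mf_sin]].
rewrite (Ri_eq (fun y => k * (partial j g y * sin (2 * pi * dotv (x - y) xi)))) => [|y]; last by ring.
rewrite RiZ; last by apply: (itgM 1 (scc_itg hg1)) => [|y]; [exact: mf_sin|exact: sin_le1].
rewrite (ibp q0 qs)//; [|exact: mf_sin|by apply: mf_mul; [mm|exact: mf_cos]].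
rewrite (Ri_eq (fun y => - k * (g y * cos (2 * pi * dotv (x - y) xi)))) => [|y]; last by ring.
rewrite RiZ; first by ring.
by apply: (itgM 1 (scc_itg hg)) => [|y]; [exact: mf_cos|exact: cos_le1].
Qed.

(** Each entry i of the list costs two derivatives in direction i, which multiply [PP] by -(2 pi
    xi_i)^2; this pays for a factor 1 + xi_i^2 because (2 pi)^2 >= 1. Repetitions in the list give
    powers of the weight in [PP_dec]. *)
Lemma PP_decay l g : smooth_cc g -> exists2 C, 0 <= C &
 forall x xi, \prod_(i <- l) (1 + xi ord0 i ^+ 2) * `|PP g x xi| <= C.
Proof.
elim: l g => [|i l IH] g hg.
 exists (Ri m (absf g)) => [|x xi]; first by apply: Ri_ge0. by rewrite big_nil mul1r; apply: PP_le; exact: scc_itg.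
have [C C0 hC] := IH g hg; have [D D0 hD] := IH _ (scc_partial i (scc_partial i hg)).
exists (C + D) => [|x xi]; first exact: addr_ge0.
rewrite big_cons -mulrA mulrDl mul1r; apply: lerD => //; apply: le_trans (hD x xi).
rewrite mulrCA; apply: ler_wpM2l; first by apply: prodr_ge0 => k _; rewrite addr_ge0 ?sqr_ge0.
rewrite PP_partial2// normrM normrN [`|_ ^+ 2|]ger0_norm ?sqr_ge0//; apply: ler_wpM2r => //.
rewrite exprMn ler_peMl ?sqr_ge0//; have := pi_ge2 R; nra.
Qed.

Lemma PP_dec g (k : nat) : smooth_cc g -> exists2 C, 0 <= C & forall x xi, `|PP g x xi| <= C * dec xi ^+ k.
Proof.
move=> hg; have [C C0 hC] := PP_decay (flatten (nseq k (index_enum 'I_n))) hg.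
exists C => // x xi; rewrite decV exprVn ler_pdivlMr; last first.
 by rewrite exprn_gt0//; apply: prodr_gt0 => i _; rewrite ltr_pwDl// sqr_ge0.
rewrite mulrC; apply: le_trans (hC x xi); apply: ler_wpM2r => //.
by elim: k {hC} => [|k IH]; rewrite ?big_nil// exprS big_cat; apply: ler_pM => //; [apply: prodr_ge0|apply: exprn_ge0; apply: prodr_ge0] => i _; rewrite addr_ge0 ?sqr_ge0.
Qed.

Lemma dotv_dec xi : (1 + dotv xi xi) * dec xi <= 1.
Proof.
have p : 0 < \prod_(i < n) (1 + xi ord0 i ^+ 2) by apply: prodr_gt0 => i _; rewrite ltr_pwDl// sqr_ge0.
rewrite decV ler_pdivrMr// mul1r /dotv.
suff [] : 1 + \sum_(i < n) xi ord0 i * xi ord0 i <= \prod_(i < n) (1 + xi ord0 i ^+ 2) /\ 0 <= \sum_(i < n) xi ord0 i * xi ord0 i by [].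
elim: (index_enum _) => [|i l [IH h]]; first by rewrite !big_nil addr0.
rewrite !big_cons; have s0 := sqr_ge0 (xi ord0 i); rewrite -expr2; split; last exact: addr_ge0.
apply: (le_via ((1 + xi ord0 i ^+ 2) * (1 + \sum_(j <- l) xi ord0 j * xi ord0 j))).
 by rewrite mulrDl mul1r mulrDr mulr1; have := mulr_ge0 s0 h; lra.
by apply: ler_wpM2l => //; exact: addr_ge0.
Qed.
End fourier.

Lemma Ri0 d (T : measurableType d) (R : realType) (m : {measure set T -> \bar R}) : Ri m (fun _ => 0) = 0.
Proof. by rewrite /Ri Rintegral_cst// mul0r. Qed.

(** * Subordination of the heat flow *)

Section subord1.
Variable R : realType.
Notation mu := (@lebesgue_measure R).
Variables (s : R) (s01 : 0 < s < 1).
Let s0 : 0 < s. Proof. by case/andP: s01. Qed.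
Let si0 : 0 < s^-1. Proof. by rewrite invr_gt0. Qed.
Let si1 : 1 <= s^-1. Proof. by case/andP: s01 => _ /ltW h; rewrite invf_ge1. Qed.

(** This is |y|^(2/s). The set where it is at most r has length 2 r^(s/2), so the image of dy is a
    multiple of r^(s/2-1) dr, the usual subordination density without its singularity at 0. *)
Definition om (y : R) := (y ^+ 2) `^ s^-1.

Lemma om_ge0 y : 0 <= om y. Proof. exact: powR_ge0. Qed.

Lemma continuous_om : continuous om.
Proof.
move=> y; have [->|y0] := eqVneq y 0.
 apply/cvgrPdist_le => e e0; near=> z. have ze : `|z| < Num.min 1 e.
  near: z; exists (Num.min 1 e) => /=; first by rewrite lt_min ltr01. by move=> z /=; rewrite sub0r normrN.
 move: ze; rewrite lt_min => /andP[z1 ze]. rewrite /om expr0n/= powR0 ?gt_eqF// sub0r normrN ger0_norm ?powR_ge0//.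
 have [->|z0] := eqVneq z 0; first by rewrite expr0n/= powR0 ?gt_eqF// ltW. have zz : 0 < z ^+ 2 <= 1.
  have zp := ltW z1; apply/andP; split; first by rewrite exprn_even_gt0. by rewrite -real_normK ?num_real//; exact: exprn_ile1.
 apply: (le_trans (ge1r_powR zz si1)); apply: le_trans (ltW ze). by rewrite -real_normK ?num_real// expr2 ler_piMr// (ltW z1).
have y2 : 0 < y ^+ 2 by rewrite exprn_even_gt0.
apply: (@continuous_comp _ _ _ (fun y : R => y ^+ 2) (fun z => z `^ s^-1)); first exact: exprn_continuous.
apply/differentiable_continuous/derivable1_diffP; apply: derivable_powR.
by rewrite in_itv/= y2.
Unshelve. all: by end_near.
Qed.

Lemma measurable_om : mfun om.
Proof. exact: continuous_measurable_fun continuous_om. Qed.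

Lemma om_sqr y : 1 <= `|y| -> y ^+ 2 <= om y.
Proof.
move=> y1; rewrite /om le1r_powR//.
by rewrite -real_normK ?num_real// exprn_ege1.
Qed.

Lemma itg_eom a : 0 < a -> itg mu (fun y => expR (- (a * om y))).
Proof.
move=> a0; have mo := measurable_om.
apply: (itg_dom _ _ _ (itgZ (2 + a^-1) (@itg_dec1 R))); first by mm.
move=> y; have p : 0 < 1 + y ^+ 2 by rewrite ltr_pwDl// sqr_ge0.
rewrite ger0_norm ?expR_ge0// ler_pdivlMr//.
have o0 := om_ge0 y; have ao : 0 <= a * om y by rewrite mulr_ge0// ltW.
have e1 : expR (- (a * om y)) <= 1 by rewrite -expR0 ler_expR oppr_le0.
have e0 := expR_gt0 (- (a * om y)); have ai : 0 < a^-1 by rewrite invr_gt0.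
have [y1|y1] := leP 1 `|y|.
 have h : expR (- (a * om y)) * (a * om y) <= 1.
  rewrite -(@ler_pM2l _ (expR (a * om y))) ?expR_gt0// mulrA -expRD subrr expR0 mul1r mulr1. by apply: le_trans (expR_ge1Dx _); rewrite lerDr.
 have h2 : expR (- (a * om y)) * om y <= a^-1.
  by rewrite -(ler_pM2l a0) mulfV ?gt_eqF// mulrCA.
 rewrite mulrDr mulr1. have : expR (- (a * om y)) * y ^+ 2 <= expR (- (a * om y)) * om y by rewrite ler_pM2l// om_sqr. lra.
have y2 : y ^+ 2 <= 1 by rewrite -real_normK ?num_real// exprn_ile1// ltW.
have : expR (- (a * om y)) * (1 + y ^+ 2) <= 1 * 2 by apply: ler_pM; lra.
lra.
Qed.

Definition com := Ri mu (fun y => expR (- om y)).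

(** Substitution y -> a^(s/2) y, which turns a om(y) into om. *)
Lemma eom_scale a : 0 < a -> Ri mu (fun y => expR (- (a * om y))) = (a `^ (s / 2))^-1 * com.
Proof.
move=> a0; set l := a `^ (s / 2); have l0 : 0 < l by exact: powR_gt0.
have E y : a * om y = om (l * y).
 rewrite /om exprMn (powRM _ (sqr_ge0 l) (sqr_ge0 y)); congr GRing.mul.
 rewrite -powR_mulrn ?powR_ge0// -powRrM /l -powRrM (_ : s / 2 * (2%:R * s^-1) = 1) ?powRr1 ?(ltW a0)//. by field; rewrite gt_eqF.
have dl : derive1 (fun y : R => l * y) = cst l.
 apply/funext => y; rewrite derive1E. have D : is_derive y 1 (fun y : R => l * y) l by apply: trigger_derive; rewrite /GRing.scale/=; ring. exact: derive_val.
have key : (\int[mu]_x (expR (- om x))%:E = \int[mu]_x (l%:E * (expR (- (a * om x)))%:E))%E.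
 rewrite (@increasing_ge0_integration_by_substitutionT _ (fun y => l * y) (fun y => expR (- om y))).
 - by apply: eq_integral => y _; rewrite dl E -EFinM mulrC.
 - by move=> x y xy; rewrite ltr_pM2l.
 - by rewrite dl; exact: cst_continuous.
 - by rewrite dl; apply/cvg_ex; exists l; exact: cvg_cst.
 - by rewrite dl; apply/cvg_ex; exists l; exact: cvg_cst.
 - by [].
 - exact: gt0_cvgMrNy.
 - exact: gt0_cvgMry.
 - move=> y; apply: (@continuous_comp _ _ _ (fun y => - om y) expR); last exact: continuous_expR. by apply: cvgN; exact: continuous_om.
 - by [].
apply: (@mulfI _ l); first by rewrite gt_eqF.
rewrite mulrA mulfV ?gt_eqF// mul1r -RiZ; last exact: itg_eom.
by rewrite /com /Ri /Rintegral key.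
Qed.

Lemma com_gt0 : 0 < com.
Proof.
have i1 : itg mu (fun y => expR (- om y)) by under eq_fun do rewrite -[om _]mul1r; exact: itg_eom.
have mI : measurable (`[0, 1]%classic : set R) by [].
have fI : (mu (`[0%R, 1%R]%classic : set R) < +oo)%E.
 by rewrite lebesgue_measure_itv lte_fin ltr01 -EFinB ltry.
have RI : Ri mu (fun y => \1_(`[0, 1]%classic : set R) y) = 1.
 rewrite /Ri /Rintegral integral_indic// setIT. transitivity (fine (@lebesgue_measure R `[0%R, 1%R]%classic)) => //.
 by rewrite lebesgue_measure_itv lte_fin ltr01 -EFinB subr0.
have iI : itg mu (fun y => \1_(`[0, 1]%classic : set R) y).
 apply: itgP; first by apply: mf_indic. rewrite (_ : (fun y => _) = (fun y => (\1_(`[0, 1]%classic : set R) y)%:E)).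
  by rewrite integral_indic// setIT.
 by apply/funext => y; rewrite ger0_norm// indicE ler0n.
apply: (@lt_le_trans _ _ (Ri mu (fun y => expR (- 1) * \1_(`[0, 1]%classic : set R) y))).
 by rewrite RiZ// RI mulr1 expR_gt0.
apply: Ri_le => //; first exact: itgZ.
move=> y; rewrite indicE; case: (boolP (y \in _)) => [|_]; last by rewrite mulr0 expR_ge0.
rewrite inE/= in_itv/= mulr1 ler_expR lerN2 => /andP[y0 y1].
rewrite /om; have : (y ^+ 2) `^ s^-1 <= 1 `^ s^-1.
 by rewrite ge0_ler_powR ?nnegrE ?sqr_ge0 ?(ltW si0)// exprn_ile1.
by rewrite powR1.
Qed.
End subord1.

Section subord.
Variables (R : realType) (n : nat).
Notation T := 'rV[R]_n.
Notation m := (lebm R n).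
Notation mu := (@lebesgue_measure R).
Variables (s : R) (s01 : 0 < s < 1).
Let s0 : 0 < s. Proof. by case/andP: s01. Qed.
Implicit Types (t : R) (x y z xi : T) (g h k : T -> R) (j : 'I_n).

Definition wt xi := (lam xi) `^ (s / 2).

Lemma wt_ge0 xi : 0 <= wt xi. Proof. exact: powR_ge0. Qed.

Lemma measurable_lam : mfun (@lam R n).
Proof.
apply: mf_mul; first exact: mf_cst.
by apply: mf_dotv.
Qed.

Lemma measurable_wt : mfun wt.
Proof. exact: mf_powR measurable_lam. Qed.

Lemma wtE xi : (2 * pi * enorm xi) `^ s = wt xi.
Proof.
have p : 0 <= 2 * pi * enorm xi by rewrite !mulr_ge0 ?sqrtr_ge0 ?pi_ge0.
rewrite /wt (_ : lam xi = (2 * pi * enorm xi) `^ 2).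
 by rewrite -powRrM; congr (_ `^ _); field.
by rewrite powR_mulrn// exprMn /enorm sqr_sqrtr ?dotv_ge0.
Qed.

Lemma PP_wt h : smooth_cc h -> exists2 C, 0 <= C & forall x xi, wt xi * `|PP h x xi| <= C * dec xi.
Proof.
move=> hh; have [C C0 hC] := PP_dec 2 hh.
pose K : R := (2 * pi) ^+ 2; have K0 : 0 <= K by exact: sqr_ge0.
exists ((1 + K) * C) => [|x xi]; first by rewrite mulr_ge0 ?addr_ge0.
have d0 := dec_gt0 xi; have l0 := lam_ge0 xi; have v0 := dotv_ge0 xi.
have w1 : wt xi <= 1 + lam xi.
 rewrite /wt; have [l1|l1] := leP (lam xi) 1.
  have : lam xi `^ (s / 2) <= 1 `^ (s / 2) by rewrite ge0_ler_powR ?nnegrE// divr_ge0// ltW. by rewrite powR1; lra.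
 have : lam xi `^ (s / 2) <= lam xi.
  by rewrite ler1_powR; case/andP: s01 => ?; lra.
 lra.
have w2 : wt xi * dec xi <= 1 + K.
 apply: (le_via ((1 + K) * (1 + dotv xi xi) * dec xi)).
  apply: ler_wpM2r; first exact: ltW. apply: (le_trans w1); rewrite /lam -/K mulrDr mulr1 mulrDl mul1r; have := mulr_ge0 K0 v0; lra.
 by rewrite -mulrA ler_piMr ?addr_ge0// dotv_dec.
apply: (le_via (wt xi * (C * dec xi ^+ 2))); first by apply: ler_wpM2l (hC _ _); exact: wt_ge0.
rewrite expr2 (_ : wt xi * (C * (dec xi * dec xi)) = (wt xi * dec xi) * (C * dec xi)); last by ring.
by rewrite -[leRHS]mulrA; apply: ler_wpM2r => //; rewrite mulr_ge0// ltW.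
Qed.

Lemma m_wP h x : mfun h -> mfun (fun xi => wt xi * PP h x xi).
Proof.
by move=> mh; have mw := measurable_wt; apply: mf_mul => //; apply: mf_PP.
Qed.

Lemma itg_wP h x : smooth_cc h -> itg m (fun xi => wt xi * PP h x xi).
Proof.
move=> hh; have [C C0 hC] := PP_wt hh.
apply: (itg_dom _ (m_wP x (scc_m hh)) _ (itgZ C (itg_dec R n))) => xi.
by rewrite normrM ger0_norm ?wt_ge0.
Qed.

Lemma fraclapE h x : smooth_cc h -> fraclap s h x = Ri m (fun xi => wt xi * PP h x xi).
Proof.
move=> hh; have [C C0 hC] := PP_wt hh; have mh := scc_m hh; have [D D0 hD] := scc_bound hh.
have mph z : mfun (fun y : T => 2 * pi * dotv y z).
 by apply: mf_mul; [exact: mf_cst|apply: mf_dotv; mm].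
have le1 (r a : R) y : `|r| <= 1 -> `|h y * r| <= D * dec y.
 by move=> r1; apply: le_trans (hD y); rewrite normrM ler_piMr.
have E xi : fourierC h xi * cos (2 * pi * dotv x xi) + fourierS h xi * sin (2 * pi * dotv x xi) = PP h x xi.
 have i1 : itg m (fun y => h y * cos (2 * pi * dotv y xi)).
  by apply: (itgM 1 (scc_itg hh)) => [|y]; [exact: mf_cos|exact: cos_le1].
 have i2 : itg m (fun y => h y * sin (2 * pi * dotv y xi)).
  by apply: (itgM 1 (scc_itg hh)) => [|y]; [exact: mf_sin|exact: sin_le1].
 rewrite /fourierC /fourierS !iintE; last first.
 - by exists D => y; apply: le1 => //; exact: cos_le1.
 - exact: itg_m i1.
 - by exists D => y; apply: le1 => //; exact: sin_le1.
 - exact: itg_m i2.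
 rewrite mulrC [X in _ + X]mulrC -!RiZ// -RiD; [|exact: itgZ|exact: itgZ]. by apply: Ri_eq => y; rewrite /cosx dotvBl mulrBr cosB; ring.
rewrite /fraclap (_ : (fun xi => _) = (fun xi => wt xi * PP h x xi)).
 rewrite iintE//; first exact: m_wP. by exists C => xi; rewrite normrM ger0_norm ?wt_ge0.
by apply/funext => xi; rewrite wtE E.
Qed.

Lemma bm_FL h : smooth_cc h -> bm (fraclap s h).
Proof.
move=> hh; have [C C0 hC] := PP_wt hh; have mh := scc_m hh; have mw := measurable_wt.
rewrite (_ : fraclap s h = fun x => Ri m (fun xi => wt xi * PP h x xi)); last first.
 by apply/funext => x; rewrite fraclapE.
split.
 apply: (@measurable_Rint _ _ _ _ _ m (fun x xi => wt xi * PP h x xi)). by apply: mf_mul; [mm|apply: mf_PP; mm].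
exists (Ri m (fun xi => C * dec xi)) => x; apply: Ri_norm_le; [exact: m_wP|exact/itgZ/itg_dec|].
by move=> xi; rewrite normrM ger0_norm ?wt_ge0.
Qed.

Lemma conv_FL k h x : itg m k -> smooth_cc h ->
 conv k (fraclap s h) x = Ri m (fun xi => wt xi * conv k (fun z => PP h z xi) x).
Proof.
move=> ik hh; have [C C0 hC] := PP_wt hh; have mh := scc_m hh; have mw := measurable_wt; have mk := itg_m ik.
rewrite /conv (Ri_eq (fun y => Ri m (fun xi => k y * (wt xi * PP h (x - y) xi)))); last first.
 by move=> y; rewrite RiZ ?fraclapE//; exact: itg_wP.
have bd y xi : `|k y * (wt xi * PP h (x - y) xi)| <= `|k y| * (C * dec xi).
 by rewrite normrM; apply: ler_wpM2l => //; rewrite normrM ger0_norm ?wt_ge0.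
have mj : mfun (fun p : T * T => k p.1 * (wt p.2 * PP h (x - p.1) p.2)).
 by apply: mf_mul; [mm|apply: mf_mul; [mm|apply: mf_PP; mm]].
have idec : itg m (fun xi => C * dec xi) by apply: itgZ; exact: itg_dec.
rewrite (@fubini_dom _ _ _ _ _ m m _ (fun y => Ri m (fun xi => C * dec xi) * `|k y|)) => //.
- apply: Ri_eq => xi; rewrite -RiZ; last by apply: conv_itg => //; apply: bm_PP; exact: scc_itg. by apply: Ri_eq => y; rewrite mulrCA.
- exact/itgZ/itg_norm.
- by move=> y; apply: itgZ; exact: itg_wP.
- move=> y; rewrite mulrC -RiZ//; apply: Ri_le; [exact/itg_norm/itgZ/itg_wP|exact: itgZ|exact: bd].
- move=> xi; apply: (itg_dom (fun y => (C * dec xi) * `|k y|)); last exact/itgZ/itg_norm.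
  by apply: mf_mul => //; apply: mf_mul; [exact: mf_cst|apply: mf_PP; mm].
 by move=> y; rewrite [leRHS]mulrC.
Qed.

Lemma conv_G_PP h t x xi : 0 < t -> smooth_cc h ->
 conv (G t) (fun z => PP h z xi) x = expR (- (lam xi * t)) * PP h x xi.
Proof.
move=> t0 hh; rewrite /PP conv_comm2//; [|exact: itg_G|exact: scc_itg|exact: bm_cosx].
have -> : conv (G t) (cosx xi) = (fun z => expR (- (lam xi * t)) * cosx xi z).
 by apply/funext => z; rewrite conv_G_cosx.
by rewrite convZ//; [exact: scc_itg|exact: bm_cosx].
Qed.

Lemma He_FL h t x : 0 < t -> smooth_cc h ->
 He t (fraclap s h) x = Ri m (fun xi => wt xi * (expR (- (lam xi * t)) * PP h x xi)).
Proof.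
move=> t0 hh; rewrite /He conv_FL//; last exact: itg_G.
by apply: Ri_eq => xi; rewrite conv_G_PP.
Qed.

(** Both sides are Fourier integrals with the same integrand, so the derivative commutes with the
    fractional Laplacian without being applied to it. *)
Lemma conv_dG_FL j h t x : 0 < t -> smooth_cc h ->
 conv (dG j t) (fraclap s h) x = He t (fraclap s (partial j h)) x.
Proof.
move=> t0 hh; have hh' := scc_partial j hh; rewrite /He (conv_FL x (itg_dG j t0) hh) (conv_FL x (itg_G n t0) hh').
apply: Ri_eq => xi; congr (_ * _).
have E k g (k1 := k) : itg m k -> smooth_cc g -> conv k (fun z => PP g z xi) x = conv (conv k g) (cosx xi) x.
 move=> ik hg; apply: conv_assoc => //; [exact: scc_itg|exact: bm_cosx|]. by have [_ [M hM]] := scc_bm hg; exists M.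
rewrite (E _ _ (itg_dG j t0) hh) (E _ _ (itg_G n t0) hh').
have -> // : conv (dG j t) h = conv (G t) (partial j h).
by apply/funext => z; rewrite -He_partial.
Qed.

(** The maximum of the kernel decays like t^(-n/2); this needs at least one coordinate. *)
Lemma G_small e : (0 < n)%N -> 0 < e -> exists2 t0, 0 < t0 & forall t y, t0 <= t -> G t y <= e.
Proof.
move=> n0 e0; pose r : R := Num.min e 1; have r0 : 0 < r by rewrite lt_min e0 ltr01.
exists (r ^- 2) => [|t y tr]; first by rewrite invr_gt0 exprn_gt0.
have t0 : 0 < t by apply: lt_le_trans tr; rewrite invr_gt0 exprn_gt0.
have q0 := sqpit_gt0 t0.
have qr : (sqrt (4 * pi * t))^-1 <= r.
 rewrite -[r]invrK lef_pV2 ?posrE ?invr_gt0//. rewrite -[leLHS]ger0_norm ?invr_ge0 ?(ltW r0)// -sqrtr_sqr ler_sqrt; last by rewrite ltW ?pit_gt0.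
 rewrite exprVn; apply: (le_trans tr); rewrite ler_peMl ?(ltW t0)//; have := pi_ge2 R; lra.
rewrite G_expR//; apply: (le_via (1 * (sqrt (4 * pi * t))^-1 ^+ n)).
 apply: ler_wpM2r; first by rewrite exprn_ge0// invr_ge0 ltW. by rewrite -expR0 ler_expR oppr_le0 divr_ge0 ?dotv_ge0// mulr_ge0// ltW.
rewrite mul1r -(prednK n0) exprS -[leRHS]mulr1; apply: ler_pM.
- by [].
- by [].
- by apply: (le_trans qr); rewrite ge_min lexx.
- apply: exprn_ile1; first by rewrite invr_ge0 ltW. by apply: (le_trans qr); rewrite ge_min lexx orbT.
Qed.

(** For lam > 0, [eom_scale] makes wt times the y-integral of exp(-lam (t + om y)) equal to com
    exp(-lam t); Fubini transfers this to the functions. *)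
Lemma subordination h t x : (0 < n)%N -> 0 < t -> smooth_cc h ->
 itg mu (fun y : R => He (t + om s y) (fraclap s h) x) /\
 com s * He t h x = Ri mu (fun y : R => He (t + om s y) (fraclap s h) x).
Proof.
move=> n0 t0 hh; have [C C0 hC] := PP_wt hh; have mh := scc_m hh; have mw := measurable_wt.
have [C1 C10 hC1] := PP_dec 1 hh.
have mo := measurable_om s01; have ml := measurable_lam; have c0 := com_gt0 s01.
pose F xi (y : R) := wt xi * (expR (- (lam xi * (t + om s y))) * PP h x xi).
have -> : (fun y : R => He (t + om s y) (fraclap s h) x) = (fun y : R => Ri m (F^~ y)).
 by apply/funext => y; rewrite He_FL// ltr_wpDr ?om_ge0.
have e1 xi (r : R) : 0 <= r -> expR (- (lam xi * r)) <= 1.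
 by move=> r0; rewrite -expR0 ler_expR oppr_le0 mulr_ge0// lam_ge0.
have r0 (y : R) : 0 <= t + om s y by rewrite addr_ge0 ?om_ge0// ltW.
have mF : mfun (fun p : T * R => F p.1 p.2).
 by apply: mf_mul; [mm|apply: mf_mul; [mm|apply: mf_PP; mm]].
have mF2 : mfun (fun p : R * T => F p.2 p.1).
 by apply: mf_mul; [mm|apply: mf_mul; [mm|apply: mf_PP; mm]].
have idec : itg m (fun xi => C * dec xi) by apply: itgZ; exact: itg_dec.
have iFy (y : R) : itg m (F^~ y).
 apply: (itg_dom _ _ _ idec) => [|xi].
  by apply: mf_mul; [mm|apply: mf_mul; [mm|apply: mf_PP; mm]].
 apply: le_trans (hC x xi); rewrite normrM (ger0_norm (wt_ge0 _)); apply: ler_wpM2l; first exact: wt_ge0. by rewrite normrM (ger0_norm (expR_ge0 _)) ler_piMl// e1.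
have FE xi : F xi = (fun y : R => (wt xi * expR (- (lam xi * t)) * PP h x xi) * expR (- (lam xi * om s y))).
 by apply/funext => y; rewrite /F mulrDr opprD expRD; ring.
have [w0 iFx RF] : [/\ forall xi, lam xi = 0 -> wt xi = 0, forall xi, itg mu (F xi) &
  forall xi, 0 < lam xi -> Ri mu (F xi) = com s * (expR (- (lam xi * t)) * PP h x xi)].
 have w0 xi : lam xi = 0 -> wt xi = 0 by move=> l0; rewrite /wt l0 powR0// gt_eqF// divr_gt0. split => // xi.
  rewrite FE; have := lam_ge0 xi; rewrite le_eqVlt => /orP[/eqP l0|l0]; last exact/itgZ/itg_eom.
  by rewrite w0// !mul0r; under eq_fun do rewrite mul0r; exact: itg0.
 move=> l0; rewrite FE RiZ; last exact: itg_eom. rewrite eom_scale// /wt; have : lam xi `^ (s / 2) != 0 by rewrite gt_eqF// powR_gt0.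
 by move: (lam xi `^ _) (expR _) (PP _ _ _) => a b c a0; field.
have Fa xi : Ri mu (fun y : R => `|F xi y|) <= com s * (C1 * dec xi).
 have h1 := hC1 x xi; rewrite expr1 in h1. have := lam_ge0 xi; rewrite le_eqVlt => /orP[/eqP l0|l0].
  rewrite (Ri_eq (fun=> 0)) => [|y]; last by rewrite FE !(w0 _ (esym l0)) !mul0r normr0. by rewrite Ri0 mulr_ge0 ?(ltW c0)// (le_trans _ h1).
 have -> : (fun y : R => `|F xi y|) = (fun y : R => `|wt xi * expR (- (lam xi * t)) * PP h x xi| * expR (- (lam xi * om s y))).
  by apply/funext => y; rewrite FE normrM [`|expR (- (lam xi * om s y))|](ger0_norm (expR_ge0 _)).
 rewrite RiZ; last exact: itg_eom. rewrite eom_scale// -/(wt xi) !normrM (ger0_norm (wt_ge0 _)) (ger0_norm (expR_ge0 _)). have wp : 0 < wt xi by exact: powR_gt0.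
 have el : expR (- (lam xi * t)) <= 1 by exact: e1 (ltW t0). rewrite (_ : wt xi * _ * _ * _ = com s * (expR (- (lam xi * t)) * `|PP h x xi|)); last first.
  by move: (expR _) => b; field; rewrite gt_eqF.
 by rewrite ler_pM2l//; apply: le_trans h1; rewrite ler_piMl.
have idec1 : itg m (fun xi => com s * (C1 * dec xi)) by apply: itgZ; apply: itgZ; exact: itg_dec.
have fin := @fubini_fin _ _ _ _ _ m mu F _ mF idec1 iFx Fa.
split.
 apply: (@fubini_integrable _ _ _ _ _ mu m (fun (y : R) xi => F xi y)) => //. rewrite -(@tonelliE _ _ _ _ _ m mu (fun xi (y : R) => `|F xi y|))//; exact: mf_norm.
rewrite -(@fubini_dom _ _ _ _ _ m mu F _ mF idec1 iFx Fa iFy) He_four//; last exact: scc_itg.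
have iQ : itg m (fun xi => expR (- (lam xi * t)) * PP h x xi).
 apply: (itg_dom _ _ _ (itgZ C1 (itg_dec R n))) => [|xi].
  by apply: mf_mul; [mm|apply: mf_PP; mm].
 rewrite normrM (ger0_norm (expR_ge0 _)). by have := hC1 x xi; rewrite expr1; apply: le_trans; rewrite ler_piMl// e1// ltW.
pose E xi := com s * (expR (- (lam xi * t)) * PP h x xi).
have iE : itg m E by exact: itgZ.
have iRF := @fubini_itg _ _ _ _ _ m mu F _ mF idec1 iFx Fa.
rewrite -RiZ//.
(* The integrands may differ where lam = 0. Instead of measuring that set, the difference is bounded
   by K exp(-lam t1), whose integral K G(t1, 0) is made small by the choice of t1. *)
apply/eqP; rewrite -subr_eq0 -RiB// -normr_le0; apply/ler_addgt0Pr => e e0; rewrite add0r.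
pose K := com s * C1 + 1; have K0 : 0 < K by rewrite ltr_wpDl// mulr_ge0// ltW.
have [t1 t10 ht1] := G_small n0 (divr_gt0 e0 K0).
apply: (le_via (Ri m (fun xi => K * expR (- (lam xi * t1))))).
 apply: Ri_norm_le; [exact: itg_m (itgB iE iRF)|exact/itgZ/itg_gauss|move=> xi]. have := lam_ge0 xi; rewrite le_eqVlt => /orP[/eqP l0|l0]; last first.
  by rewrite RF// /E subrr normr0 mulr_ge0// ltW.
 rewrite /E -l0 !mul0r !oppr0 !expR0 mulr1 mul1r (Ri_eq (fun=> 0)) => [|y]; last by rewrite FE !(w0 _ (esym l0)) !mul0r. rewrite Ri0 subr0 normrM (gtr0_norm c0).
 apply: (le_via (com s * C1)); last by rewrite /K lerDl. rewrite ler_pM2l//; have := hC1 x xi; rewrite expr1; move=> h1; apply: (le_trans h1).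
 by rewrite ler_piMr// dec_le1.
rewrite RiZ; last exact: itg_gauss.
have := ht1 t1 0 (lexx _); rewrite ler_pdivlMr// -gauss_inv// mulrC.
by rewrite (Ri_eq (fun xi => expR (- (lam xi * t1)))) // => xi; rewrite /cosx /dotv big1 ?mulr0 ?cos0 ?mulr1// => i _; rewrite mxE mul0r.
Qed.
End subord.

(** * Dyadic sums from the subordination integral *)

Section dyad.
Variable R : realType.
Notation mu := (@lebesgue_measure R).
Variables (s : R) (s01 : 0 < s < 1).
Let s0 : 0 < s. Proof. by case/andP: s01. Qed.

Lemma ta_S (tau : R) k : 0 < tau -> 8 * ta tau k = 2 * ta tau k.+1.
Proof. by move=> _; rewrite /ta exprS; ring. Qed.

Lemma ta_cover (tau r : R) : 0 < tau -> 2 * tau <= r -> exists k, 2 * ta tau k <= r <= 8 * ta tau k.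
Proof.
move=> t0 tr; suff [k kP] : exists k, r <= 8 * ta tau k.
 elim: k kP => [|k IH] h; first by exists 0%N; rewrite /ta expr0 mulr1 tr -[tau]mulr1 -[1](expr0 4). have [h'|h'] := leP r (8 * ta tau k); first exact: IH.
 by exists k.+1; rewrite h -ta_S// ltW.
have [k hk] : exists k : nat, r / tau < k%:R.
 by exists (Num.bound (r / tau)); apply: le_lt_trans (archi_boundP _); rewrite// divr_ge0; lra.
exists k; have kk : k%:R <= 4 ^+ k :> R.
 by rewrite -natrX ler_nat ltnW// ltn_expl.
move: hk; rewrite ltr_pdivrMr// => hk; rewrite /ta.
have : k%:R * tau <= 4 ^+ k * tau by rewrite ler_pM2r.
have : 0 < tau * 4 ^+ k by rewrite mulr_gt0// exprn_gt0.
rewrite [4 ^+ k * tau]mulrC; lra.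
Qed.

Lemma om_le (r y : R) : 0 < r -> om s y <= r -> `|y| <= r `^ (s / 2).
Proof.
move=> r0 h; have : om s y `^ (s / 2) <= r `^ (s / 2).
 by rewrite ge0_ler_powR ?nnegrE ?om_ge0 ?divr_ge0// ltW.
apply: le_trans; rewrite /om -real_normK ?num_real// -powR_mulrn// -!powRrM.
by rewrite (_ : 2%:R * (s^-1 * (s / 2)) = 1) ?powRr1//; field; rewrite gt_eqF.
Qed.

(** The y for which t + om y falls in the k-th window lie in an interval of length 2 (8 ta k)^(s/2),
    at most 16 (ta k)^(s/2). Finite sums with an error e are used so that no summability of c has to
    be known. *)
Lemma dyad (H : R -> R) (tau t : R) (c : nat -> R) : itg mu H -> 0 < tau -> 2 * tau <= t -> nneg c ->
 (forall k y, 2 * ta tau k <= t + om s y <= 8 * ta tau k -> `|H y| <= c k) ->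
 forall e, 0 < e -> exists A0, forall A, (A0 <= A)%N ->
  `|Ri mu H| <= \sum_(k < A) 16 * ta tau k `^ (s / 2) * c k + e.
Proof.
move=> iH tau0 tt c0 hc e e0; have mH := itg_m iH.
pose b k : R := (8 * ta tau k) `^ (s / 2).
pose I k : set R := `[- b k, b k]%classic.
have b0 k : 0 <= b k by exact: powR_ge0.
have mI k : measurable (I k) by exact: measurable_itv.
have key : ((`|Ri mu H|)%:E <= \sum_(0 <= k <oo) (2 * b k * c k)%:E)%E.
 apply: (le_via (\int[mu]_y (`|H y|)%:E)%E).
  by rewrite -RiE; [rewrite lee_fin; exact: Ri_norm|exact: itg_norm].
 apply: (le_via (\int[mu]_y \sum_(0 <= k <oo) (c k * \1_(I k) y)%:E)%E).
  apply: ge0_le_integral => //; [by mm| |move=> y _].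
   apply: ge0_emeasurable_sum => [k y _ _|k _]; first by rewrite lee_fin mulr_ge0// indicE.
   by apply/measurable_EFinP; apply: mf_mul; [exact: mf_cst|exact: (mf_indic (mI k))].
  have o0 := om_ge0 s y. have tt2 : 2 * tau <= t + om s y by lra. have [k hk] := ta_cover tau0 tt2. apply: (le_via (c k * \1_(I k) y)%:E).
   rewrite lee_fin indicE mem_set ?mulr1; first exact: hc hk. rewrite /I/= in_itv/= -ler_norml; apply: om_le.
    lra.
   lra.
  rewrite (@nneseriesD1 R _ k xpredT)//; last by move=> i _; rewrite lee_fin mulr_ge0// indicE.
  by rewrite leeDl// nneseries_ge0// => i _ _; rewrite lee_fin mulr_ge0// indicE.
 rewrite integral_nneseries//; first last.
 - by move=> k y _; rewrite lee_fin mulr_ge0// indicE.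
 - by move=> k; apply/measurable_EFinP; apply: mf_mul; [exact: mf_cst|exact: (mf_indic (mI k))].
 apply: lee_nneseries => [k _ _|k _].
  by apply: integral_ge0 => y _; rewrite lee_fin mulr_ge0// indicE.
 under eq_integral do rewrite EFinM. rewrite ge0_integralZl//; first last.
 - by rewrite lee_fin.
 - by apply/measurable_EFinP; exact: (mf_indic (mI k)).
 have -> : (\int[mu]_x (\1_(I k) x)%:E = mu (I k))%E by rewrite integral_indic ?setIT//; exact: mI. have -> : mu (I k) = (2 * b k)%:E.
  have := @lebesgue_measure_itv R `[- b k, b k]; rewrite /= lte_fin. case: ltP => h -> //; first by rewrite -EFinB; congr EFin; ring.
  by have := b0 k; move=> h2; congr EFin; lra.
 by rewrite -EFinM mulrC.
have bk k : 2 * b k <= 16 * ta tau k `^ (s / 2).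
 have tk := ta_gt0 k tau0; rewrite /b powRM ?(ltW tk)//. have : 8 `^ (s / 2) <= 8 :> R by rewrite ler1_powR; case/andP: s01 => ?; lra.
 by have := powR_gt0 (s / 2) tk; nra.
apply: contrapT => /forallNP hn.
have small A : \sum_(k < A) 2 * b k * c k <= `|Ri mu H| - e.
 have /existsNP[A' /not_implyP[AA /negP]] := hn A. rewrite -ltNge -ltrBrDr => /ltW; apply: le_trans. apply: (le_via (\sum_(k < A') 2 * b k * c k)).
  rewrite -!(big_mkord xpredT (fun k => 2 * b k * c k)) [leRHS](big_cat_nat (n := A))//= lerDl. by apply: sumr_ge0 => k _; rewrite !mulr_ge0.
 by apply: ler_sum => k _; apply: ler_wpM2r.
have : (\sum_(0 <= k <oo) (2 * b k * c k)%:E <= (`|Ri mu H| - e)%:E)%E.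
 apply: lime_le; first by apply: is_cvg_nneseries => k _ _; rewrite lee_fin !mulr_ge0. by apply: nearW => A; rewrite sumEFin big_mkord lee_fin.
by move=> /(le_trans key); rewrite lee_fin; lra.
Qed.
End dyad.

Section sobolev_bounds.
Variables (R : realType) (n : nat).
Notation T := 'rV[R]_n.
Notation m := (lebm R n).
Notation mu := (@lebesgue_measure R).
Variables (s : R) (s01 : 0 < s < 1) (n0 : (0 < n)%N).
Implicit Types (t tau e : R) (x : T) (h : T -> R) (j : 'I_n).

Let s0 : 0 < s. Proof. by case/andP: s01. Qed.

(** One derivative costs ta^(-1/2) by [grad2] and the window has length of order ta^(s/2), whence
    the exponent (s - 1) / 2. *)
Lemma sob_first : exists2 K, 0 < K & forall h j tau t x e, smooth_cc h -> 0 < tau -> 2 * tau <= t -> 0 < e ->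
 exists A0, forall A, (A0 <= A)%N ->
  `|He t (partial j h) x| <= K * (\sum_(k < A) ta tau k `^ ((s - 1) / 2) * Lp (ta tau k) (fraclap s h) x) + e.
Proof.
have c0 := com_gt0 s01; have [C [C0 CE]] : exists C : R, 0 < C /\ 4 * 30 ^+ n * 14 ^+ n = C.
 by exists (4 * 30 ^+ n * 14 ^+ n).
exists ((com s)^-1 * (16 * C)) => [|h j tau t x e hh tau0 tt e0]; first by rewrite mulr_gt0 ?invr_gt0 ?mulr_gt0.
have t0 : 0 < t by lra.
have hh' := scc_partial j hh; have bu := bm_FL s01 hh.
have [iH eH] := subordination s01 x n0 t0 hh'.
pose c k := C / sqrt (2 * ta tau k) * Lp (ta tau k) (fraclap s h) x.
have cpos k : 0 <= c k by apply: mulr_ge0; [rewrite divr_ge0 ?(ltW C0)|apply: Lp_ge0; exact: ta_gt0].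
have ec0 : 0 < com s * e by rewrite mulr_gt0.
have hb k (y : R) : 2 * ta tau k <= t + om s y <= 8 * ta tau k -> `|He (t + om s y) (fraclap s (partial j h)) x| <= c k.
 move=> hk; have tk := ta_gt0 k tau0. have r0 : 0 < t + om s y by lra. rewrite -(conv_dG_FL s01 j x r0 hh); apply: (le_trans (grad2 tk j x hk bu)); rewrite /c CE.
 apply: ler_wpM2r; first exact: Lp_ge0. apply: ler_wpM2l; first exact: ltW. rewrite lef_pV2 ?posrE ?sqrtr_gt0 ?mulr_gt0// ler_sqrt ?(ltW r0)//. by case/andP: hk.
have [A0 hA] := dyad s01 iH tau0 tt cpos hb ec0.
exists A0 => A AA; have := hA A AA; rewrite -eH normrM (gtr0_norm c0) => hm.
rewrite -(ler_pM2l c0); apply: (le_trans hm); rewrite mulrDr; apply: lerD => //.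
rewrite !mulrA mulfV ?gt_eqF// mul1r mulr_sumr; apply: ler_sum => k _.
have tk := ta_gt0 k tau0; rewrite /c.
have L0 := @Lp_ge0 R n (ta tau k) tk (fraclap s h) x.
rewrite (_ : 16 * _ * _ = 16 * C * (ta tau k `^ (s / 2) / sqrt (2 * ta tau k) * Lp (ta tau k) (fraclap s h) x)); last by ring.
apply: ler_wpM2l; first by rewrite mulr_ge0// ltW.
apply: ler_wpM2r => //.
rewrite (_ : (s - 1) / 2 = s / 2 - 2^-1); last by field.
rewrite powRB; last by rewrite (gt_eqF tk) implybT.
rewrite powR12_sqrt ?(ltW tk)//; apply: ler_wpM2l; first exact: powR_ge0.
rewrite lef_pV2 ?posrE ?sqrtr_gt0 ?mulr_gt0// ler_sqrt ?mulr_ge0 ?(ltW tk)//; lra.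
Qed.

(** Two derivatives cost ta^(-1). Since s / 2 - 1 < 0 the sum over the windows is geometric, so this
    factor needs no oscillation and keeps only a maximal function. *)
Lemma sob_second : exists2 K, 0 < K & forall h i j tau t x e m0 tau0, smooth_cc h -> 0 < tau0 -> tau = ta tau0 m0 ->
 2 * tau <= t -> 0 < e -> exists A0, forall A, (A0 <= A)%N ->
  `|He t (partial i (partial j h)) x| <=
   K * tau `^ (s / 2 - 1) * mx (m0 + A) (16 * tau0) (fun y => `|fraclap s h y|) x + e.
Proof.
have c0 := com_gt0 s01; have [C [C0 CE]] : exists C : R, 0 < C /\ 4 ^+ n * 4 ^+ n = C.
 by exists (4 ^+ n * 4 ^+ n).
pose rho : R := 4 `^ (s / 2 - 1).
have rho0 : 0 < rho by exact: powR_gt0.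
have rho1 : 0 < 1 - rho.
 rewrite subr_gt0 /rho (_ : 4 = 2 `^ 2); last by rewrite powR_mulrn// expr2 -natrM. rewrite -powRrM (_ : 2 * (s / 2 - 1) = - (2 - s)); last by field.
 by apply: rho_lt1; case/andP: s01 => ?; lra.
exists ((com s)^-1 * (16 * C / (1 - rho))) => [|h i j tau t x e m0 tau0 hh tau00 tauE tt e0].
 by rewrite mulr_gt0 ?invr_gt0// divr_gt0// mulr_gt0.
have tau1 : 0 < tau by rewrite tauE ta_gt0.
have t0 : 0 < t by lra.
have hj := scc_partial j hh; have hij := scc_partial i hj; have bu := bm_FL s01 hh.
have ba := bm_norm bu; have bj := bm_FL s01 hj.
have [iH eH] := subordination s01 x n0 t0 hij.
pose u := fun y => `|fraclap s h y|.
pose c k := C / ta tau k * He (16 * ta tau k) u x.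
have cpos k : 0 <= c k.
 have tk := ta_gt0 k tau1. by apply: mulr_ge0; [rewrite divr_ge0 ?(ltW tk) ?(ltW C0)|apply: He_ge0 => [|y]; [rewrite mulr_gt0|exact: normr_ge0]].
have ec0 : 0 < com s * e by rewrite mulr_gt0.
have dGu (l : 'I_n) (r : R) (v : T -> R) (z : T) : 0 < r -> bm v -> `|conv (dG l r) v z| <= 2 ^+ n / sqrt r * He (2 * r) (absf v) z.
 move=> r0 bv; have r20 : 0 < 2 * r by rewrite mulr_gt0. have ba' := bm_norm bv. rewrite -(HeZ (2 ^+ n / sqrt r) z r20 ba') /He.
 have E : conv (G (2 * r)) (fun y => 2 ^+ n / sqrt r * `|v y|) z =
   conv (fun y => 2 ^+ n / sqrt r * G (2 * r) y) (absf v) z.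
  by apply: Ri_eq => y; rewrite mulrCA mulrA.
 rewrite E; apply: conv_norm_le => //; [exact: itg_dG|exact/itgZ/itg_G|]. by move=> y; exact: dG_le.
have hb k (y : R) : 2 * ta tau k <= t + om s y <= 8 * ta tau k -> `|He (t + om s y) (fraclap s (partial i (partial j h))) x| <= c k.
 move=> hk; have tk := ta_gt0 k tau1; set r := t + om s y in hk *. have r0 : 0 < r by lra. have r20 : 0 < r / 2 by lra. rewrite -(conv_dG_FL s01 i x r0 hj).
 have -> : conv (dG i r) (fraclap s (partial j h)) x = conv (dG i (r / 2)) (conv (dG j (r / 2)) (fraclap s h)) x.
  have -> : conv (dG j (r / 2)) (fraclap s h) = He (r / 2) (fraclap s (partial j h)).
   by apply/funext => z; rewrite conv_dG_FL.
  by rewrite conv_dGG// -splitr.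
 have bd : bm (conv (dG j (r / 2)) (fraclap s h)) by apply: bm_conv => //; exact: itg_dG. have q0 : 0 <= 2 ^+ n / sqrt (r / 2) by [].
 have hr : 2 * (r / 2) = r by field. apply: (le_trans (dGu i _ _ x r20 bd)); rewrite hr.
 apply: (le_via (2 ^+ n / sqrt (r / 2) * (2 ^+ n / sqrt (r / 2) * He (2 * r) u x))).
  apply: ler_wpM2l => //. have -> : He (2 * r) u = He r (He r u) by rewrite HeHe// (_ : 2 * r = r + r); ring.
  rewrite -(HeZ _ x r0 (bm_He r0 ba)); apply: He_le => //; [exact: bm_norm|exact/bmZ/bm_He|]. by move=> z; have := dGu j _ _ z r20 bu; rewrite hr.
 have h16 : He (2 * r) u x <= 4 ^+ n * He (16 * ta tau k) u x.
  by case/andP: hk => h1 h2; apply: He_mono; [lra|lra|lra|lra|exact: ba|move=> z; exact: normr_ge0].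
 have st : sqrt (r / 2) * sqrt (r / 2) = r / 2 by rewrite -expr2 sqr_sqrtr// ltW.
 rewrite mulrA (_ : 2 ^+ n / sqrt (r / 2) * (2 ^+ n / sqrt (r / 2)) = 4 ^+ n / (r / 2)); last first.
  rewrite -[X in _ = _ / X]st (_ : 4 = 2 * 2); last by ring. by rewrite exprMn; field; rewrite gt_eqF// sqrtr_gt0.
 apply: (le_via (4 ^+ n / ta tau k * (4 ^+ n * He (16 * ta tau k) u x))).
  apply: ler_pM => //; [by rewrite divr_ge0 ?exprn_ge0// ltW|by apply: He_ge0 => [|z]; [rewrite mulr_gt0|exact: normr_ge0]|].
  apply: ler_wpM2l; first exact: exprn_ge0. by rewrite lef_pV2//; case/andP: hk => h1 h2; lra.
 by rewrite /c -CE; apply: le_of_eq; move: (He _ _ _) => ?; ring.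
have [A0 hA] := dyad s01 iH tau1 tt cpos hb ec0.
exists A0 => A AA; have := hA A AA; rewrite -eH normrM (gtr0_norm c0) => hm.
rewrite -(ler_pM2l c0); apply: (le_trans hm); rewrite mulrDr; apply: lerD => //.
set M := mx _ _ _ _; have M0 : 0 <= M by exact: mx_ge0.
have Mk k : (k < A)%N -> He (16 * ta tau k) u x <= M.
 move=> kA; rewrite tauE (_ : 16 * ta (ta tau0 m0) k = 16 * tau0 * 4 ^+ (m0 + k)); last by rewrite /ta exprD; ring. by apply: mx_ge; rewrite ltn_add2l.
apply: (le_via (\sum_(k < A) (16 * C * M * tau `^ (s / 2 - 1)) * rho ^+ k)).
 apply: ler_sum => k _; have tk := ta_gt0 k tau1; have := Mk k (ltn_ord k); rewrite /c. move: (He _ _ _) => H HM.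
 rewrite (_ : 16 * _ * _ = 16 * C * (ta tau k `^ (s / 2) / ta tau k) * H); last by ring. have -> : ta tau k `^ (s / 2) / ta tau k = tau `^ (s / 2 - 1) * rho ^+ k.
  rewrite -{2}[ta tau k]powRr1 ?(ltW tk)// -powRB ?(gt_eqF tk) ?implybT//. rewrite /ta powRM ?exprn_ge0 ?(ltW tau1)//; congr (_ * _).
  by rewrite /rho -powR_mulrn// -[in RHS]powR_mulrn ?powR_ge0// -!powRrM mulrC.
 rewrite (_ : 16 * C * M * _ * _ = 16 * C * (tau `^ (s / 2 - 1) * rho ^+ k) * M); last by ring.
 by apply: ler_wpM2l => //; rewrite !mulr_ge0 ?exprn_ge0 ?powR_ge0 ?(ltW C0).
rewrite -mulr_sumr.
have gs : \sum_(k < A) rho ^+ k <= (1 - rho)^-1.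
 rewrite -[leRHS]mul1r ler_pdivlMr// mulrC. have := subrX1 rho A; rewrite -opprB => /eqP; rewrite eqr_oppLR -mulNr opprB => /eqP <-.
 by rewrite lerBlDr lerDl exprn_ge0// ltW.
have tp : 0 <= tau `^ (s / 2 - 1) by exact: powR_ge0.
rewrite (_ : com s * _ = 16 * C * M * tau `^ (s / 2 - 1) * (1 - rho)^-1); last first.
 by move: (tau `^ _) => a; field; rewrite !gt_eqF.
by apply: ler_wpM2l => //; rewrite !mulr_ge0// ltW.
Qed.
End sobolev_bounds.

(** * Evolution of the trilinear form *)

Section evolution.
Variables (R : realType) (n : nat).
Notation T := 'rV[R]_n.
Notation m := (lebm R n).
Implicit Types (t s e : R) (x y : T) (a b c g f h : T -> R) (i j k : 'I_n).

Definition lapt t g x := \sum_(j < n) He t (partial j (partial j g)) x.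

Lemma lapt_four t g x : 0 < t -> smooth_cc g -> lapt t g x = Ri m (fun xi => expR (- (lam xi * t)) * (- lam xi * PP g x xi)).
Proof.
move=> t0 hg; have mg := scc_m hg; have ml := @measurable_lam R n.
have i2 j : itg m (fun xi => expR (- (lam xi * t)) * PP (partial j (partial j g)) x xi).
 have hj := scc_partial j (scc_partial j hg); have [C C0 hC] := PP_dec 1 hj; have mj := scc_m hj.
 apply: (itg_dom _ _ _ (itgZ C (itg_dec R n))) => [|xi]; first by apply: mf_mul; [mm|apply: mf_PP; mm].
 rewrite normrM (ger0_norm (expR_ge0 _)); have := hC x xi; rewrite expr1; apply: le_trans. by rewrite ler_piMl// -expR0 ler_expR oppr_le0 mulr_ge0 ?lam_ge0// ltW.
rewrite /lapt (eq_bigr _ (fun j _ => He_four x t0 (scc_itg (scc_partial j (scc_partial j hg))))).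
rewrite -Ri_sum//; apply: Ri_eq => xi; rewrite -mulr_sumr; congr (_ * _).
rewrite (eq_bigr _ (fun j _ => PP_partial2 j x xi hg)) -mulr_suml; congr (_ * _).
by rewrite sumrN /lam /dotv mulr_sumr; congr -%R; apply: eq_bigr => j _; rewrite exprMn -expr2.
Qed.

Lemma exp_lam_le1 t (xi : T) : 0 <= t -> expR (- (lam xi * t)) <= 1.
Proof. by move=> t0; rewrite -expR0 ler_expR oppr_le0; exact: mulr_ge0 (lam_ge0 _) t0. Qed.

Lemma exp_rem (r : R) : 0 <= r -> `|expR (- r) - 1 + r| <= r ^+ 2.
Proof.
move=> r0; have h1 := expR_ge1Dx (- r); have h2 := expR_ge1Dx r.
rewrite ger0_norm; last by lra.
have e0 := expR_gt0 (- r); have E : expR (- r) * expR r = 1 by rewrite -expRD addNr expR0.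
nra.
Qed.

(** Bounds uniform in t > 0, among them a second-order expansion in time that replaces
    differentiability of the flow in t. *)
Definition flow_bound g C := forall t, 0 < t -> [/\ forall x, `|He t g x| <= C, forall x, `|lapt t g x| <= C,
 Ri m (fun x => `|He t g x|) <= C &
 forall s x, 0 <= s <= 1 -> `|He (t + s) g x - He t g x| <= C * s /\
   `|He (t + s) g x - He t g x - s * lapt t g x| <= C * s ^+ 2].

Lemma flow_bound_ge0 g C : flow_bound g C -> 0 <= C.
Proof. by move=> /(_ 1 ltr01)[h _ _ _]; exact: le_trans (h 0). Qed.

Lemma flow_boundP g : smooth_cc g -> exists C, flow_bound g C.
Proof.
move=> hg; have mg := scc_m hg; have ml := @measurable_lam R n; have bg := scc_bm hg; have ig := scc_itg hg.
have [_ [M hM]] := bg; have M0 : 0 <= M := le_trans (normr_ge0 _) (hM 0).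
have [D D0 hD] := PP_dec 3 hg.
pose K : R := 4 * pi ^+ 2.
have pi0 : 0 < pi :> R by exact: pi_gt0.
have K0 : 0 <= K by rewrite mulr_ge0// sqr_ge0.
have ld xi : lam xi * dec xi <= K.
 have := dotv_dec xi; have d0 := dec_gt0 xi; rewrite mulrDl mul1r => h.
 rewrite /lam (_ : (2 * pi) ^+ 2 * dotv xi xi * dec xi = K * (dotv xi xi * dec xi)); last by rewrite /K; ring. by rewrite ler_piMr; lra.
have d1 xi := @dec_le1 R n xi; have d0 xi := ltW (@dec_gt0 R n xi); have l0 xi := @lam_ge0 R n xi.
pose L1 := Ri m (absf g); pose d := Ri m (@dec R n).
have dd0 : 0 <= d by exact: Ri_ge0.
have B1 x xi : lam xi * `|PP g x xi| <= K * D * dec xi.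
 apply: (le_via (lam xi * (D * dec xi ^+ 3))); first by apply: ler_wpM2l.
 rewrite (_ : lam xi * (D * dec xi ^+ 3) = lam xi * dec xi * (D * dec xi * dec xi)); last by ring.
 rewrite -[leRHS]mulrA; apply: ler_pM; [exact: mulr_ge0| |exact: ld|].
  by apply: mulr_ge0 => //; exact: mulr_ge0.
 by rewrite ler_piMr//; exact: mulr_ge0.
have B2 x xi : lam xi ^+ 2 * `|PP g x xi| <= K ^+ 2 * D * dec xi.
 apply: (le_via (lam xi ^+ 2 * (D * dec xi ^+ 3))); first by apply: ler_wpM2l => //; exact: sqr_ge0.
 rewrite (_ : lam xi ^+ 2 * (D * dec xi ^+ 3) = (lam xi * dec xi) ^+ 2 * (D * dec xi)); last by ring.
 rewrite -[leRHS]mulrA; apply: ler_wpM2r; first exact: mulr_ge0. by apply: lerXn2r; rewrite ?nnegrE; [exact: mulr_ge0|exact: K0|exact: ld].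
pose C0 := K * D * d; pose C1 := K ^+ 2 * D * d.
have C00 : 0 <= C0 := mulr_ge0 (mulr_ge0 K0 D0) dd0.
have C10 : 0 <= C1 := mulr_ge0 (mulr_ge0 (sqr_ge0 K) D0) dd0.
have lapC t x : 0 < t -> `|lapt t g x| <= C0.
 move=> t0; rewrite lapt_four// /C0 /d -RiZ; last exact: itg_dec.
 apply: Ri_norm_le; [by apply: mf_mul; [mm|apply: mf_mul; [mm|apply: mf_PP; mm]]|exact/itgZ/itg_dec|].
 move=> xi; apply: le_trans (B1 x xi); rewrite normrM normrM normrN (ger0_norm (l0 _)) (ger0_norm (expR_ge0 _)).
 by rewrite ler_piMl ?exp_lam_le1 ?(ltW t0)//; exact: mulr_ge0.
have remC t s x : 0 < t -> 0 <= s -> `|He (t + s) g x - He t g x - s * lapt t g x| <= C1 * s ^+ 2.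
 move=> t0 s0; have ts : 0 < t + s by rewrite ltr_wpDr. have iE r : 0 < r -> itg m (fun xi => expR (- (lam xi * r)) * PP g x xi).
  move=> r0; apply: (itg_dom _ _ _ (itgZ D (itg_dec R n))) => [|xi]; first by apply: mf_mul; [mm|apply: mf_PP; mm].
  rewrite normrM (ger0_norm (expR_ge0 _)); apply: (le_via (D * dec xi ^+ 3)).
   by apply: le_trans (hD x xi); rewrite ler_piMl// exp_lam_le1// ltW.
  by apply: ler_wpM2l => //; rewrite exprS ler_piMr// exprn_ile1.
 have iL : itg m (fun xi => expR (- (lam xi * t)) * (- lam xi * PP g x xi)).
  apply: (itg_dom _ _ _ (itgZ (K * D) (itg_dec R n))) => [|xi].
   by apply: mf_mul; [mm|apply: mf_mul; [mm|apply: mf_PP; mm]].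
  apply: le_trans (B1 x xi); rewrite normrM normrM normrN (ger0_norm (l0 _)) (ger0_norm (expR_ge0 _)).
  by rewrite ler_piMl ?exp_lam_le1 ?(ltW t0)//; exact: mulr_ge0.
 rewrite lapt_four// (He_four x ts ig) (He_four x t0 ig) -RiZ// -RiB; [|exact: iE|exact: iE]. rewrite -RiB; [|by apply: itgB; exact: iE|exact: itgZ].
 rewrite /C1 /d mulrC mulrA -RiZ; last exact: itg_dec. apply: Ri_norm_le; [|exact/itgZ/itg_dec|move=> xi].
  exact: itg_m (itgB (itgB (iE _ ts) (iE _ t0)) (itgZ s iL)).
 rewrite -[leRHS]mulrA; apply: (le_via (s ^+ 2 * (lam xi ^+ 2 * `|PP g x xi|))).
  rewrite (_ : _ - _ - _ = expR (- (lam xi * t)) * (expR (- (lam xi * s)) - 1 + lam xi * s) * PP g x xi); last first.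
   by rewrite mulrDr opprD expRD; ring.
  rewrite normrM mulrA -exprMn; apply: ler_wpM2r => //. rewrite normrM (ger0_norm (expR_ge0 _)) [s * _]mulrC; apply: le_trans (exp_rem _); last exact: mulr_ge0.
  by rewrite ler_piMl// exp_lam_le1// ltW.
 by apply: ler_wpM2l; [exact: sqr_ge0|exact: B2].
exists (M + C0 + C1 + L1) => t t0.
have L10 : 0 <= L1 by exact: Ri_ge0.
split=> [x|x||s x /andP[s0 s1]].
- have : `|He t g x| <= He t (fun _ => M) x by apply: He_norm => //; exact: bm_cst. by rewrite He_cst; lra.
- by have := lapC t x t0; lra.
- have : Ri m (fun x => `|He t g x|) <= Ri m (He t (absf g)).
  apply: Ri_le; [exact/itg_norm/itg_He|by apply: itg_He => //; [exact: bm_norm|exact: itg_norm]|]. by move=> x; apply: He_norm => //; exact: bm_norm.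
 by rewrite Ri_He//; [rewrite -/L1; lra|exact: bm_norm|exact: itg_norm].
have h2 := remC t s x t0 s0; have hl := lapC t x t0.
have s20 := sqr_ge0 s; have s2s : s ^+ 2 <= s by rewrite expr2 ler_piMl.
have q1 : 0 <= (M + C0 + L1) * s ^+ 2 by rewrite mulr_ge0// !addr_ge0.
have q2 : 0 <= (M + L1) * s by rewrite mulr_ge0// !addr_ge0.
split; last by lra.
have -> : He (t + s) g x - He t g x = (He (t + s) g x - He t g x - s * lapt t g x) + s * lapt t g x by ring.
apply: (le_trans (ler_normD _ _)); rewrite [`|s * _|]normrM (ger0_norm s0).
have : s * `|lapt t g x| <= s * C0 by exact: ler_wpM2l.
have : C1 * s ^+ 2 <= C1 * s by exact: ler_wpM2l.
lra.
Qed.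

Definition Q t a b c := Ri m (fun x => He t a x * He t b x * He t c x).

Lemma itg_Q t a b c : 0 < t -> smooth_cc a -> smooth_cc b -> smooth_cc c ->
 itg m (fun x => He t a x * He t b x * He t c x).
Proof.
move=> t0 ha hb hc; have [mB [MB hB]] := bm_He t0 (scc_bm hb); have [mC [MC hC]] := bm_He t0 (scc_bm hc).
apply: (itgM MC) => //; apply: (itgM MB) => //; exact: itg_He (scc_bm ha) (scc_itg ha).
Qed.

Definition Q' t a b c := Ri m (fun x => lapt t a x * He t b x * He t c x + He t a x * lapt t b x * He t c x
  + He t a x * He t b x * lapt t c x).

Lemma Q'E t a b c : 0 < t -> smooth_cc a -> smooth_cc b -> smooth_cc c ->
 Q' t a b c = \sum_(k < n) (Q t (partial k (partial k a)) b c + Q t a (partial k (partial k b)) c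
   + Q t a b (partial k (partial k c))).
Proof.
move=> t0 ha hb hc; have h2 g k : smooth_cc g -> smooth_cc (partial k (partial k g)).
 by move=> hg; do 2 apply: scc_partial.
rewrite /Q' (Ri_eq (fun x => \sum_(k < n) (He t (partial k (partial k a)) x * He t b x * He t c x
 + He t a x * He t (partial k (partial k b)) x * He t c x + He t a x * He t b x * He t (partial k (partial k c)) x))).
 rewrite Ri_sum => [|k].
  apply: eq_bigr => k _; rewrite RiD ?RiD//; try apply: itgD; apply: itg_Q => //; exact: h2.
 by apply: itgD; [apply: itgD|]; apply: itg_Q => //; exact: h2.
by move=> x; rewrite /lapt !big_split !mulr_suml !mulr_sumr !mulr_suml.
Qed.

(** The remainder of the product is a sum of six terms: the second-order error of each factor and
    the products of a first-order term with an increment. In each, two factors are bounded in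
    supremum norm and the third in L^1, collected in W. *)
Lemma Q_rem a b c : smooth_cc a -> smooth_cc b -> smooth_cc c -> exists2 K, 0 <= K &
 forall t s, 0 < t -> 0 <= s <= 1 -> `|Q (t + s) a b c - Q t a b c - s * Q' t a b c| <= K * s ^+ 2.
Proof.
move=> ha hb hc; have [Ca fa] := flow_boundP ha; have [Cb fb] := flow_boundP hb; have [Cc fc] := flow_boundP hc.
have Ca0 := flow_bound_ge0 fa; have Cb0 := flow_bound_ge0 fb; have Cc0 := flow_bound_ge0 fc.
pose S := Ca + Cb + Cc; have S0 : 0 <= S by rewrite !addr_ge0.
have aS : Ca <= S by rewrite /S; lra. have bS : Cb <= S by rewrite /S; lra. have cS : Cc <= S by rewrite /S; lra.
exists (6 * S ^+ 3) => [|t s t0 s01]; first by rewrite mulr_ge0// exprn_ge0.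
have [s0 s1] := andP s01; have ts : 0 < t + s by rewrite ltr_wpDr.
have [a1 a2 a3 a4] := fa t t0; have [b1 b2 b3 b4] := fb t t0; have [_ _ b3' _] := fb _ ts.
have [c1 c2 c3 c4] := fc t t0; have [d1 _ d3 _] := fc _ ts.
pose W x := `|He (t + s) b x| + 3 * `|He t a x| + `|He (t + s) c x| + `|He t b x|.
have iH r g : 0 < r -> smooth_cc g -> itg m (fun x => `|He r g x|).
 by move=> r0 hg; apply/itg_norm/itg_He => //; [exact: scc_bm|exact: scc_itg].
have iW : itg m W by repeat apply: itgD; try (by apply: iH); apply: itgZ; exact: iH.
have WS : Ri m W <= 6 * S.
 rewrite /W RiD; [|by repeat apply: itgD; try (by apply: iH); apply: itgZ; exact: iH|exact: iH].
 rewrite RiD; [|by repeat apply: itgD; try (by apply: iH); apply: itgZ; exact: iH|exact: iH]. rewrite RiD; [|exact: iH|by apply: itgZ; exact: iH].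
 rewrite RiZ; last exact: iH. apply: (le_via (Cb + 3 * Ca + Cc + Cb)); last by rewrite /S; move: Ca0 Cb0 Cc0; clear; lra. have h3 : 0 <= 3 :> R by [].
 exact: (lerD (lerD (lerD b3' (ler_wpM2l h3 a3)) d3) b3).
have bl g : smooth_cc g -> bm (lapt t g).
 move=> hg; rewrite /lapt; elim: (index_enum _) => [|j l IH].
  by under eq_fun do rewrite big_nil; exact: bm_cst.
 under eq_fun do rewrite big_cons; apply: bmD IH; apply: bm_He => //. exact: scc_bm (scc_partial j (scc_partial j hg)).
have iQ' : itg m (fun x => lapt t a x * He t b x * He t c x + He t a x * lapt t b x * He t c x + He t a x * He t b x * lapt t c x).
 have h u v w : bm u -> itg m v -> bm w -> itg m (fun x => u x * v x * w x).
  move=> [mu [Mu hu]] iv [mw [Mw hw]]; apply: (itgM Mw) => //.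
  by have -> : (fun x => u x * v x) = (fun x => v x * u x); [apply/funext => x; rewrite mulrC|exact: (itgM Mu)].
 have iHe g : smooth_cc g -> itg m (He t g) by move=> hg; apply: itg_He => //; [exact: scc_bm|exact: scc_itg].
 have bHe g : smooth_cc g -> bm (He t g) by move=> hg; apply: bm_He => //; exact: scc_bm. apply: itgD; last by apply: h; [exact: bHe|exact: iHe|exact: bl].
 apply: itgD; first by apply: h; [exact: bl|exact: iHe|exact: bHe].
 have -> : (fun x => He t a x * lapt t b x * He t c x) = (fun x => lapt t b x * He t a x * He t c x).
  by apply/funext => x; rewrite [He t a x * _]mulrC.
 by apply: h; [exact: bl|exact: iHe|exact: bHe].
have i1 := itg_Q ts ha hb hc; have i0 := itg_Q t0 ha hb hc.
rewrite /Q /Q' -RiZ// -RiB// -RiB//; [|exact: itgB|exact: itgZ].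
apply: (le_via (Ri m (fun x => S ^+ 2 * s ^+ 2 * W x))).
 apply: Ri_norm_le; [exact: itg_m (itgB (itgB i1 i0) (itgZ s iQ'))|exact: itgZ|move=> x].
 have [a5 a6] := a4 s x s01; have [b5 b6] := b4 s x s01; have [c5 c6] := c4 s x s01. have := b1 x; have := b2 x; have := a2 x; have := d1 x.
 move: a5 a6 b5 b6 c5 c6; rewrite /W. move: (He _ a x) (He _ a x) (He _ b x) (He _ b x) (He _ c x) (He _ c x) (lapt t a x) (lapt t b x) (lapt t c x).
 move=> A A1 B B1 C C1 A' B' C' a5 a6 b5 b6 c5 c6 d1x a2x bx2 b2x. have s20 := sqr_ge0 s. have sS (r c0 : R) : c0 <= S -> `|r| <= c0 * s ^+ 2 -> `|r| <= S * s ^+ 2.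
  by move=> h1 h2; apply: (le_trans h2); exact: ler_wpM2r.
 have sS1 (r c0 : R) : c0 <= S -> `|r| <= c0 * s -> `|r| <= S * s.
  by move=> h1 h2; apply: (le_trans h2); exact: ler_wpM2r.
 have {}a6 := sS _ _ aS a6; have {}b6 := sS _ _ bS b6; have {}c6 := sS _ _ cS c6. have {}b5 := sS1 _ _ bS b5; have {}c5 := sS1 _ _ cS c5.
 have {}a2x := le_trans a2x aS; have {}b2x := le_trans b2x bS; have {}d1x := le_trans d1x cS; have {}bx2 := le_trans bx2 bS.
 have -> : A1 * B1 * C1 - A * B * C - s * (A' * B * C + A * B' * C + A * B * C') =
   (A1 - A - s * A') * C1 * B1 + (B1 - B - s * B') * C1 * A + (C1 - C - s * C') * B * A + (s * B' * (C1 - C)) * A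
   + (s * A' * (B1 - B)) * C1 + (s * A' * (C1 - C)) * B by ring.
 have n3 (u v w p q : R) : `|u| <= p -> `|v| <= q -> `|u * v * w| <= p * q * `|w|.
  by move=> up vq; rewrite !normrM; apply: ler_wpM2r => //; apply: ler_pM.
 have n6 (u1 u2 u3 u4 u5 u6 : R) : `|u1 + u2 + u3 + u4 + u5 + u6| <= `|u1| + `|u2| + `|u3| + `|u4| + `|u5| + `|u6|.
  by do 4 (apply: le_trans (ler_normD _ _) _; apply: lerD => //); exact: ler_normD.
 have sM (u : R) : `|u| <= S -> `|s * u| <= s * S.
  by move=> uS; rewrite normrM (ger0_norm s0); exact: ler_wpM2l.
 apply: (le_trans (n6 _ _ _ _ _ _)). have e1 := n3 _ _ B1 _ _ a6 d1x; have e2 := n3 _ _ A _ _ b6 d1x; have e3 := n3 _ _ A _ _ c6 b2x.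
 have e4 := n3 _ _ A _ _ (sM _ bx2) c5; have e5 := n3 _ _ C1 _ _ (sM _ a2x) b5; have e6 := n3 _ _ B _ _ (sM _ a2x) c5.
 apply: (le_trans (lerD (lerD (lerD (lerD (lerD e1 e2) e3) e4) e5) e6)). by apply: le_of_eq; ring.
rewrite RiZ//; have S2 : 0 <= S ^+ 2 * s ^+ 2 by rewrite mulr_ge0// sqr_ge0.
have := ler_wpM2l S2 WS; rewrite (_ : S ^+ 2 * s ^+ 2 * (6 * S) = 6 * S ^+ 3 * s ^+ 2)//; ring.
Qed.

Lemma scc_qdc j g : smooth_cc g -> exists C, forall t, 0 < t -> qd j (fun _ => C) (He t g) (He t (partial j g)).
Proof.
move=> hg; have [C C0 q] := scc_qd j hg; exists C => t t0.
have q2 : qd j (fun _ => C) g (partial j g).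
 by apply: qd_le q => x; rewrite ler_piMr// dec_le1.
have := qd_He t0 (bm_cst n C) (scc_bm hg) (scc_bm (scc_partial j hg)) q2.
by apply: qd_le => x; rewrite He_cst.
Qed.

Lemma qd_ibp3 j (M : T -> R) (c1 c2 : R) a a' b b' c c' : itg m M -> mfun a -> mfun a' ->
 mfun b -> mfun b' -> mfun c -> mfun c' ->
 qd j M a a' -> qd j (fun _ => c1) b b' -> qd j (fun _ => c2) c c' ->
 Ri m (fun x => a' x * b x * c x) + Ri m (fun x => a x * b' x * c x) + Ri m (fun x => a x * b x * c' x) = 0.
Proof.
move=> iM ma ma' mb mb' mc mc' qa qb qc; have [a1 a2 _] := qa; have [b1 b2 _] := qb; have [d1 d2 _] := qc.
have ia : itg m a by exact: itg_dom iM. have ia' : itg m a' by exact: itg_dom iM.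
have h (u v w : T -> R) : itg m u -> mfun v -> mfun w -> (forall x, `|v x| <= c1) ->
  (forall x, `|w x| <= c2) -> itg m (fun x => u x * v x * w x).
 by move=> iu mv mw hv hw; apply: (itgM c2) => //; exact: (itgM c1).
have i1 := h _ _ _ ia' mb mc b1 d1; have i2 := h _ _ _ ia mb' mc b2 d1; have i3 := h _ _ _ ia mb mc' b1 d2.
have iM' : itg m (fun x => 4 * c2 * (4 * c1 * M x)) by apply: itgZ; exact: itgZ.
rewrite -RiD// -RiD//; last exact: itgD.
have := qd_int0 iM' _ _ (qd_mul (qd_mul qa qb) qc).
rewrite (Ri_eq (fun x => a' x * b x * c x + a x * b' x * c x + a x * b x * c' x)) => [e|x]; last by ring.
by apply: e; mm.
Qed.

Lemma ibp3 j t a b c : 0 < t -> smooth_cc a -> smooth_cc b -> smooth_cc c ->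
 Q t (partial j a) b c + Q t a (partial j b) c + Q t a b (partial j c) = 0.
Proof.
move=> t0 ha hb hc; have [C C0 q] := scc_qd j ha.
have bd : bm (fun x => C * @dec R n x) by apply/bmZ/bm_dec.
have qa := qd_He t0 bd (scc_bm ha) (scc_bm (scc_partial j ha)) q.
have [Cb /(_ t t0) qb] := scc_qdc j hb; have [Cc /(_ t t0) qc] := scc_qdc j hc.
have mH g : smooth_cc g -> mfun (He t g).
 by move=> hg; have [] := bm_He t0 (scc_bm hg).
have iM : itg m (He t (fun x => C * dec x)) by apply: itg_He => //; apply: itgZ; exact: itg_dec.
exact: qd_ibp3 iM (mH _ ha) (mH _ (scc_partial j ha)) (mH _ hb) (mH _ (scc_partial j hb))
 (mH _ hc) (mH _ (scc_partial j hc)) qa qb qc.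
Qed.

(** Mixed derivatives commute because convolutions with [dG i] and [dG j] do, each at half of the
    time. *)
Lemma He_partialC i j t g : 0 < t -> smooth_cc g -> He t (partial i (partial j g)) = He t (partial j (partial i g)).
Proof.
move=> t0 hg; have t20 : 0 < t / 2 by rewrite divr_gt0.
have E k l : He t (partial k (partial l g)) = conv (dG k (t / 2)) (conv (dG l (t / 2)) g).
 have hl := scc_partial l hg; have hk := scc_partial k hl. rewrite [in LHS](splitr t) -HeHe//; last exact: scc_bm.
 have -> : He (t / 2) (partial k (partial l g)) = conv (dG k (t / 2)) (partial l g).
  by apply/funext => x; exact: He_partial.
 have -> : conv (dG l (t / 2)) g = He (t / 2) (partial l g).
  by apply/funext => x; rewrite He_partial.
 apply/funext => x; apply: conv_comm2; [exact: itg_G|exact: itg_dG|exact: scc_bm].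
apply: etrans (E i j) _; apply: etrans _ (esym (E j i)); apply/funext => x; apply: conv_comm2; [exact: itg_dG|exact: itg_dG|exact: scc_bm].
Qed.

(** In each term g carries one derivative and f, h together three, two of them on the same
    function. *)
Definition six t f h g k i j := Q t (partial k g) (partial k (partial i f)) (partial j h)
 + Q t (partial k g) (partial i f) (partial k (partial j h))
 - Q t (partial k g) (partial k (partial j f)) (partial i h)
 - Q t (partial k g) (partial j f) (partial k (partial i h))
 - Q t (partial i g) (partial k f) (partial j (partial k h))
 + Q t (partial j g) (partial k f) (partial i (partial k h)).

Let lin3 (x1 x2 x3 y1 y2 y3 : R) : x1 + y1 + y2 = 0 -> y1 + x2 + y3 = 0 -> y2 + y3 + x3 = 0 ->
 x1 + x2 + x3 = - 2 * (y1 + y2 + y3).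
Proof. lra. Qed.

Let lin6 (a1 a2 x1 b1 b2 x2 c1 c2 z y1 y2 : R) : x1 = y1 -> x2 = y2 -> c1 + y1 + z = 0 -> c2 + y2 + z = 0 ->
 - 2 * (a1 + a2 + x1) - - 2 * (b1 + b2 + x2) = - 2 * (a1 + a2 - b1 - b2 - c1 + c2).
Proof. lra. Qed.

(** For each k, integration by parts turns the three pure second derivatives into -2 times the three
    mixed products. The products in which g is not differentiated are integrated by parts once more,
    in direction i or j; this moves a derivative to g and leaves third derivatives of h that agree
    for (i, j) and (j, i) and cancel in the antisymmetric difference. *)
Lemma Q'_six t f h g i j : 0 < t -> smooth_cc f -> smooth_cc h -> smooth_cc g ->
 Q' t g (partial i f) (partial j h) - Q' t g (partial j f) (partial i h) = - 2 * \sum_(k < n) six t f h g k i j.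
Proof.
move=> t0 hf hh hg; have p k u := @scc_partial R n k u.
have hfi := p i _ hf; have hfj := p j _ hf; have hhi := p i _ hh; have hhj := p j _ hh.
rewrite (Q'E t0 hg hfi hhj) (Q'E t0 hg hfj hhi).
rewrite -sumrB mulr_sumr; apply: eq_bigr => k _.
have S a b c : smooth_cc a -> smooth_cc b -> smooth_cc c ->
 Q t (partial k (partial k a)) b c + Q t a (partial k (partial k b)) c + Q t a b (partial k (partial k c)) =
 -2 * (Q t (partial k a) (partial k b) c + Q t (partial k a) b (partial k c) + Q t a (partial k b) (partial k c)).
 move=> ha hb hc; have h1 := ibp3 k t0 (p k _ ha) hb hc; have h2 := ibp3 k t0 ha (p k _ hb) hc. have h3 := ibp3 k t0 ha hb (p k _ hc); exact: lin3 h1 h2 h3.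
have hfk := p k _ hf; have hhk := p k _ hh.
apply: etrans (congr2 (fun u v => u - v) (S _ _ _ hg hfi hhj) (S _ _ _ hg hfj hhi)) _.
have E u v : Q t g (partial k (partial u f)) (partial k (partial v h)) = Q t g (partial u (partial k f)) (partial v (partial k h)).
 exact: (congr2 (fun U V => Ri m (fun x => He t g x * U x * V x)) (He_partialC k u t0 hf) (He_partialC k v t0 hh)).
have h1 := ibp3 i t0 hg hfk (p j _ hhk); have h2 := ibp3 j t0 hg hfk (p i _ hhk).
have h3 : Q t g (partial k f) (partial i (partial j (partial k h))) = Q t g (partial k f) (partial j (partial i (partial k h))).
 exact: (congr1 (fun V => Ri m (fun x => He t g x * He t (partial k f) x * V x)) (He_partialC i j t0 hhk)).
exact: (lin6 _ _ _ _ (E i j) (E j i) h1 (etrans (congr1 (fun u => _ + u) h3) h2)).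
Qed.
End evolution.

(** * From increments over dyadic windows to the initial value *)

Section evol.
Variable R : realType.

(** A mean value inequality drawn from the quadratic expansion alone, by subdividing [a, b]. It
    provides one time t per window, without continuity or integrability of D. *)
Lemma evol (j D : R -> R) (K a b e : R) : (forall t s, 0 < t -> 0 <= s <= 1 -> `|j (t + s) - j t - s * D t| <= K * s ^+ 2) ->
 0 < a -> a <= b -> 0 < e -> exists2 t, a <= t <= b & `|j b - j a| <= (b - a) * `|D t| + e.
Proof.
move=> hj a0 ab e0; apply: contrapT => hn.
pose X := `|j b - j a|.
have hD t : a <= t <= b -> (b - a) * `|D t| + e < X.
 by move=> tab; rewrite ltNge; apply/negP => h; apply: hn; exists t.
have K0 : 0 <= K.
 by have := hj 1 1 ltr01; rewrite ler01 lexx expr1n mulr1 => /(_ isT); exact: le_trans (normr_ge0 _).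
have d0 : 0 <= b - a by lra.
pose y := Num.max (b - a) (K * (b - a) ^+ 2 / e).
have [N hN] : exists N : nat, y < N.+1%:R.
 exists (Num.bound y); apply: lt_trans (_ : (Num.bound y)%:R < _); last by rewrite ltr_nat. by apply: le_lt_trans (archi_boundP _); rewrite// le_max d0.
have N0 : 0 < N.+1%:R :> R by [].
pose d := (b - a) / N.+1%:R.
have dd0 : 0 <= d by rewrite divr_ge0.
have d1 : d <= 1 by rewrite ler_pdivrMr// mul1r; apply: le_trans (ltW hN); rewrite le_max lexx.
have Kd : N.+1%:R * (K * d ^+ 2) < e.
 rewrite (_ : _ * _ = K * (b - a) ^+ 2 / N.+1%:R); last by rewrite /d; field; rewrite addrC natr1 gt_eqF.
 rewrite ltr_pdivrMr// [ltRHS]mulrC -ltr_pdivrMr//; apply: le_lt_trans hN. by rewrite le_max lexx orbT.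
have step k : (k <= N.+1)%N -> `|j (a + k%:R * d) - j a| <= k%:R * ((X - e) / N.+1%:R + K * d ^+ 2).
 elim: k => [_|k IH kN]; first by rewrite !mul0r addr0 subrr normr0. have IHk := IH (ltnW kN); set u := a + k%:R * d. have ku : 0 <= k%:R * d by rewrite mulr_ge0.
 have u0 : 0 < u by rewrite ltr_wpDr. have uab : a <= u <= b.
  rewrite lerDl ku/= -lerBrDl /d mulrCA -[leRHS]mulr1; apply: ler_wpM2l => //. by rewrite ler_pdivrMr// mul1r ler_nat ltnW.
 have -> : a + k.+1%:R * d = u + d by rewrite /u -natr1 mulrDl mul1r addrA. have hs : 0 <= d <= 1 by rewrite dd0. have h1 := hj u d u0 hs; have h2 := hD u uab.
 have h3 : d * `|D u| <= (X - e) / N.+1%:R.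
  by rewrite /d mulrAC; apply: ler_wpM2r; [rewrite invr_ge0 ltW|lra].
 rewrite -natr1 mulrDl mul1r. have -> : j (u + d) - j a = (j u - j a) + ((j (u + d) - j u - d * D u) + d * D u) by ring.
 apply: (le_trans (ler_normD _ _)); apply: lerD => //. apply: (le_trans (ler_normD _ _)); rewrite [`|d * _|]normrM (ger0_norm dd0) addrC. exact: lerD.
have := step N.+1 (leqnn _); rewrite (_ : a + N.+1%:R * d = b); last by rewrite /d; field; rewrite addrC natr1 gt_eqF.
rewrite -/X mulrDr mulrCA mulfV ?gt_eqF// mulr1; lra.
Qed.
End evol.

Section core.
Variables (R : realType) (n : nat).
Notation T := 'rV[R]_n.
Notation m := (lebm R n).
Implicit Types (t s e : R) (x y : T) (a b c g f h : T -> R) (i j k : 'I_n).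

Lemma deriveE_sum g v x : smooth_cc g -> 'D_v g x = \sum_(j < n) v ord0 j * partial j g x.
Proof.
move=> [sg _]; have dg : differentiable g x := sg [::] x.
rewrite deriveE// {1}(row_sum_delta v) linear_sum; apply: eq_bigr => j _.
by rewrite linearZ /partial deriveE.
Qed.

Lemma scc_lip g : smooth_cc g -> exists2 L, 0 <= L & forall x v, `|g (x + v) - g x| <= L * \sum_(j < n) `|v ord0 j|.
Proof.
move=> hg; have [L0 hL] : exists L : 'I_n -> R, forall j x, `|partial j g x| <= L j.
 have h j : exists L, forall x, `|partial j g x| <= L.
  by have [_ []] := scc_bm (scc_partial j hg) => L hL; exists L.
 by exists (fun j => sval (cid (h j))) => j x; exact: svalP (cid (h j)) x.
have L00 j : 0 <= L0 j := le_trans (normr_ge0 _) (hL j 0).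
exists (\sum_(j < n) L0 j) => [|x v]; first exact: sumr_ge0.
have D (r : R) : is_derive r 1 (fun r => g (x + r *: v)) ('D_v g (x + r *: v)).
 by apply: line_derive => y; exact: scc_derivable.
have [c _ e] := mvt_sym 0 1 D; move: e; rewrite scale1r scale0r addr0 subr0 mulr1 => ->.
rewrite deriveE_sum// mulr_sumr; apply: (le_trans (ler_norm_sum _ _ _)); apply: ler_sum => j _.
rewrite normrM mulrC; apply: ler_wpM2r => //; apply: (le_trans (hL j _)).
by rewrite (bigD1 j)//= lerDl sumr_ge0.
Qed.

(** The function is Lipschitz, and the first absolute moment of the Gaussian, read off from [dG_le],
    is of order sqrt t. *)
Lemma flow0 g : smooth_cc g -> exists2 C, 0 <= C & forall t x, 0 < t -> `|He t g x - g x| <= C * sqrt t.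
Proof.
move=> hg; have [L L0 hL] := scc_lip hg; have mg := scc_m hg.
exists (L * \sum_(j < n) (2 * 2 ^+ n)) => [|t x t0]; first by rewrite mulr_ge0// sumr_ge0// => j _; rewrite mulr_ge0// exprn_ge0.
have t20 : 0 < 2 * t by lra.
have mG := measurable_G t : mfun (G t : T -> R).
have i1 := conv_itg x (itg_G n t0) (scc_bm hg).
have i2 : itg m (fun y => g x * G t y) by apply: itgZ; exact: itg_G.
have -> : He t g x - g x = Ri m (fun y => G t y * g (x - y) - g x * G t y).
 by rewrite RiB// RiZ ?Ri_G ?mulr1//; exact: itg_G.
pose F y := \sum_(j < n) (L * (2 * 2 ^+ n * sqrt t)) * G (2 * t) y.
have iF : itg m F by apply: itg_sum => j; apply: itgZ; exact: itg_G.
apply: (le_via (Ri m F)).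
 apply: Ri_norm_le => //; first by exact: itg_m (itgB i1 i2). move=> y; rewrite [g x * _]mulrC -mulrBr normrM (ger0_norm (G_ge0 _ t0)).
 apply: (le_via (G t y * (L * \sum_(j < n) `|y ord0 j|))).
  apply: ler_wpM2l; first exact: G_ge0. by have := hL x (- y); under eq_bigr do rewrite mxE normrN.
 rewrite mulr_sumr mulr_sumr /F; apply: ler_sum => j _. rewrite mulrCA -mulrA; apply: ler_wpM2l => //. have E : G t y * `|y ord0 j| = 2 * t * `|dG j t y|.
  rewrite /dG normrM normrN normrM normfV (gtr0_norm t20) (ger0_norm (G_ge0 _ t0)). by field; rewrite gt_eqF.
 rewrite E; apply: (le_via (2 * t * (2 ^+ n / sqrt t * G (2 * t) y))).
  by apply: ler_wpM2l; [exact: ltW|exact: dG_le].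
 have st : 0 < sqrt t by rewrite sqrtr_gt0. have tE : t = sqrt t * sqrt t by rewrite -expr2 sqr_sqrtr// ltW.
 rewrite {1}tE; apply: le_of_eq; move: (G _ _) (sqrt t) st => ? q q0. by field; rewrite gt_eqF.
rewrite Ri_sum => [|j]; last by apply: itgZ; exact: itg_G.
rewrite mulr_sumr mulr_suml; apply: ler_sum => j _; rewrite RiZ; last exact: itg_G.
by rewrite Ri_G// mulr1 !mulrA.
Qed.

Lemma Q_at0 a b c e : smooth_cc a -> smooth_cc b -> smooth_cc c -> 0 < e ->
 exists2 t1, 0 < t1 & forall t, 0 < t -> t <= t1 -> `|Q t a b c - Ri m (fun x => a x * b x * c x)| <= e.
Proof.
move=> ha hb hc e0.
have [Cb fb] := flow_boundP hb; have [Cc fc] := flow_boundP hc.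
have Cb0 := flow_bound_ge0 fb; have Cc0 := flow_bound_ge0 fc.
have [A A0 hA] := flow0 ha; have [B B0 hB] := flow0 hb; have [C C0 hC] := flow0 hc.
have [_ [Mb Hb]] := scc_bm hb; have [_ [Ma Ha]] := scc_bm ha.
have Mb0 := le_trans (normr_ge0 _) (Hb 0); have Ma0 := le_trans (normr_ge0 _) (Ha 0).
have ib := scc_itg hb; have ic := scc_itg hc; have ia := scc_itg ha.
pose La := Ri m (absf a); have La0 : 0 <= La by exact: Ri_ge0.
pose K := A * Cb * Cc + B * La * Cc + C * La * Mb + 1.
have K0 : 0 < K by rewrite ltr_wpDl// !addr_ge0//; [exact: mulr_ge0 (mulr_ge0 A0 Cb0) Cc0|exact: mulr_ge0 (mulr_ge0 B0 La0) Cc0|exact: mulr_ge0 (mulr_ge0 C0 La0) Mb0].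
pose r := e / K; have r0 : 0 < r by rewrite divr_gt0.
exists (r ^+ 2) => [|t t0 tr]; first exact: exprn_gt0.
have st : sqrt t <= r by rewrite -[leRHS]ger0_norm ?(ltW r0)// -sqrtr_sqr ler_sqrt ?exprn_ge0// ltW.
have s0 := sqrtr_ge0 t.
have [b1 _ _ _] := fb t t0; have [c1 _ c3 _] := fc t t0.
have iC := itg_He t0 (scc_bm hc) ic; have iB := itg_He t0 (scc_bm hb) ib.
have iQ := itg_Q t0 ha hb hc.
have iabc : itg m (fun x => a x * b x * c x).
 have [mc [Mc Hc]] := scc_bm hc; apply: (itgM Mc) => //. by apply: (itgM Mb) => //; exact: itg_m ib.
pose F x := A * sqrt t * Cb * `|He t c x| + B * sqrt t * Cc * `|a x| + C * sqrt t * Mb * `|a x|.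
have i1 : itg m (fun x => A * sqrt t * Cb * `|He t c x|) by exact/itgZ/itg_norm.
have i2 : itg m (fun x => B * sqrt t * Cc * `|a x|) by exact/itgZ/itg_norm.
have i3 : itg m (fun x => C * sqrt t * Mb * `|a x|) by exact/itgZ/itg_norm.
have i12 := itgD i1 i2.
rewrite /Q -RiB//; apply: (le_via (Ri m F)).
 apply: Ri_norm_le; [exact: itg_m (itgB iQ iabc)|exact: itgD|move=> x]; rewrite /F.
 have := hA t x t0; have := hB t x t0; have := hC t x t0; have := b1 x; have := c1 x; have := Hb x.
 move: (He t a x) (He t b x) (He t c x) (a x) (b x) (c x) => a' b' c' u v w h1 h2 h3 h4 h5 h6.
 have -> : a' * b' * c' - u * v * w = (a' - u) * b' * c' + (b' - v) * c' * u + (c' - w) * v * u by ring.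
 have n3 (z1 z2 z3 p q : R) : `|z1| <= p -> `|z2| <= q -> `|z1 * z2 * z3| <= p * q * `|z3|.
  by move=> up vq; rewrite !normrM; apply: ler_wpM2r => //; apply: ler_pM.
 apply: (le_trans (ler_normD _ _)); apply: lerD; last exact: n3. by apply: (le_trans (ler_normD _ _)); apply: lerD; exact: n3.
rewrite /F RiD// RiD// !RiZ; [|exact: itg_norm|exact: itg_norm|exact: itg_norm].
rewrite -/La; apply: (le_via (sqrt t * (A * Cb * Cc + B * La * Cc + C * La * Mb))).
 rewrite (_ : sqrt t * (A * Cb * Cc + B * La * Cc + C * La * Mb) = A * sqrt t * Cb * Cc
   + B * sqrt t * Cc * La + C * sqrt t * Mb * La); last by move: (La) (sqrt t) => ? ?; ring.
 by rewrite !lerD2r; apply: ler_wpM2l c3; exact: mulr_ge0 (mulr_ge0 A0 s0) Cb0.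
have KE : A * Cb * Cc + B * La * Cc + C * La * Mb = K - 1 by rewrite /K addrK.
rewrite KE; apply: (le_via (r * K)); last by rewrite /r divfK ?gt_eqF.
apply: ler_pM => //; last by lra.
by rewrite -KE !addr_ge0//; [exact: mulr_ge0 (mulr_ge0 A0 Cb0) Cc0|exact: mulr_ge0 (mulr_ge0 B0 La0) Cc0|exact: mulr_ge0 (mulr_ge0 C0 La0) Mb0].
Qed.

Lemma Q_atoo a b c e : (0 < n)%N -> smooth_cc a -> smooth_cc b -> smooth_cc c -> 0 < e ->
 exists2 t1, 0 < t1 & forall t, t1 <= t -> `|Q t a b c| <= e.
Proof.
move=> n0 ha hb hc e0.
have [Cb fb] := flow_boundP hb; have [Cc fc] := flow_boundP hc.
have Cb0 := flow_bound_ge0 fb; have Cc0 := flow_bound_ge0 fc.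
have ia := scc_itg ha; have ma := itg_m ia.
pose L := Ri m (absf a); have L0 : 0 <= L by exact: Ri_ge0.
pose K := L * (Cb * Cc) + 1; have K0 : 0 < K by rewrite ltr_wpDl// !mulr_ge0.
have [t1 t10 h1] := G_small n0 (divr_gt0 e0 K0).
exists t1 => // t tt; have t0 := lt_le_trans t10 tt.
have hA x : `|He t a x| <= e / K * L.
 rewrite /L -(@Ri_refl R n (absf a) x)//; last by mm. have iar : itg m (fun y => `|a (x - y)|) by exact/itg_norm/(itg_refl x ia).
 rewrite -RiZ//; apply: Ri_norm_le; [|exact: itgZ|move=> y].
  exact: itg_m (conv_itg x (itg_G n t0) (scc_bm ha)).
 by rewrite normrM; apply: ler_wpM2r => //; rewrite (ger0_norm (G_ge0 _ t0)); exact: h1.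
have [b1 _ _ _] := fb t t0; have [_ _ c3 _] := fc t t0.
have iQ := itg_Q t0 ha hb hc; have iC : itg m (fun x => `|He t c x|).
 by apply/itg_norm/itg_He => //; [exact: scc_bm|exact: scc_itg].
apply: (le_via (Ri m (fun x => e / K * L * Cb * `|He t c x|))).
 apply: Ri_norm_le; [exact: itg_m iQ|exact: itgZ|move=> x]. rewrite !normrM; apply: ler_wpM2r => //; exact: ler_pM.
have k0 : 0 <= e / K * L * Cb := mulr_ge0 (mulr_ge0 (ltW (divr_gt0 e0 K0)) L0) Cb0.
rewrite RiZ//; apply: (le_trans (ler_wpM2l k0 c3)).
rewrite (_ : e / K * L * Cb * Cc = e * ((L * (Cb * Cc)) / K)); last by ring.
by rewrite ler_piMr ?(ltW e0)// ler_pdivrMr// mul1r /K lerDl.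
Qed.

Let sub_rem (x1 x2 x3 y1 y2 y3 s A B : R) : `|x1 - x2 - s * x3| <= A -> `|y1 - y2 - s * y3| <= B ->
 `|(x1 - y1) - (x2 - y2) - s * (x3 - y3)| <= A + B.
Proof.
move=> h1 h2; apply: le_trans (lerD h1 h2); apply: le_trans (ler_normB _ _).
by apply: le_of_eq; congr `|_|; ring.
Qed.

Let norm6 (u1 u2 u3 u4 u5 u6 : R) : `|u1 + u2 - u3 - u4 - u5 + u6| <= `|u1| + `|u2| + `|u3| + `|u4| + `|u5| + `|u6|.
Proof.
by do 4 (apply: le_trans (ler_normD _ _) _; rewrite ?normrN; apply: lerD => //); exact: ler_normD.
Qed.

Let mulr6 (w u1 u2 u3 u4 u5 u6 : R) : w * (u1 + u2 + u3 + u4 + u5 + u6) = w * u1 + w * u2 + w * u3 + w * u4 + w * u5 + w * u6.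
Proof. ring. Qed.

Let sum6 M (u F1 F2 F3 F4 F5 F6 : 'I_M -> R) : (forall r, u r <= F1 r + F2 r + F3 r + F4 r + F5 r + F6 r) ->
 \sum_(r < M) u r <= \sum_(r < M) F1 r + \sum_(r < M) F2 r + \sum_(r < M) F3 r + \sum_(r < M) F4 r
  + \sum_(r < M) F5 r + \sum_(r < M) F6 r.
Proof. by move=> h; rewrite -!big_split; apply: ler_sum => r _. Qed.

Let fin5 (q1 q2 q3 q4 r1 r2 B e : R) : `|(q3 - q4) - (q1 - q2)| <= B + e / 5 -> `|q1 - r1| <= e / 5 ->
 `|q2 - r2| <= e / 5 -> `|q3| <= e / 5 -> `|q4| <= e / 5 -> `|r1 - r2| <= B + e.
Proof. rewrite !ler_norml; lra. Qed.

(** The times t r are free in their windows because [evol] only provides some time in each. The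
    constant 72 is 6 times 2 times 6: the length 6 ta of a window, the factor -2 of [Q'_six], and
    six products. *)
Lemma core g f h i j Bd : (0 < n)%N -> smooth_cc g -> smooth_cc f -> smooth_cc h ->
 (forall tau0 M (t : nat -> R), 0 < tau0 -> (forall r, 2 * ta tau0 r <= t r <= 8 * ta tau0 r) -> forall k l p q,
  (II m M (fun r x => (ta tau0 r * (`|He (t r) (partial k g) x| * `|He (t r) (partial l (partial p f)) x|
    * `|He (t r) (partial q h) x|))%R) <= Bd%:E)%E /\
  (II m M (fun r x => (ta tau0 r * (`|He (t r) (partial k g) x| * `|He (t r) (partial p f) x|
    * `|He (t r) (partial l (partial q h)) x|))%R) <= Bd%:E)%E) ->
 `|Ri m (fun x => g x * partial i f x * partial j h x) - Ri m (fun x => g x * partial j f x * partial i h x)|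
  <= 72 * n%:R * Bd.
Proof.
move=> n0 hg hf hh hB.
have p k u := @scc_partial R n k u.
have hfi := p i _ hf; have hfj := p j _ hf; have hhi := p i _ hh; have hhj := p j _ hh.
pose J t := Q t g (partial i f) (partial j h) - Q t g (partial j f) (partial i h).
pose D t := Q' t g (partial i f) (partial j h) - Q' t g (partial j f) (partial i h).
have [K1 K10 k1] := Q_rem hg hfi hhj; have [K2 K20 k2] := Q_rem hg hfj hhi.
have hJ t s : 0 < t -> 0 <= s <= 1 -> `|J (t + s) - J t - s * D t| <= (K1 + K2) * s ^+ 2.
 move=> t0 s01; have h1 := k1 t s t0 s01; have h2 := k2 t s t0 s01. by rewrite mulrDl; exact: sub_rem h1 h2.
have DE t : 0 < t -> D t = - 2 * \sum_(k < n) six t f h g k i j by move=> t0; exact: Q'_six.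
(* one increment of [J] per dyadic time window *)
have win tau0 M e : 0 < tau0 -> 0 < e -> `|J (2 * ta tau0 M) - J (2 * tau0)| <= 72 * n%:R * Bd + e.
 move=> tau00 e0; pose e' := e / M.+1%:R; have e'0 : 0 < e' by rewrite divr_gt0. have tk r := ta_gt0 r tau00.
 have ex r : exists t, 2 * ta tau0 r <= t <= 8 * ta tau0 r /\
   `|J (2 * ta tau0 r.+1) - J (2 * ta tau0 r)| <= 6 * ta tau0 r * `|D t| + e'.
  have a0 : 0 < 2 * ta tau0 r by rewrite mulr_gt0. have ab : 2 * ta tau0 r <= 8 * ta tau0 r by lra.
  have [t h1 h2] := evol hJ a0 ab e'0; exists t; split => //; rewrite -ta_S//. lra.
 pose t r := sval (cid (ex r)). have ht r : 2 * ta tau0 r <= t r <= 8 * ta tau0 r by have [] := svalP (cid (ex r)).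
 have hI r : `|J (2 * ta tau0 r.+1) - J (2 * ta tau0 r)| <= 6 * ta tau0 r * `|D (t r)| + e'.
  by have [] := svalP (cid (ex r)).
 have t0 r : 0 < t r by have := tk r; case/andP: (ht r) => ? _; lra.
 have tel N : `|J (2 * ta tau0 N) - J (2 * tau0)| <= \sum_(r < N) (6 * ta tau0 r * `|D (t r)| + e').
  elim: N => [|N IH]; first by rewrite big_ord0 /ta expr0 mulr1 subrr normr0. rewrite big_ord_recr/= addrC. rewrite -(subrKA (J (2 * ta tau0 N))).
  exact: (le_trans (ler_normD _ _) (lerD (hI N) IH)).
 apply: (le_trans (tel M)); rewrite big_split/=; apply: lerD; last first.
  rewrite sumr_const card_ord -mulr_natl /e' mulrCA ler_piMr ?(ltW e0)// ler_pdivrMr// mul1r ler_nat//.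
 pose q a b c := \sum_(r < M) ta tau0 r * `|Q (t r) a b c|. have qB a b c : smooth_cc a -> smooth_cc b -> smooth_cc c ->
   (II m M (fun r x => (ta tau0 r * (`|He (t r) a x| * `|He (t r) b x| * `|He (t r) c x|))%R) <= Bd%:E)%E -> q a b c <= Bd.
  move=> ha hb hc; have iQ r : itg m (fun x => ta tau0 r * (`|He (t r) a x| * `|He (t r) b x| * `|He (t r) c x|)).
   apply: itgZ; have := itg_norm (itg_Q (t0 r) ha hb hc); congr itg. by apply/funext => x; rewrite !normrM.
  rewrite II_Ri// lee_fin; apply: le_trans; apply: ler_sum => r _; rewrite RiZ; last first.
   have := itg_norm (itg_Q (t0 r) ha hb hc); congr itg. by apply/funext => x; rewrite !normrM.
  apply: ler_wpM2l; first exact: ltW. apply: (le_trans (Ri_norm (itg_Q (t0 r) ha hb hc))); apply: le_of_eq. by apply: Ri_eq => x; rewrite !normrM.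
 apply: (le_via (12 * \sum_(k < n) \sum_(r < M) ta tau0 r * `|six (t r) f h g k i j|)).
  rewrite exchange_big/= mulr_sumr; apply: ler_sum => r _; rewrite DE// normrM normrN.
  have : `|\sum_(k < n) six (t r) f h g k i j| <= \sum_(k < n) `|six (t r) f h g k i j| by exact: ler_norm_sum.
  rewrite -mulr_sumr (ger0_norm (ler0n _ 2)); move: (\sum_(k < n) `|_|) (`|_|) => S1 S2 h12. have := tk r; move: (ta _ _) => tt tt0; nra.
 rewrite (_ : 72 * n%:R * Bd = 12 * (n%:R * (6 * Bd))); last by ring. apply: ler_wpM2l => //.
 have -> : n%:R * (6 * Bd) = \sum_(k < n) (6 * Bd) by rewrite sumr_const card_ord -[RHS]mulr_natl. apply: ler_sum => k _; have hB' := hB tau0 M t tau00 ht.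
 have hfk := p k _ hf; have hhk := p k _ hh; have hgk := p k _ hg; have hgi := p i _ hg; have hgj := p j _ hg.
 have b1 := qB _ _ _ hgk (p k _ hfi) hhj (hB' k k i j).1. have b2 := qB _ _ _ hgk hfi (p k _ hhj) (hB' k k i j).2.
 have b3 := qB _ _ _ hgk (p k _ hfj) hhi (hB' k k j i).1. have b4 := qB _ _ _ hgk hfj (p k _ hhi) (hB' k k j i).2.
 have b5 := qB _ _ _ hgi hfk (p j _ hhk) (hB' i j k k).2. have b6 := qB _ _ _ hgj hfk (p i _ hhk) (hB' j i k k).2.
 rewrite (_ : 6 * Bd = Bd + Bd + Bd + Bd + Bd + Bd); last by ring. apply: le_trans (lerD (lerD (lerD (lerD (lerD b1 b2) b3) b4) b5) b6).
 apply: sum6 => r; apply: (le_trans (ler_wpM2l (ltW (tk r)) (norm6 _ _ _ _ _ _))). by apply: le_of_eq.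
apply/ler_addgt0Pr => e e0; have e4 : 0 < e / 5 by rewrite divr_gt0.
have [a1 a10 A1] := Q_at0 hg hfi hhj e4; have [a2 a20 A2] := Q_at0 hg hfj hhi e4.
have [c1 c10 C1] := Q_atoo n0 hg hfi hhj e4; have [c2 c20 C2] := Q_atoo n0 hg hfj hhi e4.
(* Initial time so small that both forms are within e / 5 of their values on the data, final time so
   large that both are below e / 5; these four errors and the one of the windows make e. *)
pose tau0 := Num.min a1 a2 / 2; have tau00 : 0 < tau0 by rewrite divr_gt0// lt_min a10.
have t2 : 2 * tau0 = Num.min a1 a2 by rewrite /tau0; field.
have [M hM] : exists M, Num.max c1 c2 <= 2 * ta tau0 M.
 have y0 : 0 <= Num.max c1 c2 by rewrite le_max ltW. have [N hN] : exists N : nat, 2 * tau0 + Num.max c1 c2 <= 8 * ta tau0 N.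
  have hh2 : 2 * tau0 <= 2 * tau0 + Num.max c1 c2 by lra. by have [N /andP[_ hN]] := ta_cover tau00 hh2; exists N.
 by exists N.+1; rewrite -ta_S//; apply: le_trans hN; rewrite lerDr mulr_ge0// ltW.
have W := win tau0 M _ tau00 e4.
have tm0 : 0 < 2 * tau0 by lra.
have P1 := A1 _ tm0 (_ : 2 * tau0 <= a1); have P2 := A2 _ tm0 (_ : 2 * tau0 <= a2).
have P3 := C1 _ (le_trans (_ : c1 <= Num.max c1 c2) hM); have P4 := C2 _ (le_trans (_ : c2 <= Num.max c1 c2) hM).
have {}P1 : `|Q (2 * tau0) g (partial i f) (partial j h) - Ri m (fun x => g x * partial i f x * partial j h x)| <= e / 5.
 by apply: P1; rewrite t2 ge_min lexx.
have {}P2 : `|Q (2 * tau0) g (partial j f) (partial i h) - Ri m (fun x => g x * partial j f x * partial i h x)| <= e / 5.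
 by apply: P2; rewrite t2 ge_min lexx orbT.
have {}P3 : `|Q (2 * ta tau0 M) g (partial i f) (partial j h)| <= e / 5 by apply: P3; rewrite le_max lexx.
have {}P4 : `|Q (2 * ta tau0 M) g (partial j f) (partial i h)| <= e / 5 by apply: P4; rewrite le_max lexx orbT.
exact: fin5 W P1 P2 P3 P4.
Qed.
End core.

(** * The two trilinear estimates *)

Section terms.
Variables (R : realType) (n : nat) (n0 : (0 < n)%N).
Notation T := 'rV[R]_n.
Notation m := (lebm R n).
Implicit Types (tau e : R) (x y : T) (a b c g f h u v w : T -> R) (i j k l p q : 'I_n).

Lemma lorentz_norm (r : R) (s : \bar R) u : lorentz r s (absf u) = lorentz r s u.
Proof.
have D : @distfun R n (absf u) = distfun u.
 apply/funext => lam; rewrite /distfun; congr lebn; apply/funext => x /=. by rewrite normr_id.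
have E : @rearr R n (absf u) = rearr u by apply/funext => t; rewrite /rearr D.
by rewrite /lorentz E.
Qed.

Let pow4 (z s : R) (j : nat) : 0 <= z -> (z ^+ j) `^ s = (z `^ s) ^+ j.
Proof. by move=> z0; rewrite -powR_mulrn// -[in RHS]powR_mulrn ?powR_ge0// -!powRrM mulrC. Qed.

(** The factor tau of the window pays for the two factors t^(-1/2) of the gradients. *)
Let scal (tau t q c d a1 a2 a3 L1 L2 H : R) : 0 < tau -> 2 * tau <= t -> 0 < q -> q * q = t -> 0 <= c -> 0 <= d ->
 0 <= a1 -> 0 <= a2 -> 0 <= a3 -> a1 <= c / q * L1 -> a2 <= c / q * L2 -> a3 <= d * H ->
 tau * (a1 * a2 * a3) <= c * c * d * (L1 * L2 * H).
Proof.
move=> tau0 tt q0 qt c0 d0 a10 a20 a30 h1 h2 h3; have t0 : 0 < t by lra.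
have h : a1 * a2 * a3 <= (c / q * L1) * (c / q * L2) * (d * H).
 by apply: ler_pM => //; [exact: mulr_ge0|exact: ler_pM].
have e : (c / q * L1) * (c / q * L2) * (d * H) = (c * c * d * (L1 * L2 * H)) / t.
 by rewrite -qt; field; rewrite gt_eqF.
apply: (le_via (t * ((c * c * d * (L1 * L2 * H)) / t))).
 apply: ler_pM => //; [exact: ltW|by rewrite !mulr_ge0|lra|by rewrite -e].
by rewrite mulrCA mulfV ?gt_eqF// mulr1.
Qed.

(** The second derivative of f is the gradient of [partial p f], bounded by its oscillation like the
    gradient of g; [partial q h] is kept as a heat average. Thus the functions measured in Lorentz
    norm are first derivatives, as [main_bmo] expects. *)
Lemma term_bmo (p1 p2 : R) (q1 q2 : \bar R) : 1 < p1 -> 1 < p2 -> (1 <= q1)%E -> (1 <= q2)%E ->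
 p1^-1 + p2^-1 = 1 -> qinv q1 + qinv q2 = 1 ->
 exists2 C, 0 < C & forall (g f h gv gw : T -> R) (N A B tau0 : R) M (t : nat -> R) k l p q,
  smooth_cc g -> smooth_cc f -> smooth_cc h -> 0 < N -> (forall t x, 0 < t -> Var t g x <= N) ->
  bm gv -> nneg gv -> (forall x, `|partial p f x| <= gv x) ->
  bm gw -> nneg gw -> (forall x, `|partial q h x| <= gw x) ->
  0 < A -> 0 < B -> (lorentz p1 q1 gv <= A%:E)%E -> (lorentz p2 q2 gw <= B%:E)%E -> 0 < tau0 ->
  (forall r, 2 * ta tau0 r <= t r <= 8 * ta tau0 r) ->
  (II m M (fun r x => (ta tau0 r * (`|He (t r) (partial k g) x| * `|He (t r) (partial l (partial p f)) x|
    * `|He (t r) (partial q h) x|))%R) <= (C * N `^ 2^-1 * A * B)%:E)%E.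
Proof.
move=> p11 p21 q11 q21 pe qe; have [C C0 hC] := @main_bmo R n _ _ _ _ p11 p21 q11 q21 pe qe.
pose c1 : R := 2 * 30 ^+ n; have c10 : 0 < c1 by rewrite mulr_gt0 ?exprn_gt0.
pose D := c1 * c1 * 8 ^+ n; have D0 : 0 < D by rewrite !mulr_gt0 ?exprn_gt0.
exists (D * C) => [|g f h gv gw N A B tau0 M t k l p q hg hf hh N0 hN bgv gv0 fv bgw gw0 hw A0 B0 lA lB tau00 ht].
 by rewrite mulr_gt0.
have hfp := scc_partial p hf; have hhq := scc_partial q hh.
have bg := scc_bm hg; have bfp := scc_bm hfp; have bhq := scc_bm hhq.
have hm := hC g (partial p f) (partial q h) gv gw N A B tau0 M bg N0 hN bfp bgv gv0 fv bhq bgw gw0 hw A0 B0 lA lB tau00.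
have tk r := ta_gt0 r tau00.
have t0 r : 0 < t r by have := tk r; case/andP: (ht r) => ? _; lra.
have bF r : bm (fun x => Lop (ta tau0 r) g x * Lop (ta tau0 r) (partial p f) x * He (16 * ta tau0 r) (fun y => `|partial q h y|) x).
 by apply: bmM; [apply: bmM; exact: bm_Lop|apply: bm_He; [rewrite mulr_gt0|exact: bm_norm]].
apply: (le_via (II m M (fun r x => D * (Lop (ta tau0 r) g x * Lop (ta tau0 r) (partial p f) x * He (16 * ta tau0 r) (fun y => `|partial q h y|) x))%R)).
 have bH r u : smooth_cc u -> bm (fun x => `|He (t r) u x|) by move=> hu; apply/bm_norm/bm_He => //; exact: scc_bm. apply: II_le.
 - move=> r; exact: bm_m (bmZ _ (bmM (bmM (bH r _ (scc_partial k hg)) (bH r _ (scc_partial l hfp))) (bH r _ hhq))).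
 - by move=> r; apply: bm_m; exact: bmZ.
 - move=> r x; apply: mulr_ge0; [exact: ltW|apply: mulr_ge0; [exact: mulr_ge0|exact: normr_ge0]].
 move=> r x; have tr := tk r; have st : 0 < sqrt (t r) by rewrite sqrtr_gt0.
 have [h1 h2 h3 h4] : [/\ 2 * ta tau0 r <= t r, t r <= 16 * ta tau0 r, 16 * ta tau0 r <= 8 * t r & 1 <= 8 :> R].
  by case/andP: (ht r) => h1 h2; split; [lra|lra|lra|rewrite ler1n].
 have g1 := grad1 tr k x (ht r) bg; have g2 := grad1 tr l x (ht r) bfp. rewrite -He_partial// in g1; rewrite -He_partial// in g2.
 have g3 : `|He (t r) (partial q h) x| <= 8 ^+ n * He (16 * ta tau0 r) (fun y => `|partial q h y|) x.
  apply: (le_via (He (t r) (fun y => `|partial q h y|) x)); first by apply: He_norm => //; exact: bm_norm.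
  exact: (He_mono x (t0 r) h2 h3 h4 (bm_norm bhq) (fun z => normr_ge0 _)).
 have L1 := @Lop_ge0 R n (ta tau0 r) tr g x; have L2 := @Lop_ge0 R n (ta tau0 r) tr (partial p f) x.
 have H3 : 0 <= He (16 * ta tau0 r) (fun y => `|partial q h y|) x.
  by apply: He_ge0; [rewrite mulr_gt0|move=> z; exact: normr_ge0].
 have tE : sqrt (t r) * sqrt (t r) = t r by rewrite -expr2 sqr_sqrtr// ltW.
 exact: (scal tr h1 st tE (ltW c10) (exprn_ge0 n (ler0n _ 8)) (normr_ge0 _) (normr_ge0 _) (normr_ge0 _) g1 g2 g3).
have F0 r x : 0 <= Lop (ta tau0 r) g x * Lop (ta tau0 r) (partial p f) x * He (16 * ta tau0 r) (fun y => `|partial q h y|) x.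
 apply: mulr_ge0; first by apply: mulr_ge0; exact: Lop_ge0. by apply: He_ge0; [rewrite mulr_gt0|move=> z; exact: normr_ge0].
rewrite (II_scale m M (ltW D0) (fun r => bm_m (bF r)) F0).
rewrite (_ : D * C * N `^ 2^-1 * A * B = D * (C * N `^ 2^-1 * A * B)); last by rewrite !mulrA.
by rewrite [(D * _)%:E]EFinM; apply: lee_wpmul2l => //; rewrite lee_fin ltW.
Qed.

(* second derivative on [a], first derivatives on [b] and [c] *)
Lemma term_sob (sa sb sc pa pb pc : R) (qa qb qc : \bar R) : 0 < sa < 1 -> 0 < sb < 1 -> 0 < sc < 1 -> sa + sb + sc = 2 ->
 1 < pa -> 1 < pb -> 1 < pc -> (1 <= qa)%E -> (1 <= qb)%E -> (1 <= qc)%E ->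
 pa^-1 + pb^-1 + pc^-1 = 1 -> qinv qa + qinv qb + qinv qc = 1 ->
 exists2 C, 0 < C & forall (a b c : T -> R) (A1 A2 A3 tau0 : R) M (t : nat -> R) k l p q,
  smooth_cc a -> smooth_cc b -> smooth_cc c -> 0 < A1 -> 0 < A2 -> 0 < A3 ->
  (lorentz pa qa (fraclap sa a) <= A1%:E)%E -> (lorentz pb qb (fraclap sb b) <= A2%:E)%E ->
  (lorentz pc qc (fraclap sc c) <= A3%:E)%E -> 0 < tau0 -> (forall r, 2 * ta tau0 r <= t r <= 8 * ta tau0 r) ->
  (II m M (fun r x => (ta tau0 r * (`|He (t r) (partial l (partial p a)) x| * `|He (t r) (partial k b) x|
    * `|He (t r) (partial q c) x|))%R) <= (C * A1 * A2 * A3)%:E)%E.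
Proof.
move=> sa01 sb01 sc01 ss pa1 pb1 pc1 qa1 qb1 qc1 pe qe.
have [C C0 hC] := @main_sob R n _ _ _ _ _ _ pa1 pb1 pc1 qa1 qb1 qc1 pe qe.
have [K2 K20 hK2] := sob_second sa01 n0; have [K1 K10 hK1] := sob_first sb01 n0; have [K3 K30 hK3] := sob_first sc01 n0.
pose rb : R := 4 `^ ((sb - 1) / 2); pose rc : R := 4 `^ ((sc - 1) / 2).
have rho_lt (s : R) : 0 < s < 1 -> 0 < 1 - 4 `^ ((s - 1) / 2) :> R.
 move=> /andP[_ s1]; rewrite subr_gt0 (_ : 4 = 2 `^ 2); last by rewrite powR_mulrn// expr2 -natrM.
 by rewrite -powRrM (_ : 2 * ((s - 1) / 2) = - (1 - s)); [apply: rho_lt1; lra|field].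
have rb1 := rho_lt _ sb01; have rc1 := rho_lt _ sc01.
have rb0 : 0 < rb by exact: powR_gt0. have rc0 : 0 < rc by exact: powR_gt0.
exists (K2 * K1 * K3 * C / (1 - rb) / (1 - rc)).
 by rewrite !divr_gt0// !mulr_gt0.
move=> a b c A1 A2 A3 tau0 M t k l p q ha hb hc A10 A20 A30 l1 l2 l3 tau00 ht.
have tk r := ta_gt0 r tau00.
have t0 r : 0 < t r by have := tk r; case/andP: (ht r) => ? _; lra.
have t2 r : 2 * ta tau0 r <= t r by case/andP: (ht r).
have hlp := scc_partial l (scc_partial p ha); have hbk := scc_partial k hb; have hcq := scc_partial q hc.
pose ua := fraclap sa a; pose ub := fraclap sb b; pose uc := fraclap sc c.
have bua : bm ua := bm_FL sa01 ha. have bub : bm ub := bm_FL sb01 hb. have buc : bm uc := bm_FL sc01 hc.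
pose X r x := `|He (t r) (partial l (partial p a)) x|.
pose Y r x := `|He (t r) (partial k b) x|. pose Z r x := `|He (t r) (partial q c) x|.
pose fY A r x := \sum_(j < A) rb ^+ j * Lp (ta (ta tau0 j) r) ub x.
pose fZ A r x := \sum_(j < A) rc ^+ j * Lp (ta (ta tau0 j) r) uc x.
pose XA A r x := K2 * ta tau0 r `^ (sa / 2 - 1) * mx A (16 * tau0) (absf ua) x.
pose YA A r x := K1 * (ta tau0 r `^ ((sb - 1) / 2) * fY A r x).
pose ZA A r x := K3 * (ta tau0 r `^ ((sc - 1) / 2) * fZ A r x).
have taC (j r : nat) : ta (ta tau0 j) r = ta (ta tau0 r) j by rewrite /ta mulrAC.
have pwr (s : R) (r j : nat) : ta (ta tau0 r) j `^ s = ta tau0 r `^ s * (4 `^ s) ^+ j.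
 rewrite {1}/ta powRM ?exprn_ge0 ?(ltW (tk r))//; congr (_ * _). by apply: pow4.
have sumE (s : R) u r A x : \sum_(j < A) ta (ta tau0 r) j `^ ((s - 1) / 2) * Lp (ta (ta tau0 r) j) u x =
  ta tau0 r `^ ((s - 1) / 2) * \sum_(j < A) (4 `^ ((s - 1) / 2)) ^+ j * Lp (ta (ta tau0 j) r) u x.
 by rewrite mulr_sumr; apply: eq_bigr => j _; rewrite pwr mulrA taC.
have mu0 r A x : 0 <= mx A (16 * tau0) (absf ua) x by exact: mx_ge0.
have LpP u r A (rr : R) x : 0 <= rr -> 0 <= \sum_(j < A) rr ^+ j * Lp (ta (ta tau0 j) r) u x.
 move=> rr0; apply: sumr_ge0 => j _; apply: mulr_ge0; first exact: exprn_ge0. by apply: Lp_ge0; apply: ta_gt0.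
have bmS u r A (rr : R) : bm u -> bm (fun x => \sum_(j < A) rr ^+ j * Lp (ta (ta tau0 j) r) u x).
 move=> bu; apply: (bm_sum A (F := fun (j : nat) x => rr ^+ j * Lp (ta (ta tau0 j) r) u x)) => j. by apply: bmZ; apply: bm_Lp => //; apply: ta_gt0.
have t160 : 0 < 16 * tau0 by lra.
have bmx A : bm (mx A (16 * tau0) (absf ua)) by apply: bm_mx => //; exact: bm_norm.
have X0 r x : 0 <= X r x by exact: normr_ge0. have Y0 r x : 0 <= Y r x by exact: normr_ge0.
have Z0 r x : 0 <= Z r x by exact: normr_ge0.
have XA0 A r x : 0 <= XA A r x by apply: mulr_ge0; [exact: mulr_ge0 (ltW K20) (powR_ge0 _ _)|exact: mx_ge0].
have YA0 A r x : 0 <= YA A r x.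
 by apply: mulr_ge0; [exact: ltW|apply: mulr_ge0; [exact: powR_ge0|exact: LpP (ltW rb0)]].
have ZA0 A r x : 0 <= ZA A r x.
 by apply: mulr_ge0; [exact: ltW|apply: mulr_ge0; [exact: powR_ge0|exact: LpP (ltW rc0)]].
have bX r : bm (X r) by apply/bm_norm/bm_He => //; exact: scc_bm.
have bY r : bm (Y r) by apply/bm_norm/bm_He => //; exact: scc_bm.
have bZ r : bm (Z r) by apply/bm_norm/bm_He => //; exact: scc_bm.
have bXA A r : bm (XA A r) by apply: bmZ.
have bYA A r : bm (YA A r) by do 2 apply: bmZ; exact: bmS.
have bZA A r : bm (ZA A r) by do 2 apply: bmZ; exact: bmS.
(* The bounds by finite sums hold up to an error e. Each factor truncated by its bound converges to
   the factor, so that [II_lim] applies to the truncated products. *)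
have min_cvg (z : R) (zA : nat -> R) : (forall e : R, 0 < e -> exists A0, forall A, (A0 <= A)%N -> z <= zA A + e) ->
  Num.min z (zA A) @[A --> \oo] --> z.
 move=> h; apply/cvgrPdist_le => e e0; have [A0 hA] := h e e0; near=> A. have AA : (A0 <= A)%N by near: A; exact: nbhs_infty_ge.
 have := hA A AA; case: (leP z (zA A)) => h1 h2; first by rewrite subrr normr0 ltW. by rewrite ger0_norm; [lra|rewrite subr_ge0 ltW].
have cX r x : Num.min (X r x) (XA A r x) @[A --> \oo] --> X r x.
 apply: min_cvg => e e0; have [A0 hA] := hK2 a l p (ta tau0 r) (t r) x e r tau0 ha tau00 erefl (t2 r) e0.
 exists (r + A0)%N => A AA; have rA : (r <= A)%N := leq_trans (leq_addr _ _) AA. by have := hA (A - r)%N; rewrite leq_subRL// subnKC//; apply.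
have cY r x : Num.min (Y r x) (YA A r x) @[A --> \oo] --> Y r x.
 apply: min_cvg => e e0; have [A0 hA] := hK1 b k (ta tau0 r) (t r) x e hb (tk r) (t2 r) e0. by exists A0 => A AA; have := hA A AA; rewrite sumE.
have cZ r x : Num.min (Z r x) (ZA A r x) @[A --> \oo] --> Z r x.
 apply: min_cvg => e e0; have [A0 hA] := hK3 c q (ta tau0 r) (t r) x e hc (tk r) (t2 r) e0. by exists A0 => A AA; have := hA A AA; rewrite sumE.
pose F A r x := ta tau0 r * (Num.min (X r x) (XA A r x) * Num.min (Y r x) (YA A r x) * Num.min (Z r x) (ZA A r x)).
have min0 (u v : R) : 0 <= u -> 0 <= v -> 0 <= Num.min u v by move=> u0 v0; rewrite le_min u0.
have bmin u v : bm u -> bm v -> bm (fun x => Num.min (u x) (v x)).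
 move=> bu bv; have bN w : bm w -> bm (fun x => - w x).
  by move=> bw; have := bmZ (-1) bw; under eq_fun do rewrite mulN1r.
 have := bN _ (bm_max (bN _ bu) (bN _ bv)); congr bm; apply/funext => x. by rewrite oppr_max !opprK.
have bF A r : bm (F A r).
 exact: (bmZ _ (bmM (bmM (bmin _ _ (bX r) (bXA A r)) (bmin _ _ (bY r) (bYA A r))) (bmin _ _ (bZ r) (bZA A r)))).
have F0 A r x : 0 <= F A r x.
 exact: (mulr_ge0 (ltW (tk r)) (mulr_ge0 (mulr_ge0 (min0 _ _ (X0 r x) (XA0 A r x)) (min0 _ _ (Y0 r x) (YA0 A r x)))
  (min0 _ _ (Z0 r x) (ZA0 A r x)))).
have minr (u v : R) : Num.min u v <= v by rewrite ge_min lexx orbT.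
apply: (II_lim bF F0) => [r x|A].
 by apply: cvgM; [exact: cvg_cst|apply: cvgM; [apply: cvgM; [exact: cX|exact: cY]|exact: cZ]].
pose W r x := mx A (16 * tau0) (absf ua) x * fY A r x * fZ A r x.
pose K := K2 * K1 * K3; have K0 : 0 < K by rewrite !mulr_gt0.
have bW r : bm (W r) by apply: bmM; [apply: bmM; [exact: bmx|exact: bmS]|exact: bmS].
have W0 r x : 0 <= W r x.
 by apply: mulr_ge0; [apply: mulr_ge0; [exact: mx_ge0|exact: LpP (ltW rb0)]|exact: LpP (ltW rc0)].
apply: (le_via (II m M (fun r x => (K * W r x)%R))).
 apply: II_le => [r|r|r x|r x]; [exact: bm_m (bF A r)|exact: bm_m (bmZ _ (bW r))|exact: F0|]. apply: (le_via (ta tau0 r * (XA A r x * YA A r x * ZA A r x))).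
  apply: ler_wpM2l; first exact: ltW. have m1 := min0 _ _ (X0 r x) (XA0 A r x); have m2 := min0 _ _ (Y0 r x) (YA0 A r x).
  exact: (ler_pM (mulr_ge0 m1 m2) (min0 _ _ (Z0 r x) (ZA0 A r x)) (ler_pM m1 m2 (minr _ _) (minr _ _)) (minr _ _)).
 (* The exponents of the time are 1, sa / 2 - 1, (sb - 1) / 2 and (sc - 1) / 2; their sum is 0
    because sa + sb + sc = 2. *)
 rewrite /XA /YA /ZA /W /K. have pw : ta tau0 r * (ta tau0 r `^ (sa / 2 - 1) * (ta tau0 r `^ ((sb - 1) / 2) * ta tau0 r `^ ((sc - 1) / 2))) = 1.
  have tr0 : ta tau0 r != 0 by rewrite gt_eqF. rewrite -[X in X * _]powRr1 ?(ltW (tk r))// -!powRD ?tr0 ?implybT//. by rewrite (_ : 1 + _ = 0) ?powRr0//; lra.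
 move: (mx _ _ _ _) (fY _ _ _) (fZ _ _ _) (ta tau0 r) (ta tau0 r `^ _) (ta tau0 r `^ _) (ta tau0 r `^ _) pw. move=> m1 m2 m3 T0 P3 P2 P1 pw.
 rewrite (_ : T0 * _ = T0 * (P1 * (P2 * P3)) * (K2 * K1 * K3 * (m1 * m2 * m3))); last by ring. by rewrite pw mul1r.
rewrite (II_scale m M (ltW K0) (fun r => bm_m (bW r)) W0).
pose S := C * A1 * A2 * A3; have S0 : 0 <= S by rewrite /S !mulr_ge0// ltW.
have geo (rr : R) N : 0 < rr -> 0 < 1 - rr -> \sum_(j < N) rr ^+ j <= (1 - rr)^-1.
 move=> rr0 rr1; rewrite -[leRHS]mul1r ler_pdivlMr// mulrC. have := subrX1 rr N; rewrite -opprB => /eqP; rewrite eqr_oppLR -mulNr opprB => /eqP <-.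
 by rewrite lerBlDr lerDl exprn_ge0// ltW.
(* Shifting the scales of the second and third factors only changes base times, which the constant
   of [main_sob] does not see; the weights rb^j rc^k then sum the double series. *)
have hW : (II m M W <= ((1 - rb)^-1 * (1 - rc)^-1 * S)%:E)%E.
 pose P (j : nat) r x := rb ^+ j * Lp (ta (ta tau0 j) r) ub x. pose Q (j : nat) r x := rc ^+ j * Lp (ta (ta tau0 j) r) uc x.
 have L0 (j r : nat) u x : 0 <= Lp (ta (ta tau0 j) r) u x by apply: Lp_ge0; apply: ta_gt0.
 have bL (j r : nat) u : bm u -> bm (Lp (ta (ta tau0 j) r) u) by move=> bu; apply: bm_Lp => //; apply: ta_gt0.
 apply: (le_via (\sum_(j < A) \sum_(k < A) rb ^+ j * rc ^+ k * S)%:E).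
  apply: (@II_sum2 R n M A P Q (fY A) (fZ A) (fun _ x => mx A (16 * tau0) (absf ua) x) (fun j k : nat => rb ^+ j * rc ^+ k * S)) => //.
  - by move=> j r; apply: bmZ; exact: bL.
  - by move=> j r; apply: bmZ; exact: bL.
  - by move=> j r x; apply: mulr_ge0; [exact: exprn_ge0 (ltW rb0)|exact: L0].
  - by move=> j r x; apply: mulr_ge0; [exact: exprn_ge0 (ltW rc0)|exact: L0].
  - by move=> r x; exact: mx_ge0.
  - by move=> r; exact: bmS.
  - by move=> r; exact: bmS.
  - by move=> r x; exact: LpP (ltW rb0).
  - by move=> r x; exact: LpP (ltW rc0).
  move=> j k' _ _; pose V r x := mx A (16 * tau0) (absf ua) x * Lp (ta (ta tau0 j) r) ub x * Lp (ta (ta tau0 k') r) uc x. have h : (II m M V <= S%:E)%E.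
   apply: (hC ua ub uc (absf ua) (absf ub) (absf uc)) => //; try exact: bm_norm;
    rewrite ?lorentz_norm//; exact: ta_gt0.
  have e0 : 0 <= rb ^+ j * rc ^+ k' by rewrite mulr_ge0 ?exprn_ge0 ?(ltW rb0) ?(ltW rc0).
  have V0 r x : 0 <= V r x by apply: mulr_ge0; [apply: mulr_ge0; [exact: mx_ge0|exact: L0]|exact: L0].
  have bV r : bm (V r) by apply: bmM; [apply: bmM; [exact: bmx|exact: bL]|exact: bL].
  have -> : (fun r x => mx A (16 * tau0) (absf ua) x * P j r x * Q k' r x) = (fun r x => rb ^+ j * rc ^+ k' * V r x).
   by apply/funext => r; apply/funext => x; rewrite /P /Q /V; move: (mx _ _ _ _) (Lp _ _ _) (Lp _ _ _) => ? ? ?; ring.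
  by rewrite (II_scale m M e0 (fun r => bm_m (bV r)) V0) [(_ * S)%:E]EFinM; apply: lee_wpmul2l => //.
 rewrite lee_fin (eq_bigr (fun j : 'I_A => rb ^+ j * (\sum_(k' < A) rc ^+ k') * S)); last first.
  by move=> j _; rewrite mulr_sumr mulr_suml.
 rewrite -mulr_suml -mulr_suml; apply: ler_wpM2r => //; apply: ler_pM; try exact: geo.
  by apply: sumr_ge0 => j _; exact: exprn_ge0 (ltW rb0).
 by apply: sumr_ge0 => j _; exact: exprn_ge0 (ltW rc0).
rewrite (_ : _ * A1 * A2 * A3 = K * ((1 - rb)^-1 * (1 - rc)^-1 * S)); last by rewrite /K /S; ring.
by rewrite [(K * _)%:E]EFinM; apply: lee_wpmul2l => //; rewrite lee_fin ltW.
Unshelve. all: by end_near.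
Qed.
End terms.

Lemma int_prod (R : realType) n (h : R -> R) (c : R) : mfun h -> nneg h ->
 (\int[@lebesgue_measure R]_u (h u)%:E = c%:E)%E ->
 (\int[lebm R n]_x (\prod_(i < n) h (x ord0 i))%:E = (c ^+ n)%:E)%E.
Proof.
move=> mh h0 hc; have mp k : mfun (fun x : 'rV[R]_k => \prod_(i < k) h (x ord0 i)).
 by apply: mf_prod => i; mm.
elim: n => [|k IH]; first by rewrite integral_lebm0// big_ord0 expr0.
rewrite (eq_integral (fun x => (h (vhead x) * (fun y : 'rV[R]_k => \prod_(i < k) h (y ord0 i)) (vtail x))%:E)); last first.
 by move=> x _; rewrite big_ord_recl; congr (_ * _)%:E; apply: eq_bigr => i _; rewrite mxE.
rewrite (@integral_prodS R k h (fun y : 'rV[R]_k => \prod_(i < k) h (y ord0 i)))//; last by move=> y; exact: prodr_ge0.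
by rewrite hc IH -EFinM exprS.
Qed.

(** * BMO functions have bounded heat variance *)

Section cubes.
Variables (R : realType) (n : nat).
Notation T := 'rV[R]_n.
Notation m := (lebm R n).
Implicit Types (r u : R) (a x y : T) (f g : T -> R) (i j : 'I_n).

(** Half-open, so that a cube is exactly the disjoint union of its 2^n children. *)
Definition h1 r u : R := ((0 <= u) && (u < r))%:R.

Definition cb r a x : R := \prod_(i < n) h1 r (x ord0 i - a ord0 i).

Lemma h1_split r u : 0 < r -> h1 r u = h1 (r / 2) u + h1 (r / 2) (u - r / 2).
Proof.
move=> r0; rewrite /h1; have [u0|u0] := leP 0 u; last first.
 by rewrite (_ : (0 <= u - r / 2) = false) ?addr0//; apply/negbTE; rewrite -ltNge; lra.
have [h|h] := ltP u (r / 2).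
 rewrite (_ : u < r); last by lra. by rewrite (_ : (0 <= u - r / 2) = false) ?addr0//; apply/negbTE; rewrite -ltNge; lra.
rewrite (_ : 0 <= u - r / 2); last by lra.
by rewrite add0r ltrBlDr -splitr.
Qed.

Lemma cb_split r a x : 0 < r ->
 cb r a x = \sum_(e : {ffun 'I_n -> bool}) cb (r / 2) (a + (r / 2) *: \row_i (e i)%:R) x.
Proof.
move=> r0; rewrite /cb.
rewrite (eq_bigr (fun i => \sum_(b : bool) h1 (r / 2) (x ord0 i - (a ord0 i + r / 2 * b%:R)))); last first.
 move=> i _; rewrite big_bool/= mulr1 mulr0 addr0 addrC h1_split//; congr (_ + h1 _ _); ring.
rewrite bigA_distr_bigA/=; apply: eq_bigr => e _; apply: eq_bigr => i _.
by rewrite !mxE.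
Qed.

Lemma cb01 r a x : cb r a x = 0 \/ cb r a x = 1.
Proof.
rewrite /cb; elim/big_ind: _ => [|u v [->|->] [->|->]|i _]; rewrite ?mulr0 ?mul0r ?mulr1; try by [left|right].
by rewrite /h1; case: (_ && _); [right|left].
Qed.

Lemma cb_ge0 r a x : 0 <= cb r a x. Proof. by have [->|->] := cb01 r a x. Qed.
Lemma cb_le1 r a x : cb r a x <= 1. Proof. by have [->|->] := cb01 r a x. Qed.

Lemma cb1P r a x : cb r a x != 0 -> forall i, a ord0 i <= x ord0 i < a ord0 i + r.
Proof.
move=> /prodf_neq0 h i; have := h i isT; rewrite /h1 subr_ge0 ltrBlDl.
by case: (_ && _) => //; rewrite eqxx.
Qed.

Lemma cb1 r a x : (forall i, a ord0 i <= x ord0 i < a ord0 i + r) -> cb r a x = 1.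
Proof. by move=> h; rewrite /cb big1// => i _; rewrite /h1 subr_ge0 ltrBlDl h. Qed.

Lemma measurable_h1 r : mfun (h1 r).
Proof.
have -> : h1 r = \1_(`[0, r[%classic).
 by apply/funext => u; rewrite /h1 indicE; congr (nat_of_bool _)%:R; rewrite mem_setE in_itv.
by [].
Qed.

Lemma measurable_cb r a : mfun (cb r a).
Proof.
apply: mf_prod => i; apply: (measurableT_comp (measurable_h1 r)); by mm.
Qed.

Lemma Ri_cb r a : 0 < r -> itg m (cb r a) /\ Ri m (cb r a) = r ^+ n.
Proof.
move=> r0; have mh := measurable_h1 r; have mc := measurable_cb r a.
have h0 u : 0 <= h1 r u by [].
have E : (\int[m]_x (cb r a x)%:E = (r ^+ n)%:E)%E.
 pose f x : R := \prod_(i < n) h1 r (x ord0 i). have mf : mfun f by apply: mf_prod => i; mm. have -> : (fun x => (cb r a x)%:E) = (fun x => (f (x - a))%:E).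
  by apply/funext => x; congr EFin; apply: eq_bigr => i _; rewrite !mxE.
 rewrite (@lebm_shift R n (- a) f)//.
  apply: int_prod => //. have -> : (fun u => (h1 r u)%:E) = (fun u => (\1_(`[0, r[%classic : set R) u)%:E).
   by apply/funext => u; rewrite /h1 indicE; congr (nat_of_bool _)%:R%:E; rewrite mem_setE in_itv.
  rewrite integral_indic// setIT. by have := @lebesgue_measure_itv R `[0, r[; rewrite lte_fin r0 -EFinB subr0.
 by move=> x; apply: prodr_ge0.
split; last by rewrite /Ri /Rintegral E.
apply: itgP => //; rewrite (_ : (fun x => _) = (fun x => (cb r a x)%:E)).
 by rewrite E ltry.
by apply/funext => x; rewrite ger0_norm ?cb_ge0.
Qed.

Lemma itg_cb r a f : 0 < r -> bm f -> itg m (fun x => f x * cb r a x).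
Proof.
move=> r0 [mf [M hM]]; have [ic _] := Ri_cb a r0; have mc := measurable_cb r a.
by have := itgM M ic mf hM; congr itg; apply/funext => x; rewrite mulrC.
Qed.

Definition Icb r a f := Ri m (fun x => f x * cb r a x).

Lemma Icb_split r a f : 0 < r -> bm f -> Icb r a f = \sum_(e : {ffun 'I_n -> bool}) Icb (r / 2) (a + (r / 2) *: \row_i (e i)%:R) f.
Proof.
move=> r0 bf; have r20 : 0 < r / 2 by rewrite divr_gt0.
rewrite /Icb -Ri_sum => [|e]; last exact: itg_cb.
by apply: Ri_eq => x; rewrite -mulr_sumr -cb_split.
Qed.

Lemma Icb_le r a f g : 0 < r -> bm f -> bm g -> (forall x, cb r a x != 0 -> f x <= g x) -> Icb r a f <= Icb r a g.
Proof.
move=> r0 bf bg h; apply: Ri_le; [exact: itg_cb|exact: itg_cb|move=> x].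
have [->|c0] := eqVneq (cb r a x) 0; first by rewrite !mulr0.
by apply: ler_wpM2r; [exact: cb_ge0|exact: h].
Qed.

Lemma Icb_cst r a (k : R) : 0 < r -> Icb r a (fun _ => k) = k * r ^+ n.
Proof. by move=> r0; have [ic <-] := Ri_cb a r0; rewrite /Icb RiZ. Qed.

Lemma IcbD r a f g : 0 < r -> bm f -> bm g -> Icb r a (fun x => f x + g x) = Icb r a f + Icb r a g.
Proof.
move=> r0 bf bg; rewrite /Icb -RiD; [|exact: itg_cb|exact: itg_cb].
by apply: Ri_eq => x; rewrite mulrDl.
Qed.

Lemma IcbZ r a (k : R) f : 0 < r -> bm f -> Icb r a (fun x => k * f x) = k * Icb r a f.
Proof. by move=> r0 bf; rewrite /Icb -RiZ; [apply: Ri_eq => x; rewrite mulrA|exact: itg_cb]. Qed.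

Section john_nirenberg.
Variables (phi : T -> R) (N r0 : R) (cc : R -> T -> R).
Hypotheses (bphi : bm phi) (N0 : 0 < N) (r00 : 0 < r0)
 (osc : forall r a, 0 < r -> Icb r a (fun x => `|phi x - cc r a|) <= N * r ^+ n)
 (fine : forall a x, cb r0 a x != 0 -> `|phi x - cc r0 a| <= 2 * N).

Let L := N * (1 + 2 ^+ n).
Let bd (k : R) : bm (fun x => `|phi x - k|).
Proof. by apply: bm_norm; apply: bmB => //; exact: bm_cst. Qed.
Let bd2 (k : R) : bm (fun x => `|phi x - k| ^+ 2). Proof. exact: bm_sqr. Qed.

Let sub (r : R) a a' : 0 < r -> (forall x, cb r a' x <= cb (2 * r) a x) -> `|cc r a' - cc (2 * r) a| <= L.
Proof.
move=> rp h; have r20 : 0 < 2 * r by rewrite mulr_gt0.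
have rn : 0 < r ^+ n by rewrite exprn_gt0.
rewrite -(ler_pM2r rn) -(Icb_cst a' _ rp).
apply: (le_via (Icb r a' (fun x => `|phi x - cc r a'| + `|phi x - cc (2 * r) a|))).
 apply: Icb_le => //; [exact: bm_cst|exact: bmD|move=> x _]. rewrite (_ : cc r a' - cc (2 * r) a = (phi x - cc (2 * r) a) - (phi x - cc r a')); last by ring.
 by rewrite [leRHS]addrC; exact: ler_normB.
rewrite IcbD//; apply: (le_via (N * r ^+ n + N * (2 * r) ^+ n)).
 apply: lerD; first exact: osc. apply: le_trans (osc _ r20); apply: Ri_le; [exact: itg_cb|exact: itg_cb|move=> x]. by apply: ler_wpM2l.
by rewrite /L exprMn; apply: le_of_eq; ring.
Qed.

(** V is the fixed point V = 49 N^2 + V / 2 + (5 N + L)^2 / 2 of the estimate [PA]. The constant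
    beta, defined next, is what a stopped cube needs, on which |phi - k| has mean at least 4 N. *)
Let V := 98 * N ^+ 2 + (5 * N + L) ^+ 2.
Let beta := (2 * V + 2 * (5 * N + L) ^+ 2) / (4 * N).

(** Induction on the generation with a free constant k within 5 N of that of the cube. A child whose
    constant stays within 5 N of k is covered by induction. Otherwise it is stopped: the bound for
    its own constant gives at most (2 V + 2 (5 N + L)^2)|Q|, charged to beta times the integral of
    |phi - k|, which is at least 4 N |Q|. The charges add up over the children. In the finest cubes
    |phi - k| <= 2 N + 5 N. *)
Let step (e : nat) : (forall a (k : R), `|cc (2 ^+ e * r0) a - k| <= 5 * N ->
  Icb (2 ^+ e * r0) a (fun x => `|phi x - k| ^+ 2) <=
  (7 * N) ^+ 2 * (2 ^+ e * r0) ^+ n + beta * Icb (2 ^+ e * r0) a (fun x => `|phi x - k|)) /\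
 (forall a, Icb (2 ^+ e * r0) a (fun x => `|phi x - cc (2 ^+ e * r0) a| ^+ 2) <= V * (2 ^+ e * r0) ^+ n).
Proof.
have L0 : 0 <= L by rewrite /L mulr_ge0 ?(ltW N0)// addr_ge0 exprn_ge0.
have V0 : 0 <= V by rewrite /V addr_ge0 ?sqr_ge0// mulr_ge0// sqr_ge0.
have b0 : 0 <= beta by rewrite /beta divr_ge0 ?mulr_ge0 ?(ltW N0)// addr_ge0// mulr_ge0// sqr_ge0.
have PA r : 0 < r -> (forall a (k : R), `|cc r a - k| <= 5 * N ->
  Icb r a (fun x => `|phi x - k| ^+ 2) <= (7 * N) ^+ 2 * r ^+ n + beta * Icb r a (fun x => `|phi x - k|)) ->
  forall a, Icb r a (fun x => `|phi x - cc r a| ^+ 2) <= V * r ^+ n.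
 move=> rp h a; have rn : 0 < r ^+ n by rewrite exprn_gt0. have h' : `|cc r a - cc r a| <= 5 * N by rewrite subrr normr0 mulr_ge0// ltW.
 apply: (le_trans (h a _ h')). apply: (le_via ((7 * N) ^+ 2 * r ^+ n + beta * (N * r ^+ n))).
  by rewrite lerD2l; apply: ler_wpM2l => //; exact: osc.
 have -> : beta * (N * r ^+ n) = (V / 2 + (5 * N + L) ^+ 2 / 2) * r ^+ n by rewrite /beta; field; rewrite gt_eqF.
 by rewrite -mulrDl; apply: ler_wpM2r; [exact: ltW|rewrite /V; lra].
have re0 (d : nat) : 0 < 2 ^+ d * r0 by rewrite mulr_gt0// exprn_gt0.
suff P d : forall a (k : R), `|cc (2 ^+ d * r0) a - k| <= 5 * N ->
  Icb (2 ^+ d * r0) a (fun x => `|phi x - k| ^+ 2) <=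
  (7 * N) ^+ 2 * (2 ^+ d * r0) ^+ n + beta * Icb (2 ^+ d * r0) a (fun x => `|phi x - k|).
 by split; [exact: P|apply: PA (P e); exact: re0].
elim: d => [|d IH] a k hk.
 rewrite expr0 mul1r in hk *; apply: (le_via ((7 * N) ^+ 2 * r0 ^+ n)); last first.
  by rewrite lerDl mulr_ge0//; apply: Ri_ge0 => x; rewrite mulr_ge0// cb_ge0.
 rewrite -(Icb_cst a _ r00); apply: Icb_le => //; first exact: bm_cst. move=> x hx; apply: lerXn2r; rewrite ?nnegrE ?mulr_ge0 ?(ltW N0)//.
 have := fine hx; move: hk; rewrite !ler_norml; lra.
set r := 2 ^+ d * r0 in IH; have rp : 0 < r by exact: re0.
have rE : 2 ^+ d.+1 * r0 = 2 * r by rewrite /r exprS mulrA.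
rewrite rE in hk *; have r2 : 0 < 2 * r by rewrite mulr_gt0.
have h2 : 2 * r / 2 = r by field.
have key a' : (forall x, cb r a' x <= cb (2 * r) a x) -> Icb r a' (fun x => `|phi x - k| ^+ 2) <=
  (7 * N) ^+ 2 * r ^+ n + beta * Icb r a' (fun x => `|phi x - k|).
 move=> ha; have [h|h] := leP `|cc r a' - k| (5 * N); first exact: IH. have hL := sub rp ha; have rn : 0 < r ^+ n by rewrite exprn_gt0.
 set c' := cc r a' in h hL; pose D := `|c' - k|. have D1 : D <= 5 * N + L.
  by rewrite /D (_ : c' - k = (c' - cc (2 * r) a) + (cc (2 * r) a - k)); [have := ler_normD (c' - cc (2 * r) a) (cc (2 * r) a - k); lra|ring].
 have low : 4 * N * r ^+ n <= Icb r a' (fun x => `|phi x - k|).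
  have : Icb r a' (fun _ => D) <= Icb r a' (fun x => `|phi x - k| + `|phi x - c'|).
   apply: Icb_le => //; [exact: bm_cst|exact: bmD|move=> x _]. rewrite /D (_ : c' - k = (phi x - k) - (phi x - c')); [exact: ler_normB|ring].
  rewrite IcbD// Icb_cst//; have := osc a' rp; rewrite -/c'. have : 5 * N * r ^+ n <= D * r ^+ n by apply: ler_wpM2r; exact: ltW. lra.
 apply: (le_via (beta * Icb r a' (fun x => `|phi x - k|))); last first.
  by rewrite lerDr mulr_ge0 ?sqr_ge0// ltW.
 apply: (le_via (beta * (4 * N * r ^+ n))); last exact: ler_wpM2l.
 rewrite (_ : beta * (4 * N * r ^+ n) = 2 * (V * r ^+ n) + (2 * (5 * N + L) ^+ 2) * r ^+ n); last first.
  by rewrite /beta; field; rewrite gt_eqF.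
 have A := PA r rp IH a'; rewrite -/c' in A. apply: (le_via (Icb r a' (fun x => 2 * `|phi x - c'| ^+ 2 + 2 * D ^+ 2))).
  apply: Icb_le => //; first by apply: bmD; [exact: bmZ|exact: bm_cst]. move=> x _; rewrite /D (_ : phi x - k = (phi x - c') + (c' - k)); last by ring.
  have n1 := normr_ge0 (phi x - c'); have n2 := normr_ge0 (c' - k). have n3 := ler_normD (phi x - c') (c' - k); have n4 := normr_ge0 (phi x - c' + (c' - k)).
  have n5 := sqr_ge0 (`|phi x - c'| - `|c' - k|). by move: (`|phi x - c'|) (`|c' - k|) (`|_|) n1 n2 n3 n4 n5 => u v w; nra.
 rewrite IcbD//; [|exact: bmZ|exact: bm_cst]. rewrite IcbZ// Icb_cst//; apply: lerD; first by apply: ler_wpM2l. apply: ler_wpM2r; first exact: ltW.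
 by apply: ler_wpM2l => //; apply: lerXn2r; rewrite ?nnegrE ?addr_ge0 ?mulr_ge0 ?(ltW N0)//; exact: normr_ge0.
rewrite !(Icb_split a r2)// h2.
apply: (le_via (\sum_(e' : {ffun 'I_n -> bool}) ((7 * N) ^+ 2 * r ^+ n + beta * Icb r (a + r *: \row_i (e' i)%:R) (fun x => `|phi x - k|)))).
 apply: ler_sum => e' _; apply: key => x. have := cb_split a x r2; rewrite h2 => ->; rewrite (bigD1 e')//= lerDl. by apply: sumr_ge0 => *; exact: cb_ge0.
rewrite big_split/= mulr_sumr lerD2r sumr_const card_ffun card_bool card_ord -[leLHS]mulr_natl natrX [(2 * r) ^+ n]exprMn.
lra.
Qed.

Lemma jn_cube (e : nat) a : Icb (2 ^+ e * r0) a (fun x => (phi x - cc (2 ^+ e * r0) a) ^+ 2) <=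
 (98 * N ^+ 2 + (5 * N + N * (1 + 2 ^+ n)) ^+ 2) * (2 ^+ e * r0) ^+ n.
Proof.
have [_ h] := step e; apply: le_trans (h a); apply: le_of_eq.
by apply: Ri_eq => x; rewrite real_normK ?num_real.
Qed.

Lemma cc_sub (r : R) a a' : 0 < r -> (forall x, cb r a' x <= cb (2 * r) a x) ->
 `|cc r a' - cc (2 * r) a| <= N * (1 + 2 ^+ n).
Proof. exact: sub. Qed.
End john_nirenberg.

Lemma cb_dec r a : 0 < r -> exists2 K, 0 <= K & forall x, cb r a x <= K * dec x.
Proof.
move=> r0; exists (\prod_(i < n) (1 + (`|a ord0 i| + r) ^+ 2)) => [|x].
 by apply: prodr_ge0 => i _; rewrite addr_ge0 ?sqr_ge0.
rewrite /dec -big_split/=; apply: ler_prod => i _; rewrite /h1 ler0n/=.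
have p : 0 < 1 + x ord0 i ^+ 2 by rewrite ltr_pwDl ?sqr_ge0.
case: (boolP (_ && _)) => [/andP[h1' h2']|_]; last by rewrite divr_ge0 ?(ltW p)// addr_ge0 ?sqr_ge0.
rewrite ler_pdivlMr// mul1r lerD2l -real_normK ?num_real//; apply: lerXn2r; rewrite ?nnegrE ?addr_ge0 ?(ltW r0)//.
rewrite -[x ord0 i](subrK (a ord0 i)) addrC; apply: le_trans (ler_normD _ _) _; rewrite lerD2l.
by rewrite ger0_norm// ltW.
Qed.

Lemma enorm_lt x (s : R) : 0 < s -> (enorm x < s) = (dotv x x < s ^+ 2).
Proof. by move=> s0; rewrite /enorm -{1}[s]ger0_norm ?(ltW s0)// -sqrtr_sqr ltr_sqrt// exprn_gt0. Qed.

(** The cube lies in the ball of radius (n + 1) r about its corner, and this ball in a cube of side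
    2 (n + 1) r; the constant is the mean over the ball. *)
Lemma bmo_cube (phi : T -> R) (b : R) : bm phi -> 0 < b -> (bmo phi <= b%:E)%E ->
 exists cc : R -> T -> R, forall r a, 0 < r -> Icb r a (fun x => `|phi x - cc r a|) <= b * (2 * (n%:R + 1)) ^+ n * r ^+ n.
Proof.
move=> bphi b0 hb; pose rho r : R := (n%:R + 1) * r.
exists (fun r a => bmean phi (eball a (rho r))) => r a rp.
have n0 : 0 <= n%:R :> R by [].
have n10 : 0 < n%:R + 1 :> R by [].
have rhop : 0 < rho r by rewrite mulr_gt0.
set B := eball a (rho r); set c := bmean phi B.
have BP x : B x <-> dotv (x - a) (x - a) < rho r ^+ 2 by rewrite /B /eball/= enorm_lt.
have mB : measurable B.
 have md : mfun (fun x => - dotv (x - a) (x - a)) by apply: mf_opp; apply: mf_dotv; mm.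
 rewrite (_ : B = [set x | - rho r ^+ 2 < - dotv (x - a) (x - a)]); first exact: measurable_gt md. by apply/seteqP; split => x /=; rewrite ltrN2 => /BP.
pose a' : T := a - const_mx (rho r); have rho2 : 0 < 2 * rho r by rewrite mulr_gt0.
have cbB x : cb r a x <= \1_B x.
 have [->|c0] := eqVneq (cb r a x) 0; first by rewrite indicE. rewrite indicE mem_set ?cb_le1//; apply/BP; have h := cb1P c0.
 apply: (@le_lt_trans _ _ (\sum_(i < n) r ^+ 2)).
  apply: ler_sum => i _; rewrite !mxE -expr2; have /andP[h1' h2'] := h i. by apply: lerXn2r; rewrite ?nnegrE; lra.
 rewrite sumr_const card_ord -mulr_natl /rho exprMn ltr_pM2r ?exprn_gt0//; nra.
have Bcb x : \1_B x <= cb (2 * rho r) a' x.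
 rewrite indicE; case: (boolP (x \in B)) => [|_]; last exact: cb_ge0. rewrite inE => /BP hx; rewrite cb1// => i. have hi : (x ord0 i - a ord0 i) ^+ 2 < rho r ^+ 2.
  apply: le_lt_trans hx; rewrite /dotv (bigD1 i)//= !mxE expr2 lerDl. by apply: sumr_ge0 => k _; rewrite -expr2 sqr_ge0.
 have : `|x ord0 i - a ord0 i| < rho r.
  by rewrite -(ltr_pXn2r (n := 2)) ?nnegrE ?(ltW rhop)// real_normK ?num_real.
 rewrite ltr_norml !mxE => /andP[? ?]; lra.
have [ic1 Rc1] := Ri_cb a rp; have [ic2 Rc2] := Ri_cb a' rho2; have [K K0 hK] := cb_dec a' rho2.
have iB : itg m (\1_B : T -> R).
 apply: (itg_dom _ (mf_indic mB) _ ic2) => x; rewrite ger0_norm; [exact: Bcb|by rewrite indicE].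
have mBE : fine (lebn B) = Ri m (\1_B : T -> R).
 by rewrite lebnE// /Ri /Rintegral integral_indic// setIT.
have B1 : r ^+ n <= Ri m (\1_B : T -> R) by rewrite -Rc1; exact: Ri_le.
have B2 : Ri m (\1_B : T -> R) <= (2 * rho r) ^+ n by rewrite -Rc2; exact: Ri_le.
have Bp : 0 < Ri m (\1_B : T -> R) by apply: lt_le_trans B1; rewrite exprn_gt0.
have bF : bm (fun x => `|phi x - c|) by apply: bm_norm; apply: bmB => //; exact: bm_cst.
have [mF [M hM]] := bF; have M0 := le_trans (normr_ge0 _) (hM 0).
have mFB : mfun (fun x => `|phi x - c| * \1_B x) by apply: mf_mul.
have iF : iint (fun x => `|phi x - c| * \1_B x) = Ri m (fun x => `|phi x - c| * \1_B x).
 apply: iintE => //; exists (M * K) => x; rewrite normrM -mulrA; apply: ler_pM => //.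
 by rewrite ger0_norm ?indicE//; rewrite -indicE; apply: le_trans (Bcb x) (hK x).
have iFB : itg m (fun x => `|phi x - c| * \1_B x).
 by have := itgM M iB mF hM; congr itg; apply/funext => x; rewrite mulrC.
have h : Ri m (fun x => `|phi x - c| * \1_B x) <= b * Ri m (\1_B : T -> R).
 rewrite -ler_pdivrMr// -iF -mBE -lee_fin; apply: le_trans hb. by apply: ereal_sup_ubound; exists a, (rho r).
apply: (le_via (Ri m (fun x => `|phi x - c| * \1_B x))).
 by apply: Ri_le => //; [exact: itg_cb|move=> x; apply: ler_wpM2l].
apply: (le_trans h); rewrite -mulrA; apply: ler_wpM2l; first exact: ltW.
by rewrite -exprMn -mulrA.
Qed.

(** At each point one term of the series dominates f, so termwise integration bounds its
    integral. *)
Lemma Ri_cover f (h : nat -> T -> R) (B : R) : itg m f -> nneg f -> (forall k, itg m (h k)) ->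
 (forall k x, 0 <= h k x) -> (forall x, exists k, f x <= h k x) ->
 (forall K, \sum_(k < K) Ri m (h k) <= B) -> Ri m f <= B.
Proof.
move=> iF f0 ih h0 cov hB; rewrite -lee_fin RiE//.
apply: (le_via (\int[m]_x \sum_(0 <= k <oo) (h k x)%:E)%E).
 apply: ge0_le_integral => //; [by move=> x _; rewrite lee_fin|by apply/measurable_EFinP; exact: itg_m iF| |move=> x _].
  apply: ge0_emeasurable_sum => [k x _ _|k _]; first by rewrite lee_fin. by apply/measurable_EFinP; exact: itg_m (ih k).
 have [k hk] := cov x; apply: (le_via (h k x)%:E); first by rewrite lee_fin. rewrite (@nneseriesD1 R _ k xpredT)//; last by move=> i _; rewrite lee_fin.
 by rewrite leeDl// nneseries_ge0// => i _ _; rewrite lee_fin.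
rewrite integral_nneseries//; first last.
- by move=> k x _; rewrite lee_fin.
- by move=> k; apply/measurable_EFinP; exact: itg_m (ih k).
apply: lime_le; first by apply: is_cvg_nneseries => k _ _; apply: integral_ge0 => x _; rewrite lee_fin.
apply: nearW => K; rewrite big_mkord.
have -> : (\sum_(k < K) \int[m]_x (h k x)%:E = (\sum_(k < K) Ri m (h k))%:E)%E.
 by rewrite -sumEFin; apply: eq_bigr => k _; rewrite RiE.
by rewrite lee_fin.
Qed.

Lemma Var_le t g x (c : R) : 0 < t -> bm g -> Var t g x <= He t (fun y => (g y - c) ^+ 2) x.
Proof.
move=> t0 bg; have b2 := bm_sqr bg; have bc := bmZ (2 * c) bg; have bk := bm_cst n (c ^+ 2).
have -> : (fun y => (g y - c) ^+ 2) = (fun y => g y ^+ 2 - 2 * c * g y + c ^+ 2).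
 by apply/funext => y; ring.
rewrite (HeD x t0 (bmB b2 bc) bk) (HeB x t0 b2 bc) (HeZ _ x t0 bg) He_cst// /Var.
by have := sqr_ge0 (He t g x - c); move: (He t g x) (He _ _ _) => u v; nra.
Qed.

(** From (u / p)^p <= exp(u): a Gaussian weight is traded for a power of any order. *)
Lemma expN_le (p : nat) u : (0 < p)%N -> 0 < u -> expR (- u) <= (p%:R / u) ^+ p.
Proof.
move=> p0 u0; have pp : 0 < p%:R :> R by rewrite ltr0n.
have up : 0 < u / p%:R by rewrite divr_gt0.
have h : (u / p%:R) ^+ p <= expR u.
 rewrite (_ : expR u = expR (u / p%:R) ^+ p); last by rewrite -expRM_natl mulrC divfK// gt_eqF. apply: lerXn2r; rewrite ?nnegrE ?expR_ge0 ?(ltW up)//.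
 by apply: le_trans (expR_ge1Dx _); rewrite lerDr.
rewrite expRN -[p%:R / u]invf_div exprVn lef_pV2 ?posrE ?expR_gt0 ?exprn_gt0//.
Qed.

Lemma G_far t y (d : R) : 0 < t -> d <= dotv y y -> G t y <= (sqrt t)^-1 ^+ n * expR (- (d / (4 * t))).
Proof.
move=> t0 hd; rewrite G_expR// mulrC; apply: ler_pM; [by rewrite exprn_ge0// invr_ge0 ltW ?sqpit_gt0|exact: expR_ge0| |].
- apply: lerXn2r; rewrite ?nnegrE ?invr_ge0 ?sqrtr_ge0//. rewrite lef_pV2 ?posrE ?sqpit_gt0 ?sqrtr_gt0// ler_sqrt ?(ltW (pit_gt0 t0))//.
 by rewrite ler_peMl ?(ltW t0)//; have := pi_ge2 R; lra.
- by rewrite ler_expR lerN2 ler_pM2r// invr_gt0 mulr_gt0.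
Qed.

(** One constant, that of the smallest cube around x, serves for all cubes of side 2^(k+1) sqrt t,
    since the constants drift at most linearly in k. The squared deviation on the k-th cube grows
    like (1 + k^2) times its volume, which the Gaussian weight exp(-4^k / 16) beats. *)
Lemma var_bmo : exists2 C, 0 < C & forall phi (b : R), smooth_cc phi -> 0 < b -> (bmo phi <= b%:E)%E ->
 forall t x, 0 < t -> Var t phi x <= C * b ^+ 2.
Proof.
have n00 : 0 <= n%:R :> R by [].
have n10 : 0 < n%:R + 1 :> R by rewrite ltr_wpDl.
pose kap : R := (2 * (n%:R + 1)) ^+ n; have kap0 : 0 < kap by rewrite exprn_gt0// mulr_gt0.
pose cV : R := 98 + (5 + (1 + 2 ^+ n)) ^+ 2; pose cL : R := 1 + 2 ^+ n.
have cL0 : 0 < cL by rewrite ltr_pwDl// exprn_ge0.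
have cV0 : 0 < cV by rewrite ltr_pwDl// sqr_ge0.
(* Of the n + 3 powers of 4^(-k), n pay for the volume, one for k^2 <= 4^k, and two are left for the
   sum. *)
pose p := n.+3; pose D : R := (16 * p%:R) ^+ p; have D0 : 0 < D by rewrite exprn_gt0// mulr_gt0.
pose S : R := expR 1 * 2 ^+ n * D * (2 * cV + 2 * cL ^+ 2) * 2.
have q0 : 0 < 2 * cV + 2 * cL ^+ 2 by rewrite addr_gt0 ?mulr_gt0 ?exprn_gt0.
have p2 : 0 < 2 :> R by [].
have S0 : 0 < S := mulr_gt0 (mulr_gt0 (mulr_gt0 (mulr_gt0 (expR_gt0 1) (exprn_gt0 n p2)) D0) q0) p2.
exists (S * kap ^+ 2) => [|phi b hphi b0 hb t x t0]; first by rewrite mulr_gt0 ?exprn_gt0.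
have bphi := scc_bm hphi; have [cc osc] := bmo_cube bphi b0 hb.
pose N := b * kap; have N0 : 0 < N by rewrite mulr_gt0.
have {}osc r a : 0 < r -> Icb r a (fun x => `|phi x - cc r a|) <= N * r ^+ n by exact: osc.
have [Lp Lp0 hLp] := scc_lip hphi.
pose rho := sqrt t; have rho0 : 0 < rho by rewrite sqrtr_gt0.
have rho2 : rho ^+ 2 = t by rewrite sqr_sqrtr// ltW.
(* On cubes of side 2 sqrt t / 2^J the Lipschitz bound keeps the oscillation below N, which is the
   base case of [jn_cube]; J does not enter the constant. *)
have [J hJ] : exists J : nat, Lp * (n%:R * (2 * rho)) <= N * 2 ^+ J.
 pose y := Lp * (n%:R * (2 * rho)) / N; exists (Num.bound y). rewrite [leRHS]mulrC -ler_pdivrMr// -/y; apply: (le_via (Num.bound y)%:R).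
  apply: ltW; apply: archi_boundP. by rewrite divr_ge0 ?(ltW N0)// !mulr_ge0// ltW.
 by rewrite -natrX ler_nat ltnW// ltn_expl.
pose r0 := 2 * rho / 2 ^+ J; have J0 : 0 < 2 ^+ J :> R by rewrite exprn_gt0.
have r00 : 0 < r0 by rewrite divr_gt0// mulr_gt0.
have fin a y : cb r0 a y != 0 -> `|phi y - cc r0 a| <= 2 * N.
 move=> hy; have rn : 0 < r0 ^+ n by rewrite exprn_gt0. rewrite -(ler_pM2r rn) -(Icb_cst a _ r00).
 have bd : bm (fun x => `|phi x - cc r0 a|) by apply: bm_norm; apply: bmB => //; exact: bm_cst. apply: (le_via (Icb r0 a (fun z => `|phi z - cc r0 a| + N))).
  apply: Icb_le => //; [exact: bm_cst|apply: bmD => //; exact: bm_cst|move=> z hz]. have : `|phi y - phi z| <= N.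
   have := hLp z (y - z); rewrite addrCA subrr addr0 => h; apply: (le_trans h). apply: (le_via (Lp * (n%:R * r0))).
    apply: ler_wpM2l => //; rewrite (_ : n%:R * r0 = \sum_(i < n) r0); last first.
     by rewrite sumr_const card_ord -[RHS]mulr_natl.
    apply: ler_sum => i _; rewrite !mxE. have /andP[? ?] := cb1P hy i; have /andP[? ?] := cb1P hz i. by rewrite ler_norml; apply/andP; split; lra.
   rewrite (_ : Lp * (n%:R * r0) = Lp * (n%:R * (2 * rho)) / 2 ^+ J); last by rewrite /r0; ring. by rewrite ler_pdivrMr.
  rewrite (_ : phi y - cc r0 a = (phi y - phi z) + (phi z - cc r0 a)); last by ring. by move=> h; have := ler_normD (phi y - phi z) (phi z - cc r0 a); lra.
 rewrite IcbD//; last exact: bm_cst. by rewrite Icb_cst//; have := osc r0 a r00; lra.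
pose r (k : nat) := 2 ^+ k.+1 * rho; have rp k : 0 < r k by rewrite mulr_gt0// exprn_gt0.
have rE k : r k = 2 ^+ (k + J) * r0 by rewrite /r /r0 exprD exprS; field; rewrite gt_eqF.
pose q (k : nat) : T := x - const_mx (2 ^+ k * rho).
pose c k := cc (r k) (q k).
have V k : Icb (r k) (q k) (fun y => (phi y - c k) ^+ 2) <= cV * N ^+ 2 * r k ^+ n.
 have := jn_cube bphi N0 r00 osc fin (k + J) (q k); rewrite -rE => h; apply: (le_trans h). by rewrite /cV; apply: le_of_eq; ring.
have cS k : `|c k - c k.+1| <= N * cL.
 have rS : r k.+1 = 2 * r k by rewrite /r exprS mulrA. rewrite /c rS; apply: (cc_sub bphi osc) => // y.
 have [->|h] := eqVneq (cb (r k) (q k) y) 0; first exact: cb_ge0. rewrite [leRHS]cb1 ?cb_le1// => i; have := cb1P h i; rewrite !mxE /r !exprS.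
 have w0 : 0 < 2 ^+ k * rho by rewrite mulr_gt0// exprn_gt0. by move=> /andP[? ?]; apply/andP; split; lra.
have cK k : `|c k - c 0%N| <= k%:R * (N * cL).
 elim: k => [|k IH]; first by rewrite subrr normr0 mul0r. rewrite -natr1 mulrDl mul1r (_ : c k.+1 - c 0%N = (c k - c 0%N) - (c k - c k.+1)); last by ring.
 by apply: (le_trans (ler_normB _ _)); exact: lerD.
pose f y := (phi y - c 0%N) ^+ 2.
have bf : bm f by apply: bm_sqr; apply: bmB => //; exact: bm_cst.
have f0 y : 0 <= f y by exact: sqr_ge0.
have If k : Icb (r k) (q k) f <= (2 * cV + 2 * (k%:R * cL) ^+ 2) * N ^+ 2 * r k ^+ n.
 have b1 : bm (fun y => (phi y - c k) ^+ 2) by apply: bm_sqr; apply: bmB => //; exact: bm_cst.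
 apply: (le_via (Icb (r k) (q k) (fun y => 2 * (phi y - c k) ^+ 2 + 2 * (k%:R * (N * cL)) ^+ 2))).
  apply: Icb_le => //; first by apply: bmD; [exact: bmZ|exact: bm_cst]. move=> y _; rewrite /f; have h := cK k.
  have : (c k - c 0%N) ^+ 2 <= (k%:R * (N * cL)) ^+ 2.
   by rewrite -real_normK ?num_real//; apply: lerXn2r; rewrite ?nnegrE// !mulr_ge0// ltW.
  have := sqr_ge0 (phi y - c k - (c k - c 0%N)); lra.
 rewrite IcbD//; [|exact: bmZ|exact: bm_cst]. rewrite IcbZ// Icb_cst//; have := V k; set rn := r k ^+ n; move=> h.
 rewrite (_ : _ * N ^+ 2 * rn = 2 * (cV * N ^+ 2 * rn) + 2 * (k%:R * (N * cL)) ^+ 2 * rn); last by ring. by rewrite lerD2r; apply: ler_wpM2l.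
apply: (le_trans (Var_le x (c 0%N) t0 bphi)).
pose w k := expR 1 * rho^-1 ^+ n * expR (- (4 ^+ k / 16)).
have w0 k : 0 <= w k by rewrite !mulr_ge0 ?expR_ge0// exprn_ge0// invr_ge0 ltW.
rewrite -/f /He /conv.
apply: (@Ri_cover _ (fun k z => w k * (f (x - z) * cb (r k) (q k) (x - z)))).
- by apply: conv_itg => //; exact: itg_G.
- by move=> z; rewrite mulr_ge0// G_ge0.
- by move=> k; apply: itgZ; exact: (itg_refl x (itg_cb (q k) (rp k) bf)).
- by move=> k z; exact: mulr_ge0 (w0 k) (mulr_ge0 (f0 _) (cb_ge0 _ _ _)).
(* The smallest cube around x that contains x - z is used. If it is not the first, some |z_i| is at
   least half of its half-side, and this gives the Gaussian decay. *)
- move=> z; pose P (k : nat) := `[< forall i, - (2 ^+ k * rho) <= - z ord0 i < 2 ^+ k * rho >]. have exP : exists k, P k.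
  pose y := (\sum_(i < n) `|z ord0 i|) / rho; exists (Num.bound y); apply/asboolP => i. have yb : y < 2 ^+ Num.bound y.
   apply: (@lt_le_trans _ _ (Num.bound y)%:R).
    apply: archi_boundP. by rewrite divr_ge0 ?(ltW rho0)// sumr_ge0.
   by rewrite -natrX ler_nat ltnW// ltn_expl.
  have : `|z ord0 i| < 2 ^+ Num.bound y * rho.
   rewrite -ltr_pdivrMr//; apply: le_lt_trans yb; rewrite ler_pM2r ?invr_gt0//. by rewrite (bigD1 i)//= lerDl sumr_ge0.
  by rewrite ltr_norml => /andP[? ?]; apply/andP; split; lra.
 case: (ex_minnP exP) => k /asboolP Pk mink; exists k. have -> : cb (r k) (q k) (x - z) = 1.
  apply: cb1 => i; have /andP[? ?] := Pk i; rewrite !mxE /r exprS; apply/andP; split; lra.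
 rewrite mulr1; apply: ler_wpM2r; first exact: f0. have e1 : 1 <= expR 1 :> R by rewrite -expR0 ler_expR.
 have E0 : 0 <= rho^-1 ^+ n by rewrite exprn_ge0// invr_ge0 ltW. case: k Pk mink => [|k] Pk mink.
  have d0 : 0 <= dotv z z by exact: dotv_ge0. have := G_far t0 d0; rewrite mul0r oppr0 expR0 mulr1 => h; apply: (le_trans h).
  rewrite /w expr0 mulrAC -expRD ler_peMl// -[leLHS]expR0 ler_expR; lra.
 have /asboolPn/existsNP[i hi] : ~~ P k by apply/negP => /mink; rewrite ltnn. have zi : 2 ^+ k * rho <= `|z ord0 i|.
  rewrite leNgt; apply/negP; rewrite ltr_norml => /andP[h1' h2']; apply: hi; apply/andP; split; lra.
 have hd : 4 ^+ k * t <= dotv z z.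
  rewrite -rho2 (_ : 4 = 2 ^+ 2); last by ring. rewrite -exprM mulnC exprM -exprMn /dotv (bigD1 i)//= -expr2. apply: (le_via (z ord0 i ^+ 2)).
   by rewrite -[leRHS]real_normK ?num_real//; apply: lerXn2r; rewrite ?nnegrE// mulr_ge0 ?(ltW rho0)// exprn_ge0.
  by rewrite lerDl sumr_ge0// => l _; rewrite -expr2 sqr_ge0.
 apply: (le_trans (G_far t0 hd)); rewrite /w (_ : 4 ^+ k * t / (4 * t) = 4 ^+ k.+1 / 16).
  by rewrite -mulrA ler_peMl// mulr_ge0 ?expR_ge0.
 by rewrite exprS; field; rewrite gt_eqF.
move=> K; have half : \sum_(k < K) (2^-1 : R) ^+ k <= 2.
 have h1' : 0 < 1 - 2^-1 :> R by lra. have := subrX1 (2^-1 : R) K; rewrite -opprB => /eqP; rewrite eqr_oppLR -mulNr opprB => /eqP e.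
 have e0 : 0 <= (2^-1 : R) ^+ K by rewrite exprn_ge0. by move: e e0; move: (\sum_(k < K) _) (_ ^+ K) => u v; lra.
apply: (le_via (\sum_(k < K) (S / 2 * N ^+ 2) * 2^-1 ^+ k)); last first.
 rewrite -mulr_sumr; apply: (le_via (S / 2 * N ^+ 2 * 2)).
  by apply: ler_wpM2l => //; rewrite mulr_ge0 ?divr_ge0 ?(ltW S0)// sqr_ge0.
 by rewrite /N; apply: le_of_eq; field.
apply: ler_sum => k _; rewrite RiZ; last exact: (itg_refl x (itg_cb (q k) (rp k) bf)).
rewrite (@Ri_refl R n (fun y => f y * cb (r k) (q k) y) x); last exact: itg_m (itg_cb (q k) (rp k) bf).
apply: (le_via (w k * ((2 * cV + 2 * (k%:R * cL) ^+ 2) * N ^+ 2 * r k ^+ n))).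
 by apply: ler_wpM2l => //; exact: If.
have Fk0 : 0 < 4 ^+ k :> R by rewrite exprn_gt0.
have ex := @expN_le p (4 ^+ k / 16) isT (divr_gt0 Fk0 (ltr0n _ 16 : 0 < 16 :> R)).
have {}ex : expR (- (4 ^+ k / 16)) <= D * (4 ^+ k)^-1 ^+ p.
 apply: (le_trans ex); rewrite -exprMn; apply: le_of_eq; congr (_ ^+ _). by field; rewrite gt_eqF.
have k4 : (k%:R : R) ^+ 2 <= 4 ^+ k.
 rewrite (_ : 4 = 2 ^+ 2); last by ring. rewrite -exprM mulnC exprM; apply: lerXn2r; rewrite ?nnegrE ?exprn_ge0//. by rewrite -natrX ler_nat ltnW// ltn_expl.
have F1 : 1 <= 4 ^+ k :> R by rewrite exprn_ege1// ler1n.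
have b1 : 2 * cV + 2 * (k%:R * cL) ^+ 2 <= (2 * cV + 2 * cL ^+ 2) * 4 ^+ k.
 rewrite [leRHS]mulrDl; apply: lerD; first by rewrite ler_peMr// mulr_ge0// ltW.
 rewrite [(_ * cL) ^+ 2]exprMn -[leRHS]mulrA ler_pM2l// [leRHS]mulrC; apply: ler_wpM2r => //; exact: sqr_ge0.
have rn : r k ^+ n = 2 ^+ n * (2 ^+ k) ^+ n * rho ^+ n by rewrite /r exprS !exprMn.
have b2 : (2 ^+ k : R) ^+ n <= (4 ^+ k) ^+ n.
 apply: lerXn2r; rewrite ?nnegrE ?exprn_ge0//; apply: lerXn2r; rewrite ?nnegrE//; lra.
have b3 : (4 ^+ k : R)^-1 <= 2^-1 ^+ k.
 rewrite exprVn lef_pV2 ?posrE ?exprn_gt0//; apply: lerXn2r; rewrite ?nnegrE//; lra.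
have N2 : 0 <= N ^+ 2 by exact: sqr_ge0.
have rr : rho^-1 ^+ n * rho ^+ n = 1 by rewrite -exprMn mulVf ?expr1n// gt_eqF.
rewrite rn /w.
rewrite (_ : _ * _ * _ * _ = expR 1 * 2 ^+ n * (rho^-1 ^+ n * rho ^+ n) * N ^+ 2 *
  (expR (- (4 ^+ k / 16)) * ((2 * cV + 2 * (k%:R * cL) ^+ 2) * (2 ^+ k) ^+ n))); last by ring.
rewrite rr mulr1.
apply: (le_via (expR 1 * 2 ^+ n * N ^+ 2 * ((D * (4 ^+ k)^-1 ^+ p) * (((2 * cV + 2 * cL ^+ 2) * 4 ^+ k) * (4 ^+ k) ^+ n)))).
 have q1 : 0 <= 2 * cV + 2 * (k%:R * cL) ^+ 2 := addr_ge0 (mulr_ge0 (ltW p2) (ltW cV0)) (mulr_ge0 (ltW p2) (sqr_ge0 _)).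
 have q2 : 0 <= (2 ^+ k) ^+ n :> R := exprn_ge0 n (exprn_ge0 k (ltW p2)). apply: ler_wpM2l; first exact: mulr_ge0 (mulr_ge0 (expR_ge0 1) (exprn_ge0 n (ltW p2))) N2.
 exact: ler_pM (expR_ge0 _) (mulr_ge0 q1 q2) ex (ler_pM q1 q2 b1 b2).
have pE : (4 ^+ k)^-1 ^+ p * (4 ^+ k * (4 ^+ k) ^+ n) = (4 ^+ k)^-1 * (4 ^+ k)^-1 :> R.
 rewrite -exprS /p !exprS exprVn; have : (4 ^+ k) ^+ n != 0 :> R by rewrite expf_neq0// gt_eqF. have : 4 ^+ k != 0 :> R by rewrite gt_eqF.
 by move: (4 ^+ k) => F F0; move: (F ^+ n) => G' G0; field; rewrite F0 G0.
rewrite (_ : _ * _ = expR 1 * 2 ^+ n * D * (2 * cV + 2 * cL ^+ 2) * N ^+ 2 * ((4 ^+ k)^-1 ^+ p * (4 ^+ k * (4 ^+ k) ^+ n))); last by ring.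
rewrite pE (_ : S / 2 * N ^+ 2 = expR 1 * 2 ^+ n * D * (2 * cV + 2 * cL ^+ 2) * N ^+ 2); last by rewrite /S; field.
apply: ler_wpM2l.
 exact: mulr_ge0 (mulr_ge0 (mulr_ge0 (mulr_ge0 (expR_ge0 1) (exprn_ge0 n (ltW p2))) (ltW D0)) (ltW q0)) N2.
apply: le_trans b3; rewrite ler_piMl ?invr_ge0 ?(ltW Fk0)//.
by rewrite invf_le1.
Qed.
End cubes.

(** * Signs in the exterior product *)

Section signs.
Variable n : nat.
Implicit Types (I K L : {set 'I_n}) (i j k p q : 'I_n).

(** Total sign exponent of a term of df wedge dh: the inversions in [wedge_top] plus the positions
    in the two [dform], when dx^i is the new differential in I and dx^j that in its complement. *)
Definition sexp I i j : nat := (#|[set pr : 'I_n * 'I_n | [&& pr.1 \in I, pr.2 \notin I & (pr.2 < pr.1)%N]]|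
 + #|[set k in I | (k < i)%N]| + #|[set k in ~: I | (k < j)%N]|)%N.

Let inv (X Y : 'I_n -> nat) : nat := (\sum_p \sum_q X p * Y q * (q < p))%N.

Let invD X X' Y Y' : inv (fun p => X p + X' p)%N (fun q => Y q + Y' q)%N = (inv X Y + inv X Y' + (inv X' Y + inv X' Y'))%N.
Proof.
rewrite /inv -!big_split/=; apply: eq_bigr => p _; rewrite -!big_split/=; apply: eq_bigr => q _.
by rewrite !mulnDl !mulnDr !mulnDl addnACA -!addnA.
Qed.

Let inv1l i Y : inv (fun p => p == i) Y = (\sum_q Y q * (q < i))%N.
Proof.
rewrite /inv (bigD1 i)//= eqxx [X in (_ + X)%N]big1 ?addn0 => [|p /negbTE ->]; last by rewrite big1// => q _; rewrite !mul0n.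
by apply: eq_bigr => q _; rewrite mul1n.
Qed.

Let inv1r X j : inv X (fun q => q == j) = (\sum_p X p * (j < p))%N.
Proof.
apply: eq_bigr => p _; rewrite (bigD1 j)//= eqxx muln1 big1 ?addn0// => q /negbTE ->.
by rewrite muln0 mul0n.
Qed.

Let card_sum (U : finType) (P : pred U) : #|[set k | P k]| = (\sum_k P k)%N.
Proof.
rewrite -sum1_card [LHS]big_mkcond; apply: eq_bigr => k _.
by have -> : (k \in [set k | P k]) = P k by apply/idP/idP; rewrite inE.
Qed.

(* [E K L i j] is the exponent of the sign of dx^i dx^K against dx^j dx^L *)
Let E (K L : pred 'I_n) i j : nat := (inv K L + \sum_p K p * (j < p) + (\sum_q L q * (q < i) + (j < i))
 + \sum_k K k * (k < i) + \sum_k L k * (k < j))%N.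

(** Removing i from I and j from the complement leaves K and L, which do not change when i and j are
    exchanged. *)
Let sexpE I i j : i \in I -> j \notin I ->
 sexp I i j = E (fun k => k \in I :\ i) (fun k => k \in ~: I :\ j) i j.
Proof.
move=> iI jI; have ij : i != j by apply: contraNneq jI => <-.
have KI k : (k \in I : nat) = ((k \in I :\ i) + (k == i))%N.
 by rewrite !inE; case: eqVneq => [->|_]; [rewrite iI|rewrite addn0].
have LI k : (k \notin I : nat) = ((k \in ~: I :\ j) + (k == j))%N.
 by rewrite !inE; case: eqVneq => [->|_]; [rewrite jI|rewrite addn0].
rewrite /sexp /E; congr (_ + _ + _)%N.
- rewrite (card_sum (fun pr : 'I_n * 'I_n => [&& pr.1 \in I, pr.2 \notin I & (pr.2 < pr.1)%N])). transitivity (inv (fun p => p \in I) (fun q => q \notin I)).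
  rewrite /inv pair_big/=; apply: eq_bigr => -[p q] _ /=. by case: (p \in I); case: (q \in I); case: (q < p)%N.
 have -> : inv (fun p => p \in I) (fun q => q \notin I) =
   inv (fun p => (p \in I :\ i) + (p == i))%N (fun q => (q \in ~: I :\ j) + (q == j))%N.
  by apply: eq_bigr => p _; apply: eq_bigr => q _; rewrite KI LI.
 rewrite invD inv1r !inv1l; congr (_ + (_ + _))%N. by rewrite (bigD1 j)//= eqxx mul1n big1 ?addn0// => q /negbTE ->.
- rewrite -sum1_card [LHS]big_mkcond; apply: eq_bigr => k _; rewrite !inE. by case: (k =P i) => [->|_]; [rewrite ltnn andbF|case: (k \in I); case: (k < i)%N].
- rewrite -sum1_card [LHS]big_mkcond; apply: eq_bigr => k _; rewrite !inE. by case: (k =P j) => [->|_]; [rewrite ltnn andbF|case: (k \in I); case: (k < j)%N].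
Qed.

(** The counts in L below i and below j enter symmetrically. In K, the elements above j and those
    below i are, modulo 2, the size of K plus the counts below j and below i, again symmetric. Only
    the comparison of i with j changes. *)
Lemma sexp_swap (R : realType) I i j : i \in I -> j \notin I ->
 (-1) ^+ sexp (j |: I :\ i) j i = - (-1) ^+ sexp I i j :> R.
Proof.
move=> iI jI; have ij : i != j by apply: contraNneq jI => <-.
have iI' : i \notin j |: I :\ i by rewrite !inE (negbTE ij) eqxx.
rewrite !sexpE//; last by rewrite !inE eqxx.
have -> : (fun k => k \in (j |: I :\ i) :\ j) = (fun k => k \in I :\ i).
 apply/funext => k; rewrite !inE; case: (k =P j) => [->|_] //=. by rewrite (negbTE jI) andbF.
have -> : (fun k => k \in ~: (j |: I :\ i) :\ i) = (fun k => k \in ~: I :\ j).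
 apply/funext => k; rewrite !inE; case: (k =P i) => [->|_] /=; first by rewrite iI andbF. by rewrite negb_or.
set K := fun k => k \in I :\ i; set L := fun k => _.
suff h : odd (E K L j i) = ~~ odd (E K L i j).
 by rewrite -signr_odd h -[in RHS]signr_odd; case: (odd _); rewrite ?opprK.
have Kj k : K k -> k != j by rewrite /K !inE => /andP[_ kI]; apply: contraNneq jI => <-.
have Ki k : K k -> k != i by rewrite /K !inE => /andP[].
have tri c : (forall k, K k -> k != c) -> odd (\sum_p K p * (c < p))%N = odd (\sum_p K p)%N (+) odd (\sum_p K p * (p < c))%N.
 move=> hc; have -> : (\sum_p K p = \sum_p K p * (c < p) + \sum_p K p * (p < c))%N.
  rewrite -big_split/=; apply: eq_bigr => p _; rewrite -mulnDr; case Kp: (K p) => //. by have := hc p Kp; rewrite neq_ltn mul1n; case: ltngtP.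
 by rewrite oddD addbK.
have cmp : odd (i < j)%N = ~~ odd (j < i)%N by have := ij; rewrite neq_ltn; case: ltngtP.
rewrite /E !oddD (tri i Ki) (tri j Kj) cmp.
by move: (odd _) (odd _) (odd _) (odd _) (odd _) (odd _) (odd _); do 7 case.
Qed.
End signs.

(** * Reduction to Jacobians, and vanishing norms *)

Section wedge.
Variables (R : realType) (n : nat).
Notation T := 'rV[R]_n.
Notation m := (lebm R n).
Implicit Types (x y z : T) (I : {set 'I_n}) (i j k : 'I_n).

Lemma wedgeE (f h : kform R n) x : wedge_top (dform f) (dform h) x =
 \sum_(I : {set 'I_n}) \sum_(i in I) \sum_(j in ~: I) (-1) ^+ sexp I i j * (partial i (f (I :\ i)) x * partial j (h (~: I :\ j)) x).
Proof.
apply: eq_bigr => I _; rewrite /dform -mulrA mulr_suml mulr_sumr; apply: eq_bigr => i _.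
rewrite !mulr_sumr; apply: eq_bigr => j _; rewrite /sexp !exprD; ring.
Qed.

Definition Jac (phi u v : T -> R) i j := Ri m (fun x => phi x * partial i u x * partial j v x).

Lemma itg_Jac (phi u v : T -> R) i j : smooth_cc phi -> smooth_cc u -> smooth_cc v ->
 itg m (fun x => phi x * partial i u x * partial j v x).
Proof.
move=> hp hu hv; have [mu [Mu hMu]] := scc_bm (scc_partial i hu); have [mv [Mv hMv]] := scc_bm (scc_partial j hv).
by apply: (itgM Mv) => //; apply: (itgM Mu) => //; exact: scc_itg.
Qed.

(** Twice the sum is the sum of F p + F (tau p). *)
Lemma sum_invol (U : finType) (D : pred U) (tau : U -> U) (F : U -> R) (B : R) :
 (forall p, D p -> D (tau p)) -> (forall p, D p -> tau (tau p) = p) -> 0 <= B ->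
 (forall p, D p -> `|F p + F (tau p)| <= B) -> `|\sum_(p | D p) F p| <= #|U|%:R * B.
Proof.
move=> Dtau tauK B0 hB; set S := \sum_(p | D p) _.
have S2 : S = \sum_(p | D p) F (tau p).
 rewrite /S (reindex_onto tau tau)/=; last by move=> p Dp; exact: tauK. apply: eq_bigl => p; apply/andP/idP => [[h1 /eqP h2]|h1]; last by rewrite Dtau// tauK.
 by rewrite -h2; exact: Dtau.
have SS : `|S + S| <= \sum_(p | D p) B.
 rewrite {2}S2 /S -big_split/=; apply: (le_trans (ler_norm_sum _ _ _)); exact: ler_sum.
have cnt : \sum_(p | D p) B <= #|U|%:R * B.
 apply: (le_via (\sum_(p : U) B)); last by rewrite sumr_const -[leLHS]mulr_natl. by rewrite [leRHS](bigID D) lerDl sumr_ge0.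
have : `|S| <= `|S + S| by rewrite -mulr2n -mulr_natl normrM ger0_norm// ler_peMl// ler1n.
lra.
Qed.

(** Exchanging i with j and replacing i by j in I keeps the coefficients of f and h and flips the
    sign, so the terms pair into Jacobians. *)
Lemma wedge_bound (phi : T -> R) (f h : kform R n) (B : R) : 0 <= B -> smooth_cc phi -> form_smooth_cc f -> form_smooth_cc h ->
 (forall K L i j, `|Jac phi (f K) (h L) i j - Jac phi (f K) (h L) j i| <= B) ->
 `|iint (fun x => phi x * wedge_top (dform f) (dform h) x)| <= (#|{set 'I_n}| * n * n)%:R * B.
Proof.
move=> B0 hp hf hh hB.
pose c (p : {set 'I_n} * ('I_n * 'I_n)) : R := (-1) ^+ sexp p.1 p.2.1 p.2.2.
pose D (p : {set 'I_n} * ('I_n * 'I_n)) : bool := (p.2.1 \in p.1) && (p.2.2 \in ~: p.1).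
pose g (p : {set 'I_n} * ('I_n * 'I_n)) x := phi x * partial p.2.1 (f (p.1 :\ p.2.1)) x * partial p.2.2 (h (~: p.1 :\ p.2.2)) x.
have ig p : itg m (g p) by exact: itg_Jac.
have E : (fun x => phi x * wedge_top (dform f) (dform h) x) = (fun x => \sum_(p | D p) c p * g p x).
 apply/funext => x; rewrite wedgeE mulr_sumr. rewrite (eq_bigr (fun I => \sum_(q : 'I_n * 'I_n | (q.1 \in I) && (q.2 \in ~: I)) c (I, q) * g (I, q) x)).
  by rewrite pair_big_dep.
 move=> I _; rewrite mulr_sumr (eq_bigr (fun i => \sum_(j in ~: I) c (I, (i, j)) * g (I, (i, j)) x)).
  by rewrite pair_big_dep.
 move=> i _; rewrite mulr_sumr; apply: eq_bigr => j _; rewrite /c /g/=; ring.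
have ie : itg m (fun x => \sum_(p | D p) c p * g p x).
 by apply: itg_sum => p; apply: itgZ.
have -> : iint (fun x => phi x * wedge_top (dform f) (dform h) x) = \sum_(p | D p) c p * Ri m (g p).
 rewrite E iintE.
 - by rewrite Ri_sum => [|p]; [apply: eq_bigr => p _; rewrite RiZ|exact: itgZ].
 - exact: itg_m ie.
 have [C C0 hC] := scc_bound hp. have [M hM] : exists M : {set 'I_n} * ('I_n * 'I_n) -> R, forall p x, `|g p x| <= M p * dec x.
  have ex p : exists M, forall x, `|g p x| <= M * dec x.
   have [_ [Mu hMu]] := scc_bm (scc_partial p.2.1 (hf (p.1 :\ p.2.1))). have [_ [Mv hMv]] := scc_bm (scc_partial p.2.2 (hh (~: p.1 :\ p.2.2))).
   exists (C * Mu * Mv) => x; rewrite /g !normrM (_ : C * Mu * Mv * dec x = C * dec x * Mu * Mv); last by ring. by apply: ler_pM => //; apply: ler_pM.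
  by exists (fun p => sval (cid (ex p))) => p x; exact: svalP (cid (ex p)) x.
 exists (\sum_(p | D p) M p) => x; rewrite mulr_suml; apply: (le_trans (ler_norm_sum _ _ _)). by apply: ler_sum => p _; rewrite normrM /c normr_sign mul1r.
pose tau (p : {set 'I_n} * ('I_n * 'I_n)) := (p.2.2 |: p.1 :\ p.2.1, (p.2.2, p.2.1)).
have DP p : D p -> [/\ p.2.1 \in p.1, p.2.2 \notin p.1 & p.2.1 != p.2.2].
 by rewrite /D inE => /andP[h1 h2]; split => //; apply: contraNneq h2 => <-.
have Dtau p : D p -> D (tau p).
 by move=> /DP[h1 h2 h3]; rewrite /D /tau !inE !eqxx (negbTE h3).
have tauK p : D p -> tau (tau p) = p.
 case: p => I [i j] /DP[/= h1 h2 h3]; rewrite /tau/=; congr (_, _).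
 by apply/setP => k; rewrite !inE; case: (k =P i) => [->|_] //=; case: (k =P j) => [->|_] //=; rewrite (negbTE h2).
apply: le_trans (sum_invol Dtau tauK B0 _) _; last first.
 by apply: ler_wpM2r => //; rewrite !card_prod card_ord mulnA.
move=> [I [i j]] Dp; have [/= h1 h2 h3] := DP _ Dp.
have -> : c (tau (I, (i, j))) = - c (I, (i, j)) by rewrite /c /tau sexp_swap.
have e1 : (j |: I :\ i) :\ j = I :\ i.
 by apply/setP => k; rewrite !inE; case: (k =P j) => [->|_] //=; rewrite (negbTE h2) andbF.
have e2 : ~: (j |: I :\ i) :\ i = ~: I :\ j.
 by apply/setP => k; rewrite !inE; case: (k =P i) => [->|_]; [rewrite h1 andbF|rewrite negb_or].
have -> : Ri m (g (tau (I, (i, j)))) = Jac phi (f (I :\ i)) (h (~: I :\ j)) j i by rewrite /g /tau e1 e2.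
rewrite mulNr -mulrBr normrM /c normr_sign mul1r.
exact: (hB (I :\ i) (~: I :\ j) i j).
Qed.
Implicit Types (u g f h : T -> R).

(** A positive level rr g t would contradict [lorentz_qunit] with A equal to an eighth of rr g t
    t^(1/p), which gives 8 A <= 4 A. Hence g > 0 only on a set of measure at most t, for arbitrarily
    small t. *)
Lemma lorentz0_null (p : R) (q : \bar R) g : bm g -> nneg g -> 1 < p -> (1 <= q)%E ->
 (lorentz p q g <= 0)%E -> m [set x | 0 < g x] = 0%E.
Proof.
move=> [mg [B hB]] g0 p1 q1 l0; have gB x : g x <= B := le_trans (ler_norm _) (hB x).
have r0 K : rr g (tdy R K 0) <= 0.
 rewrite leNgt; apply/negP => r0; set t := tdy R K 0 in r0. have t0 : 0 < t `^ p^-1 by rewrite powR_gt0// /t /tdy powR_gt0.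
 pose A := rr g t * t `^ p^-1 / 8; have A0 : 0 < A by rewrite divr_gt0// mulr_gt0. have lA : (lorentz p q g <= A%:E)%E by apply: le_trans l0 _; rewrite lee_fin ltW.
 have [h _] := lorentz_qunit mg g0 gB p1 A0 K q1 lA 1. have /andP[_] := h 0%N isT; rewrite -/t ler_pdivrMr ?mulr_gt0// mul1r.
 rewrite (_ : rr g t * t `^ p^-1 = 8 * A); last by rewrite /A; field. lra.
apply/eqP; rewrite eq_le measure_ge0 andbT; apply/lee_addgt0Pr => e e0; rewrite add0e.
have [K hK] : exists K, tdy R K 0 <= e.
 exists (Num.bound e^-1); rewrite /tdy sub0r powRN powR_mulrn//. rewrite invf_ple ?posrE ?exprn_gt0//; apply: (le_via (Num.bound e^-1)%:R).
  by apply/ltW/archi_boundP; rewrite invr_ge0 ltW.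
 by rewrite -natrX ler_nat; apply/ltnW/ltn_expl.
have t0 : 0 < tdy R K 0 by rewrite /tdy powR_gt0.
apply: le_trans (le_trans (rr_dist mg g0 gB t0) _); last by rewrite lee_fin.
apply: le_measure; rewrite ?inE; [exact: measurable_gt|exact: measurable_gt|].
by move=> x; exact: le_lt_trans.
Qed.

Lemma He_null (t : R) u x : 0 < t -> bm u -> m [set y | 0 < `|u y|] = 0%E -> He t u x = 0.
Proof.
move=> t0 bu mu0; have mu := bm_m bu; have mG := itg_m (itg_refl x (itg_G n t0)).
pose F y := G t (x - y) * u y; have mF : mfun F by exact: measurable_funM.
transitivity (Ri m F).
 rewrite -(Ri_refl x mF) /He /conv; apply: Ri_eq => y. by rewrite /F subKr.
suff E : (\int[m]_y (F y)%:E = \int[m]_y 0)%E by rewrite /Ri /Rintegral E integral0.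
apply: ae_eq_integral => //; first exact/measurable_EFinP.
exists [set y | 0 < `|u y|]; split => //.
 by apply: measurable_gt; exact: bm_m (bm_norm bu).
move=> y /= Fy; rewrite normr_gt0; apply/negP => /eqP u0; apply: Fy => _.
by rewrite /F u0 mulr0.
Qed.

Lemma He0_eq0 u : smooth_cc u -> (forall t x, 0 < t -> He t u x = 0) -> forall x, u x = 0.
Proof.
move=> hu h0 x; have [C C0 hC] := flow0 hu; apply/eqP; rewrite -normr_le0; apply/ler_addgt0Pr => e e0.
rewrite add0r; pose t := (e / (C + 1)) ^+ 2; have C1 : 0 < C + 1 by rewrite ltr_wpDl.
have t0 : 0 < t by rewrite exprn_gt0// divr_gt0.
have := hC t x t0; rewrite h0// sub0r normrN => /le_trans; apply.
rewrite sqrtr_sqr ger0_norm; last by rewrite divr_ge0// ltW.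
by rewrite mulrCA ger_pMr// ler_pdivrMr// mul1r lerDl.
Qed.

Lemma partial0 u j : (forall x, u x = 0) -> forall x, partial j u x = 0.
Proof.
move=> u0 x; rewrite (_ : u = fun=> 0); last exact/funext.
by rewrite /partial; exact: derive_cst.
Qed.

Lemma grad_lorentz0 (p : R) (q : \bar R) u gv j : smooth_cc u -> bm gv -> nneg gv ->
 (forall x, `|partial j u x| <= gv x) -> 1 < p -> (1 <= q)%E -> (lorentz p q gv <= 0)%E ->
 forall x, partial j u x = 0.
Proof.
move=> hu bgv gv0 uv p1 q1 l0; have hj := scc_partial j hu; have bj := scc_bm hj.
apply: He0_eq0 => // t x t0; apply: He_null => //; apply/eqP; rewrite eq_le measure_ge0 andbT.
rewrite -(lorentz0_null bgv gv0 p1 q1 l0); apply: le_measure; rewrite ?inE.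
- by apply: measurable_gt; exact: bm_m (bm_norm bj).
- by apply: measurable_gt; exact: bm_m.
- by move=> y /lt_le_trans; apply.
Qed.

(** Subordination expresses every [He t u] through flows of a function that vanishes almost
    everywhere. *)
Lemma fraclap_lorentz0 (s p : R) (q : \bar R) u : (0 < n)%N -> 0 < s < 1 -> smooth_cc u ->
 1 < p -> (1 <= q)%E -> (lorentz p q (fraclap s u) <= 0)%E -> forall x, u x = 0.
Proof.
move=> n0 s01 hu p1 q1; rewrite -lorentz_norm => l0; have bF := bm_FL s01 hu.
have F0 := lorentz0_null (bm_norm bF) (fun x => normr_ge0 _) p1 q1 l0.
apply: He0_eq0 => // t x t0; have [_ E] := subordination s01 x n0 t0 hu.
have := com_gt0 s01; set c := com s in E * => c0.
have H0 (y : R) : He (t + om s y) (fraclap s u) x = 0.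
 by apply: He_null => //; rewrite ltr_wpDr//; exact: om_ge0.
have : c * He t u x = 0 by rewrite E (_ : (fun y : R => _) = fun=> 0) ?Ri0//; exact/funext.
by move/eqP; rewrite mulf_eq0 (gt_eqF c0) => /eqP.
Qed.

(** The heat variance vanishes by [var_bmo], hence so do [Dop] and [Lop], and [grad1] then kills the
    derivative of the flow at every positive time. *)
Lemma bmo0 phi j : smooth_cc phi -> (bmo phi <= 0)%E -> forall x, partial j phi x = 0.
Proof.
move=> hp b0; have bp := scc_bm hp; have [C C0 hC] := @var_bmo R n.
have V0 t x : 0 < t -> Var t phi x <= 0.
 move=> t0; apply/ler_addgt0Pr => e e0; rewrite add0r. have d0 : 0 < sqrt (e / C) by rewrite sqrtr_gt0 divr_gt0.
 have le : (bmo phi <= (sqrt (e / C))%:E)%E by apply: le_trans b0 _. have := hC phi _ hp d0 le t x t0.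
 by rewrite sqr_sqrtr ?divr_ge0 ?(ltW e0) ?(ltW C0)// mulrC divfK// gt_eqF.
apply: He0_eq0; first exact: scc_partial.
move=> t x t0; rewrite He_partial//; set tau := t / 4; have tau0 : 0 < tau by rewrite divr_gt0.
have w : 2 * tau <= t <= 8 * tau by rewrite /tau; lra.
have V16 y : Var (16 * tau) phi y <= 0 by apply: V0; rewrite mulr_gt0.
have V1 y : 0 <= Var tau phi y by rewrite subr_ge0; exact: He_sqr.
have H15 : 0 <= He (15 * tau) (Var tau phi) x by apply: He_ge0 => //; rewrite mulr_gt0.
have D0 : Dop tau phi x <= 0.
 by move: H15; rewrite DopVar// subr_ge0 => /le_trans; apply.
have L0 : Lop tau phi x = 0.
 apply/eqP; rewrite -sqrf_eq0 eq_le sqr_ge0 andbT; exact: le_trans (LopD tau0 x bp) D0.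
have := grad1 tau0 j x w bp; rewrite L0 mulr0 normr_le0 => /eqP; exact.
Qed.

Lemma gradnorm_ge0 g x : 0 <= gradnorm g x. Proof. exact: sqrtr_ge0. Qed.

Lemma partial_gradnorm g (j : 'I_n) x : `|partial j g x| <= gradnorm g x.
Proof.
rewrite -sqrtr_sqr; apply: ler_wsqrtr; rewrite (bigD1 j)//= lerDl.
by apply: sumr_ge0 => i _; exact: sqr_ge0.
Qed.

Lemma bm_gradnorm g : smooth_cc g -> bm (gradnorm g).
Proof.
move=> hg; pose F x := \sum_(j < n) partial j g x ^+ 2.
have F0 x : 0 <= F x by apply: sumr_ge0 => i _; exact: sqr_ge0.
have bF : bm F.
 have b (s : seq 'I_n) : bm (fun x => \sum_(j <- s) partial j g x ^+ 2).
  elim: s => [|j s IH].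
   by rewrite (_ : (fun _ => _) = fun=> 0); [exact: bm_cst|apply/funext => x; rewrite big_nil].
  rewrite (_ : (fun _ => _) = fun x => partial j g x ^+ 2 + \sum_(j <- s) partial j g x ^+ 2).
   by apply: bmD => //; exact/bm_sqr/scc_bm/scc_partial.
  by apply/funext => x; rewrite big_cons.
 exact: b.
rewrite (_ : gradnorm g = fun x => F x `^ 2^-1); first by apply: bm_powR; rewrite ?invr_ge0.
by apply/funext => x; rewrite powR12_sqrt.
Qed.

Lemma rearr_ge0 g (t : R) : (0 <= rearr g t)%E.
Proof. by apply: le_ereal_inf_tmp => _ [l [l0 _] <-]; rewrite lee_fin ltW. Qed.

Lemma lorentz_ge0 (p : R) (q : \bar R) g : (0 <= lorentz p q g)%E.
Proof.
case: q => [r| |] //=; first exact: poweR_ge0.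
apply: (le_via ((1 `^ p^-1)%:E * rearr g 1)%E).
 by apply: mule_ge0; [rewrite lee_fin powR_ge0|exact: rearr_ge0].
by apply: ereal_sup_ubound; exists 1 => //=.
Qed.

End wedge.

Lemma iint_ge0 (R : realType) n (g : 'rV[R]_n -> R) : nneg g -> 0 <= iint g.
Proof.
elim: n g => [|n IH] g g0 /=; first exact: g0.
by apply: fine_ge0; apply: integral_ge0 => t _; rewrite lee_fin; apply: IH.
Qed.

Lemma lebn_ge0 (R : realType) n (A : set 'rV[R]_n) : (0 <= lebn A)%E.
Proof.
elim: n A => [|n IH] A /=; first by case: ifP.
by apply: integral_ge0 => t _.
Qed.

Lemma bmo_ge0 (R : realType) n (g : 'rV[R]_n -> R) : (0 <= bmo g)%E.
Proof.
set y := (iint (fun x => `|g x - bmean g (eball 0 1)| * \1_(eball 0 1) x) / fine (lebn (eball (0 : 'rV[R]_n) 1)))%:E.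
apply: (le_via y).
 by rewrite lee_fin divr_ge0//; [apply: iint_ge0 => x; exact: mulr_ge0|exact/fine_ge0/lebn_ge0].
by apply: ereal_sup_ubound; exists 0, 1.
Qed.

(** * Assembly of the two estimates *)

Section jacobians.
Variables (R : realType) (n : nat) (n0 : (0 < n)%N).
Notation T := 'rV[R]_n.
Notation m := (lebm R n).

Let swap12 (a b c d : R) : a * (b * c * d) = a * (c * b * d). Proof. lra. Qed.
Let swap23 (a b c d : R) : a * (b * c * d) = a * (b * d * c). Proof. by rewrite mulrAC. Qed.
Let rot (a b c d : R) : a * (b * c * d) = a * (d * b * c).
Proof. by ring. Qed.

Let bd1 (c1 c2 z A B : R) : 0 <= c1 -> 0 <= c2 -> 0 <= z -> 0 <= A -> 0 <= B ->
 c1 * z * A * B <= (c1 + c2) * z * A * B /\ c2 * z * B * A <= (c1 + c2) * z * A * B.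
Proof.
move=> c10 c20 z0 A0 B0; rewrite [c2 * z * B * A]mulrAC.
by split; do 3![apply: ler_wpM2r => //]; rewrite ?lerDl ?lerDr.
Qed.

(** The two kinds of products in [core] are exchanged by swapping f and h, so [term_bmo] is used
    once for each. The variance bound V b^2 enters through its square root, which makes the result
    linear in b. *)
Lemma jac_bmo (p1 p2 : R) (q1 q2 : \bar R) : 1 < p1 -> 1 < p2 -> (1 <= q1)%E -> (1 <= q2)%E ->
 p1^-1 + p2^-1 = 1 -> qinv q1 + qinv q2 = 1 ->
 exists2 C, 0 < C & forall (g f h : T -> R) (b A B : R) (i j : 'I_n), smooth_cc g -> smooth_cc f -> smooth_cc h ->
  0 < b -> 0 < A -> 0 < B -> (bmo g <= b%:E)%E ->
  (lorentz p1 q1 (gradnorm f) <= A%:E)%E -> (lorentz p2 q2 (gradnorm h) <= B%:E)%E ->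
  `|Jac g f h i j - Jac g f h j i| <= C * (b * A * B).
Proof.
move=> p11 p21 q11 q21 pe qe; have [C1 C10 h1] := @term_bmo R n _ _ _ _ p11 p21 q11 q21 pe qe.
have [C2 C20 h2] := @term_bmo R n _ _ _ _ p21 p11 q21 q11 (etrans (addrC _ _) pe) (etrans (addrC _ _) qe).
have [V V0 hV] := @var_bmo R n.
have n00 : 0 < n%:R :> R by rewrite ltr0n.
exists (72 * n%:R * ((C1 + C2) * V `^ 2^-1)) => [|g f h b A B i j hg hf hh b0 A0 B0 lb lA lB].
 by rewrite !mulr_gt0 ?addr_gt0 ?powR_gt0.
have N0 : 0 < V * b ^+ 2 by rewrite mulr_gt0// exprn_gt0.
have NE : (V * b ^+ 2) `^ 2^-1 = V `^ 2^-1 * b.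
 rewrite powRM ?(ltW V0) ?exprn_ge0 ?(ltW b0)//; congr (_ * _). by rewrite -powR_mulrn ?(ltW b0)// -powRrM mulfV// powRr1// ltW.
have hN t x : 0 < t -> Var t g x <= V * b ^+ 2 by exact: hV.
have [e1 e2] := bd1 (ltW C10) (ltW C20) (ltW (mulr_gt0 (powR_gt0 2^-1 V0) b0)) (ltW A0) (ltW B0).
have bf := bm_gradnorm hf; have bh := bm_gradnorm hh.
have := @core R n g f h i j ((C1 + C2) * (V `^ 2^-1 * b) * A * B) n0 hg hf hh.
rewrite (_ : 72 * n%:R * ((C1 + C2) * (V `^ 2^-1 * b) * A * B) = 72 * n%:R * ((C1 + C2) * V `^ 2^-1) * (b * A * B)); last first.
 by rewrite -!mulrA.
apply=> tau0 M t tau00 ht k l p q; rewrite -NE in e1 e2 *; split.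
 apply: le_trans (h1 g f h _ _ _ A B tau0 M t k l p q hg hf hh N0 hN bf (gradnorm_ge0 f) (partial_gradnorm f p) bh (gradnorm_ge0 h) (partial_gradnorm h q) A0 B0 lA lB tau00 ht) _.
 by [].
rewrite (_ : (fun r x => _) = (fun r x => ta tau0 r * (`|He (t r) (partial k g) x| * `|He (t r) (partial l (partial q h)) x|
    * `|He (t r) (partial p f) x|))); last by apply/funext => r; apply/funext => x; exact: swap23.
apply: le_trans (h2 g h f _ _ _ B A tau0 M t k l q p hg hh hf N0 hN bh (gradnorm_ge0 h) (partial_gradnorm h q) bf (gradnorm_ge0 f) (partial_gradnorm f p) B0 A0 lB lA tau00 ht) _.
by [].
Qed.

Let bd2 (c1 c2 x y z : R) : 0 <= c1 -> 0 <= c2 -> 0 <= x -> 0 <= y -> 0 <= z ->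
 c1 * y * x * z <= (c1 + c2) * (x * y * z) /\ c2 * z * x * y <= (c1 + c2) * (x * y * z).
Proof.
move=> c10 c20 x0 y0 z0.
rewrite (_ : c1 * y * x * z = c1 * (x * y * z)); last by ring.
rewrite (_ : c2 * z * x * y = c2 * (x * y * z)); last by ring.
by split; apply: ler_wpM2r; rewrite ?lerDl ?lerDr// !mulr_ge0.
Qed.

Lemma jac_sob (s1 s2 s3 p1 p2 p3 : R) (q1 q2 q3 : \bar R) : 0 < s1 < 1 -> 0 < s2 < 1 -> 0 < s3 < 1 -> s1 + s2 + s3 = 2 ->
 1 < p1 -> 1 < p2 -> 1 < p3 -> (1 <= q1)%E -> (1 <= q2)%E -> (1 <= q3)%E ->
 p1^-1 + p2^-1 + p3^-1 = 1 -> qinv q1 + qinv q2 + qinv q3 = 1 ->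
 exists2 C, 0 < C & forall (g f h : T -> R) (b A B : R) (i j : 'I_n), smooth_cc g -> smooth_cc f -> smooth_cc h ->
  0 < b -> 0 < A -> 0 < B -> (lorentz p1 q1 (fraclap s1 g) <= b%:E)%E ->
  (lorentz p2 q2 (fraclap s2 f) <= A%:E)%E -> (lorentz p3 q3 (fraclap s3 h) <= B%:E)%E ->
  `|Jac g f h i j - Jac g f h j i| <= C * (b * A * B).
Proof.
move=> s11 s21 s31 se p11 p21 p31 q11 q21 q31 pe qe.
have r213 (a b c d : R) : a + b + c = d -> b + a + c = d by lra.
have r312 (a b c d : R) : a + b + c = d -> c + a + b = d by lra.
have [C1 C10 h1] := @term_sob R n n0 _ _ _ _ _ _ _ _ _ s21 s11 s31 (r213 _ _ _ _ se) p21 p11 p31 q21 q11 q31 (r213 _ _ _ _ pe) (r213 _ _ _ _ qe).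
have [C2 C20 h2] := @term_sob R n n0 _ _ _ _ _ _ _ _ _ s31 s11 s21 (r312 _ _ _ _ se) p31 p11 p21 q31 q11 q21 (r312 _ _ _ _ pe) (r312 _ _ _ _ qe).
have n00 : 0 < n%:R :> R by rewrite ltr0n.
exists (72 * n%:R * (C1 + C2)) => [|g f h b A B i j hg hf hh b0 A0 B0 lb lA lB].
 by rewrite !mulr_gt0 ?addr_gt0.
have [e1 e2] := bd2 (ltW C10) (ltW C20) (ltW b0) (ltW A0) (ltW B0).
have := @core R n g f h i j ((C1 + C2) * (b * A * B)) n0 hg hf hh.
rewrite (_ : 72 * n%:R * ((C1 + C2) * (b * A * B)) = 72 * n%:R * (C1 + C2) * (b * A * B)); last by ring.
apply=> tau0 M t tau00 ht k l p q; split.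
 rewrite (_ : (fun r x => _) = (fun r x => ta tau0 r * (`|He (t r) (partial l (partial p f)) x| * `|He (t r) (partial k g) x|
    * `|He (t r) (partial q h) x|))); last by apply/funext => r; apply/funext => x; exact: swap12.
 apply: le_trans (h1 f g h A b B tau0 M t k l p q hf hg hh A0 b0 B0 lA lb lB tau00 ht) _. by [].
rewrite (_ : (fun r x => _) = (fun r x => ta tau0 r * (`|He (t r) (partial l (partial q h)) x| * `|He (t r) (partial k g) x|
    * `|He (t r) (partial p f) x|))); last by apply/funext => r; apply/funext => x; exact: rot.
apply: le_trans (h2 h g f B b A tau0 M t k l q p hh hg hf B0 b0 A0 lB lb lA tau00 ht) _.
by [].
Qed.

(** For f and h the integrands vanish pointwise. For g it is the hypothesis of [core] that holds
    with bound 0. *)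
Lemma jac0 (g f h : T -> R) (i j : 'I_n) : smooth_cc g -> smooth_cc f -> smooth_cc h ->
 (forall k x, partial k g x = 0) \/ (forall k x, partial k f x = 0) \/ (forall k x, partial k h x = 0) ->
 Jac g f h i j - Jac g f h j i = 0.
Proof.
move=> hg hf hh [z|[z|z]]; last 2 first.
- by rewrite /Jac !(@Ri_eq _ _ _ _ _ (fun=> 0)) ?Ri0 ?subrr// => x; rewrite z mulr0 mul0r.
- by rewrite /Jac !(@Ri_eq _ _ _ _ _ (fun=> 0)) ?Ri0 ?subrr// => x; rewrite z mulr0.
apply/eqP; rewrite -normr_le0 -(mulr0 (72 * n%:R)).
apply: core => // tau0 M t tau00 ht k l p q.
have z0 r x : He (t r) (partial k g) x = 0.
 have -> : partial k g = fun=> 0 by exact/funext. apply: He_cst; case/andP: (ht r) => + _; apply: lt_le_trans. by rewrite mulr_gt0//; exact: ta_gt0.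
by split; rewrite /II big1// => r _; apply: integral0_eq => x _; rewrite z0 normr0 !mul0r mulr0.
Qed.

End jacobians.

(** An infinite factor settles the claim only if no other factor is 0; a vanishing factor makes the
    right-hand side 0 and has its own hypothesis. *)
Lemma ereal_triple_bound (R : realType) (v C : R) (X Y Z : \bar R) : 0 < C -> (0 <= X)%E -> (0 <= Y)%E -> (0 <= Z)%E ->
 ((X <= 0)%E \/ (Y <= 0)%E \/ (Z <= 0)%E -> v <= 0) ->
 (forall a b c, 0 < a -> 0 < b -> 0 < c -> X = a%:E -> Y = b%:E -> Z = c%:E -> v <= C * (a * b * c)) ->
 (v%:E <= C%:E * X * Y * Z)%E.
Proof.
move=> C0 X0 Y0 Z0 hz hp.
have C0' : (0 <= C%:E)%E by rewrite lee_fin ltW.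
have [zz|/not_orP[Xp /not_orP[Yp Zp]]] := pselect ((X <= 0)%E \/ (Y <= 0)%E \/ (Z <= 0)%E).
 apply: (le_via 0%E); first by rewrite lee_fin hz. by rewrite !mule_ge0.
move: Xp Yp Zp => /negP; rewrite -ltNge => Xp /negP; rewrite -ltNge => Yp /negP; rewrite -ltNge => Zp.
have CX : (0 < C%:E * X)%E by rewrite mule_gt0// lte_fin.
have CXY : (0 < C%:E * X * Y)%E by rewrite mule_gt0.
case: Z Zp Z0 hz hp => [c| |] //; last by move=> *; rewrite gt0_muley// leey.
rewrite lte_fin => c0 _ hz hp.
case: Y Yp Y0 hz hp CXY => [b| |] //; last by move=> *; rewrite gt0_muley// gt0_mulye ?lte_fin// leey.
rewrite lte_fin => b0 _ hz hp _.
case: X Xp X0 hz hp CX => [a| |] //; last first.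
 by move=> *; rewrite gt0_muley// gt0_mulye// gt0_mulye ?lte_fin// leey.
rewrite lte_fin => a0 _ hz hp _; rewrite -!EFinM lee_fin.
by apply: le_trans (hp a b c a0 b0 c0 erefl erefl erefl) _; rewrite !mulrA.
Qed.

(** Common end of both estimates, for abstract nonnegative functionals whose vanishing kills the
    gradient. Each component is bounded by the sum over all components. *)
Lemma wedge_lorentz (R : realType) (n : nat) (X Y Z : ('rV[R]_n -> R) -> \bar R) (C : R) : (0 < n)%N -> 0 < C ->
 (forall z, 0 <= X z)%E -> (forall z, 0 <= Y z)%E -> (forall z, 0 <= Z z)%E ->
 (forall u k, smooth_cc u -> (X u <= 0)%E -> forall x, partial k u x = 0) ->
 (forall u k, smooth_cc u -> (Y u <= 0)%E -> forall x, partial k u x = 0) ->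
 (forall u k, smooth_cc u -> (Z u <= 0)%E -> forall x, partial k u x = 0) ->
 (forall (g f h : 'rV[R]_n -> R) (b A B : R) (i j : 'I_n), smooth_cc g -> smooth_cc f -> smooth_cc h ->
  0 < b -> 0 < A -> 0 < B -> (X g <= b%:E)%E -> (Y f <= A%:E)%E -> (Z h <= B%:E)%E ->
  `|Jac g f h i j - Jac g f h j i| <= C * (b * A * B)) ->
 exists C' : R, 0 < C' /\ forall phi (f h : kform R n), smooth_cc phi -> form_smooth_cc f -> form_smooth_cc h ->
  ((iint (fun x => phi x * wedge_top (dform f) (dform h) x))%:E
   <= C'%:E * X phi * (\sum_(I : {set 'I_n}) Y (f I)) * (\sum_(I : {set 'I_n}) Z (h I)))%E.
Proof.
move=> n0 C0 X0 Y0 Z0 zX zY zZ hC; pose c : R := (#|{set 'I_n}| * n * n)%:R.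
have c0 : 0 < c by rewrite ltr0n !muln_gt0 n0 !andbT; apply/card_gt0P; exists finset.set0.
have comp (F : {set 'I_n} -> \bar R) K : (forall z, 0 <= F z)%E -> (F K <= \sum_(I : {set 'I_n}) F I)%E.
 by move=> F0; rewrite (bigD1 K)//= leeDl// sume_ge0.
exists (c * C); split=> [|phi f h hp hf hh]; first exact: mulr_gt0.
have lf K := comp (fun K => Y (f K)) K (fun I => Y0 _).
have lh K := comp (fun K => Z (h K)) K (fun I => Z0 _).
apply: ereal_triple_bound; [exact: mulr_gt0|exact: X0|by apply: sume_ge0|by apply: sume_ge0| |].
 move=> z; have := @wedge_bound R n phi f h 0 (lexx _) hp hf hh. rewrite mulr0 => W; apply: le_trans (ler_norm _) (W _) => K L i j.
 rewrite jac0 ?normr0//; case: z => [z|[z|z]]; [left|right; left|right; right] => k.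
 - exact: zX.
 - by apply: zY => //; exact: le_trans (lf K) z.
 - by apply: zZ => //; exact: le_trans (lh L) z.
move=> b A B b0 A0 B0 bE AE BE; rewrite -mulrA; apply: le_trans (ler_norm _) _.
apply: wedge_bound => //; first by apply/ltW; rewrite !mulr_gt0.
move=> K L i j; apply: hC => //; first by rewrite bE.
 by rewrite -AE.
by rewrite -BE.
Qed.

Theorem theorem2p2 (R : realType) (n l : nat) :
  (2 <= n)%N -> (l <= n - 2)%N ->
  (forall (p1 p2 : R) (q1 q2 : \bar R),
      1 < p1 -> 1 < p2 -> (1 <= q1)%E -> (1 <= q2)%E ->
      p1^-1 + p2^-1 = 1 -> qinv q1 + qinv q2 = 1 ->
      exists C : R, 0 < C /\
        forall (phi : 'rV[R]_n -> R) (f h : @kform R n),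
          smooth_cc phi ->
          is_form l f -> form_smooth_cc f ->
          is_form (n - l - 2) h -> form_smooth_cc h ->
          ((iint (fun x => phi x * wedge_top (dform f) (dform h) x))%:E
            <= C%:E * bmo phi * grad_lorentz p1 q1 f * grad_lorentz p2 q2 h)%E)
  /\
  (forall (s1 s2 s3 p1 p2 p3 : R) (q1 q2 q3 : \bar R),
      0 < s1 < 1 -> 0 < s2 < 1 -> 0 < s3 < 1 -> s1 + s2 + s3 = 2 ->
      1 < p1 -> 1 < p2 -> 1 < p3 ->
      (1 <= q1)%E -> (1 <= q2)%E -> (1 <= q3)%E ->
      p1^-1 + p2^-1 + p3^-1 = 1 -> qinv q1 + qinv q2 + qinv q3 = 1 ->
      exists C : R, 0 < C /\
        forall (phi : 'rV[R]_n -> R) (f h : @kform R n),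
          smooth_cc phi ->
          is_form l f -> form_smooth_cc f ->
          is_form (n - l - 2) h -> form_smooth_cc h ->
          ((iint (fun x => phi x * wedge_top (dform f) (dform h) x))%:E
            <= C%:E * lorentz p1 q1 (fraclap s1 phi)
                * fraclap_lorentz s2 p2 q2 f * fraclap_lorentz s3 p3 q3 h)%E).
Proof.
move=> n2 _; have n0 : (0 < n)%N by exact: leq_trans n2.
split=> [p1 p2 q1 q2 p11 p21 q11 q21 pe qe|s1 s2 s3 p1 p2 p3 q1 q2 q3 s11 s21 s31 se p11 p21 p31 q11 q21 q31 pe qe].
 have zero (p : R) (q : \bar R) : 1 < p -> (1 <= q)%E -> forall (u : 'rV[R]_n -> R) k, smooth_cc u ->
   (lorentz p q (gradnorm u) <= 0)%E -> forall x, partial k u x = 0.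
  by move=> p1' q1' u k hu; exact: grad_lorentz0 hu (bm_gradnorm hu) (gradnorm_ge0 _) (partial_gradnorm _ k) p1' q1'.
 have [C C0 hC] := jac_bmo n0 p11 p21 q11 q21 pe qe. have [C' [C'0 h]] := wedge_lorentz n0 C0 (@bmo_ge0 R n) (fun u => lorentz_ge0 p1 q1 (gradnorm u))
  (fun u => lorentz_ge0 p2 q2 (gradnorm u)) (@bmo0 R n) (zero _ _ p11 q11) (zero _ _ p21 q21) hC.
 by exists C'; split=> // phi f k hp _ hf _; exact: h.
have zero (s p : R) (q : \bar R) : 0 < s < 1 -> 1 < p -> (1 <= q)%E -> forall (u : 'rV[R]_n -> R) k, smooth_cc u ->
  (lorentz p q (fraclap s u) <= 0)%E -> forall x, partial k u x = 0.
 by move=> s' p' q' u k hu l0; apply: partial0; exact: fraclap_lorentz0 s' hu p' q' l0.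
have [C C0 hC] := jac_sob n0 s11 s21 s31 se p11 p21 p31 q11 q21 q31 pe qe.
have [C' [C'0 h]] := wedge_lorentz n0 C0 (fun u => lorentz_ge0 p1 q1 (fraclap s1 u)) (fun u => lorentz_ge0 p2 q2 (fraclap s2 u))
 (fun u => lorentz_ge0 p3 q3 (fraclap s3 u)) (zero _ _ _ s11 p11 q11) (zero _ _ _ s21 p21 q21) (zero _ _ _ s31 p31 q31) hC.
by exists C'; split=> // phi f k hp _ hf _; exact: h.
Qed.
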